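(* Let $G=\mathrm{SL}_2(\mathbb{R})$ with a fixed Haar measure $\mu$. There exists a constant $C>0$, depending only on $\mu$, with the following property. If $\Gamma$ is a torsion free cocompact arithmetic Fuchsian group in $G$ with invariant trace field $k$, then $\Gamma$ is generated by the finite subset $$\left\{ \gamma\in\Gamma : \|\gamma\| < C \cdot \big(\log [k:\mathbb{Q}]\big)^{\frac{180}{1-\sqrt{1-4\lambda}}} \cdot \mathrm{vol}_\mu(G/\Gamma)^{\frac{6}{1-\sqrt{1-4\lambda}}} \right\},$$ where $\mathrm{vol}_\mu(G/\Gamma)$ is the covolume of $\Gamma$ with respect to $\mu$, and $\lambda=\min\{\tfrac14,\lambda_1(\Gamma)\}$, with $\lambda_1(\Gamma)$ the smallest non-zero eigenvalue of the Laplace-Beltrami operator on $\mathbb{H}^2/\Gamma$.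
   Context: Arithmetic Fuchsian groups: let $k$ be a totally real number field with ring of integers $R_k$, $A$ a quaternion algebra over $k$ ramified at all archimedean places except one, $\mathcal{O}$ an $R_k$-order in $A$, $\mathcal{O}^1$ the elements of $\mathcal{O}$ of $A$-norm (reduced norm) $1$, and $\rho$ a $k$-embedding of $A$ in $M_2(\mathbb{R})$, the $2\times 2$ matrices over $\mathbb{R}$. A subgroup $\Gamma$ of $\mathrm{SL}_2(\mathbb{R})$ is an arithmetic Fuchsian group if it is commensurable, up to conjugation, with some such $\rho(\mathcal{O}^1)$. The invariant trace field of $\Gamma$ is $k=\mathbb{Q}(\mathrm{tr}(\Gamma^{(2)}))$, where $\Gamma^{(2)}$ is the subgroup generated by the squares of elements of $\Gamma$; it coincides with the field $k$ in the definition. $\Gamma$ is cocompact if $G/\Gamma$ is compact; this is the case when either $k\neq\mathbb{Q}$, or $k=\mathbb{Q}$ and $A$ is a division algebra. The group $\Gamma$ acts on the hyperbolic plane $\mathbb{H}^2$ (from the right). The norm $\|\cdot\|$ is the $L^\infty$-norm on $2\times2$ real matrices (maximum of the absolute values of the entries).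
   Formalization: When k = Q the factor log [k:Q] is read as 1: as printed it is 0, the set is empty and cannot generate the infinite group Γ, so the claim fails there; for [k:Q] ≥ 2 the bound is exactly the printed one. *)

(* Defs.v *)
From HB Require Import structures.
From mathcomp Require Import all_boot all_order all_algebra all_field.
From mathcomp Require Import generic_quotient.
From mathcomp Require Import all_classical all_reals all_analysis.
From mathcomp Require Import complex.
From mathcomp Require Import ring.

Set Implicit Arguments.
Unset Strict Implicit.
Unset Printing Implicit Defensive.

Import Order.TTheory GRing.Theory Num.Theory.
Import numFieldNormedType.Exports.

Local Open Scope classical_set_scope.
Local Open Scope ring_scope.

Definition is_subgroup (T : groupType) (H : set T) : Prop :=
  [/\ H 1%g,
      forall x y, H x -> H y -> H (x * y)%g &
      forall x, H x -> H (x^-1)%g].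

Record subgroup (T : groupType) := Subgroup {
  subgroup_set :> set T;
  subgroupP : is_subgroup subgroup_set }.

Definition generated (T : groupType) (S : set T) : set T :=
  smallest (@is_subgroup T) S.

Definition lcosets (T : groupType) (K H : set T) : set (set T) :=
  [set [set (x * h)%g | h in H] | x in K].

Definition commensurable (T : groupType) (H K : set T) : Prop :=
  finite_set (lcosets H (H `&` K)) /\ finite_set (lcosets K (H `&` K)).

Definition torsion_free (T : groupType) (H : set T) : Prop :=
  forall (x : T) (n : nat), H x -> (0 < n)%N -> (x ^+ n)%g = 1%g -> x = 1%g.

Section CosetSpace.
Variables (T : groupType) (H : subgroup T).

Definition coset_rel (x y : T) : bool := `[< subgroup_set H (x^-1 * y)%g >].

Lemma coset_rel_refl : reflexive coset_rel.
Proof. by move=> x; apply/asboolP; rewrite mulVg; case: (subgroupP H). Qed.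

Lemma coset_rel_sym : symmetric coset_rel.
Proof.
case: (subgroupP H) => _ _ HV x y.
by apply/asboolP/asboolP => /HV; rewrite invgM invgK.
Qed.

Lemma coset_rel_trans : transitive coset_rel.
Proof.
case: (subgroupP H) => _ HM _ y x z /asboolP xy /asboolP yz; apply/asboolP.
by have := HM _ _ xy yz; rewrite -mulgA mulVKg.
Qed.

Canonical coset_equiv :=
  EquivRel coset_rel coset_rel_refl coset_rel_sym coset_rel_trans.

End CosetSpace.

Record SL2 (R : realType) := MkSL2 {
  SL2_mx :> 'M[R]_2;
  SL2_det : \det SL2_mx == 1 }.

HB.instance Definition _ (R : realType) := [isSub for @SL2_mx R].
HB.instance Definition _ (R : realType) := [Choice of SL2 R by <:].

Section SL2Group.
Variable R : realType.

Lemma SL2_one_subproof : \det (1%:M : 'M[R]_2) == 1.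
Proof. by rewrite det1. Qed.

Lemma SL2_mul_subproof (g h : SL2 R) : \det (g *m h) == 1.
Proof. by rewrite det_mulmx (eqP (SL2_det g)) (eqP (SL2_det h)) mulr1. Qed.

Lemma SL2_inv_subproof (g : SL2 R) : \det (invmx g) == 1.
Proof. by rewrite det_inv (eqP (SL2_det g)) invr1. Qed.

Definition SL2_one : SL2 R := MkSL2 SL2_one_subproof.
Definition SL2_mul (g h : SL2 R) : SL2 R := MkSL2 (SL2_mul_subproof g h).
Definition SL2_inv (g : SL2 R) : SL2 R := MkSL2 (SL2_inv_subproof g).

Lemma SL2_unit (g : SL2 R) : (g : 'M[R]_2) \in unitmx.
Proof. by rewrite unitmxE (eqP (SL2_det g)) unitr1. Qed.

Lemma SL2_mulA : associative SL2_mul.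
Proof. by move=> x y z; apply/val_inj; rewrite /= mulmxA. Qed.
Lemma SL2_mul1 : left_id SL2_one SL2_mul.
Proof. by move=> x; apply/val_inj; rewrite /= mul1mx. Qed.
Lemma SL2_1mul : right_id SL2_one SL2_mul.
Proof. by move=> x; apply/val_inj; rewrite /= mulmx1. Qed.
Lemma SL2_mulV : left_inverse SL2_one SL2_inv SL2_mul.
Proof. by move=> x; apply/val_inj; rewrite /= mulVmx ?SL2_unit. Qed.
Lemma SL2_Vmul : right_inverse SL2_one SL2_inv SL2_mul.
Proof. by move=> x; apply/val_inj; rewrite /= mulmxV ?SL2_unit. Qed.

HB.instance Definition _ := isGroup.Build (SL2 R)
  SL2_mulA SL2_mul1 SL2_1mul SL2_mulV SL2_Vmul.
HB.instance Definition _ := isPointed.Build (SL2 R) SL2_one.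
HB.instance Definition _ :=
  Topological.copy (SL2 R) (initial_topology (@SL2_mx R)).

End SL2Group.

Definition cocompact (R : realType) (Gamma : subgroup (SL2 R)) : Prop :=
  compact [set: quotient_topology {eq_quot (coset_equiv Gamma)}%qT].

Definition borelSL2 (R : realType) := g_sigma_algebraType (@open (SL2 R)).

Definition is_haar (R : realType)
    (mu : {measure set (borelSL2 R) -> \bar R}) : Prop :=
  [/\ forall (g : SL2 R) (A : set (SL2 R)), measurable (A : set (borelSL2 R)) ->
        mu [set (g * x)%g | x in A] = mu A,
      forall K : set (SL2 R), compact K -> (mu K < +oo)%E &
      forall U : set (SL2 R), open U -> U !=set0 -> (0 < mu U)%E].

Definition fundamental_domain (R : realType) (Gamma F : set (SL2 R)) : Prop :=
  measurable (F : set (borelSL2 R)) /\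
  forall g : SL2 R, exists! gamma : SL2 R, Gamma gamma /\ F (g * gamma)%g.

(* All Borel fundamental domains of a discrete subgroup have the same measure
   (SL_2(R) is unimodular); the infimum only picks out this common value. *)
Definition covolume (R : realType) (mu : {measure set (borelSL2 R) -> \bar R})
    (Gamma : set (SL2 R)) : \bar R :=
  ereal_inf [set mu F | F in fundamental_domain Gamma].

(* The quaternion algebra with Hilbert symbol (a, b / K): the tuple
   (x0, x1, x2, x3) stands for x0 + x1 i + x2 j + x3 ij, where
   i^2 = a, j^2 = b and ij = - ji. *)
Definition quat (K : fieldType) (a b : K) : Type := (K^o * K^o * K^o * K^o)%type.

Section Quaternion.
Variables (K : fieldType) (a b : K).

HB.instance Definition _ := GRing.Lmodule.copy (quat a b)
  (K^o * K^o * K^o * K^o)%type.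

Definition mkquat (x0 x1 x2 x3 : K) : quat a b := (x0, x1, x2, x3).
Definition quat0 (x : quat a b) : K := x.1.1.1.
Definition quat1 (x : quat a b) : K := x.1.1.2.
Definition quat2 (x : quat a b) : K := x.1.2.
Definition quat3 (x : quat a b) : K := x.2.

Definition quat_one : quat a b := mkquat 1 0 0 0.

Definition quat_mul (x y : quat a b) : quat a b :=
  mkquat
    (quat0 x * quat0 y + a * (quat1 x * quat1 y) + b * (quat2 x * quat2 y)
       - a * b * (quat3 x * quat3 y))
    (quat0 x * quat1 y + quat1 x * quat0 y - b * (quat2 x * quat3 y)
       + b * (quat3 x * quat2 y))
    (quat0 x * quat2 y + quat2 x * quat0 y + a * (quat1 x * quat3 y)
       - a * (quat3 x * quat1 y))
    (quat0 x * quat3 y + quat3 x * quat0 y + quat1 x * quat2 y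
       - quat2 x * quat1 y).

Definition reduced_norm (x : quat a b) : K :=
  quat0 x ^+ 2 - a * quat1 x ^+ 2 - b * quat2 x ^+ 2 + a * b * quat3 x ^+ 2.

Lemma quat_eq (x y : quat a b) : quat0 x = quat0 y -> quat1 x = quat1 y ->
  quat2 x = quat2 y -> quat3 x = quat3 y -> x = y.
Proof.
case: x y => [[[x0 x1] x2] x3] [[[y0 y1] y2] y3].
by rewrite /quat0 /quat1 /quat2 /quat3 /= => -> -> -> ->.
Qed.

Local Ltac quat_ring := apply: quat_eq;
  rewrite /quat_mul /mkquat /quat0 /quat1 /quat2 /quat3 /=; ring.

Lemma quat_mulA : associative quat_mul.
Proof. by move=> x y z; quat_ring. Qed.
Lemma quat_mul1 : left_id quat_one quat_mul.
Proof. by move=> x; quat_ring. Qed.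
Lemma quat_1mul : right_id quat_one quat_mul.
Proof. by move=> x; quat_ring. Qed.
Lemma quat_mulDl : left_distributive quat_mul +%R.
Proof. by move=> x y z; quat_ring. Qed.
Lemma quat_mulDr : right_distributive quat_mul +%R.
Proof. by move=> x y z; quat_ring. Qed.
Lemma quat_1neq0 : quat_one != 0.
Proof. by apply/eqP => /(congr1 quat0) /eqP; rewrite /quat0 /= oner_eq0. Qed.

HB.instance Definition _ := GRing.Zmodule_isNzRing.Build (quat a b)
  quat_mulA quat_mul1 quat_1mul quat_mulDl quat_mulDr quat_1neq0.

Definition is_division : Prop :=
  forall x : quat a b, x != 0 -> exists y : quat a b, x * y = 1 /\ y * x = 1.

End Quaternion.

Definition alg_integer (k : nzRingType) (x : k) : Prop :=
  integralOver (intr : int -> k) x.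

Definition totally_real (R : realType) (k : fieldExtType rat) : Prop :=
  forall (tau : {rmorphism k -> R[i]}) (x : k), complex.Im (tau x) = 0.

(* The completed algebra at the place sigma is the quaternion algebra over R
   with Hilbert symbol (sigma a, sigma b). *)
Definition ramified_at (R : realType) (k : fieldType) (a b : k)
  (sigma : {rmorphism k -> R}) : Prop := is_division (sigma a) (sigma b).

(* The R_k-span of a finite family spanning A over k, closed under products and
   containing 1. *)
Definition is_order (k : fieldType) (a b : k) (O : set (quat a b)) : Prop :=
  [/\ O 1,
      forall x y, O x -> O y -> O (x * y) &
      exists (n : nat) (e : 'I_n -> quat a b),
        (forall x, O x <-> exists c : 'I_n -> k,
           (forall i, alg_integer (c i)) /\ x = \sum_i c i *: e i) /\
        (forall x, exists c : 'I_n -> k, x = \sum_i c i *: e i)].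

Definition norm_one_image (R : realType) (k : fieldType) (a b : k)
    (rho : quat a b -> 'M[R]_2) (O : set (quat a b)) : set (SL2 R) :=
  [set g | exists x, [/\ O x, reduced_norm x = 1 & SL2_mx g = rho x]].

(* The field k is totally real, so that its archimedean places are its real
   embeddings. The embedding sigma of k in R with respect to which rho is
   k-linear is necessarily the unramified place sigma0. *)
Definition arithmetic_fuchsian (R : realType) (Gamma : set (SL2 R)) : Prop :=
  exists (k : fieldExtType rat) (a b : k) (O : set (quat a b))
    (sigma : {rmorphism k -> R}) (rho : {rmorphism quat a b -> 'M[R]_2}),
    [/\ totally_real R k /\ (a != 0 /\ b != 0),
        exists sigma0 : {rmorphism k -> R}, ~ ramified_at a b sigma0 /\
          forall tau : {rmorphism k -> R}, ~ tau =1 sigma0 -> ramified_at a b tau,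
        is_order O,
        injective rho /\ (forall (c : k) x, rho (c *: x) = sigma c *: rho x) &
        exists g : SL2 R,
          commensurable Gamma [set (x ^ g)%g | x in norm_one_image rho O]].

Definition is_subfield (R : fieldType) (F : set R) : Prop :=
  [/\ F 1, forall x y, F x -> F y -> F (x - y) &
      forall x y, F x -> F y -> F (x / y)].

Definition invariant_trace_field (R : realType) (Gamma : set (SL2 R)) : set R :=
  smallest (@is_subfield R)
    [set \tr (SL2_mx g) | g in generated [set (x * x)%g | x in Gamma]].

Definition upper_half_plane (R : realType) : set R[i] :=
  [set z | 0 < complex.Im z].

Definition mobius (R : realType) (g : SL2 R) (z : R[i]) : R[i] :=
  (real_complex R (SL2_mx g 0 0) * z + real_complex R (SL2_mx g 0 1)) /
  (real_complex R (SL2_mx g 1 0) * z + real_complex R (SL2_mx g 1 1)).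

(* H^2 is identified with SO(2) \ SL_2(R) through SO(2) g |-> g^-1 i, under which
   right translation by g becomes z |-> g^-1 z. *)
Definition right_action (R : realType) (z : R[i]) (g : SL2 R) : R[i] :=
  mobius (g^-1)%g z.

Definition in_coords (R : realType) (f : R[i] -> R) : R * R -> R :=
  fun p => f (Complex p.1 p.2).

Definition dx (R : realType) (u : R * R -> R) : R * R -> R :=
  fun p => 'D_((1, 0) : R * R) u p.
Definition dy (R : realType) (u : R * R -> R) : R * R -> R :=
  fun p => 'D_((0, 1) : R * R) u p.

(* true stands for dx and false for dy; w lists successive derivatives. *)
Definition iter_partial (R : realType) (w : seq bool) (u : R * R -> R) :
    R * R -> R :=
  foldr (fun (c : bool) v => if c then dx v else dy v) u w.

Definition smooth_on_half_plane (R : realType) (f : R[i] -> R) : Prop :=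
  forall (w : seq bool) (p : R * R), 0 < p.2 ->
    differentiable (iter_partial w (in_coords f)) p.

Definition laplace_beltrami (R : realType) (f : R[i] -> R) (z : R[i]) : R :=
  let u := in_coords f in
  let p := (complex.Re z, complex.Im z) in
  - (complex.Im z) ^+ 2 * (dx (dx u) p + dy (dy u) p).

(* A smooth function on H^2 / Gamma is a Gamma-invariant smooth function on H^2;
   the operator is real, so real-valued eigenfunctions suffice. *)
Definition is_eigenvalue (R : realType) (Gamma : set (SL2 R)) (l : R) : Prop :=
  exists f : R[i] -> R,
    [/\ smooth_on_half_plane f,
        forall z g, upper_half_plane z -> Gamma g -> f (right_action z g) = f z,
        exists2 z, upper_half_plane z & f z != 0 &
        forall z, upper_half_plane z -> laplace_beltrami f z = l * f z].

(* For cocompact Gamma the spectrum is discrete and contained in [0, +oo[, so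
   the infimum is a minimum. *)
Definition lambda1 (R : realType) (Gamma : set (SL2 R)) : R :=
  inf [set l | is_eigenvalue Gamma l /\ l != 0].

(* This is log d, except for the value 1 at d = 1: there log d = 0, and the bound
   ||gamma|| < 0 would select no element, although k = Q does occur. *)
Definition log_degree (R : realType) (d : nat) : R :=
  if d == 1%N then 1 else ln d%:R.
Arguments log_degree R d : clear implicits.

(* Main.v *)
(** If all conjugates of nontrivial elements of Gamma displace the base point by a fixed amount, the
    quotient contains an embedded disc of definite area, and the spectral gap makes averages over large
    discs equidistribute. Beyond a radius of order (log covolume - log injectivity radius) / spectral
    gap any two small discs are joined by an element of Gamma moving the base point at most that far,
    and such elements generate. For the injectivity radius, the square t^2 of a trace lies in k, and
    (t / 2 + sqrt (t^2 / 4 - 1))^2 is an algebraic integer of degree at most 2 [k : Q] whose other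
    conjugates lie in the closed unit disc, the algebra being definite at the other places. Dobrowolski's
    argument bounds such a number away from 1 by a power of log [k : Q]. *)

Require Import Defs.
From HB Require Import structures.
From mathcomp Require Import all_boot all_order all_algebra all_field.
From mathcomp Require Import generic_quotient.
From mathcomp Require Import all_classical all_reals all_analysis.
From mathcomp Require Import measurable_realfun.
From mathcomp Require Import complex.
From mathcomp Require Import ring lra zify.

Set Implicit Arguments.
Unset Strict Implicit.
Unset Printing Implicit Defensive.

Import Order.TTheory GRing.Theory Num.Theory.
Import numFieldNormedType.Exports.

Local Open Scope classical_set_scope.
Local Open Scope ring_scope.

(** The analytic input is concentrated in averaging operators with kernels (A - cosh d)_+^j, j = 1,
    2, 3. They commute and are compact and symmetric on the quotient; differentiating in A lowers j,
    and Green's formula closes the means of an eigenfunction into a second-order equation in A. The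
    norm of the operator on functions of mean zero is attained at an eigenfunction which can be
    chosen to be a Laplace eigenfunction, and an energy estimate for the equation bounds that norm
    by a constant times A^(-r/4) times the kernel mass, where r is the denominator of the exponents.
    So two cells meet under Gamma once A is of order (volume / cell volume)^(4/r). The cell volume
    is at least of order (log degree)^(-12): the form of Dobrowolski's argument used here gives U -
    1 >= c / (log degree)^6 for the dilation factor U, and the displacement is of second order in U
    - 1. This alone yields exponents 4 and 48 with a constant that depends on r; the surplus up to 6
    and 180 removes the dependence. *)

Notation SL2_measure R := {measure set (borelSL2 R) -> \bar R}.

(** * Entries of SL_2(R) and the displacement function *)

Section SL2Entries.
Variable R : realType.
Implicit Types (g h : SL2 R) (a b c d t : R).

Definition ea g := SL2_mx g 0 0.
Definition eb g := SL2_mx g 0 1.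
Definition ec g := SL2_mx g 1 0.
Definition ed g := SL2_mx g 1 1.

Lemma ord2P (i : 'I_2) : i = 0 \/ i = 1.
Proof. by case: i => [[|[|//]]] i; [left|right]; apply: val_inj. Qed.

Lemma det2 (M : 'M[R]_2) : \det M = M 0 0 * M 1 1 - M 0 1 * M 1 0.
Proof.
rewrite (expand_det_row _ 0) !big_ord_recl big_ord0 addr0 /cofactor !det_mx11 !mxE /=.
rewrite expr0 mul1r (_ : bump _ _ = 1%N) // expr1 mulN1r mulrN.
by congr (M _ _ * M _ _ - M _ _ * M _ _); apply: val_inj.
Qed.

Lemma SL2_detE g : ea g * ed g - eb g * ec g = 1.
Proof. by rewrite -det2; apply/eqP/SL2_det. Qed.

Lemma SL2_eq g h : ea g = ea h -> eb g = eb h -> ec g = ec h -> ed g = ed h -> g = h.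
Proof.
move=> ha hb hc hd; apply/val_inj/matrixP => i j.
by case: (ord2P i) => ->; case: (ord2P j) => ->.
Qed.

Definition mx2 a b c d : 'M[R]_2 :=
  \matrix_(i, j) if i == 0 then (if j == 0 then a else b) else (if j == 0 then c else d).

Lemma mkSL2_subproof a b c d : a * d - b * c = 1 -> \det (mx2 a b c d) == 1.
Proof. by move=> h; rewrite det2 !mxE /= h. Qed.

Definition mkSL2 a b c d (h : a * d - b * c = 1) : SL2 R := MkSL2 (mkSL2_subproof h).

Lemma mkSL2E a b c d (h : a * d - b * c = 1) :
  [/\ ea (mkSL2 h) = a, eb (mkSL2 h) = b, ec (mkSL2 h) = c & ed (mkSL2 h) = d].
Proof. by split; rewrite /ea /eb /ec /ed /= mxE. Qed.

Lemma SL2_ME g h :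
  [/\ ea (g * h)%g = ea g * ea h + eb g * ec h, eb (g * h)%g = ea g * eb h + eb g * ed h,
      ec (g * h)%g = ec g * ea h + ed g * ec h & ed (g * h)%g = ec g * eb h + ed g * ed h].
Proof.
by split; rewrite /ea /eb /ec /ed /= mxE !big_ord_recl big_ord0 addr0;
  congr (SL2_mx g _ _ * SL2_mx h _ _ + SL2_mx g _ _ * SL2_mx h _ _); apply: val_inj.
Qed.
Lemma eaM g h : ea (g * h)%g = ea g * ea h + eb g * ec h. Proof. by case: (SL2_ME g h). Qed.
Lemma ebM g h : eb (g * h)%g = ea g * eb h + eb g * ed h. Proof. by case: (SL2_ME g h). Qed.
Lemma ecM g h : ec (g * h)%g = ec g * ea h + ed g * ec h. Proof. by case: (SL2_ME g h). Qed.
Lemma edM g h : ed (g * h)%g = ec g * eb h + ed g * ed h. Proof. by case: (SL2_ME g h). Qed.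
Lemma SL2_1E : [/\ ea 1%g = 1, eb 1%g = 0, ec 1%g = 0 & ed 1%g = 1].
Proof. by split; rewrite /ea /eb /ec /ed mxE. Qed.
Lemma ea1 : ea 1%g = 1. Proof. by case: SL2_1E. Qed.
Lemma eb1 : eb 1%g = 0. Proof. by case: SL2_1E. Qed.
Lemma ec1 : ec 1%g = 0. Proof. by case: SL2_1E. Qed.
Lemma ed1 : ed 1%g = 1. Proof. by case: SL2_1E. Qed.

Lemma SL2_VE g : [/\ ea g^-1%g = ed g, eb g^-1%g = - eb g, ec g^-1%g = - ec g & ed g^-1%g = ea g].
Proof.
have H : ed g * ea g - (- eb g) * (- ec g) = 1.
  by rewrite mulrNN mulrC SL2_detE.
suff -> : (g^-1)%g = mkSL2 H by apply: mkSL2E.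
apply: (mulgI g); rewrite mulgV; have [Ea Eb Ec Ed] := mkSL2E H; have D := SL2_detE g.
by apply: SL2_eq; rewrite ?(eaM, ebM, ecM, edM) ?Ea ?Eb ?Ec ?Ed ?ea1 ?eb1 ?ec1 ?ed1; lra.
Qed.
Lemma eaV g : ea g^-1%g = ed g. Proof. by case: (SL2_VE g). Qed.
Lemma ebV g : eb g^-1%g = - eb g. Proof. by case: (SL2_VE g). Qed.
Lemma ecV g : ec g^-1%g = - ec g. Proof. by case: (SL2_VE g). Qed.
Lemma edV g : ed g^-1%g = ea g. Proof. by case: (SL2_VE g). Qed.

Definition entM := (eaM, ebM, ecM, edM).
Definition entV := (eaV, ebV, ecV, edV).
Definition ent1 := (ea1, eb1, ec1, ed1).

(* The hyperbolic cosine of the distance from i to g i. *)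
Definition hs g : R := (ea g ^+ 2 + eb g ^+ 2 + ec g ^+ 2 + ed g ^+ 2) / 2.

Lemma hs1 : hs 1%g = 1. Proof. by rewrite /hs !ent1; lra. Qed.
Lemma hsV g : hs g^-1%g = hs g. Proof. by rewrite /hs !entV; lra. Qed.
Lemma hs_ge1 g : 1 <= hs g. Proof.
rewrite /hs; have := SL2_detE g; have := sqr_ge0 (ea g - ed g).
by have := sqr_ge0 (eb g + ec g); nra.
Qed.
Lemma hs_gt0 g : 0 < hs g. Proof. by have := hs_ge1 g; lra. Qed.

(* The difference of the two sides is [hs (g h^-T) - 1]. *)
Lemma hsM g h : hs (g * h)%g + 1 <= 2 * hs g * hs h.
Proof.
have D := SL2_detE h; have D' := SL2_detE g.
pose a := ea g * ed h - eb g * eb h; pose b := eb g * ea h - ea g * ec h.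
pose c := ec g * ed h - ed g * eb h; pose d := ed g * ea h - ec g * ec h.
have E : a * d - b * c = 1.
  have -> : a * d - b * c = (ea g * ed g - eb g * ec g) * (ea h * ed h - eb h * ec h).
    by rewrite /a /b /c /d; ring.
  by rewrite D D' mulr1.
have -> : 2 * hs g * hs h = hs (g * h)%g + (a ^+ 2 + b ^+ 2 + c ^+ 2 + d ^+ 2) / 2.
  rewrite /hs !entM /a /b /c /d.
  set p := ea g; set q := eb g; set r := ec g; set s := ed g.
  by field.
rewrite lerD2l; have := sqr_ge0 (a - d); have := sqr_ge0 (b + c); move: E; clearbody a b c d; nra.
Qed.

Lemma hs_tr g : (ea g + ed g) ^+ 2 / 2 - 1 <= hs g.
Proof. by rewrite /hs; have := SL2_detE g; have := sqr_ge0 (eb g - ec g); nra. Qed.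

Definition rotation g := ea g = ed g /\ eb g = - ec g.

Lemma rotation_norm g : rotation g -> ea g ^+ 2 + ec g ^+ 2 = 1.
Proof. by move=> [h1 h2]; have := SL2_detE g; rewrite h1 h2; lra. Qed.
Lemma rotationM g h : rotation g -> rotation h -> rotation (g * h)%g.
Proof. by move=> [g1 g2] [h1 h2]; split; rewrite !entM g1 g2 h1 h2; lra. Qed.
Lemma rotationV g : rotation g -> rotation g^-1%g.
Proof. by move=> [g1 g2]; split; rewrite !entV ?g1 ?g2. Qed.

Lemma hs_rotl k g : rotation k -> hs (k * g)%g = hs g.
Proof.
move=> rk; have N := rotation_norm rk; case: rk => k1 k2; rewrite /hs !entM -k1 k2.
have -> : forall p q r s u v : R, (u * p + - v * r) ^+ 2 + (u * q + - v * s) ^+ 2 +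
  (v * p + u * r) ^+ 2 + (v * q + u * s) ^+ 2 = (u ^+ 2 + v ^+ 2) * (p ^+ 2 + q ^+ 2 + r ^+ 2 + s ^+ 2).
  by move=> *; ring.
by rewrite N mul1r.
Qed.

Lemma hs_rotr k g : rotation k -> hs (g * k)%g = hs g.
Proof. by move=> rk; rewrite -hsV invgM hs_rotl ?hsV //; apply: rotationV. Qed.

(* The polar decomposition shows that the transpose of g is in K g K. *)
Lemma inv_rotation g : exists k1 k2, [/\ rotation k1, rotation k2 & (g^-1 = k1 * g * k2)%g].
Proof.
have D := SL2_detE g.
pose N := (ea g + ed g) ^+ 2 + (ec g - eb g) ^+ 2.
have N0 : 0 < N by rewrite /N; nra.
have sN0 : 0 < Num.sqrt N by rewrite sqrtr_gt0.
have sN : Num.sqrt N ^+ 2 = N by rewrite sqr_sqrtr // ltW.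
(* These are the entries of [k], the inverse of the rotation factor of [g]: then [k g k] is the
   transpose of [g], and conjugating the transpose by the quarter turn [j] gives the inverse. *)
pose u := (ea g + ed g) / Num.sqrt N; pose v := (ec g - eb g) / Num.sqrt N.
have uv : u ^+ 2 + v ^+ 2 = 1.
  by rewrite /u /v !expr_div_n sN -mulrDl -/N divff // gt_eqF.
have H : u * u - v * (- v) = 1 by rewrite -uv; ring.
have J : 0 * 0 - (-1) * 1 = 1 :> R by ring.
have eN : v * (ea g + ed g) = u * (ec g - eb g) by rewrite /u /v; field; rewrite gt_eqF.
pose k := mkSL2 H; pose j := mkSL2 J.
have [k1 k2 k3 k4] := mkSL2E H; have [j1 j2 j3 j4] := mkSL2E J.
have rk : rotation k by split; rewrite /k ?k1 ?k2 ?k3 ?k4; lra.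
have rj : rotation j by split; rewrite /j ?j1 ?j2 ?j3 ?j4; lra.
exists (j * k)%g, (k * j^-1)%g; split; [exact: rotationM|apply: rotationM => //; exact: rotationV|].
have e1 : u * (u * ea g + v * ec g) - v * (u * eb g + v * ed g) = ea g.
  have -> : u * (u * ea g + v * ec g) - v * (u * eb g + v * ed g) =
    (u ^+ 2 + v ^+ 2) * ea g + v * (u * (ec g - eb g) - v * (ea g + ed g)) by ring.
  by rewrite eN uv; ring.
have e2 : v * (u * ea g + v * ec g) + u * (u * eb g + v * ed g) = ec g.
  have -> : v * (u * ea g + v * ec g) + u * (u * eb g + v * ed g) =
    (u ^+ 2 + v ^+ 2) * ec g + u * (v * (ea g + ed g) - u * (ec g - eb g)) by ring.
  by rewrite eN uv; ring.
have e3 : u * (- v * ea g + u * ec g) - v * (- v * eb g + u * ed g) = eb g.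
  have -> : u * (- v * ea g + u * ec g) - v * (- v * eb g + u * ed g) =
    (u ^+ 2 + v ^+ 2) * eb g + u * (u * (ec g - eb g) - v * (ea g + ed g)) by ring.
  by rewrite eN uv; ring.
have e4 : v * (- v * ea g + u * ec g) + u * (- v * eb g + u * ed g) = ed g.
  have -> : v * (- v * ea g + u * ec g) + u * (- v * eb g + u * ed g) =
    (u ^+ 2 + v ^+ 2) * ed g + v * (u * (ec g - eb g) - v * (ea g + ed g)) by ring.
  by rewrite eN uv; ring.
apply: SL2_eq; rewrite !(entM, entV) /k /j ?(k1, k2, k3, k4, j1, j2, j3, j4).
- by rewrite -[LHS]e4; ring.
- by rewrite -[X in - X = _]e3; ring.
- by rewrite -[X in - X = _]e2; ring.
- by rewrite -[LHS]e1; ring.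
Qed.

Lemma E12_subproof t : 1 * 1 - t * 0 = 1 :> R. Proof. by ring. Qed.
Lemma E21_subproof t : 1 * 1 - 0 * t = 1 :> R. Proof. by ring. Qed.
Definition E12 t := mkSL2 (E12_subproof t).
Definition E21 t := mkSL2 (E21_subproof t).
Lemma E12E t : [/\ ea (E12 t) = 1, eb (E12 t) = t, ec (E12 t) = 0 & ed (E12 t) = 1].
Proof. exact: mkSL2E. Qed.
Lemma E21E t : [/\ ea (E21 t) = 1, eb (E21 t) = 0, ec (E21 t) = t & ed (E21 t) = 1].
Proof. exact: mkSL2E. Qed.
Lemma hs_E12 t : hs (E12 t) = 1 + t ^+ 2 / 2.
Proof. by rewrite /hs; have [-> -> -> ->] := E12E t; lra. Qed.
Lemma hs_E21 t : hs (E21 t) = 1 + t ^+ 2 / 2.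
Proof. by rewrite /hs; have [-> -> -> ->] := E21E t; lra. Qed.

Lemma E12D t1 t2 : E12 (t1 + t2) = (E12 t1 * E12 t2)%g.
Proof.
have [a1 b1 c1 d1] := E12E t1; have [a2 b2 c2 d2] := E12E t2; have [a3 b3 c3 d3] := E12E (t1 + t2).
by apply: SL2_eq; rewrite !entM ?(a1, b1, c1, d1, a2, b2, c2, d2, a3, b3, c3, d3); ring.
Qed.
Lemma E21D t1 t2 : E21 (t1 + t2) = (E21 t1 * E21 t2)%g.
Proof.
have [a1 b1 c1 d1] := E21E t1; have [a2 b2 c2 d2] := E21E t2; have [a3 b3 c3 d3] := E21E (t1 + t2).
by apply: SL2_eq; rewrite !entM ?(a1, b1, c1, d1, a2, b2, c2, d2, a3, b3, c3, d3); ring.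
Qed.

(** SL_2(R) is connected: elementary unipotent matrices generate it, and each of them is a product
    of arbitrarily small ones. The lemma serves as an induction principle over the group. *)
Lemma near1_gen (b : R) (P : SL2 R -> Prop) : 0 < b -> P 1%g ->
  (forall g w, P g -> hs w < 1 + b -> P (g * w)%g) -> forall g, P g.
Proof.
move=> b0 P1 PM.
have small t : exists n : nat, (0 < n)%N /\ (t / n%:R) ^+ 2 / 2 < b.
  exists (Num.truncn (t ^+ 2 / 2 / b)).+1; split => //.
  set n := _.+1; have n1 : (1 : R) <= n%:R by rewrite ler1n.
  have : t ^+ 2 / 2 / b < n%:R by apply: truncnS_gt.
  rewrite ltr_pdivrMr // => h; rewrite expr_div_n mulrAC ltr_pdivrMr; last by apply: exprn_gt0; lra.
  by apply: (lt_le_trans h); rewrite mulrC ler_pM2l // expr2; nra.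
have mult (E : R -> SL2 R) (hE : forall s, hs (E s) = 1 + s ^+ 2 / 2) (E0 : E 0 = 1%g)
    (ED : forall s s', E (s + s') = (E s * E s')%g) g t : P g -> P (g * E t)%g.
  move=> Pg; have [n [n0 hn]] := small t.
  have st k : P (g * E (t / n%:R *+ k))%g.
    elim: k => [|k IH]; first by rewrite mulr0n E0 mulg1.
    by rewrite mulrSr ED mulgA; apply: PM => //; rewrite hE ltrD2l.
  by have := st n; rewrite -mulr_natr divfK // pnatr_eq0 -lt0n.
have m12 := mult _ hs_E12; have m21 := mult _ hs_E21.
have E120 : E12 0 = 1%g by apply: SL2_eq; rewrite ?ent1; case: (E12E 0).
have E210 : E21 0 = 1%g by apply: SL2_eq; rewrite ?ent1; case: (E21E 0).
have nz g : ec g != 0 -> P g.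
  move=> c0.
  (* Factorisation into three elementary matrices, available when the lower left entry is
     nonzero. *)
  have -> : g = (1 * E12 ((ea g - 1) / ec g) * E21 (ec g) * E12 ((ed g - 1) / ec g))%g.
    have D := SL2_detE g.
    have [a1 b1 c1 d1] := E12E ((ea g - 1) / ec g); have [a2 b2 c2 d2] := E21E (ec g).
    have [a3 b3 c3 d3] := E12E ((ed g - 1) / ec g).
    have eb' : eb g = (ea g * ed g - 1) / ec g by rewrite -[X in _ - X]D; field.
    by apply: SL2_eq; rewrite !entM ?ent1 ?(a1, b1, c1, d1, a2, b2, c2, d2, a3, b3, c3, d3) ?eb'; field.
  by apply: (m12 E120 E12D); apply: (m21 E210 E21D); apply: (m12 E120 E12D).
move=> g; have [c0|] := eqVneq (ec g) 0; last exact: nz.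
(* When that entry vanishes, [g * E21 1] has lower left entry [ed g], which the determinant keeps
   away from zero. *)
have -> : g = (g * E21 1 * E21 (-1))%g by rewrite -mulgA -E21D subrr E210 mulg1.
apply: (m21 E210 E21D); apply: nz.
have [a2 b2 c2 d2] := E21E 1; rewrite !entM a2 c2 c0; apply/eqP => h.
have d0 : ed g = 0 by lra.
by have := SL2_detE g; rewrite c0 d0; lra.
Qed.

End SL2Entries.

(** * Entrywise topology and compactness of displacement balls *)

Section SL2Topology.
Variable R : realType.
Implicit Types (g h x y : SL2 R).

Definition near_entries (e : R) g h :=
  [/\ `|ea g - ea h| < e, `|eb g - eb h| < e, `|ec g - ec h| < e & `|ed g - ed h| < e].

Lemma ent_continuous (i j : 'I_2) : continuous (fun g : SL2 R => SL2_mx g i j).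
Proof.
move=> g; apply: (@continuous_comp _ _ _ (@SL2_mx R) (fun M : 'M[R]_2 => M i j)).
  exact: initial_continuous.
exact: coord_continuous.
Qed.

Lemma near_entries_nbhs e g : 0 < e -> nbhs g (near_entries e g).
Proof.
move=> e0; have H i j : \forall h \near g, `|SL2_mx g i j - SL2_mx h i j| < e.
  by have := @ent_continuous i j g; move/cvgrPdist_lt => /(_ _ e0).
near=> h; split; [near: h; exact: H..].
Unshelve. all: by end_near. Qed.

Lemma nbhs_near_entries g (A : set (SL2 R)) : nbhs g A ->
  exists2 e : R, 0 < e & near_entries e g `<=` A.
Proof.
rewrite nbhsE => -[B [oB Bg] BA]; case: oB Bg BA => C oC <- Cg CA.
have : nbhs (SL2_mx g) C by apply: open_nbhs_nbhs.
case=> P hP PC.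
have E i j : exists2 e : R, 0 < e & ball (SL2_mx g i j) e `<=` P i j.
  by have /nbhs_ballP [e /= e0 he] := hP i j; exists e.
have [e1 p1 h1] := E 0 0; have [e2 p2 h2] := E 0 1; have [e3 p3 h3] := E 1 0; have [e4 p4 h4] := E 1 1.
exists (Num.min (Num.min e1 e2) (Num.min e3 e4)).
  by rewrite !lt_min p1 p2 p3 p4.
move=> h [H1 H2 H3 H4]; apply: CA; apply: PC => i j.
move: H1 H2 H3 H4; rewrite !lt_min.
move=> /andP[/andP[a1 _] _] /andP[/andP[_ a2] _] /andP[_ /andP[a3 _]] /andP[_ /andP[_ a4]].
by case: (ord2P i) => ->; case: (ord2P j) => ->; [apply: h1|apply: h2|apply: h3|apply: h4].
Qed.

Lemma SL2_cvg (T : Type) (F : set_system T) (FF : Filter F) (f : T -> SL2 R) g :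
  ea (f x) @[x --> F] --> ea g -> eb (f x) @[x --> F] --> eb g ->
  ec (f x) @[x --> F] --> ec g -> ed (f x) @[x --> F] --> ed g -> f x @[x --> F] --> g.
Proof.
move=> /cvgrPdist_lt ha /cvgrPdist_lt hb /cvgrPdist_lt hc /cvgrPdist_lt hd A /nbhs_near_entries [e e0 he].
rewrite nbhs_filterE /=; near=> x; apply: he; split; near: x; [exact: ha|exact: hb|exact: hc|exact: hd].
Unshelve. all: by end_near. Qed.

Lemma ea_continuous : continuous (@ea R). Proof. exact: ent_continuous. Qed.
Lemma eb_continuous : continuous (@eb R). Proof. exact: ent_continuous. Qed.
Lemma ec_continuous : continuous (@ec R). Proof. exact: ent_continuous. Qed.
Lemma ed_continuous : continuous (@ed R). Proof. exact: ent_continuous. Qed.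

Lemma ent_cvg g : [/\ ea x @[x --> g] --> ea g, eb x @[x --> g] --> eb g,
  ec x @[x --> g] --> ec g & ed x @[x --> g] --> ed g].
Proof. by split; [exact: ea_continuous|exact: eb_continuous|exact: ec_continuous|exact: ed_continuous]. Qed.

Local Ltac entrywise_cvg h := 
  by apply: (@SL2_cvg _ (nbhs h)); [under eq_fun do rewrite eaM; rewrite eaM|under eq_fun do rewrite ebM; rewrite ebM
  |under eq_fun do rewrite ecM; rewrite ecM|under eq_fun do rewrite edM; rewrite edM];
  apply: cvgD; apply: cvgM => //; apply: cvg_cst.

Lemma SL2_mul_continuous g : continuous (fun h => g * h)%g.
Proof.
move=> h; have [a b c d] := ent_cvg h.
entrywise_cvg h.
Qed.

Lemma SL2_mulr_continuous g : continuous (fun h => h * g)%g.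
Proof.
move=> h; have [a b c d] := ent_cvg h.
entrywise_cvg h.
Qed.

Lemma hs_continuous : continuous (@hs R).
Proof.
move=> h; have [a b c d] := ent_cvg h.
have q (f : SL2 R -> R) (l : R) : f x @[x --> h] --> l -> (f x ^+ 2) @[x --> h] --> l ^+ 2.
  by move=> fl; under eq_fun do rewrite expr2; rewrite expr2; apply: (@cvgM _ _ (nbhs h)).
rewrite /continuous_at /hs; apply: (@cvgM _ _ (nbhs h)); last exact: cvg_cst.
by do 3 ?[apply: (@cvgD _ _ _ (nbhs h))]; apply: q.
Qed.

Lemma hs_open (c : R) : open [set g | hs g < c].
Proof. by apply: (@open_comp _ _ (@hs R) [set x | x < c]) => [g _|]; [exact: hs_continuous|exact: open_lt]. Qed.

Lemma ent_le_hs g : `|ea g| <= 2 * hs g /\ `|eb g| <= 2 * hs g /\ `|ec g| <= 2 * hs g /\ `|ed g| <= 2 * hs g.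
Proof.
have h := hs_ge1 g; rewrite !ler_norml.
have e : 2 * hs g = ea g ^+ 2 + eb g ^+ 2 + ec g ^+ 2 + ed g ^+ 2 by rewrite /hs; lra.
have := sqr_ge0 (ea g); have := sqr_ge0 (eb g); have := sqr_ge0 (ec g); have := sqr_ge0 (ed g) => d2 c2 b2 a2.
by do ?split; apply/andP; split; nra.
Qed.

(** Compactness of a segment, phrased for ultrafilters; it provides the limits both in [hs_compact]
    and for the maximising sequences of the spectral argument. *)
Lemma ultra_cvg_segment (T : Type) (F : set_system T) (UF : UltraFilter F) (f : T -> R) (c : R) :
  F [set x | `|f x| <= c] -> exists l : R, f x @[x --> F] --> l.
Proof.
move=> Fc; have pF : ProperFilter (f x @[x --> F]) by apply: fmap_proper_filter; exact: ultra_proper.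
have H : (f x @[x --> F]) `[- c, c]%classic.
  by apply: filterS Fc => x /= hx; rewrite in_itv /= -ler_norml; exact: hx.
have [l [_ cl]] := @segment_compact R (- c) c _ pF H.
exists l => B nB; have [//|FB] := in_ultra_setVsetC (f @^-1` B) UF.
exfalso; have [z [/= z1 z2]] := cl (~` B) B FB nB; exact: z1.
Qed.

(** The displacement bounds every entry. Along an ultrafilter the four entries converge, and the
    determinant condition and the displacement bound pass to the limit. *)
Lemma hs_compact (c : R) : compact [set g | hs g <= c].
Proof.
rewrite compact_ultra => F UF Fc; have pF := @ultra_proper _ F UF.
have bnd (f : SL2 R -> R) : (forall g, `|f g| <= 2 * hs g) -> exists l : R, f x @[x --> F] --> l.
  move=> hf; apply: (@ultra_cvg_segment _ F UF f (2 * c)).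
  apply: filterS Fc => g /= hg; apply: le_trans (hf g) _; lra.
have [a ha] := bnd (@ea R) (fun g => (ent_le_hs g).1).
have [b hb] := bnd (@eb R) (fun g => (ent_le_hs g).2.1).
have [c' hc] := bnd (@ec R) (fun g => (ent_le_hs g).2.2.1).
have [d hd] := bnd (@ed R) (fun g => (ent_le_hs g).2.2.2).
have D : a * d - b * c' = 1.
  have l1 : (ea x * ed x - eb x * ec x) @[x --> F] --> a * d - b * c'.
    by apply: cvgB; apply: cvgM.
  have l2 : (ea x * ed x - eb x * ec x) @[x --> F] --> (1 : R).
    under eq_fun do rewrite SL2_detE.
    exact: cvg_cst.
  by apply: (cvg_unique _ l1 l2).
have [m1 m2 m3 m4] := mkSL2E D.
have cv : F --> mkSL2 D.
  by apply: (@SL2_cvg _ F _ id); rewrite /= ?m1 ?m2 ?m3 ?m4.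
exists (mkSL2 D); split => //=.
have hc' : hs x @[x --> F] --> hs (mkSL2 D) by apply: (cvg_comp _ _ cv); exact: hs_continuous.
rewrite leNgt; apply/negP => lt.
have /cvgrPdist_lt /(_ (hs (mkSL2 D) - c)) := hc'; rewrite subr_gt0 => /(_ lt) Fg.
have [x [/= h1]] := filter_ex (filterI Fc Fg).
by rewrite ltr_norml => /andP[_ h2]; move: h1 h2 {hc' cv}; lra.
Qed.

(** Elements whose whole cosets leave larger and larger balls would cluster in the compact quotient
    at some coset. A displacement ball around a representative has open image, so cosets far out in
    the sequence would meet this ball. *)
Lemma cocompact_hs (Gamma : subgroup (SL2 R)) : cocompact Gamma ->
  exists c : R, forall g, exists2 gam, subgroup_set Gamma gam & hs (g * gam)%g <= c.
Proof.
move=> cG; apply: contrapT => H.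
have H' (n : nat) : exists g, forall gam, subgroup_set Gamma gam -> n%:R < hs (g * gam)%g.
  apply: contrapT => Hn; apply: H; exists n%:R => g; apply: contrapT => Hg; apply: Hn; exists g => gam Gg.
  by rewrite ltNge; apply/negP => hle; apply: Hg; exists gam.
have [u hu] := choice H'.
pose Q := quotient_topology {eq_quot (coset_equiv Gamma)}%qT.
pose p (g : SL2 R) : Q := (\pi_{eq_quot (coset_equiv Gamma)}%qT g)%qT.
have pE g h : p g = p h <-> subgroup_set Gamma (g^-1 * h)%g.
  split=> [/eqmodP /asboolP //|hg]; apply/eqmodP; exact/asboolP.
have [q [_ cq]] := cG (p (u n) @[n --> \oo]) _ filterT.
have [g qg] : exists g, q = p g by exists (repr q); rewrite /p reprK.
pose N := [set h : SL2 R | hs h < hs g + 1].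
have nb : nbhs q (p @` N).
  apply: open_nbhs_nbhs; split; last by exists g => //; rewrite /N /=; lra.
  have -> : p @` N = [set y | (p @` N) y] by [].
  suff oS : open (p @^-1` (p @` N)) by exact: oS.
  have -> : p @^-1` (p @` N) = \bigcup_(gam in subgroup_set Gamma) [set h | N (h * gam)%g].
    rewrite predeqE => h; split=> [[h' Nh' /pE eh]|[gam Gg Nh]]; last first.
      by exists (h * gam)%g => //; apply/pE; rewrite invgM mulgVK; case: (subgroupP Gamma) => _ _; apply.
    exists (h^-1 * h')%g; last by rewrite /= mulVKg.
    by case: (subgroupP Gamma) => _ _ /(_ _ eh); rewrite invgM invgK.
  apply: bigcup_open => gam Gg; apply: (@open_comp _ _ (fun h => h * gam)%g N) => [h _|].
    exact: SL2_mulr_continuous.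
  exact: hs_open.
pose m := Num.truncn (hs g + 1).
have A : (p (u n) @[n --> \oo]) [set y | exists2 n, (m < n)%N & y = p (u n)].
  by exists m.+1 => // n /= mn; exists n.
have [y [[n mn ->] [h Nh /esym /pE eh]]] := cq _ _ A nb.
have := hu n _ eh; rewrite mulVKg => hlt.
suff : hs g + 1 < n%:R by move: Nh; rewrite /N /=; lra.
by apply: (lt_le_trans (truncnS_gt _)); rewrite ler_nat.
Qed.

End SL2Topology.

(** * Measurability of maps into SL_2(R) *)

Section SL2Measurable.
Variable R : realType.
Local Notation G := (borelSL2 R).

Lemma open_measurable_SL2 (U : set (SL2 R)) : open U -> measurable (U : set G).
Proof. by move=> oU; apply: sub_sigma_algebra. Qed.

Lemma continuous_measurable_SL2 (f : SL2 R -> R) : continuous f -> measurable_fun [set: G] f.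
Proof.
move=> cf; apply: (measurability _ (RGenOpens.measurableE R)) => //.
move=> _ [_ [a [b ->] <-]]; rewrite setTI; apply: open_measurable_SL2.
by move/continuousP : cf; apply; exact: interval_open.
Qed.

Lemma measurable_ea : measurable_fun [set: G] (@ea R). Proof. exact: continuous_measurable_SL2 (@ea_continuous R). Qed.
Lemma measurable_eb : measurable_fun [set: G] (@eb R). Proof. exact: continuous_measurable_SL2 (@eb_continuous R). Qed.
Lemma measurable_ec : measurable_fun [set: G] (@ec R). Proof. exact: continuous_measurable_SL2 (@ec_continuous R). Qed.
Lemma measurable_ed : measurable_fun [set: G] (@ed R). Proof. exact: continuous_measurable_SL2 (@ed_continuous R). Qed.

Lemma countable_bigcup_measurable d (T : measurableType d) (I : countType) (F : I -> set T) :
  (forall i, measurable (F i)) -> measurable (\bigcup_i F i).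
Proof.
move=> mF; have -> : \bigcup_i F i = \bigcup_k (if unpickle k is Some i then F i else set0).
  rewrite predeqE => x; split=> [[i _ Fx]|[k _]]; first by exists (pickle i) => //=; rewrite pickleK.
  by case: (unpickle k) => // i Fx; exists i.
by apply: bigcupT_measurable => k; case: unpickle.
Qed.

(** Boxes with rational centres and sides given by reciprocals of integers form a countable family
    exhausting every open set, so measurability of the entries reaches all Borel sets. *)
Lemma measurable_fun_SL2 d (T : measurableType d) (f : T -> G) :
  measurable_fun [set: T] (fun x => ea (f x)) -> measurable_fun [set: T] (fun x => eb (f x)) ->
  measurable_fun [set: T] (fun x => ec (f x)) -> measurable_fun [set: T] (fun x => ed (f x)) ->
  measurable_fun [set: T] f.
Proof.
move=> ma mb mc md.
apply: (@measurability _ _ T G setT f (@open (SL2 R))) => //.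
move=> _ [U oU <-]; rewrite setTI.
pose box (i : (rat * rat * rat * rat) * nat) : set (SL2 R) :=
  [set h | [/\ `|ratr i.1.1.1.1 - ea h| < i.2.+1%:R^-1, `|ratr i.1.1.1.2 - eb h| < i.2.+1%:R^-1,
     `|ratr i.1.1.2 - ec h| < i.2.+1%:R^-1 & `|ratr i.1.2 - ed h| < i.2.+1%:R^-1]].
have -> : f @^-1` U = \bigcup_i (if `[< box i `<=` U >] then f @^-1` (box i) else set0).
  rewrite predeqE => x; split=> [Ux|[i _]]; last by case: asboolP => // bU /bU.
  have /nbhs_near_entries [e e0 he] : nbhs (f x : SL2 R) U by apply: open_nbhs_nbhs.
  pose n := Num.truncn (2 / e); have n0 : n.+1%:R^-1 < e / 2 :> R.
    rewrite invf_plt ?posrE ?ltr0n //; last lra.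
    by rewrite invf_div; apply: truncnS_gt.
  have np : 0 < n.+1%:R^-1 :> R by rewrite invr_gt0 ltr0n.
  have ap (t : R) : exists q : rat, `|ratr q - t| < n.+1%:R^-1.
    move: (n.+1%:R^-1 : R) np => w w0; have [|q] := @rat_in_itvoo R (t - w) (t + w); first lra.
    by rewrite in_itv /= => /andP[q1 q2]; exists q; rewrite ltr_norml; apply/andP; split; lra.
  have [qa ha] := ap (ea (f x)); have [qb hb] := ap (eb (f x)).
  have [qc hc] := ap (ec (f x)); have [qd hd] := ap (ed (f x)).
  exists ((qa, qb, qc, qd), n) => //; case: asboolP => [_|]; first by split.
  case=> h [h1 h2 h3 h4]; apply: he; move: ha hb hc hd h1 h2 h3 h4 => /=.
  move: (n.+1%:R^-1 : R) n0 => w hw.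
  by rewrite /near_entries !ltr_norml; clear -hw => /andP[? ?] /andP[? ?] /andP[? ?] /andP[? ?]
    /andP[? ?] /andP[? ?] /andP[? ?] /andP[? ?]; split; apply/andP; split; lra.
apply: countable_bigcup_measurable => i; case: asboolP => _ //.
have B (u : T -> R) (q e : R) : measurable_fun setT u -> measurable [set x | `|q - u x| < e].
  move=> mu; have -> : [set x | `|q - u x| < e] = u @^-1` `]q - e, q + e[%classic.
    by rewrite predeqE => x /=; rewrite in_itv /= ltr_norml; split => /andP[? ?]; apply/andP; split; lra.
  by rewrite -[X in measurable X]setTI; apply: mu.
have -> : f @^-1` (box i) = [set x | `|ratr i.1.1.1.1 - ea (f x)| < i.2.+1%:R^-1] `&`
  [set x | `|ratr i.1.1.1.2 - eb (f x)| < i.2.+1%:R^-1] `&`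
  [set x | `|ratr i.1.1.2 - ec (f x)| < i.2.+1%:R^-1] `&` [set x | `|ratr i.1.2 - ed (f x)| < i.2.+1%:R^-1].
  by rewrite predeqE => x; split=> [[]|[[[]]]].
by do 3 ?apply: measurableI; apply: B.
Qed.

Lemma measurable_mulSL2 d (T : measurableType d) (f g : T -> G) :
  measurable_fun [set: T] f -> measurable_fun [set: T] g ->
  measurable_fun [set: T] (fun x => (f x * g x)%g : G).
Proof.
move=> mf mg; have a := measurable_ea; have b := measurable_eb; have c := measurable_ec; have d' := measurable_ed.
apply: measurable_fun_SL2; [under eq_fun do rewrite eaM|under eq_fun do rewrite ebM
  |under eq_fun do rewrite ecM|under eq_fun do rewrite edM];
  by apply: measurable_funD; apply: measurable_funM; apply: measurableT_comp.
Qed.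

Lemma measurable_invSL2 d (T : measurableType d) (f : T -> G) :
  measurable_fun [set: T] f -> measurable_fun [set: T] (fun x => (f x)^-1%g : G).
Proof.
move=> mf; have a := measurable_ea; have b := measurable_eb; have c := measurable_ec; have d' := measurable_ed.
apply: measurable_fun_SL2; [under eq_fun do rewrite eaV|under eq_fun do rewrite ebV
  |under eq_fun do rewrite ecV|under eq_fun do rewrite edV];
  by [apply: measurableT_comp|apply: measurable_funN; apply: measurableT_comp].
Qed.

Lemma measurable_hs : measurable_fun [set: G] (@hs R).
Proof. exact: continuous_measurable_SL2 (@hs_continuous R). Qed.

End SL2Measurable.

(* The same measure, carrying a sigma-finite structure that depends on the Haar hypothesis. *)
Definition haar_sf (R : realType) (mu : SL2_measure R) (h : is_haar mu) :
  set (borelSL2 R) -> \bar R := mu.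

HB.instance Definition _ (R : realType) (mu : SL2_measure R) (h : is_haar mu) :=
  Measure.copy (haar_sf h) mu.

Section HaarSigmaFinite.
Variables (R : realType) (mu : SL2_measure R).
Hypothesis mu_haar : is_haar mu.
Local Notation G := (borelSL2 R).

Lemma hs_measurable (C : R) : measurable ([set x : SL2 R | hs x <= C] : set G).
Proof.
have -> : [set x : SL2 R | hs x <= C] = @hs R @^-1` `]-oo, C] by rewrite predeqE => x /=; rewrite in_itv.
by rewrite -[X in measurable X]setTI; apply: measurable_hs.
Qed.

Lemma mu_hs_fin (C : R) : (mu [set x | (hs x <= C)%R] < +oo)%E.
Proof. by case: mu_haar => _ + _; apply; exact: hs_compact. Qed.

Lemma mu_sigma_finite : sigma_finite [set: G] (haar_sf mu_haar).
Proof.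
exists (fun n => [set x : SL2 R | hs x <= n%:R]) => [|n]; last first.
  by split; [exact: hs_measurable|exact: mu_hs_fin].
rewrite predeqE => x; split=> // _; exists (Num.truncn (hs x)).+1 => //=.
exact/ltW/truncnS_gt.
Qed.

End HaarSigmaFinite.

HB.instance Definition _ (R : realType) (mu : SL2_measure R) (h : is_haar mu) :=
  Measure_isSigmaFinite.Build _ _ _ (haar_sf h) (mu_sigma_finite h).

(** * Haar integration of bounded functions of bounded support *)

Section HaarIntegral.
Variables (R : realType) (mu : SL2_measure R).
Hypothesis mu_haar : is_haar mu.
Local Notation G := (borelSL2 R).
Implicit Types (f g : SL2 R -> R) (x y : SL2 R) (C : R).

Let m : {sigma_finite_measure set G -> \bar R} := haar_sf mu_haar.

Lemma haar_tonelli_measurable (f : G * G -> \bar R) : measurable_fun [set: G * G] f -> (forall z, (0 <= f z)%E) ->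
  measurable_fun [set: G] (fun x : G => \int[mu]_y f (x, y))%E.
Proof. exact: (@measurable_fun_fubini_tonelli_F _ _ _ _ _ m). Qed.
Lemma measurable_mull x : measurable_fun [set: G] (fun y : G => (x * y)%g : G).
Proof. by apply: measurable_mulSL2 => //; exact: measurable_id. Qed.
Lemma measurable_mulr x : measurable_fun [set: G] (fun y : G => (y * x)%g : G).
Proof. by apply: measurable_mulSL2 => //; exact: measurable_id. Qed.

Lemma mu_left x (A : set G) : measurable A -> mu ((fun y : G => (x * y)%g : G) @^-1` A : set G) = mu A.
Proof.
move=> mA; have mB : measurable ((fun y : G => (x * y)%g : G) @^-1` A : set G).
  by rewrite -[X in measurable X]setTI; apply: measurable_mull.
case: mu_haar => /(_ x _ mB) <- _ _; congr (mu _).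
rewrite predeqE => y; split=> [[z /= Az <-] //|Ay]; exists (x^-1 * y)%g; last by rewrite mulVKg.
by rewrite /= mulVKg.
Qed.

(** A class stable under linear combinations, translations and inversion, on which integrability is
    automatic. One constant serves both as bound and as radius of the support. *)
Definition adm f := measurable_fun [set: G] f /\
  exists C, (forall x, `|f x| <= C) /\ (forall x, C < hs x -> f x = 0).

Definition hI f : R := (\int[mu]_x f x)%R.

Lemma admP f C D : measurable_fun [set: G] f -> (forall x, `|f x| <= C) ->
  (forall x, D < hs x -> f x = 0) -> adm f.
Proof.
move=> mf fC fD; split => //; exists (Num.max C D); split=> x.
  by rewrite le_max fC.
by rewrite gt_max => /andP[_ /fD].
Qed.

Lemma adm_integrable f : adm f -> mu.-integrable [set: G] (EFin \o f).
Proof.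
move=> [mf [C [fC f0]]].
have mE : mu.-integrable [set: G] (fun x => (C * \1_[set x | hs x <= C] x)%:E).
  apply/integrableP; split.
    by apply/measurable_EFinP; apply: measurable_funM => //; apply: measurable_indic; exact: hs_measurable.
  have C0 : 0 <= C by apply: le_trans (normr_ge0 (f 1%g)) (fC _).
  under eq_integral do rewrite gee0_abs ?lee_fin ?mulr_ge0 // EFinM.
  rewrite ge0_integralZl_EFin //; last first.
    by apply/measurable_EFinP; apply: measurable_indic; exact: hs_measurable.
  rewrite integral_indic ?setIT //; last exact: hs_measurable.
  apply: lte_mul_pinfty => //; exact: mu_hs_fin.
apply: le_integrable mE => //; first exact/measurable_EFinP.
move=> x _ /=; rewrite lee_fin; apply: le_trans (ler_norm _).
have [h|h] := leP (hs x) C; first by rewrite indicE mem_set // mulr1.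
by rewrite f0 // normr0 indicE memNset ?mulr0 //= => /(lt_le_trans h); rewrite ltxx.
Qed.

Lemma admD f g : adm f -> adm g -> adm (fun x => f x + g x).
Proof.
move=> [mf [C [fC f0]]] [mg [D [gD g0]]]; apply: (@admP _ (C + D) (Num.max C D)).
- exact: measurable_funD.
- by move=> x; apply: le_trans (ler_normD _ _) _; apply: lerD.
- by move=> x; rewrite gt_max => /andP[/f0 -> /g0 ->]; rewrite addr0.
Qed.

Lemma admMl f g C : measurable_fun [set: G] g -> (forall x, `|g x| <= C) -> adm f -> adm (fun x => g x * f x).
Proof.
move=> mg gC [mf [D [fD f0]]]; apply: (@admP _ (C * D) D).
- exact: measurable_funM.
- by move=> x; rewrite normrM; apply: ler_pM.
- by move=> x /f0 ->; rewrite mulr0.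
Qed.

Lemma admMr f g C : measurable_fun [set: G] g -> (forall x, `|g x| <= C) -> adm f -> adm (fun x => f x * g x).
Proof. by move=> mg gC /(admMl mg gC); under eq_fun do rewrite mulrC. Qed.
Lemma admZ c f : adm f -> adm (fun x => c * f x).
Proof. by apply: (@admMl _ (cst c) `|c|) => //. Qed.
Lemma admN f : adm f -> adm (fun x => - f x).
Proof. by move=> /(admZ (-1)); under eq_fun do rewrite mulN1r. Qed.
Lemma admB f g : adm f -> adm g -> adm (fun x => f x - g x).
Proof. by move=> af /admN; apply: admD. Qed.
Lemma adm0 : adm (fun=> 0).
Proof. by apply: (@admP _ 0 0) => // x; rewrite normr0. Qed.

Lemma adm_norm f : adm f -> adm (fun x => `|f x|).
Proof.
move=> [mf [D [fD f0]]]; apply: (@admP _ D D); [exact: measurableT_comp|by move=> x; rewrite normr_id|].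
by move=> x /f0 ->; rewrite normr0.
Qed.

Lemma adm_left x f : adm f -> adm (fun y => f (x * y)%g).
Proof.
move=> [mf [C [fC f0]]]; apply: (@admP _ C (2 * hs x * C)) => // [|y h].
  exact: (measurableT_comp mf (measurable_mull x)).
apply: f0; have := hsM x^-1%g (x * y)%g; rewrite mulKg hsV => h2.
have p : 0 < 2 * hs x by have := hs_gt0 x; lra.
by rewrite -(ltr_pM2l p); apply: (lt_le_trans h); lra.
Qed.

Lemma adm_right x f : adm f -> adm (fun y => f (y * x)%g).
Proof.
move=> [mf [C [fC f0]]]; apply: (@admP _ C (2 * hs x * C)) => // [|y h].
  exact: (measurableT_comp mf (measurable_mulr x)).
apply: f0; have := hsM (y * x)%g x^-1%g; rewrite mulgK hsV => h2.
have p : 0 < 2 * hs x by have := hs_gt0 x; lra.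
by rewrite -(ltr_pM2l p); apply: (lt_le_trans h); lra.
Qed.

Lemma adm_inv f : adm f -> adm (fun y => f y^-1%g).
Proof.
move=> [mf [C [fC f0]]]; apply: (@admP _ C C) => // [|y h]; last by apply: f0; rewrite hsV.
have mi : measurable_fun [set: G] (fun y : G => y^-1%g : G) by apply: measurable_invSL2; exact: measurable_id.
  exact: (measurableT_comp mf mi).
Qed.

Lemma adm_sum (I : Type) (s : seq I) (F : I -> SL2 R -> R) : (forall i, adm (F i)) ->
  adm (fun x => \sum_(i <- s) F i x).
Proof.
move=> aF; elim: s => [|i s IH]; first by under eq_fun do rewrite big_nil; exact: adm0.
by under eq_fun do rewrite big_cons; apply: admD.
Qed.

Lemma eq_hI f g : f =1 g -> hI f = hI g.
Proof. by move=> fg; apply: eq_Rintegral => x _; exact: fg. Qed.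
Lemma hID f g : adm f -> adm g -> hI (fun x => f x + g x) = hI f + hI g.
Proof. by move=> af ag; apply: RintegralD => //; exact: adm_integrable. Qed.
Lemma hIB f g : adm f -> adm g -> hI (fun x => f x - g x) = hI f - hI g.
Proof. by move=> af ag; apply: RintegralB => //; exact: adm_integrable. Qed.
Lemma hIZ c f : adm f -> hI (fun x => c * f x) = c * hI f.
Proof. by move=> af; apply: RintegralZl => //; exact: adm_integrable. Qed.
Lemma hI0 : hI (fun=> 0) = 0.
Proof. by rewrite -[RHS](mul0r (hI (fun=> 0))) -hIZ ?mul0r //; exact: adm0. Qed.

Lemma hI_sum (I : Type) (s : seq I) (F : I -> SL2 R -> R) : (forall i, adm (F i)) ->
  hI (fun x => \sum_(i <- s) F i x) = \sum_(i <- s) hI (F i).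
Proof.
move=> aF; elim: s => [|i s IH].
  by transitivity (hI (fun=> 0)); [apply: eq_hI => x; rewrite big_nil|rewrite hI0 big_nil].
rewrite big_cons -IH -hID //; last exact: adm_sum.
by apply: eq_hI => x; rewrite big_cons.
Qed.

Lemma hI_le f g : adm f -> adm g -> (forall x, f x <= g x) -> hI f <= hI g.
Proof. by move=> af ag fg; apply: le_Rintegral => //; exact: adm_integrable. Qed.
Lemma hI_ge0 f : (forall x, 0 <= f x) -> 0 <= hI f.
Proof. by move=> f0; apply: Rintegral_ge0. Qed.
Lemma hI_norm f : adm f -> `|hI f| <= hI (fun x => `|f x|).
Proof. by move=> af; apply: le_normr_Rintegral => //; exact: adm_integrable. Qed.
Lemma hI_EFin f : adm f -> (hI f)%:E = (\int[mu]_x (f x)%:E)%E.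
Proof. by move=> af; rewrite /hI /Rintegral fineK //; exact/integrable_fin_num/adm_integrable. Qed.

Lemma hI_left x f : adm f -> hI (fun y => f (x * y)%g) = hI f.
Proof.
move=> af; have mx := measurable_mull x; rewrite /hI /Rintegral; congr fine.
have [mf _] := af; have mEf : measurable_fun [set: G] (EFin \o f) by exact/measurable_EFinP.
transitivity (\int[pushforward mu (fun y : G => (x * y)%g : G)]_y (f y)%:E)%E.
  symmetry; apply: etrans (integral_pushforward mx (mu := mu) mEf _ measurableT) _; rewrite preimage_setT //.
  exact: (adm_integrable (adm_left x af)).
by apply: eq_measure_integral => A mA _; apply: mu_left.
Qed.

(** Integrability on the product comes from Tonelli: the inner integral of the absolute value is
    bounded by a constant times the indicator of a ball, which has finite Haar measure. *)
Lemma hI_fubini_adm (K : SL2 R * SL2 R -> R) C : measurable_fun [set: G * G] K ->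
  (forall z, `|K z| <= C) -> (forall x y, C < hs x \/ C < hs y -> K (x, y) = 0) ->
  [/\ forall x, adm (fun y => K (x, y)), adm (fun x => hI (fun y => K (x, y))) &
    hI (fun x => hI (fun y => K (x, y))) = hI (fun y => hI (fun x => K (x, y)))].
Proof.
move=> mK KC K0.
have mEK : measurable_fun [set: G * G] (fun z => (K z)%:E) by exact/measurable_EFinP.
have a1 x : adm (fun y => K (x, y)).
  by apply: (@admP _ C C) => [|//|y h]; [exact: (measurable_fun_pair2 (T1 := G))|apply: K0; right].
have a2 y : adm (fun x => K (x, y)).
  by apply: (@admP _ C C) => [|//|x h]; [exact: (measurable_fun_pair1 (T2 := G))|apply: K0; left].
pose B := hI (fun x => C * \1_[set x | hs x <= C] x).
have aB : adm (fun x => C * \1_[set x | hs x <= C] x).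
  apply: admZ; apply: (@admP _ 1 C); first by apply: measurable_indic; exact: hs_measurable.
    by move=> x; rewrite indicE; case: (_ \in _); rewrite ?normr1 ?normr0.
  by move=> x h; rewrite indicE memNset //= => /(lt_le_trans h); rewrite ltxx.
have hB x : hI (fun y => `|K (x, y)|) <= B.
  apply: hI_le => // [|y]; first exact: adm_norm.
  have [h|h] := leP (hs y) C; first by rewrite indicE mem_set // mulr1.
  by rewrite K0 ?normr0 ?mulr_ge0 //; [exact: le_trans (KC (x, y))|right].
have iK : (mu \x mu)%E.-integrable [set: G * G] (EFin \o K).
  apply/(@integrable12ltyP _ _ _ _ _ m m) => //.
  apply: (@le_lt_trans _ _ (\int[mu]_x (B * \1_[set x | hs x <= C] x)%:E)%E).
    apply: ge0_le_integral => //.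
    - by move=> x _; apply: integral_ge0.
    - apply: (@haar_tonelli_measurable (fun z => `|(K z)%:E|%E)) => //.
      exact: measurableT_comp.
    - by apply/measurable_EFinP; apply: measurable_funM => //; apply: measurable_indic; exact: hs_measurable.
    move=> x _; rewrite (_ : (\int[_]_y _)%E = (hI (fun y => `|K (x, y)|))%:E); last first.
      by rewrite hI_EFin //; exact: adm_norm.
    rewrite lee_fin; have [h|h] := leP (hs x) C; first by rewrite indicE mem_set // mulr1.
    rewrite (_ : hI _ = 0) ?mulr_ge0 //; first by apply: le_trans (hB x); exact: hI_ge0.
    by rewrite -hI0; apply: eq_hI => y; rewrite K0 ?normr0 //; left.
  have aB' : adm (fun x => B * \1_[set x | hs x <= C] x).
    apply: admZ; apply: (@admP _ 1 C); first by apply: measurable_indic; exact: hs_measurable.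
      by move=> x; rewrite indicE; case: (_ \in _); rewrite ?normr1 ?normr0.
    by move=> x h; rewrite indicE memNset //= => /(lt_le_trans h); rewrite ltxx.
  by rewrite -hI_EFin // ltry.
have mF : measurable_fun [set: G] (fun x => hI (fun y => K (x, y))).
  suff h : measurable_fun [set: G] (EFin \o (fun x : G => hI (fun y => K (x, y)))) by move/measurable_EFinP: h.
  rewrite (_ : _ \o _ = @fubini_F _ _ G G R m (EFin \o K)); last by apply/funext => x /=; rewrite hI_EFin.
  exact: (@measurable_fubini_F _ _ _ _ _ m m _ iK).
split; [exact: a1| |].
  apply: (@admP _ B C) => // [x|x h].
    by apply: le_trans (hI_norm (a1 x)) (hB x).
  by rewrite -hI0; apply: eq_hI => y; rewrite K0 //; left.
have := @Fubini _ _ _ _ _ m m _ iK.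
rewrite {1 3}/hI /Rintegral => h; congr fine.
under eq_integral do rewrite hI_EFin //.
by under [RHS]eq_integral do rewrite hI_EFin //.
Qed.

Lemma adm_indic (A : set G) C : measurable A -> (forall x, A x -> hs x <= C) -> adm (\1_A).
Proof.
move=> mA AC; apply: (@admP _ 1 C); first exact: measurable_indic.
  by move=> x; rewrite indicE; case: (_ \in _); rewrite ?normr1 ?normr0.
by move=> x h; rewrite indicE memNset // => /AC /(lt_le_trans h); rewrite ltxx.
Qed.

Lemma hI_indic (A : set G) C : measurable A -> (forall x, A x -> hs x <= C) -> (hI (\1_A))%:E = mu A.
Proof.
move=> mA AC; have aA := adm_indic mA AC.
by rewrite hI_EFin // integral_indic // setIT.
Qed.

Lemma hI_gt0 f (U : set (SL2 R)) c : adm f -> (forall x, 0 <= f x) -> 0 < c -> open U -> U !=set0 ->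
  (forall x, U x -> c <= f x) -> 0 < hI f.
Proof.
move=> af f0 c0 oU U0 Uc; have [mf [C [_ fC]]] := af.
have mU := open_measurable_SL2 oU.
have UC x : U x -> hs x <= C.
  by move=> /Uc h; rewrite leNgt; apply/negP => /fC fx; move: h; rewrite fx leNgt c0.
have aU := adm_indic mU UC.
apply: (@lt_le_trans _ _ (c * hI (\1_U))); last first.
  rewrite -hIZ //; apply: hI_le => //; [exact: admZ|move=> x].
  by rewrite indicE; case: (boolP (x \in _)) => [/set_mem /Uc|]; rewrite ?mulr1 ?mulr0.
rewrite mulr_gt0 // -lte_fin (hI_indic mU UC); case: mu_haar => _ _; exact.
Qed.

End HaarIntegral.

(** * Unimodularity and invariance under inversion *)

Section Unimodular.
Variables (R : realType) (mu : SL2_measure R).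
Hypothesis mu_haar : is_haar mu.
Local Notation G := (borelSL2 R).
Local Notation hI := (hI mu).
Implicit Types (f k psi : SL2 R -> R).

Lemma measurable_fun_mulpair f (u v : G * G -> G) : measurable_fun [set: G] f ->
  measurable_fun [set: G * G] u -> measurable_fun [set: G * G] v ->
  measurable_fun [set: G * G] (fun z => f (u z * v z)%g).
Proof. by move=> mf mu' mv; exact: (measurableT_comp mf (measurable_mulSL2 mu' mv)). Qed.

(** In classical terms the inner integral is [hI k] times the modular function or its inverse. The
    identity uses only left invariance and Fubini, so it is available before that function is known
    to be a character. *)
Lemma modular_identity psi k : adm psi -> adm k ->
  adm (fun x => psi x * hI (fun y => k (y * x)%g)) /\
  hI (fun x => psi x * hI (fun y => k (y * x)%g)) = hI k * hI (fun y => psi y^-1%g).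
Proof.
move=> apsi ak; have [mp [C [pC p0]]] := apsi; have [mk [D [kD k0]]] := ak.
have C0 : 0 <= C by apply: le_trans (normr_ge0 _) (pC 1%g).
have D0 : 0 <= D by apply: le_trans (normr_ge0 _) (kD 1%g).
pose B := C + D + C * D + 2 * C * D.
have CD : 0 <= C * D by rewrite mulr_ge0.
have [hC hD hCD hCD2] : [/\ C <= B, D <= B, C * D <= B & 2 * D * C <= B] by rewrite /B; split; lra.
have big x y : B < hs y -> C < hs x \/ D < hs (y * x)%g.
  move=> hy; have [h|h] := ltP C (hs x); [by left|right].
  rewrite ltNge; apply/negP => h'; have := hsM (y * x)%g x^-1%g; rewrite mulgK hsV => h2.
  have : 2 * hs (y * x)%g * hs x <= 2 * D * C.
    by have := hs_gt0 (y * x)%g; have := hs_gt0 x; nra.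
  by lra.
have [|||a1 a2 e1] := @hI_fubini_adm _ mu mu_haar (fun z => psi z.1 * k (z.2 * z.1)%g) B.
- apply: measurable_funM; first exact: (measurableT_comp mp measurable_fst).
  by apply: measurable_fun_mulpair.
- by move=> z; rewrite normrM; apply: le_trans hCD; apply: ler_pM.
- move=> x y /= [h|h]; first by rewrite p0 ?mul0r //; lra.
  by case: (big x y h) => [/p0 ->|/k0 ->]; rewrite ?mul0r ?mulr0.
have ain x : adm (fun y => k (y * x)%g) by apply: adm_right.
have E x : hI (fun y => psi x * k (y * x)%g) = psi x * hI (fun y => k (y * x)%g) by rewrite hIZ.
split; first by move: a2; under eq_fun do rewrite /= E.
rewrite -(eq_hI mu E) e1 /=.
have a3 y : adm (fun x => psi x * k (y * x)%g) by apply: (admMl mp pC); apply: adm_left.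
transitivity (hI (fun y => hI (fun x => psi (y^-1 * x)%g * k x))).
  apply: eq_hI => y; rewrite -(hI_left mu_haar y^-1%g (a3 y)).
  by apply: eq_hI => x; rewrite mulVKg.
have [|||b1 b2 ->] := @hI_fubini_adm _ mu mu_haar (fun z => psi (z.1^-1 * z.2)%g * k z.2) B.
- apply: measurable_funM; last exact: (measurableT_comp mk measurable_snd).
  by apply: measurable_fun_mulpair => //; apply: measurable_invSL2.
- by move=> z; rewrite normrM; apply: le_trans hCD; apply: ler_pM.
- move=> y x /= [h|h]; last by rewrite (k0 x (le_lt_trans hD h)) mulr0.
  have [h'|h'] := ltP D (hs x); first by rewrite (k0 x) ?mulr0.
  rewrite p0 ?mul0r // ltNge; apply/negP => h2.
  have := hsM x (y^-1 * x)^-1%g; rewrite invgM invgK mulVKg.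
  have h3 : 2 * hs x * hs (x^-1 * y)%g <= 2 * D * C.
    rewrite -(hsV (x^-1 * y)%g) invgM invgK.
    by have := hs_gt0 (y^-1 * x)%g; have := hs_gt0 x; nra.
  by move=> h4; lra.
transitivity (hI (fun x => hI (fun y => psi y^-1%g) * k x)); last by rewrite hIZ // mulrC.
apply: eq_hI => x; have ai : adm (fun y => psi (y^-1 * x)%g) by exact: (adm_inv (adm_right x apsi)).
transitivity (hI (fun y => k x * psi (y^-1 * x)%g)); first by apply: eq_hI => y /=; rewrite mulrC.
rewrite (hIZ mu_haar _ ai) mulrC; congr (_ * _).
rewrite -(hI_left mu_haar x ai); apply: eq_hI => y.
by rewrite invgM mulgVK.
Qed.

Definition tent (g : SL2 R) : R := Num.max (2 - hs g) 0.

Lemma tent_ge0 g : 0 <= tent g. Proof. by rewrite /tent le_max lexx orbT. Qed.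
Lemma tent_measurable : measurable_fun [set: G] tent.
Proof. by apply: measurable_maxr => //; apply: measurable_funB => //; exact: measurable_hs. Qed.
Lemma tent0 g : 2 <= hs g -> tent g = 0.
Proof. by move=> h; rewrite /tent; apply/max_idPr; lra. Qed.

Lemma tent_adm : adm tent.
Proof.
apply: (@admP _ _ 2 2); [exact: tent_measurable|move=> g|by move=> g /ltW /tent0].
by rewrite ger0_norm ?tent_ge0 // /tent ge_max; have := hs_ge1 g => h; apply/andP; split; lra.
Qed.

Lemma tent_lip g h : `|tent g - tent h| <= `|hs g - hs h|.
Proof.
rewrite /tent; have [a|a] := leP (2 - hs g) 0; have [b|b] := leP (2 - hs h) 0;
  rewrite ler_norml; apply/andP; split; rewrite ?subrr ?oppr_le0 ?normr_ge0 //.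
all: by have := ler_norm (hs g - hs h); have := ler_norm (- (hs g - hs h)); rewrite normrN; lra.
Qed.

(** The sum of the absolute values of the distinct entries of w w^T - 1. It vanishes exactly on
    rotations and controls the change of [hs] under right multiplication by [w], because 2 [hs g] is
    the trace of g g^T. *)
Definition Edev (w : SL2 R) : R :=
  `|ea w ^+ 2 + eb w ^+ 2 - 1| + `|ec w ^+ 2 + ed w ^+ 2 - 1| + `|ea w * ec w + eb w * ed w|.

Lemma hs_mul_dev g w : `|hs (g * w)%g - hs g| <= hs g * Edev w.
Proof.
rewrite /Edev; set al := _ - 1; set be := ec w ^+ 2 + _ - 1; set ka := _ * _ + _ * _.
have q (p s : R) : `|((p * ea w + s * ec w) ^+ 2 + (p * eb w + s * ed w) ^+ 2) - (p ^+ 2 + s ^+ 2)|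
    <= (p ^+ 2 + s ^+ 2) * (`|al| + `|be| + `|ka|).
  have -> : ((p * ea w + s * ec w) ^+ 2 + (p * eb w + s * ed w) ^+ 2) - (p ^+ 2 + s ^+ 2) =
    p ^+ 2 * al + s ^+ 2 * be + (2 * (p * s)) * ka by rewrite /al /be /ka; ring.
  have h1 : `|p ^+ 2 * al| <= (p ^+ 2 + s ^+ 2) * `|al|.
    by rewrite normrM ler_wpM2r // ger0_norm ?sqr_ge0 // lerDl sqr_ge0.
  have h2 : `|s ^+ 2 * be| <= (p ^+ 2 + s ^+ 2) * `|be|.
    by rewrite normrM ler_wpM2r // ger0_norm ?sqr_ge0 // lerDr sqr_ge0.
  have h3 : `|2 * (p * s) * ka| <= (p ^+ 2 + s ^+ 2) * `|ka|.
    rewrite normrM ler_wpM2r // ler_norml; have := sqr_ge0 (p - s); have := sqr_ge0 (p + s).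
    by move=> ? ?; apply/andP; split; lra.
  rewrite (mulrDr _ (_ + _) `|ka|) (mulrDr _ `|al|); apply: le_trans (ler_normD _ _) _; apply: lerD => //.
  by apply: le_trans (ler_normD _ _) _; apply: lerD.
have := q (ea g) (eb g); have := q (ec g) (ed g); rewrite /hs !entM !ler_norml.
by move=> /andP[? ?] /andP[? ?]; apply/andP; split; lra.
Qed.

Lemma Edev_continuous : continuous Edev.
Proof.
move=> h; have [a b c d] := ent_cvg h.
have q (f : SL2 R -> R) (l : R) : f x @[x --> h] --> l -> (f x ^+ 2) @[x --> h] --> l ^+ 2.
  by move=> fl; under eq_fun do rewrite expr2; rewrite expr2; apply: (@cvgM _ _ (nbhs h)).
rewrite /continuous_at /Edev; apply: (@cvgD _ _ _ (nbhs h)); [apply: (@cvgD _ _ _ (nbhs h))|].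
- apply: (@cvg_norm _ _ _ (nbhs h)); apply: (@cvgB _ _ _ (nbhs h)); last exact: cvg_cst.
  by apply: (@cvgD _ _ _ (nbhs h)); apply: q.
- apply: (@cvg_norm _ _ _ (nbhs h)); apply: (@cvgB _ _ _ (nbhs h)); last exact: cvg_cst.
  by apply: (@cvgD _ _ _ (nbhs h)); apply: q.
- by apply: (@cvg_norm _ _ _ (nbhs h)); apply: (@cvgD _ _ _ (nbhs h)); apply: (@cvgM _ _ (nbhs h)).
Qed.

Lemma Edev1 : Edev 1%g = 0.
Proof. rewrite /Edev !ent1.
have [-> -> ->] : [/\ (1 : R) ^+ 2 + 0 ^+ 2 - 1 = 0, (0 : R) ^+ 2 + 1 ^+ 2 - 1 = 0 & (1 : R) * 0 + 0 * 1 = 0].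
  by split; ring.
by rewrite !normr0 !addr0. Qed.

Let D (x : SL2 R) := hI (fun y => tent (y * x)%g).
Let J := hI tent.

Lemma J_gt0 : 0 < J.
Proof.
apply: (@hI_gt0 _ _ mu_haar _ [set g | hs g < 3 / 2] (1 / 2)); [exact: tent_adm|exact: tent_ge0|lra|exact: hs_open| |].
  by exists 1%g; rewrite /= hs1; lra.
by move=> g /= h; rewrite /tent le_max; apply/orP; left; lra.
Qed.

Lemma D_continuous : continuous D.
Proof.
move=> x; apply/(@cvgrPdist_lt _ _ _ (nbhs x)) => e e0.
have m8 : measurable ([set y | hs (y * x)%g <= 8] : set G).
  have := measurable_mulr x measurableT (hs_measurable 8); rewrite setTI; exact.
have b8 y : [set y | hs (y * x)%g <= 8] y -> hs y <= 2 * 8 * hs x.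
  move=> /= h; have := hsM (y * x)%g x^-1%g; rewrite mulgK hsV => h2.
  have : 2 * hs (y * x)%g * hs x <= 2 * 8 * hs x by rewrite ler_wpM2r ?ler_pM2l // ltW // hs_gt0.
  lra.
have a8 := adm_indic m8 b8.
pose M := hI (\1_[set y | hs (y * x)%g <= 8]).
have M0 : 0 <= M by apply: hI_ge0 => y; rewrite indicE.
have c1 : \forall z \near x, hs (x^-1 * z)%g < 2.
  have : continuous (fun z => hs (x^-1 * z)%g).
    by move=> z; apply: continuous_comp; [exact: SL2_mul_continuous|exact: hs_continuous].
  move=> /(_ x) /cvgrPdist_lt /(_ 1 ltr01); rewrite mulVg hs1.
  by apply: filterS => z; rewrite ltr_norml => /andP[h1 h2]; lra.
have c2 : \forall z \near x, Edev (x^-1 * z)%g * (8 * M + 1) < e.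
  have : continuous (fun z => Edev (x^-1 * z)%g).
    by move=> z; apply: continuous_comp; [exact: SL2_mul_continuous|exact: Edev_continuous].
  have p : 0 < 8 * M + 1 by lra.
  have ep : 0 < e / (8 * M + 1) by rewrite divr_gt0.
  move=> /(_ x) /cvgrPdist_lt /(_ _ ep); rewrite mulVg Edev1 => h.
  by apply: filterS h => z; rewrite sub0r normrN -ltr_pdivlMr // => h; exact: le_lt_trans (ler_norm _) h.
near=> z; have z1 : hs (x^-1 * z)%g < 2 by near: z.
have z2 : Edev (x^-1 * z)%g * (8 * M + 1) < e by near: z.
apply: le_lt_trans z2; set w := (x^-1 * z)%g in z1 *.
have E0 : 0 <= Edev w by rewrite /Edev !addr_ge0.
have zE : z = (x * w)%g by rewrite /w mulVKg.
clearbody w.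
have ax : adm (fun y => tent (y * x)%g) by apply: adm_right; exact: tent_adm.
have az : adm (fun y => tent (y * z)%g) by apply: adm_right; exact: tent_adm.
rewrite -hIB //; apply: le_trans (hI_norm mu_haar (admB ax az)) _.
apply: (@le_trans _ _ (hI (fun y => (8 * Edev w) * \1_[set y | hs (y * x)%g <= 8] y))); last first.
  by rewrite (hIZ mu_haar (8 * Edev w) a8) -/M; nra.
apply: hI_le => //; [exact/adm_norm/admB|exact: admZ|move=> y].
have Hd := hs_mul_dev (y * x)%g w; have Hm := hsM (y * z)%g w^-1%g.
have e3 : (y * x * w = y * z)%g by rewrite zE mulgA.
have e4 : (y * z * w^-1 = y * x)%g by rewrite -e3 mulgK.
rewrite e3 in Hd; rewrite e4 hsV in Hm.
have [h|h] := leP (hs (y * x)%g) 8.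
  rewrite indicE mem_set // mulr1; apply: le_trans (tent_lip _ _) _; rewrite distrC.
  by apply: le_trans Hd _; rewrite ler_wpM2r.
rewrite indicE memNset ?mulr0; last by move=> /= h'; move: h; rewrite ltNge h'.
rewrite !tent0 ?subrr ?normr0 //; last lra.
have := hs_ge1 (y * z)%g => h1; have := hs_ge1 w => h2; rewrite leNgt; apply/negP => h3; nra.
Unshelve. all: by end_near. Qed.

(** A nonzero defect at [x] would keep its sign on a small open set. Integrating it there, with
    [modular_identity] applied to [tent] and to its right translate by [z], gives zero. *)
Lemma D_mul x z : J * D (x * z)%g = D z * D x.
Proof.
apply/eqP; rewrite -subr_eq0; apply/negPn/negP => n0.
pose F y := J * D (y * z)%g - D z * D y.
have cF : continuous F.
  move=> y; rewrite /continuous_at /F; apply: (@cvgB _ _ _ (nbhs y)); apply: (@cvgM _ _ (nbhs y)).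
  - exact: cvg_cst.
  - by apply: (@cvg_comp _ _ _ (fun y => y * z)%g D (nbhs y) (nbhs (y * z)%g)); [exact: SL2_mulr_continuous|exact: D_continuous].
  - exact: cvg_cst.
  - exact: D_continuous.
pose s : R := Num.sg (F x); pose c := `|F x| / 2.
have c0 : 0 < c by rewrite divr_gt0 // normr_gt0.
pose U := [set y | c < s * F y] `&` [set y | hs y < hs x + 1].
have oU : open U.
  apply: openI; last exact: hs_open.
  apply: (@open_comp _ _ (fun y => s * F y) [set t | c < t]) => [y _|]; last exact: open_gt.
  by apply: (@cvgM _ _ (nbhs y)); [exact: cvg_cst|exact: cF].
have Ux : U x by split; rewrite /= ?ltrDl ?ltr01 // /s -normrEsg /c; have := normr_gt0 (F x); rewrite n0; lra.
have mU := open_measurable_SL2 oU.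
have bU y : U y -> hs y <= hs x + 1 by case=> _ /= /ltW.
have aU := adm_indic mU bU.
have aT : adm (fun y => tent (y * z)%g) by apply: adm_right; exact: tent_adm.
have [a1 e1] := modular_identity aU tent_adm.
have [a2 e2] := modular_identity aU aT.
have e2' : hI (fun y => \1_U y * D (y * z)%g) = D z * hI (fun y => \1_U y^-1%g).
  rewrite -e2; apply: eq_hI => y; congr (_ * _); apply: eq_hI => t; by rewrite mulgA.
have a2' : adm (fun y => \1_U y * D (y * z)%g).
  move: a2; congr adm; apply/funext => y; congr (_ * _); apply: eq_hI => t; by rewrite mulgA.
have aF : adm (fun y => s * (J * (\1_U y * D (y * z)%g) - D z * (\1_U y * D y))).
  by apply: admZ; apply: admB; apply: admZ.
have E y : s * (J * (\1_U y * D (y * z)%g) - D z * (\1_U y * D y)) = \1_U y * (s * F y).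
  by rewrite /F; ring.
have : 0 < hI (fun y => s * (J * (\1_U y * D (y * z)%g) - D z * (\1_U y * D y))).
  apply: (@hI_gt0 _ _ mu_haar _ U c) => //.
  - move=> y; rewrite E indicE; case: (boolP (y \in U)) => [/set_mem [/= h _]|]; rewrite ?mul0r // mul1r; exact: ltW (lt_trans c0 h).
  - by exists x.
  - by move=> y Uy; rewrite E indicE mem_set // mul1r; case: Uy => /ltW.
rewrite hIZ ?hIB ?hIZ //; try by [apply: admZ|apply: admB; apply: admZ].
by rewrite e1 e2' -/J [J * (D z * _)]mulrCA subrr mulr0 ltxx.
Qed.

(** [D / J] is multiplicative and invariant under rotations on both sides. The inverse of [x] lies
    in the double coset of [x], so the two values agree and their product is 1; nonnegativity leaves
    only the value 1. *)
Lemma D_const x : D x = J.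
Proof.
have Dr y (k : SL2 R) : rotation k -> D (y * k)%g = D y.
  move=> rk; apply: eq_hI => t; by rewrite mulgA /tent (hs_rotr _ rk).
have D1 (k : SL2 R) : rotation k -> D k = J.
  by move=> rk; apply: eq_hI => t; rewrite /tent (hs_rotr _ rk).
have Dl y (k : SL2 R) : rotation k -> D (k * y)%g = D y.
  move=> rk; have := D_mul k y; rewrite (D1 k rk) mulrC => /mulIf; apply; apply/eqP => j0.
  by have := J_gt0; rewrite j0 ltxx.
have Dv : D x^-1%g = D x.
  by have [k1 [k2 [r1 r2 ->]]] := inv_rotation x; rewrite Dr // Dl.
have := D_mul x x^-1%g; rewrite mulgV Dv.
have r1 : rotation (1%g : SL2 R) by split; rewrite !ent1 ?oppr0.
rewrite (D1 _ r1); have := J_gt0; have : 0 <= D x by apply: hI_ge0 => y; exact: tent_ge0.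
by move=> d0 j0 h; nra.
Qed.

Lemma hI_inv f : adm f -> hI (fun x => f x^-1%g) = hI f.
Proof.
move=> af; have [_] := modular_identity af tent_adm; rewrite -/J.
have -> : (fun x => f x * hI (fun y => tent (y * x)%g)) = (fun x => J * f x).
  by apply/funext => x; rewrite -/(D x) D_const mulrC.
by rewrite hIZ // => /mulfI ->//; rewrite gt_eqF // J_gt0.
Qed.

End Unimodular.

(* A cocompact discrete group Gamma whose displacements are at least 1 + 6 b, with a bounded
   Borel fundamental domain for its action by left translations. *)
Record lattice (R : realType) := Lattice {
  lG :> subgroup (SL2 R);
  lb : R;
  lC : R;
  lD : set (SL2 R);
  lb_gt0 : 0 < lb;
  lb_le1 : lb <= 1;
  l_gap : forall g gam, subgroup_set lG gam -> gam != 1%g -> 1 + 6 * lb <= hs (g^-1 * gam * g)%g;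
  lD_measurable : measurable (lD : set (borelSL2 R));
  lD_le : forall y, lD y -> hs y <= lC;
  lD_ex : forall y, exists2 gam, subgroup_set lG gam & lD (gam * y)%g;
  lD_uniq : forall y gam, subgroup_set lG gam -> lD y -> lD (gam * y)%g -> gam = 1%g }.

(** * Cells and fundamental domains of a lattice *)

Section SubgroupClosure.
Variables (T : groupType) (H : subgroup T).
Lemma sgM x y : subgroup_set H x -> subgroup_set H y -> subgroup_set H (x * y)%g.
Proof. by case: (subgroupP H) => _ + _; apply. Qed.
Lemma sgV x : subgroup_set H x -> subgroup_set H x^-1%g.
Proof. by case: (subgroupP H) => _ _; apply. Qed.
End SubgroupClosure.

Section HsIneq.
Variable R : realType.
Implicit Types x y : SL2 R.

Lemma hs_quot x y : hs x <= 2 * hs (x * y)%g * hs y.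
Proof. by have := hsM (x * y)%g y^-1%g; rewrite mulgK hsV; lra. Qed.
Lemma hs_quotl x y : hs y <= 2 * hs (x * y)%g * hs x.
Proof. by have := hsM x^-1%g (x * y)%g; rewrite mulKg hsV; lra. Qed.

(** By [hsM] the displacement is below 2 (1 + b)^2 - 1, which is at most 1 + 6 b for b <= 1. This is
    the origin of the 6 in [l_gap]: it keeps the translates of a cell of parameter b disjoint. *)
Lemma hs_near_gap (b : R) x y (gam : SL2 R) : 0 < b -> b <= 1 ->
  hs (x^-1 * y)%g < 1 + b -> hs (x^-1 * (gam * y))%g < 1 + b -> hs (x^-1 * gam * x)%g < 1 + 6 * b.
Proof.
move=> b0 b1 h1 h2; have := hsM (x^-1 * (gam * y))%g (x^-1 * y)^-1%g.
rewrite hsV invgM invgK !mulgA mulgK -[(x^-1 * gam * y)%g]mulgA.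
have := hs_ge1 (x^-1 * y)%g; have := hs_ge1 (x^-1 * (gam * y))%g; nra.
Qed.

End HsIneq.

Section Existence.
Variables (R : realType) (mu : SL2_measure R).
Hypothesis mu_haar : is_haar mu.
Variables (Gamma : subgroup (SL2 R)) (b C0 : R).
Hypothesis b0 : 0 < b.
Hypothesis b1 : b <= 1.
Hypothesis gap : forall g gam, subgroup_set Gamma gam -> gam != 1%g -> 1 + 6 * b <= hs (g^-1 * gam * g)%g.
Hypothesis coc : forall g, exists2 gam, subgroup_set Gamma gam & hs (gam * g)%g <= C0.

Lemma near_gap_eq1 x y gam : subgroup_set Gamma gam ->
  hs (x^-1 * y)%g < 1 + b -> hs (x^-1 * (gam * y))%g < 1 + b -> gam = 1%g.
Proof.
move=> Gg h1 h2; apply/eqP/negPn/negP => n1.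
by have := hs_near_gap b0 b1 h1 h2; rewrite ltNge gap.
Qed.

Lemma ball_cover (C : R) : exists s : seq (SL2 R), forall y, hs y <= C -> exists2 x, x \in s & hs (x^-1 * y)%g < 1 + b.
Proof.
have := @hs_compact R C; rewrite compact_cover.
move=> /(_ (SL2 R) setT (fun x => [set y | hs (x^-1 * y)%g < 1 + b])) [].
- move=> x _; apply: (@open_comp _ _ (fun y => x^-1 * y)%g [set y | hs y < 1 + b]) => [y _|].
    exact: SL2_mul_continuous.
  exact: hs_open.
- by move=> y _; exists y => //=; rewrite mulVg hs1 ltrDl.
move=> s _ sc; exists (finmap.enum_fset s) => y /sc [x xs h]; exists x => //.
Qed.

(** Finitely many cells cover a ball that meets every orbit. Removing from each cell the
    Gamma-saturations of the earlier ones leaves exactly one point of each orbit, since the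
    translates of a single cell are disjoint. *)
Lemma lattice_exists : exists2 L : lattice R, lG L = Gamma & lb L = b.
Proof.
have [xs hxs] := ball_cover C0.
pose B (x : SL2 R) := [set y | hs (x^-1 * y)%g < 1 + b].
have oB x : open (B x).
  apply: (@open_comp _ _ (fun y => x^-1 * y)%g [set y | hs y < 1 + b]) => [y _|]; last exact: hs_open.
  exact: SL2_mul_continuous.
pose GB (x : SL2 R) := [set y | exists2 gam, subgroup_set Gamma gam & B x (gam * y)%g].
have oGB x : open (GB x).
  have -> : GB x = \bigcup_(gam in subgroup_set Gamma) [set y | B x (gam * y)%g].
    by rewrite predeqE => y; split=> -[gam]; exists gam.
  apply: bigcup_open => gam _; apply: (@open_comp _ _ (fun y => gam * y)%g (B x)) => [y _|//].
  exact: SL2_mul_continuous.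
pose D := \bigcup_(i in [set i | (i < size xs)%N]) (B (nth 1%g xs i) `\` \bigcup_(j in [set j | (j < i)%N]) GB (nth 1%g xs j)).
have mD : measurable (D : set (borelSL2 R)).
  apply: bigcup_measurable => i _; apply: measurableD; first exact: open_measurable_SL2.
  by apply: bigcup_measurable => j _; exact: open_measurable_SL2.
have [M hM] : exists M : R, forall x, x \in xs -> 4 * hs x <= M.
  elim: xs {hxs D mD} => [|x s [M hM]]; first by exists 0.
  exists (Num.max M (4 * hs x)) => y; rewrite inE => /orP[/eqP ->|/hM h]; rewrite le_max ?lexx ?orbT //.
  by rewrite h.
have DM y : D y -> hs y <= M.
  case=> i /= si [h _]; apply: le_trans (hM _ (mem_nth 1%g si)).
  have := hsM (nth 1%g xs i) ((nth 1%g xs i)^-1 * y)%g; rewrite mulVKg; move: h; rewrite /B /=.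
  by have := hs_gt0 (nth 1%g xs i); have := b1; nra.
have Dex y : exists2 gam, subgroup_set Gamma gam & D (gam * y)%g.
  have [gam Gg hg] := coc y; have [x xin hx] := hxs _ hg.
  have ex : exists i, (i < size xs)%N && `[< GB (nth 1%g xs i) y >].
    exists (index x xs); rewrite index_mem xin nth_index //=; apply/asboolP; by exists gam.
  case: (ex_minnP ex) => i /andP[si /asboolP [d Gd Bd]] mini.
  exists d => //; exists i => //; split => // -[j /= ji [d' Gd' Bd']].
  have : (i <= j)%N.
    apply: mini; rewrite (ltn_trans ji si) /=; apply/asboolP; exists (d' * d)%g; first exact: sgM.
    by rewrite -mulgA.
  by rewrite leqNgt ji.
have Duniq y gam : subgroup_set Gamma gam -> D y -> D (gam * y)%g -> gam = 1%g.
  move=> Gg [i /= si [Bi ni]] [j /= sj [Bj nj]].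
  have [ij|ji|ij] := ltngtP i j.
  - by case: nj; exists i => //; exists gam^-1%g; [exact: sgV|rewrite mulKg].
  - by case: ni; exists j => //; exists gam.
  - by rewrite -ij in Bj; exact: near_gap_eq1 Bi Bj.
by exists (@Lattice R Gamma b M D b0 b1 gap mD DM Dex Duniq).
Qed.

End Existence.

Section LatticeTheory.
Variables (R : realType) (mu : SL2_measure R).
Hypothesis mu_haar : is_haar mu.
Variable L : lattice R.
Local Notation G := (borelSL2 R).
Local Notation hI := (hI mu).
Local Notation Gam := (subgroup_set (lG L)).
Local Notation b := (lb L).
Local Notation D := (lD L).
Implicit Types (x y gam : SL2 R) (f g : SL2 R -> R).

Definition cell x : set (SL2 R) := [set y | hs (x^-1 * y)%g < 1 + b].

Lemma cell_open x : open (cell x).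
Proof.
apply: (@open_comp _ _ (fun y => x^-1 * y)%g [set y | hs y < 1 + b]) => [y _|]; last exact: hs_open.
exact: SL2_mul_continuous.
Qed.

Lemma cell_self x : cell x x.
Proof. by rewrite /cell /= mulVg hs1; have := lb_gt0 L; lra. Qed.
Lemma cell_uniq x y gam : Gam gam -> cell x y -> cell x (gam * y)%g -> gam = 1%g.
Proof. by move=> Gg; exact: (near_gap_eq1 (lb_gt0 L) (lb_le1 L) (@l_gap _ L) Gg). Qed.

Lemma cell_hs x y : cell x y -> hs y <= 4 * hs x.
Proof.
rewrite /cell /= => h; have := hsM x (x^-1 * y)%g; rewrite mulVKg.
by have := hs_gt0 x; have := lb_le1 L; nra.
Qed.

Lemma cell_mfun x : measurable_fun [set: G] (\1_(cell x) : G -> R).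
Proof. by apply: measurable_indic; apply: open_measurable_SL2; exact: cell_open. Qed.
Lemma D_mfun : measurable_fun [set: G] (\1_D : G -> R).
Proof. by apply: measurable_indic; exact: lD_measurable. Qed.

Definition bvol : R := hI (\1_(cell 1%g)).

Lemma cell_adm x : adm (\1_(cell x)).
Proof. apply: (@adm_indic _ _ (4 * hs x)); last exact: cell_hs.
by apply: open_measurable_SL2; exact: cell_open. Qed.

Lemma bvolE x : hI (\1_(cell x)) = bvol.
Proof.
rewrite /bvol -[RHS](hI_left mu_haar x^-1%g (cell_adm 1%g)).
apply: eq_hI => y; rewrite !indicE; congr (_%:R); congr nat_of_bool.
by apply/idP/idP => /set_mem h; apply: mem_set; move: h; rewrite /cell /= invg1 mul1g.
Qed.

Lemma bvol_gt0 : 0 < bvol.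
Proof.
apply: (@hI_gt0 _ _ mu_haar _ (cell 1%g) 1 (cell_adm _) _ ltr01 (cell_open _)).
- by move=> x; rewrite indicE.
- by exists 1%g; exact: cell_self.
- by move=> x h; rewrite indicE mem_set.
Qed.

(** Cells centred at distinct elements of Gamma are disjoint and have equal volume; when the centres
    lie in a ball, the cells lie in a ball four times as large, whose measure is finite. *)
Lemma gamma_finite (C : R) : finite_set [set gam | Gam gam /\ hs gam <= C].
Proof.
apply: contrapT => inf.
have m4 : measurable ([set y | hs y <= 4 * C] : set G) by exact: hs_measurable.
have a4 := adm_indic m4 (fun y h => h).
pose V := hI (\1_[set y | hs y <= 4 * C]).
pose n := (Num.truncn (V / bvol)).+1.
have [B BG nB] := infinite_set_fset n inf.
have uB : uniq (finmap.enum_fset B) by exact: finmap.fset_uniq.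
have BG' gam : gam \in finmap.enum_fset B -> Gam gam /\ hs gam <= C by move=> h; apply: BG.
move: (finmap.enum_fset B) uB nB BG' => s us ns sG.
suff : \sum_(gam <- s) hI (\1_(cell gam)) <= V.
  rewrite (eq_bigr (fun=> bvol)) => [|i _]; last exact: bvolE.
  rewrite big_const_seq count_predT iter_addr addr0 -mulr_natl => h.
  have : V / bvol < n%:R by apply: truncnS_gt.
  rewrite ltr_pdivrMr ?bvol_gt0 // => h2.
  have : n%:R * bvol <= (size s)%:R * bvol by rewrite ler_wpM2r ?ler_nat // ltW // bvol_gt0.
  lra.
rewrite -hI_sum //; last by move=> i; exact: cell_adm.
apply: hI_le => //; first by apply: adm_sum => i; exact: cell_adm.
move=> y; have [[gam gs hg]|ny] := pselect (exists2 gam, gam \in s & cell gam y).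
  rewrite (bigD1_seq gam) //= big1_seq ?addr0 => [|d /andP[dg ds]].
    by rewrite !indicE !mem_set //=; apply: le_trans (cell_hs hg) _; have [] := sG _ gs; lra.
  rewrite indicE memNset // => hd; case/eqP: dg.
  have Gd : Gam (gam * d^-1)%g by apply: sgM; [case: (sG _ gs)|apply: sgV; case: (sG _ ds)].
  have e : (gam * d^-1 = 1)%g.
    by apply: (cell_uniq Gd hg); rewrite /cell /= -!mulgA mulKg.
  by rewrite -[LHS]mul1g -e mulgVK.
rewrite big1_seq => [|d /andP[_ ds]]; first by rewrite indicE.
by rewrite indicE memNset // => hd; apply: ny; exists d.
Qed.

Lemma gl_ex (C : R) : exists s : seq (SL2 R), uniq s /\ forall gam, gam \in s <-> Gam gam /\ hs gam <= C.
Proof.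
have /finite_seqP [s hs] := gamma_finite C; exists (undup s); rewrite undup_uniq; split => // gam.
by rewrite mem_undup; move: (congr1 (fun A => A gam) hs) => /= ->.
Qed.

(** Sums over Gamma are written as sums over such a list: the support of an admissible function
    meets only finitely many translates of the bounded domain. *)
Definition gl (C : R) : seq (SL2 R) := projT1 (cid (gl_ex C)).
Lemma gl_uniq C : uniq (gl C). Proof. by rewrite /gl; case: cid => s []. Qed.
Lemma glP C gam : gam \in gl C <-> Gam gam /\ hs gam <= C.
Proof. by rewrite /gl; case: cid => s [? h] /=; exact: h. Qed.

Lemma D_sum1 (s : seq (SL2 R)) x C : uniq s -> (forall gam, gam \in s -> Gam gam) ->
  hs x <= C -> (forall gam, Gam gam -> hs gam <= 2 * C * lC L -> gam \in s) ->
  \sum_(gam <- s) \1_D (gam^-1 * x)%g = 1 :> R /\ \sum_(gam <- s) \1_D (gam * x)%g = 1 :> R.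
Proof.
move=> us sG xC sC; have [d Gd Dd] := lD_ex L x.
have hd : hs d <= 2 * C * lC L.
  apply: le_trans (hs_quot d x) _; have := lD_le Dd; have := hs_gt0 (d * x)%g; have := hs_gt0 x; nra.
have key e : Gam e -> \1_D (e * x)%g = (e == d)%:R :> R.
  move=> Ge; rewrite indicE; have [->|ned] := eqVneq; first by rewrite mem_set.
  rewrite memNset // => De; case/eqP: ned.
  have : (e * d^-1 = 1)%g.
    by apply: (@lD_uniq _ L (d * x)%g) => //; [apply: sgM => //; exact: sgV|rewrite mulgA mulgVK].
  by move=> h; rewrite -[LHS](mulgVK d) h mul1g.
split.
  rewrite (bigD1_seq d^-1%g) //=; last by apply: sC; [exact: sgV|rewrite hsV].
  rewrite invgK key // eqxx big1_seq ?addr0 // => e /andP[ne es].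
  rewrite key; last by apply/sgV/sG.
  by case: eqVneq => // h; case/eqP: ne; rewrite -h invgK.
rewrite (bigD1_seq d) //=; last exact: sC.
by rewrite key // eqxx big1_seq ?addr0 // => e /andP[ne es]; rewrite key ?(negbTE ne) //; exact: sG.
Qed.

Lemma D_sum_le1 (s : seq (SL2 R)) x : uniq s -> (forall gam, gam \in s -> Gam gam) ->
  \sum_(gam <- s) \1_D (gam * x)%g <= 1 :> R.
Proof.
move=> us sG; have [[d ds Dd]|n] := pselect (exists2 d, d \in s & D (d * x)%g); last first.
  by rewrite big1_seq // => d /andP[_ ds]; rewrite indicE memNset // => Dd; apply: n; exists d.
rewrite (bigD1_seq d) //= indicE mem_set // big1_seq ?addr0 // => e /andP[ne es].
rewrite indicE memNset // => De; case/eqP: ne.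
have : (e * d^-1 = 1)%g.
  apply: (@lD_uniq _ L (d * x)%g) => //; last by rewrite mulgA mulgVK.
  by apply: sgM; [exact: sG|apply/sgV/sG].
by move=> h; rewrite -[LHS](mulgVK d) h mul1g.
Qed.

Lemma D_adm : adm (\1_D). Proof. by apply: adm_indic (@lD_measurable _ L) (@lD_le _ L). Qed.
Lemma indic_bound (A : set (SL2 R)) x : `|\1_A x : R| <= 1.
Proof. by rewrite indicE; case: (_ \in _); rewrite ?normr1 ?normr0. Qed.
Lemma D_admM f : measurable_fun [set: G] f -> (exists M, forall x, `|f x| <= M) -> adm (fun x => \1_D x * f x).
Proof. by move=> mf [M fM]; apply: (admMr mf fM D_adm). Qed.

(** An integral over the group becomes an integral over the domain of a sum over Gamma. The radius
    [2 * C * lC L] retains every element that can carry a point of the domain into the support. *)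
Lemma unfold f C : adm f -> (forall x, C < hs x -> f x = 0) ->
  hI f = hI (fun y => \1_D y * \sum_(gam <- gl (2 * C * lC L)) f (gam * y)%g).
Proof.
move=> af fC; set s := gl _.
have sG gam : gam \in s -> Gam gam by move/glP => [].
have aD e f' : adm f' -> adm (fun x => \1_D (e * x)%g * f' x).
  apply: (@admMl _ _ _ 1) => [|x]; last exact: indic_bound.
  exact: (measurableT_comp D_mfun (measurable_mull e)).
transitivity (hI (fun x => \sum_(gam <- s) \1_D (gam^-1 * x)%g * f x)).
  apply: eq_hI => x; rewrite -mulr_suml; have [h|/fC ->] := leP (hs x) C; last by rewrite mulr0.
  rewrite (D_sum1 (gl_uniq _) sG h _).1 ?mul1r // => gam Gg hg; exact/glP.
rewrite hI_sum //; last by move=> gam; exact: aD.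
transitivity (\sum_(gam <- s) hI (fun x => \1_D x * f (gam * x)%g)).
  apply: eq_bigr => gam _; rewrite -(hI_left mu_haar gam (aD gam^-1%g f af)).
  by apply: eq_hI => x; rewrite mulKg.
rewrite -hI_sum //; first by apply: eq_hI => x; rewrite mulr_sumr.
by move=> gam; apply: (admMl D_mfun (indic_bound D)); exact: adm_left.
Qed.

Definition qvol : R := hI (\1_D).

(** After unfolding, the sum over Gamma of the indicator of one cell is at most 1, again by
    disjointness of translates. *)
Lemma qvol_ge_bvol : bvol <= qvol.
Proof.
rewrite -(bvolE 1%g) (@unfold _ (4 * hs (1%g : SL2 R))); [|exact: cell_adm|]; last first.
  by move=> x h; rewrite indicE memNset // => /cell_hs; rewrite leNgt h.
apply: hI_le; [exact: mu_haar| |exact: D_adm|].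
- apply: (admMr (C := (size (gl (2 * (4 * hs 1%g) * lC L)))%:R)); last exact: D_adm.
    apply: measurable_sum => gam.
    exact: (measurableT_comp (cell_mfun _) (measurable_mull gam)).
  move=> x; apply: le_trans (ler_norm_sum _ _ _) _.
  elim: (gl _) => [|d s IH]; rewrite ?big_nil ?big_cons //= -natr1 addrC lerD //; exact: indic_bound.
move=> y; rewrite ler_piMr //.
set s := gl _; have [[d ds hd]|n] := pselect (exists2 d, d \in s & cell 1%g (d * y)%g).
  rewrite (bigD1_seq d) //=; last exact: gl_uniq.
  rewrite indicE mem_set // big1_seq ?addr0 // => e /andP[ne es].
  rewrite indicE memNset // => he; case/eqP: ne.
  have Ge : Gam (e * d^-1)%g by apply: sgM; [case/glP: es|apply: sgV; case/glP: ds].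
  have := cell_uniq Ge hd; rewrite mulgA mulgVK => /(_ he) h.
  by rewrite -[LHS](mulgVK d) h mul1g.
rewrite big1_seq // => e /andP[_ es]; rewrite indicE memNset // => h; apply: n; by exists e.
Qed.

Lemma qvol_gt0 : 0 < qvol. Proof. exact: lt_le_trans bvol_gt0 qvol_ge_bvol. Qed.

(** [fundamental_domain] refers to right translations by Gamma, the domain of a lattice to left
    translations; inversion exchanges the two. *)
Lemma lD_inv_fundamental : fundamental_domain Gam [set g | D g^-1%g].
Proof.
split.
  have := measurable_invSL2 (@measurable_id _ G setT) measurableT (@lD_measurable _ L); rewrite setTI; exact.
move=> g; have [gam Gg Dg] := lD_ex L g^-1%g; exists gam^-1%g; split.
  by split; [exact: sgV|rewrite /= invgM invgK].
move=> d [Gd] /=; rewrite invgM => Dd.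
have : (d^-1 * gam^-1 = 1)%g.
  apply: (@lD_uniq _ L (gam * g^-1)%g) => //; first by apply: sgM; exact: sgV.
  by rewrite mulgA mulgVK.
by move=> h; rewrite -[LHS](mulVKg d) h mulg1.
Qed.

Lemma covolume_lt_pinfty : (covolume mu Gam < +oo)%E.
Proof.
have [mF _] := lD_inv_fundamental.
apply: (@le_lt_trans _ _ (mu [set g | D g^-1%g])).
  by apply: ereal_inf_lbound; exists [set g | D g^-1%g] => //; exact: lD_inv_fundamental.
apply: (@le_lt_trans _ _ (mu [set y | hs y <= lC L])); last exact: mu_hs_fin.
by apply: le_measure; rewrite ?inE //; [exact: hs_measurable|move=> g /= /lD_le; rewrite hsV].
Qed.

(* The pieces D n gam F^-1 are moved into F by left translations and inversion. *)
Lemma qvol_le_fundamental (F : set (SL2 R)) : fundamental_domain Gam F -> (qvol%:E <= mu F)%E.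
Proof.
move=> [mF Fex].
pose A (n : nat) : set (SL2 R) := D `&` \bigcup_(gam in [set` gl n%:R]) [set x | F (x^-1 * gam)%g].
have mFg gam : measurable ([set x | F (x^-1 * gam)%g] : set G).
  have mi := measurable_invSL2 (@measurable_id _ G setT).
  have := measurable_mulSL2 mi (measurable_cst (gam : G)) measurableT mF.
  by rewrite setTI; exact.
have mA n : measurable (A n : set G).
  apply: measurableI; first exact: lD_measurable.
  by apply: fin_bigcup_measurable => // gam _; exact: mFg.
have ndA : nondecreasing_seq A.
  move=> n m nm; apply/subsetPset => x [Dx [gam /= gs hx]]; split => //; exists gam => //=.
  apply/glP; case/glP: gs => Gg hg; split => //; apply: le_trans hg _; by rewrite ler_nat.
have uA : \bigcup_n A n = D.
  rewrite predeqE => x; split=> [[n _ []//]|Dx].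
  have [gam [[Gg hg] _]] := Fex x^-1%g; exists (Num.truncn (hs gam)).+1 => //; split => //.
  by exists gam => //=; apply/glP; split => //; exact/ltW/truncnS_gt.
have mD : measurable (\bigcup_n A n : set G) by rewrite uA; exact: lD_measurable.
have cv := nondecreasing_cvg_mu (mu := mu) mA mD ndA; rewrite uA in cv.
rewrite /qvol (hI_indic mu_haar (@lD_measurable _ L) (@lD_le _ L)).
apply: cvge_le cv; apply: nearW => n /=.
have AC x : A n x -> hs x <= lC L by case=> /lD_le.
rewrite -(hI_indic mu_haar (mA n) AC); set s := gl n%:R.
pose Fi x : R := \1_[set x | F x] x.
have mFi : measurable_fun [set: G] (Fi : G -> R) by apply: measurable_indic.
have mi := measurable_invSL2 (@measurable_id _ G setT).
have aF gam : adm (fun x => \1_D x * Fi (x^-1 * gam)%g).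
  apply: (@admMr _ _ _ 1) D_adm => [|x]; last exact: indic_bound.
  exact: (measurableT_comp mFi (measurable_mulSL2 mi (measurable_cst (gam : G)))).
have sG gam : gam \in s -> Gam gam by move/glP => [].
have E gam : hI (fun x => \1_D x * Fi (x^-1 * gam)%g) = hI (fun x => \1_D (gam * x^-1)%g * Fi x).
  have al := adm_left gam (aF gam).
  rewrite -(hI_left mu_haar gam (aF gam)) -(hI_inv mu_haar al).
  by apply: eq_hI => x; rewrite invgM invgK mulgVK.
have aE gam : adm (fun x => \1_D (gam * x^-1)%g * Fi x).
  have := adm_inv (adm_left gam (aF gam)); congr adm; apply/funext => x.
  by rewrite invgM invgK mulgVK.
apply: (@le_trans _ _ (hI (fun x => \sum_(gam <- s) \1_D (gam * x^-1)%g * Fi x))%:E).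
  rewrite lee_fin hI_sum // -(eq_bigr _ (fun gam _ => E gam)) -hI_sum //.
  apply: hI_le => //; [exact: (adm_indic (mA n) AC)|exact: adm_sum|move=> x].
  rewrite indicE; case: (boolP (x \in A n)) => [/set_mem [Dx [gam /= gs hx]]|_]; last first.
    by apply: sumr_ge0 => gam _; rewrite mulr_ge0 // /Fi indicE.
  rewrite (big_rem gam) //= (_ : \1_D x * Fi _ = 1) ?lerDl; last by rewrite /Fi !indicE !mem_set // mulr1.
  by apply: sumr_ge0 => d _; rewrite mulr_ge0 // /Fi indicE.
rewrite hI_EFin //; last exact: adm_sum.
apply: (@le_trans _ _ (\int[mu]_x (Fi x)%:E)%E); last by rewrite integral_indic // setIT.
apply: ge0_le_integral => //.
- by move=> x _; rewrite lee_fin; apply: sumr_ge0 => d _; rewrite mulr_ge0 // /Fi indicE.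
- by apply/measurable_EFinP; apply: measurable_sum => gam; case: (aE gam).
- exact/measurable_EFinP.
move=> x _; rewrite lee_fin -mulr_suml ler_piMl //.
by apply: D_sum_le1 => //; exact: gl_uniq.
Qed.

Lemma qvol_le_covolume : qvol <= fine (covolume mu Gam).
Proof.
have lo : (qvol%:E <= covolume mu Gam)%E.
  by apply/ereal_infP => _ [F fF <-]; exact: qvol_le_fundamental.
have fn : covolume mu Gam \is a fin_num.
  rewrite ge0_fin_numE ?covolume_lt_pinfty //.
  by apply: le_trans lo; rewrite lee_fin ltW // qvol_gt0.
by move: lo; rewrite -(fineK fn) lee_fin.
Qed.

End LatticeTheory.

(** * Averaging operators with radial kernels on the quotient *)

Section RadialOperators.
Variables (R : realType) (mu : SL2_measure R).
Hypothesis mu_haar : is_haar mu.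
Variable L : lattice R.
Local Notation G := (borelSL2 R).
Local Notation hI := (hI mu).
Local Notation Gam := (subgroup_set (lG L)).
Local Notation D := (lD L).
Implicit Types (x y gam : SL2 R) (f g : SL2 R -> R) (k : R -> R).

(* Only the values on [1, +oo[, the range of [hs], matter. *)
Definition rker k := exists C : R, [/\ measurable_fun [set: R] k, forall t, 1 <= t -> `|k t| <= C,
  forall t, C < t -> k t = 0 & forall s t, 1 <= s -> 1 <= t -> `|k s - k t| <= C * `|s - t|].

Definition bmf f := measurable_fun [set: G] f /\ exists M : R, forall x, `|f x| <= M.

Definition rop k f x : R := hI (fun y => k (hs (x^-1 * y)%g) * f y).

Lemma measurable_khs k x : measurable_fun [set: R] k -> measurable_fun [set: G] (fun y => k (hs (x^-1 * y)%g)).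
Proof.
by move=> mk; exact: (measurableT_comp mk (measurableT_comp (@measurable_hs R) (measurable_mull x^-1%g))).
Qed.

Lemma khs_adm k x : rker k -> adm (fun y => k (hs (x^-1 * y)%g)).
Proof.
move=> [C [mk kC k0 _]]; apply: (@admP _ _ C (2 * C * hs x)).
- exact: measurable_khs.
- by move=> y; apply: kC; exact: hs_ge1.
- move=> y h; apply: k0; rewrite ltNge; apply/negP => h'; move: h; rewrite ltNge => /negP; apply.
  by apply: le_trans (hs_quotl x^-1%g y) _; rewrite hsV ler_wpM2r ?ler_pM2l // ltW // hs_gt0.
Qed.

Lemma khs_bmf k : rker k -> bmf (fun y => k (hs y)).
Proof.
move=> [C [mk kC _ _]]; split; first exact: (measurableT_comp mk (@measurable_hs R)).
by exists C => y; apply: kC; exact: hs_ge1.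
Qed.

Lemma kf_adm k f x : rker k -> bmf f -> adm (fun y => k (hs (x^-1 * y)%g) * f y).
Proof. by move=> rk [mf [M fM]]; apply: (admMr mf fM); exact: khs_adm. Qed.

Lemma ropD k f g x : rker k -> bmf f -> bmf g -> rop k (fun y => f y + g y) x = rop k f x + rop k g x.
Proof.
move=> rk bf bg; rewrite /rop -hID //; [|exact: kf_adm..].
by apply: eq_hI => y; rewrite mulrDr.
Qed.

Lemma ropZ k f c x : rker k -> bmf f -> rop k (fun y => c * f y) x = c * rop k f x.
Proof.
move=> rk bf; rewrite /rop -hIZ //; last exact: kf_adm.
by apply: eq_hI => y; rewrite mulrCA.
Qed.

Lemma bmfZ f c : bmf f -> bmf (fun y => c * f y).
Proof.
move=> [mf [M fM]]; split; first exact: measurable_funM.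
by exists (`|c| * M) => x; rewrite normrM ler_wpM2l.
Qed.

Lemma bmfD f g : bmf f -> bmf g -> bmf (fun y => f y + g y).
Proof.
move=> [mf [M fM]] [mg [M' gM]]; split; first exact: measurable_funD.
by exists (M + M') => x; apply: le_trans (ler_normD _ _) _; apply: lerD.
Qed.

Lemma bmfM f g : bmf f -> bmf g -> bmf (fun y => f y * g y).
Proof.
move=> [mf [M fM]] [mg [M' gM]]; split; first exact: measurable_funM.
by exists (M * M') => x; rewrite normrM ler_pM.
Qed.

Lemma bmf_norm f : bmf f -> bmf (fun y => `|f y|).
Proof. by move=> [mf [M fM]]; split; [exact: measurableT_comp|exists M => x; rewrite normr_id]. Qed.
Lemma bmf_cst c : bmf (fun=> c).
Proof. by split => //; exists `|c|. Qed.

Lemma ropB k f g x : rker k -> bmf f -> bmf g -> rop k (fun y => f y - g y) x = rop k f x - rop k g x.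
Proof.
move=> rk bf bg; rewrite -[- rop k g x]mulN1r -ropZ // -ropD //; last exact: bmfZ.
by apply: eq_hI => y; rewrite mulN1r.
Qed.

Definition kmass k : R := hI (fun y => k (hs y)).

Lemma rop1 k x : rker k -> rop k (fun=> 1) x = kmass k.
Proof.
move=> rk; have a := khs_adm 1%g rk.
have a' : adm (fun y => k (hs y)) by move: a; congr adm; apply/funext => y; rewrite invg1 mul1g.
by rewrite /kmass -(hI_left mu_haar x^-1%g a'); apply: eq_hI => y; rewrite mulr1.
Qed.

Lemma rker_norm k : rker k -> rker (fun t => `|k t|).
Proof.
move=> [C [mk kC k0 kl]]; exists C; split.
- exact: measurableT_comp.
- by move=> t t1; rewrite normr_id kC.
- by move=> t /k0 ->; rewrite normr0.
- by move=> s t s1 t1; apply: le_trans (kl _ _ s1 t1); exact: ler_dist_dist.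
Qed.

Lemma rop_le k f x M : rker k -> bmf f -> (forall y, `|f y| <= M) -> `|rop k f x| <= M * kmass (fun t => `|k t|).
Proof.
move=> rk bf fM; have an := kf_adm x rk bf.
have a := khs_adm x (rker_norm rk).
apply: le_trans (hI_norm mu_haar an) _.
have := rop1 x (rker_norm rk); rewrite /rop => <-.
under [X in M * X]eq_hI do rewrite mulr1.
rewrite -hIZ //; apply: hI_le => //; [exact: adm_norm|exact: admZ|].
by move=> y; rewrite normrM mulrC ler_wpM2r.
Qed.

Definition qI f : R := hI (fun y => \1_D y * f y).

Lemma qI_adm f : bmf f -> adm (fun y => \1_D y * f y).
Proof. by move=> [mf fM]; exact: D_admM. Qed.

Lemma qID f g : bmf f -> bmf g -> qI (fun y => f y + g y) = qI f + qI g.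
Proof.
move=> bf bg; rewrite /qI -hID //; [|exact: qI_adm..].
by apply: eq_hI => y; rewrite mulrDr.
Qed.

Lemma qIZ f c : bmf f -> qI (fun y => c * f y) = c * qI f.
Proof.
move=> bf; rewrite /qI -hIZ //; last exact: qI_adm.
by apply: eq_hI => y; rewrite mulrCA.
Qed.

Lemma qIB f g : bmf f -> bmf g -> qI (fun y => f y - g y) = qI f - qI g.
Proof.
move=> bf bg; rewrite -[- qI g]mulN1r -qIZ // -qID //; last exact: bmfZ.
by apply: eq_hI => y; rewrite mulN1r.
Qed.

Lemma qI_le f g : bmf f -> bmf g -> (forall y, D y -> f y <= g y) -> qI f <= qI g.
Proof.
move=> bf bg fg; apply: hI_le => //; [exact: qI_adm..|move=> y].
by rewrite indicE; case: (boolP (y \in D)) => [/set_mem /fg|]; rewrite ?mul1r ?mul0r.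
Qed.

Lemma qI_ge0 f : (forall y, 0 <= f y) -> 0 <= qI f.
Proof. by move=> f0; apply: hI_ge0 => y; rewrite mulr_ge0 // indicE. Qed.

Lemma qI_cst c : qI (fun=> c) = c * qvol mu L.
Proof.
have := qIZ c (bmf_cst 1); rewrite [qI (fun=> 1)](eq_hI mu (fun y => mulr1 _)) -/(qvol mu L) => <-.
by apply: eq_hI => y; rewrite mulr1.
Qed.

Definition qf f := bmf f /\ forall gam x, Gam gam -> f (gam * x)%g = f x.

(** A ball meets the orbits with bounded multiplicity, so the L^1 mass on the quotient controls the
    L^1 mass on balls. The constant is chosen before [g], and this uniformity is what makes the
    operators compact. *)
Lemma ball_mass f (C : R) : qf f -> exists2 N : R, 0 <= N &
  forall g, qf g -> hI (fun y => \1_[set y | hs y <= C] y * `|g y|) <= N * qI (fun y => `|g y|).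
Proof.
move=> _; exists (size (gl mu_haar L (2 * C * lC L)))%:R => // g [bg ig].
have mI := hs_measurable (R := R) C.
have mIf : measurable_fun [set: G] (\1_[set y | hs y <= C] : G -> R) by apply: measurable_indic.
have [mn [M nM]] := bmf_norm bg.
have aB : adm (fun y => \1_[set y | hs y <= C] y * `|g y|).
  by apply: (admMr mn nM); exact: (adm_indic mI (fun y h => h)).
rewrite (@unfold _ _ mu_haar L _ C aB); last first.
  by move=> x h; rewrite indicE memNset ?mul0r //= => /(lt_le_trans h); rewrite ltxx.
rewrite -qIZ; last exact: bmf_norm.
have bS : bmf (fun y => \sum_(gam <- gl mu_haar L (2 * C * lC L)) \1_[set y | hs y <= C] (gam * y)%g * `|g (gam * y)%g|).
  elim: (gl _ _ _) => [|d s IH]; first by under eq_fun do rewrite big_nil; exact: bmf_cst.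
  under eq_fun do rewrite big_cons; apply: bmfD => //; apply: bmfM.
    by split; [exact: (measurableT_comp mIf (measurable_mull d))|exists 1 => x; exact: indic_bound].
  by split; [exact: (measurableT_comp mn (measurable_mull d))|exists M => x].
apply: qI_le => //; first by apply: bmfZ; exact: bmf_norm.
move=> y _; rewrite (eq_big_seq (fun gam => \1_[set y | hs y <= C] (gam * y)%g * `|g y|)); last first.
  by move=> d /glP [Gd _]; rewrite ig.
rewrite -mulr_suml ler_wpM2r //; elim: (gl _ _ _) => [|d s IH]; rewrite ?big_nil ?big_cons //= -natr1 addrC lerD //.
Qed.

(** Equicontinuity: the kernel is Lipschitz and [Edev] controls the change of its argument, while
    [f] enters only through its L^1 norm. *)
Lemma rop_dev k (x : SL2 R) : rker k -> exists2 N : R, 0 <= N & forall f w, qf f -> hs w < 2 ->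
  `|rop k f (x * w)%g - rop k f x| <= N * Edev w * qI (fun y => `|f y|).
Proof.
move=> rk; have [C [mk kC k0 kl]] := rk.
have C0 : 0 <= C by apply: le_trans (normr_ge0 (k 1)) (kC 1 _).
have [N N0 hN] := @ball_mass (fun=> 0) (8 * C * hs x) (conj (bmf_cst 0) (fun _ _ _ => erefl)).
exists (4 * C * C * N) => [|f w qfs w2]; first by rewrite !mulr_ge0.
have [bf invf] := qfs; have [mf [M fM]] := bf.
have E0 : 0 <= Edev w by rewrite /Edev !addr_ge0.
have mI := hs_measurable (R := R) (8 * C * hs x).
have [mn [M' nM]] := bmf_norm bf.
have aB : adm (fun y => \1_[set y | hs y <= 8 * C * hs x] y * `|f y|).
  by apply: (admMr mn nM); exact: (adm_indic mI (fun y h => h)).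
have a1 := kf_adm (x * w)%g rk bf; have a2 := kf_adm x rk bf.
rewrite /rop -hIB //; apply: le_trans (hI_norm mu_haar (admB a1 a2)) _.
apply: (@le_trans _ _ (hI (fun y => (4 * C * C * Edev w) * (\1_[set y | hs y <= 8 * C * hs x] y * `|f y|)))); last first.
  rewrite (hIZ mu_haar _ aB); have p : 0 <= 4 * C * C * Edev w by rewrite !mulr_ge0.
  apply: le_trans (ler_wpM2l p (hN f qfs)) _.
  by rewrite le_eqVlt; apply/orP; left; apply/eqP; ring.
apply: hI_le => //; [exact/adm_norm/admB|exact: admZ|move=> y].
rewrite -mulrBl normrM mulrA ler_wpM2r //.
set u := (x^-1 * y)%g; have -> : ((x * w)^-1 * y = w^-1 * u)%g by rewrite invgM /u mulgA.
have e1 : hs (w^-1 * u)%g = hs (u^-1 * w)%g by rewrite -hsV invgM invgK.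
have hd := hs_mul_dev u^-1%g w; rewrite hsV -e1 in hd.
have hq : hs u <= 2 * hs (w^-1 * u)%g * hs w by have := hs_quotl w^-1%g u; rewrite hsV.
have ux : hs y <= 2 * hs u * hs x by have := hs_quotl x^-1%g y; rewrite hsV.
have s1 := hs_ge1 u; have s2 := hs_ge1 (w^-1 * u)%g; have s3 := hs_gt0 x.
have [h|h] := leP (hs u) (4 * C); last first.
  rewrite k0; last by nra.
  by rewrite k0 ?subrr ?normr0 ?mulr_ge0 // ?indicE //; lra.
rewrite indicE mem_set; last by rewrite /=; nra.
rewrite mulr1; apply: le_trans (kl _ _ s2 s1) _.
rewrite [4 * C * C]mulrC -mulrA; apply: ler_wpM2l => //; apply: le_trans hd _; exact: ler_wpM2r.
Qed.

Lemma rop_bound_L1 k (C : R) : rker k -> exists2 N : R, 0 <= N & forall f x, qf f -> hs x <= C ->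
  `|rop k f x| <= N * qI (fun y => `|f y|).
Proof.
move=> rk; have [C' [mk kC k0 kl]] := rk.
have C0 : 0 <= C' by apply: le_trans (normr_ge0 (k 1)) (kC 1 _).
have [N N0 hN] := @ball_mass (fun=> 0) (2 * C' * C) (conj (bmf_cst 0) (fun _ _ _ => erefl)).
exists (C' * N) => [|f x qfs xC]; first by rewrite !mulr_ge0.
have [bf invf] := qfs; have [mf [M fM]] := bf.
have mI := hs_measurable (R := R) (2 * C' * C).
have [mn [M' nM]] := bmf_norm bf.
have aB : adm (fun y => \1_[set y | hs y <= 2 * C' * C] y * `|f y|).
  by apply: (admMr mn nM); exact: (adm_indic mI (fun y h => h)).
have a2 := kf_adm x rk bf.
apply: le_trans (hI_norm mu_haar a2) _.
apply: (@le_trans _ _ (hI (fun y => C' * (\1_[set y | hs y <= 2 * C' * C] y * `|f y|)))); last first.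
  rewrite (hIZ mu_haar _ aB); apply: le_trans (ler_wpM2l C0 (hN f qfs)) _.
  by rewrite le_eqVlt; apply/orP; left; apply/eqP; ring.
apply: hI_le => //; [exact/adm_norm|exact: admZ|move=> y].
rewrite normrM mulrA ler_wpM2r //.
have ux : hs y <= 2 * hs (x^-1 * y)%g * hs x by have := hs_quotl x^-1%g y; rewrite hsV.
have s1 := hs_ge1 (x^-1 * y)%g; have s3 := hs_gt0 x.
have [h|h] := leP (hs (x^-1 * y)%g) C'; last by rewrite k0 // normr0 mulr_ge0 // indicE.
by rewrite indicE mem_set ?mulr1 ?kC //=; nra.
Qed.

Lemma rop_continuous k f : rker k -> qf f -> continuous (rop k f).
Proof.
move=> rk qfs x; apply/(@cvgrPdist_lt _ _ _ (nbhs x)) => e e0.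
have [N N0 hN] := rop_dev x rk; set Q := qI (fun y => `|f y|).
have Q0 : 0 <= Q by apply: qI_ge0.
have cE : continuous (fun z => Edev (x^-1 * z)%g).
  by move=> z; apply: continuous_comp; [exact: SL2_mul_continuous|exact: Edev_continuous].
have cH : continuous (fun z => hs (x^-1 * z)%g).
  by move=> z; apply: continuous_comp; [exact: SL2_mul_continuous|exact: hs_continuous].
have p : 0 < N * Q + 1 by rewrite ltr_wpDl ?mulr_ge0.
have ep : 0 < e / (N * Q + 1) by rewrite divr_gt0.
move: cE => /(_ x) /cvgrPdist_lt /(_ _ ep); rewrite mulVg Edev1 => h1.
move: cH => /(_ x) /cvgrPdist_lt /(_ 1 ltr01); rewrite mulVg hs1 => h2.
near=> z; have z1 : `|0 - Edev (x^-1 * z)%g| < e / (N * Q + 1) by near: z.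
have z2 : `|1 - hs (x^-1 * z)%g| < 1 by near: z.
have hw : hs (x^-1 * z)%g < 2 by move: z2; rewrite ltr_norml => /andP[? ?]; lra.
have := hN f _ qfs hw; rewrite mulVKg distrC -/Q => h.
apply: le_lt_trans h _; move: z1; rewrite sub0r normrN ltr_pdivlMr // => z1.
have E0 : 0 <= Edev (x^-1 * z)%g by rewrite /Edev !addr_ge0.
rewrite ger0_norm // in z1; apply: le_lt_trans z1; set E := Edev _ in E0 *; nra.
Unshelve. all: by end_near. Qed.

Lemma rop_qf k f : rker k -> qf f -> qf (rop k f).
Proof.
move=> rk qfs; have [bf invf] := qfs; have [mf [M fM]] := bf; split.
  split; first by apply: continuous_measurable_SL2; exact: rop_continuous.
  by exists (M * kmass (fun t => `|k t|)) => x; exact: rop_le.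
move=> gam x Gg; rewrite /rop -(hI_left mu_haar gam (kf_adm (gam * x)%g rk bf)).
by apply: eq_hI => y; rewrite invgM -mulgA mulKg invf.
Qed.

Lemma rop_rotation k f x (u : SL2 R) : rotation u -> rop k f (x * u)%g = rop k f x.
Proof. by move=> ru; apply: eq_hI => y; rewrite invgM -mulgA hs_rotl //; exact: rotationV. Qed.

Lemma measurable_khs2 k : measurable_fun [set: R] k ->
  measurable_fun [set: G * G] (fun z : G * G => k (hs (z.1^-1 * z.2)%g)).
Proof.
move=> mk; apply: (measurableT_comp mk); apply: (measurableT_comp (@measurable_hs R)).
by apply: measurable_mulSL2 => //; apply: measurable_invSL2.
Qed.

(** Unfold the second variable of the double integral and fold the first one back. The kernel is
    symmetric because [hs] is invariant under inversion. *)
Lemma rop_sym k f g : rker k -> qf f -> qf g -> qI (fun x => g x * rop k f x) = qI (fun x => rop k g x * f x).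
Proof.
move=> rk qff qfg; have [[mf [M fM]] invf] := qff; have [[mg [M' gM]] invg] := qfg.
have [C [mk kC k0 kl]] := rk.
have C0 : 0 <= C by apply: le_trans (normr_ge0 (k 1)) (kC 1 _).
have M0 : 0 <= M by apply: le_trans (normr_ge0 _) (fM 1%g).
have M0' : 0 <= M' by apply: le_trans (normr_ge0 _) (gM 1%g).
pose K (z : SL2 R * SL2 R) := (\1_D z.1 * g z.1) * (k (hs (z.1^-1 * z.2)%g) * f z.2).
pose CD := Num.max (lC L) 0.
pose B := CD + 2 * C * CD.
have CD0 : 0 <= CD by rewrite le_max lexx orbT.
have DC x : D x -> hs x <= CD by move=> /lD_le h; rewrite le_max h.
have K0 x y : B < hs x \/ B < hs y -> K (x, y) = 0.
  rewrite /K /= => h; rewrite indicE; case: (boolP (x \in D)) => [/set_mem /DC Dx|]; last by rewrite !mul0r.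
  have CCD : 0 <= 2 * C * CD by rewrite !mulr_ge0.
  rewrite k0 ?mul0r ?mulr0 //; have ux : hs y <= 2 * hs (x^-1 * y)%g * hs x.
    by have := hs_quotl x^-1%g y; rewrite hsV.
  have s1 := hs_gt0 x; have s2 := hs_gt0 (x^-1 * y)%g.
  case: h => h; first by move: h; rewrite /B; lra.
  rewrite ltNge; apply/negP => h'; have : hs y <= 2 * C * CD by nra.
  by move: h; rewrite /B; lra.
have mK : measurable_fun [set: G * G] K.
  apply: measurable_funM; apply: measurable_funM.
  - exact: (measurableT_comp (D_mfun L) measurable_fst).
  - exact: (measurableT_comp mg measurable_fst).
  - exact: measurable_khs2.
  - exact: (measurableT_comp mf measurable_snd).
have KB z : `|K z| <= M' * (C * M).
  rewrite /K normrM ler_pM // normrM; last by rewrite ler_pM // kC // hs_ge1.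
  by rewrite -[M']mul1r ler_pM // indic_bound.
have [a1 a2 e1] : [/\ forall x, adm (fun y => K (x, y)), adm (fun x => hI (fun y => K (x, y))) &
    hI (fun x => hI (fun y => K (x, y))) = hI (fun y => hI (fun x => K (x, y)))].
  apply: (@hI_fubini_adm _ _ mu_haar K (Num.max B (M' * (C * M)))) => // [z|x y].
    by rewrite le_max KB orbT.
  by rewrite !gt_max => -[/andP[h _]|/andP[h _]]; apply: K0; [left|right].
have KB2 (y : SL2 R) : adm (fun x => K (x, y)).
  apply: (@admP _ _ (M' * (C * M)) B); [exact: (measurable_fun_pair1 (T2 := G))|move=> x; exact: KB|].
  by move=> x h; apply: K0; left.
have aK : adm (fun y => hI (fun x => K (x, y))).
  have := @hI_fubini_adm _ _ mu_haar (fun z => K (z.2, z.1)) (Num.max B (M' * (C * M))).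
  case; last by [].
  - exact: (measurableT_comp mK (measurable_fun_pair (measurable_snd) (measurable_fst))).
  - by move=> z; rewrite le_max KB orbT.
  - by move=> x y; rewrite !gt_max => -[/andP[h _]|/andP[h _]]; apply: K0; [right|left].
have E1 : qI (fun x => g x * rop k f x) = hI (fun x => hI (fun y => K (x, y))).
  by apply: eq_hI => x; rewrite mulrA /rop -(hIZ mu_haar (\1_D x * g x) (kf_adm x rk (conj mf (ex_intro _ M fM)))).
rewrite E1 e1 (@unfold _ _ mu_haar L _ B aK); last first.
  by move=> y h; rewrite -(hI0 mu_haar); apply: eq_hI => x; apply: K0; right.
set s := gl _ _ _; apply: eq_hI => y.
rewrite indicE; case: (boolP (y \in D)) => [/set_mem Dy|]; last by rewrite !mul0r.
congr (_ * _).
have sG gam : gam \in s -> Gam gam by move/glP => [].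
have aS gam : adm (fun x => \1_D (gam * x)%g * (k (hs (y^-1 * x)%g) * g x)).
  apply: (@admMl _ _ _ 1) => [|x|]; [exact: (measurableT_comp (D_mfun L) (measurable_mull gam))|exact: indic_bound|].
  exact: (kf_adm y rk (conj mg (ex_intro _ M' gM))).
transitivity (\sum_(gam <- s) f y * hI (fun x => \1_D (gam * x)%g * (k (hs (y^-1 * x)%g) * g x))).
  apply: eq_big_seq => gam /sG Gg; rewrite -(hI_left mu_haar gam (KB2 _)) -hIZ //.
  apply: eq_hI => x; rewrite /K /= invgM -mulgA mulKg invf // invg //.
  by rewrite -[hs (y^-1 * x)%g]hsV invgM invgK; ring.
rewrite -mulr_sumr mulrC; congr (_ * _); rewrite -hI_sum //.
apply: eq_hI => x; rewrite -mulr_suml; have [h|/k0 ->] := leP (hs (y^-1 * x)%g) C; last by rewrite !mul0r mulr0.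
have hx : hs x <= 2 * C * CD.
  have ux : hs x <= 2 * hs (y^-1 * x)%g * hs y by have := hs_quotl y^-1%g x; rewrite hsV.
  have s1 := hs_gt0 y; have s2 := hs_gt0 (y^-1 * x)%g; have := DC y Dy; clear -s1 s2 ux h; nra.
have hB : hs x <= B by rewrite /B; move: hx CD0; clear; lra.
rewrite (D_sum1 (gl_uniq mu_haar L _) sG hB _).2 ?mul1r // => gam Gg hg; exact/glP.
Qed.

Lemma qI_rop k f : rker k -> qf f -> qI (rop k f) = kmass k * qI f.
Proof.
move=> rk qff; have := rop_sym rk qff (conj (bmf_cst 1) (fun _ _ _ => erefl)).
rewrite -qIZ; last by case: qff.
move=> h; transitivity (qI (fun x => 1 * rop k f x)); first by apply: eq_hI => y; rewrite mul1r.
by rewrite h; apply: eq_hI => y; rewrite rop1.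
Qed.

(** Gelfand's argument: the convolution kernel [p] is invariant under rotations on both sides,
    inversion exchanges the two factors, and the inverse of an element lies in its double coset. *)
Lemma rop_comm k k' f : rker k -> rker k' -> qf f -> rop k (rop k' f) = rop k' (rop k f).
Proof.
suff H (j j' : R -> R) x : rker j -> rker j' -> qf f -> exists psi : SL2 R -> R,
  (forall g : SL2 R, psi g = hI (fun y => j (hs y) * j' (hs (y^-1 * g)%g))) /\
  rop j (rop j' f) x = hI (fun z => psi (x^-1 * z)%g * f z).
  move=> rk rk' qff; apply/funext => x.
  have [p [hp ->]] := H k k' x rk rk' qff; have [p' [hp' ->]] := H k' k x rk' rk qff.
  apply: eq_hI => z; congr (_ * _).
  have aj (i : R -> R) : rker i -> adm (fun y => i (hs y)).
    by move=> ri; have := khs_adm 1%g ri; congr adm; apply/funext => y; rewrite invg1 mul1g.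
  have ai (g : SL2 R) : adm (fun y => k' (hs y) * k (hs (y^-1 * g)%g)).
    have := kf_adm g rk (khs_bmf rk').
    congr adm; apply/funext => y; rewrite mulrC; congr (_ * _).
    by rewrite -hsV invgM invgK.
  have flip (g : SL2 R) : p' g = p g^-1%g.
    rewrite hp hp' -(hI_left mu_haar g (ai g)); apply: eq_hI => y.
    rewrite invgM mulgVK hsV mulrC; congr (_ * _).
    by rewrite -hsV invgM.
  have pl (u g : SL2 R) : rotation u -> p (u * g)%g = p g.
    move=> ru; rewrite !hp.
    have a : adm (fun y => k (hs y) * k' (hs (y^-1 * (u * g))%g)).
      have := kf_adm (u * g)%g rk' (khs_bmf rk).
      congr adm; apply/funext => y; rewrite mulrC; congr (_ * _).
      by rewrite -[in RHS]hsV [in RHS]invgM invgK.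
    rewrite -(hI_left mu_haar u a); apply: eq_hI => y.
    by rewrite hs_rotl // invgM -mulgA mulKg.
  have pr (u g : SL2 R) : rotation u -> p (g * u)%g = p g.
    by move=> ru; rewrite !hp; apply: eq_hI => y; rewrite mulgA (hs_rotr _ ru).
  rewrite flip; have [u1 [u2 [r1 r2 ->]]] := inv_rotation (x^-1 * z)%g.
  by rewrite pr // pl.
move=> rj rj' qff; have [bf invf] := qff; have [mf [M fM]] := bf.
have [C [mk kC k0 kl]] := rj; have [C' [mk' kC' k0' kl']] := rj'.
have C0 : 0 <= C by apply: le_trans (normr_ge0 (j 1)) (kC 1 _).
have C0' : 0 <= C' by apply: le_trans (normr_ge0 (j' 1)) (kC' 1 _).
have M0 : 0 <= M by apply: le_trans (normr_ge0 _) (fM 1%g).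
exists (fun g : SL2 R => hI (fun y => j (hs y) * j' (hs (y^-1 * g)%g))); split => //.
pose K (z : SL2 R * SL2 R) := j (hs (x^-1 * z.1)%g) * (j' (hs (z.1^-1 * z.2)%g) * f z.2).
pose B1 := 2 * C * hs x; pose B := B1 + 2 * C' * B1.
have x0 := hs_gt0 x; have B10 : 0 <= B1 by have := mulr_ge0 C0 (ltW x0); rewrite /B1; lra.
have K0 y z : B < hs y \/ B < hs z -> K (y, z) = 0.
  rewrite /K /= => h; have [h1|/k0 ->] := leP (hs (x^-1 * y)%g) C; last by rewrite mul0r.
  have hy : hs y <= B1.
    have := hs_quotl x^-1%g y; rewrite hsV /B1; have := hs_gt0 (x^-1 * y)%g; nra.
  have p0 : 0 <= 2 * C' * B1 by rewrite -mulrA mulr_ge0 //; exact: mulr_ge0 C0' B10.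
  case: h => h; first by move: h; rewrite /B; lra.
  rewrite k0' ?mul0r ?mulr0 // ltNge; apply/negP => h2.
  have := hs_quotl y^-1%g z; rewrite hsV => h3; have s2 := hs_gt0 (y^-1 * z)%g; have s3 := hs_gt0 y.
  have : hs z <= 2 * C' * B1 by nra.
  by move: h; rewrite /B; lra.
have mK : measurable_fun [set: G * G] K.
  apply: measurable_funM; first exact: (measurableT_comp (measurable_khs x mk) measurable_fst).
  apply: measurable_funM; first exact: measurable_khs2.
  exact: (measurableT_comp mf measurable_snd).
have KB z : `|K z| <= C * (C' * M).
  by rewrite /K !normrM ler_pM ?mulr_ge0 ?kC ?hs_ge1 // ler_pM // kC' // hs_ge1.
have [a1 a2 e1] : [/\ forall x, adm (fun y => K (x, y)), adm (fun x => hI (fun y => K (x, y))) &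
    hI (fun x => hI (fun y => K (x, y))) = hI (fun y => hI (fun x => K (x, y)))].
  apply: (@hI_fubini_adm _ _ mu_haar K (Num.max B (C * (C' * M)))) => // [z|y z].
    by rewrite le_max KB orbT.
  by rewrite !gt_max => -[/andP[h _]|/andP[h _]]; apply: K0; [left|right].
transitivity (hI (fun x => hI (fun y => K (x, y)))).
  by apply: eq_hI => y; rewrite /rop -(hIZ mu_haar (j (hs (x^-1 * y)%g)) (kf_adm y rj' bf)).
rewrite e1; apply: eq_hI => z.
have a : adm (fun y => j (hs y) * j' (hs (y^-1 * (x^-1 * z))%g)).
  have := kf_adm (x^-1 * z)%g rj' (khs_bmf rj).
  congr adm; apply/funext => y; rewrite mulrC; congr (_ * _).
  by rewrite -[in RHS]hsV [in RHS]invgM invgK.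
rewrite mulrC -(hIZ mu_haar (f z) a) -(hI_left mu_haar x^-1%g (admZ (f z) a)).
by apply: eq_hI => y; rewrite /K /= invgM invgK -!mulgA mulVKg; ring.
Qed.

End RadialOperators.

(** * Compactness and the extremal eigenvalue of an averaging operator *)

Section Spectral.
Variables (R : realType) (mu : SL2_measure R).
Hypothesis mu_haar : is_haar mu.
Variable L : lattice R.
Local Notation qf := (qf L).
Local Notation rop := (rop mu).
Local Notation qI := (qI mu L).
Local Notation Gam := (subgroup_set (lG L)).
Local Notation D := (lD L).
Implicit Types (x y gam : SL2 R) (f g : SL2 R -> R) (k : R -> R).

Definition n2 f : R := qI (fun x => f x * f x).

(** Closedness refers to uniform limits along ultrafilters with continuous limit function, which are
    exactly the limits produced by [rop_ultra_limit]. *)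
Record closed_subspace (V : (SL2 R -> R) -> Prop) : Prop := ClosedSubspace {
  cs_qf : forall f, V f -> qf f;
  cs_lin : forall a f g, V f -> V g -> V (fun x => a * f x + g x);
  cs_closed : forall (f_ : nat -> SL2 R -> R) g (U : set_system nat), UltraFilter U ->
    (forall n, V (f_ n)) -> continuous g ->
    (forall e : R, 0 < e -> U [set n | forall x, `|f_ n x - g x| <= e]) -> V g }.

Lemma n2_ge0 f : 0 <= n2 f.
Proof. by apply: qI_ge0 => x; rewrite -expr2 sqr_ge0. Qed.

Lemma n2Z f c : bmf f -> n2 (fun x => c * f x) = c ^+ 2 * n2 f.
Proof.
move=> bf; rewrite /n2 -(qIZ mu_haar _ _ (bmfM bf bf)).
by apply: eq_hI => x; congr (_ * _); ring.
Qed.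

Lemma n2_le f (e : R) : bmf f -> 0 <= e -> (forall x, D x -> `|f x| <= e) -> n2 f <= e ^+ 2 * qvol mu L.
Proof.
move=> bf e0 fe; rewrite -(qI_cst mu_haar); apply: (qI_le mu_haar (bmfM bf bf) (bmf_cst _)) => x Dx.
rewrite -expr2 -[X in X <= _]real_normK ?num_real // ler_sqr ?nnegrE //; exact: fe.
Qed.

(** The inequality of means with a free weight [e], playing the role of Cauchy-Schwarz. *)
Lemma qI_norm_le f (e : R) : bmf f -> 0 < e -> qI (fun x => `|f x|) <= (e * qvol mu L + n2 f / e) / 2.
Proof.
move=> bf e0; have bff := bmfM bf bf.
have -> : (e * qvol mu L + n2 f / e) / 2 = qI (fun x => e / 2 + (e^-1 / 2) * (f x * f x)).
  rewrite (qID mu_haar L (bmf_cst _) (bmfZ _ bff)) (qI_cst mu_haar) (qIZ mu_haar L _ bff) -/(n2 f).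
  by field; rewrite gt_eqF.
apply: (qI_le mu_haar (bmf_norm bf) (bmfD (bmf_cst _) (bmfZ _ bff))) => x _.
have -> : e / 2 + e^-1 / 2 * (f x * f x) = `|f x| + (e - `|f x|) ^+ 2 / (2 * e).
  rewrite -[f x * f x]expr2 -[f x ^+ 2]real_normK ?num_real //; field; rewrite gt_eqF //.
by rewrite lerDl divr_ge0 ?sqr_ge0 // mulr_ge0 // ltW.
Qed.

Lemma filter_lim_le (F : set_system nat) (PF : ProperFilter F) (u : nat -> R) (l c : R) :
  u n @[n --> F] --> l -> (forall n, `|u n| <= c) -> `|l| <= c.
Proof.
move=> ul uc; rewrite leNgt; apply/negP => lt.
have /cvgrPdist_lt /(_ (`|l| - c)) := ul; rewrite subr_gt0 => /(_ lt) Fg.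
have [n /= h] := filter_ex Fg; have := lerB_dist l (u n); have := uc n; move: h; lra.
Qed.

(** Compactness of the operator. On a family bounded in L^2 the images are bounded at each point and
    equicontinuous, so limits exist pointwise; they are uniform on a ball meeting every orbit, hence
    everywhere by invariance. *)
Lemma rop_ultra_limit k (f_ : nat -> SL2 R -> R) (U : set_system nat) : rker k -> UltraFilter U ->
  (forall n, qf (f_ n)) -> (forall n, n2 (f_ n) <= 1) ->
  exists2 g, continuous g & forall e : R, 0 < e -> U [set n | forall x, `|rop k (f_ n) x - g x| <= e].
Proof.
move=> rk UU fq f1; have PU := @ultra_proper _ U UU.
pose Q := (qvol mu L + 1) / 2.
have Q0 : 0 < Q by have := qvol_gt0 mu_haar L; rewrite /Q; lra.
have fQ n : qI (fun x => `|f_ n x|) <= Q.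
  have [bf _] := fq n; apply: le_trans (qI_norm_le bf ltr01) _.
  by rewrite mul1r divr1 /Q; have := f1 n; lra.
have fq0 n : 0 <= qI (fun x => `|f_ n x|) by apply: qI_ge0.
have lim x : exists l : R, rop k (f_ n) x @[n --> U] --> l.
  have [N N0 hN] := rop_bound_L1 mu_haar L (hs x) rk.
  apply: (@ultra_cvg_segment _ _ U UU _ (N * Q)); apply: filterE => n /=.
  by apply: le_trans (hN _ _ (fq n) (lexx _)) _; rewrite ler_wpM2l.
have [g gl] := choice lim.
have dev x : exists2 N : R, 0 <= N & forall w, hs w < 2 ->
    (forall n, `|rop k (f_ n) (x * w)%g - rop k (f_ n) x| <= N * Edev w) /\ `|g (x * w)%g - g x| <= N * Edev w.
  have [N N0 hN] := rop_dev mu_haar L x rk; exists (N * Q) => [|w w2]; first by rewrite mulr_ge0 // ltW.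
  have E0 : 0 <= Edev w by rewrite /Edev !addr_ge0.
  have h n : `|rop k (f_ n) (x * w)%g - rop k (f_ n) x| <= N * Q * Edev w.
    by apply: le_trans (hN _ _ (fq n) w2) _; rewrite mulrAC ler_wpM2r // ler_wpM2l.
  split=> //; apply: (@filter_lim_le U PU (fun n => rop k (f_ n) (x * w)%g - rop k (f_ n) x)) => //.
  by apply: cvgB; exact: gl.
have near_dev x (e : R) : 0 < e -> \forall y \near x, forall n,
    `|rop k (f_ n) y - rop k (f_ n) x| <= e /\ `|g y - g x| <= e.
  move=> e0; have [N N0 hN] := dev x.
  have cE : continuous (fun z => Edev (x^-1 * z)%g).
    by move=> z; apply: continuous_comp; [exact: SL2_mul_continuous|exact: Edev_continuous].
  have cH : continuous (fun z => hs (x^-1 * z)%g).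
    by move=> z; apply: continuous_comp; [exact: SL2_mul_continuous|exact: hs_continuous].
  have p : 0 < N + 1 by lra.
  have ep : 0 < e / (N + 1) by rewrite divr_gt0.
  move: cE => /(_ x) /cvgrPdist_lt /(_ _ ep); rewrite mulVg Edev1 => h1.
  move: cH => /(_ x) /cvgrPdist_lt /(_ 1 ltr01); rewrite mulVg hs1 => h2.
  near=> z; have z1 : `|0 - Edev (x^-1 * z)%g| < e / (N + 1) by near: z.
  have z2 : `|1 - hs (x^-1 * z)%g| < 1 by near: z.
  have hw : hs (x^-1 * z)%g < 2 by move: z2; rewrite ltr_norml => /andP[? ?]; lra.
  have [d1 d2] := hN _ hw; rewrite mulVKg in d1 d2.
  have E0 : 0 <= Edev (x^-1 * z)%g by rewrite /Edev !addr_ge0.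
  have le : N * Edev (x^-1 * z)%g <= e.
    move: z1; rewrite sub0r normrN ger0_norm // ltr_pdivlMr // => z1.
    by apply: le_trans (ltW z1); set E := Edev _ in E0 *; nra.
  by move=> n; split; [apply: le_trans (d1 n) le|apply: le_trans d2 le].
exists g => [x|e e0].
  apply/(@cvgrPdist_lt _ _ _ (nbhs x)) => e e0.
  have e2 : 0 < e / 2 by lra.
  by apply: filterS (near_dev x _ e2) => y /(_ 0%N) [_ h]; rewrite distrC; lra.
have ginv gam x : Gam gam -> g (gam * x)%g = g x.
  move=> Gg; have l1 := gl (gam * x)%g.
  have e1 : (fun n => rop k (f_ n) (gam * x)%g) = (fun n => rop k (f_ n) x).
    by apply/funext => n; have [_ ->] := rop_qf mu_haar rk (fq n).
  by rewrite e1 in l1; apply: (cvg_unique _ l1 (gl x)).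
have /compact_near_coveringP nc := @hs_compact R (lC L).
have e3 : 0 < e / 3 by lra.
have := nc _ U (fun n y => `|rop k (f_ n) y - g y| <= e) _ _ => /(_ _) UK.
have {}UK : \near U, [set y | hs y <= lC L] `<=` (fun y => `|rop k (f_ U) y - g y| <= e).
  apply: UK => x _.
  have h2 : U [set n | `|g x - rop k (f_ n) x| < e / 3] by have /cvgrPdist_lt := gl x; apply.
  exists ([set y | forall n, `|rop k (f_ n) y - rop k (f_ n) x| <= e / 3 /\ `|g y - g x| <= e / 3],
    [set n | `|g x - rop k (f_ n) x| < e / 3]); first by split => //; exact: near_dev.
  move=> [y n] /= [/(_ n) [h3 h4] h5].
  have -> : rop k (f_ n) y - g y = (rop k (f_ n) y - rop k (f_ n) x) - (g y - g x) - (g x - rop k (f_ n) x) by ring.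
  apply: le_trans (ler_normB _ _) _; have := ler_normB (rop k (f_ n) y - rop k (f_ n) x) (g y - g x); lra.
apply: filterS UK => n h x /=; have [gam Gg Dg] := lD_ex L x.
have [_ ri] := rop_qf mu_haar rk (fq n); rewrite -(ri _ _ Gg) -(ginv _ _ Gg).
exact: (h _ (lD_le Dg)).
Unshelve. all: by end_near. Qed.

Variables (V : (SL2 R -> R) -> Prop) (k : R -> R).
Hypothesis cV : closed_subspace V.
Hypothesis rk : rker k.
Hypothesis VT : forall f, V f -> V (rop k f).

Lemma V_scale f a : V f -> V (fun x => a * f x).
Proof.
move=> Vf; have := cs_lin cV (a - 1) Vf Vf; congr V; apply/funext => x; ring.
Qed.

(* The maximizing vectors f_n satisfy (T^2 - |T|^2) f_n -> 0, while T f_n has a uniform limit. *)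
Lemma spectral f1 : V f1 -> 0 < n2 (rop k f1) -> exists N f, [/\ 0 < N, V f, (exists x, f x != 0),
  (forall x, rop k f x = N * f x) \/ (forall x, rop k f x = - N * f x) &
  forall h, V h -> n2 (rop k h) <= N ^+ 2 * n2 h].
Proof.
move=> Vf1 pos.
have qV f : V f -> qf f by exact: cs_qf.
have bV f : V f -> bmf f by move=> /qV [].
have Q0 := qvol_gt0 mu_haar L.
pose S := [set s : R | exists f, [/\ V f, n2 f <= 1 & s = n2 (rop k f)]].
have [N N0 hN] := rop_bound_L1 mu_haar L (lC L) rk.
pose Q := (qvol mu L + 1) / 2.
have Qp : 0 <= Q by rewrite /Q; lra.
have bS : has_ubound S.
  exists ((N * Q) ^+ 2 * qvol mu L) => _ [f [Vf f1' ->]].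
  apply: n2_le; [by apply: bV; exact: VT|by rewrite mulr_ge0|move=> x /lD_le Dx].
  apply: le_trans (hN _ _ (qV _ Vf) Dx) _; apply: ler_wpM2l => //.
  by apply: le_trans (qI_norm_le (bV _ Vf) ltr01) _; rewrite mul1r divr1 /Q; lra.
have scal f s : V f -> 0 <= s -> s * n2 f <= 1 -> S (s * n2 (rop k f)).
  move=> Vf s0 h; exists (fun x => Num.sqrt s * f x); split; first exact: V_scale.
    by rewrite (n2Z _ (bV _ Vf)) sqr_sqrtr.
  rewrite -[s in LHS]sqr_sqrtr // -(n2Z _ (bV _ (VT Vf))).
  by apply: eq_hI => x; rewrite !ropZ //; exact: bV.
have sS : has_sup S by split => //; exists (0 * n2 (rop k f1)); apply: scal => //; rewrite mul0r.
pose B := sup S.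
have ubS s : S s -> s <= B by move=> Ss; exact: sup_upper_bound.
have B0 : 0 < B.
  have p1 : 0 < 1 + n2 f1 by have := n2_ge0 f1; lra.
  apply: (@lt_le_trans _ _ ((1 + n2 f1)^-1 * n2 (rop k f1))); first by rewrite mulr_gt0 ?invr_gt0.
  apply: ubS; apply: scal => //; first by rewrite invr_ge0 ltW.
  by rewrite mulrC ler_pdivrMr // mul1r; lra.
have homB h : V h -> n2 (rop k h) <= B * n2 h.
  move=> Vh; have a0 := n2_ge0 h; have [a1|a1] := ltP 0 (n2 h).
    have := ubS _ (scal h (n2 h)^-1 Vh _ _); rewrite invr_ge0 mulVf ?gt_eqF // => /(_ a0 (lexx _)).
    by rewrite mulrC ler_pdivrMr.
  have -> : n2 h = 0 by apply/eqP; rewrite eq_le a0 a1.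
  rewrite mulr0 leNgt; apply/negP => p0.
  have := ubS _ (scal h ((B + 1) / n2 (rop k h)) Vh _ _).
  have -> : n2 h = 0 by apply/eqP; rewrite eq_le a0 a1.
  rewrite mulr0 divfK ?gt_eqF // => /(_ _ ler01) h2.
  have : B + 1 <= B by apply: h2; apply: divr_ge0; [exact: addr_ge0 (ltW B0) ler01|exact: ltW].
  by rewrite gerDl ler10.
have ex n : exists f, [/\ V f, n2 f <= 1 & B - n.+1%:R^-1 < n2 (rop k f)].
  have [|_ [f [Vf f1' ->]] h] := @sup_adherent _ S n.+1%:R^-1 _ sS; first by rewrite invr_gt0 ltr0n.
  by exists f.
have [f_ hf] := choice ex.
have Vf n : V (f_ n) by case: (hf n).
have f1' n : n2 (f_ n) <= 1 by case: (hf n).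
have fB n : B - n.+1%:R^-1 < n2 (rop k (f_ n)) by case: (hf n).
have [U [UU oU]] := @ultraFilterLemma nat (nbhs \oo) _.
have PU := @ultra_proper _ U UU.
have [g cg gU] := rop_ultra_limit rk UU (fun n => qV _ (Vf n)) f1'.
have Vg : V g by apply: (cs_closed cV UU (fun n => VT (Vf n))).
pose h_ n x := rop k (rop k (f_ n)) x - B * f_ n x.
have Vh n : V (h_ n).
  have := cs_lin cV (- B) (Vf n) (VT (VT (Vf n))); congr V; apply/funext => x; rewrite /h_; ring.
(* Write T for the operator. Expanding the square and using symmetry, |T^2 f - B f|^2 = |T^2 f|^2 -
   2 B |T f|^2 + B^2 |f|^2, which is at most B (B - |T f|^2) since |T^2 f|^2 <= B |T f|^2 and |f| <=
   1. *)
have n2h n : n2 (h_ n) <= B / n.+1%:R.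
  have b1 := bV _ (VT (VT (Vf n))); have b2 := bV _ (Vf n).
  have -> : n2 (h_ n) = n2 (rop k (rop k (f_ n))) - 2 * B * qI (fun x => rop k (rop k (f_ n)) x * f_ n x) + B ^+ 2 * n2 (f_ n).
    rewrite /n2 -(qIZ mu_haar _ _ (bmfM b1 b2)) -(qIZ mu_haar _ _ (bmfM b2 b2)).
    rewrite -(qIB mu_haar _ (bmfM b1 b1) (bmfZ _ (bmfM b1 b2))).
    rewrite -(qID mu_haar _ _ (bmfZ _ (bmfM b2 b2))); last first.
      have := bmfD (bmfM b1 b1) (bmfZ (-1) (bmfZ (2 * B) (bmfM b1 b2))); congr bmf; apply/funext => x; ring.
    by apply: eq_hI => x; rewrite /h_; congr (_ * _); ring.
  rewrite -(rop_sym mu_haar rk (qV _ (Vf n)) (qV _ (VT (Vf n)))) -/(n2 (rop k (f_ n))).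
  have e1 := homB _ (VT (Vf n)); have e2 := homB _ (Vf n); have e3 := fB n; have e4 := f1' n.
  move: (n.+1%:R^-1 : R) e3 => w e3; set a := n2 (rop k (f_ n)) in e1 e2 e3 *.
  set c := n2 (f_ n) in e2 e4 *; set d := n2 (rop k (rop k (f_ n))) in e1 *.
  have h1 : B * (B - w) <= B * a := ler_wpM2l (ltW B0) (ltW e3).
  have h2 : B ^+ 2 * c <= B ^+ 2 by rewrite ler_piMr // sqr_ge0.
  by move: h1 h2 e1; rewrite expr2; lra.
have qIh (d : R) : 0 < d -> exists n0, forall n, (n0 <= n)%N -> qI (fun x => `|h_ n x|) <= d.
  move=> d0; pose e := d / (qvol mu L + 1).
  have qv1 : 0 < qvol mu L + 1 by exact: addr_gt0.
  have e0 : 0 < e by exact: divr_gt0.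
  exists (Num.truncn (B / (e * d))).+1 => n nn.
  apply: le_trans (qI_norm_le (bV _ (Vh n)) e0) _.
  have h1 : e * qvol mu L <= d.
    rewrite /e mulrAC ler_pdivrMr //.
    by rewrite ler_wpM2l ?(ltW d0) // lerDl.
  clearbody e; have h2 : n2 (h_ n) / e <= d.
    rewrite ler_pdivrMr //; apply: le_trans (n2h n) _.
    rewrite ler_pdivrMr ?ltr0n // mulrC -ler_pdivrMr ?mulr_gt0 //.
    rewrite [d * e]mulrC; apply: ltW; apply: (lt_le_trans (truncnS_gt _)).
    by rewrite ler_nat; apply: leq_trans nn _.
  lra.
pose m := kmass mu (fun t => `|k t|).
have m0 : 0 <= m by apply: hI_ge0.
(* [h_ n] is small only in the mean; applying the operator once more makes it small at the point
   [x], and the uniform limit [g] can then be inserted. *)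
have TTg x : rop k (rop k g) x = B * g x.
  apply/eqP; rewrite -subr_eq0 -normr_le0; apply/ler_addgt0Pl => z z0; rewrite addr0.
  have [N' N0' hN'] := rop_bound_L1 mu_haar L (hs x) rk.
  pose C := m * m + N' + B.
  have C0 : 0 < C by rewrite /C; have := mulr_ge0 m0 m0; lra.
  pose d := z / C; have d0 : 0 < d by rewrite /d divr_gt0.
  have [n0 hn0] := qIh d d0.
  have U1 : U [set n | (n0 <= n)%N] by apply: oU; exists n0.
  have [n [/= nn gn]] := filter_ex (filterI U1 (gU d d0)).
  have b0 := bV _ Vg; have b1 := bV _ (VT (Vf n)); have b2 := bV _ (Vf n); have b3 := bV _ (VT (VT (Vf n))).
  have bd : bmf (fun y => rop k (f_ n) y - g y).
    have := bmfD b1 (bmfZ (-1) b0); congr bmf; apply/funext => y; ring.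
  have s1 y : `|rop k (rop k (f_ n)) y - rop k g y| <= d * m.
    by rewrite -(ropB mu_haar _ rk b1 b0); apply: rop_le.
  have s2 : `|rop k (rop k (rop k (f_ n))) x - rop k (rop k g) x| <= d * m * m.
    have b4 := bV _ (VT Vg); rewrite -(ropB mu_haar _ rk b3 b4); apply: rop_le => //.
    have := bmfD b3 (bmfZ (-1) b4); congr bmf; apply/funext => y; ring.
  have s3 : `|rop k (h_ n) x| <= N' * d.
    by apply: le_trans (hN' _ _ (qV _ (Vh n)) (lexx _)) _; rewrite ler_wpM2l // hn0.
  have e3 : rop k (h_ n) x = rop k (rop k (rop k (f_ n))) x - B * rop k (f_ n) x.
    by rewrite /h_ (ropB mu_haar _ rk b3 (bmfZ B b2)) (ropZ mu_haar _ _ rk b2).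
  have s4 := gn x.
  have s5 : `|B * rop k (f_ n) x - B * g x| <= B * d by rewrite -mulrBr normrM gtr0_norm // ler_pM2l.
  have zE : z = d * m * m + N' * d + B * d by rewrite /d /C; field; rewrite gt_eqF // -/C.
  rewrite zE.
  have tele (p q t u : R) : p - u = - (q - p) + (q - t) + (t - u) by ring.
  rewrite (tele _ (rop k (rop k (rop k (f_ n))) x) (B * rop k (f_ n) x)) -e3.
  apply: le_trans (ler_normD _ _) _; apply: lerD => //.
  by apply: le_trans (ler_normD _ _) _; rewrite normrN; apply: lerD.
have gn0 : exists x, g x != 0.
  apply: contrapT => ng; have g0 x : g x = 0 by apply/eqP/negPn/negP => h; apply: ng; exists x.
  pose e := Num.sqrt (B / (4 * qvol mu L)).
  have e2 : e ^+ 2 * qvol mu L = B / 4 by rewrite /e sqr_sqrtr ?divr_ge0 ?mulr_ge0 ?ltW //; field; rewrite gt_eqF.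
  have e0 : 0 < e by rewrite sqrtr_gt0 divr_gt0 // mulr_gt0.
  have U1 : U [set n | (Num.truncn (2 / B) <= n)%N] by apply: oU; exists (Num.truncn (2 / B)).
  have [n [/= nn gn]] := filter_ex (filterI U1 (gU e e0)).
  have : n2 (rop k (f_ n)) <= B / 4.
    rewrite -e2; apply: n2_le; [exact: bV (VT (Vf n))|exact: ltW|move=> x _].
    by have := gn x; rewrite g0 subr0.
  have := fB n; have : n.+1%:R^-1 < B / 2.
    rewrite invf_plt ?posrE ?ltr0n //; last lra.
    by rewrite invf_div; apply: (lt_le_trans (truncnS_gt _)); rewrite ler_nat.
  by move: B0 (n.+1%:R^-1 : R) (n2 (rop k (f_ n))) => b0 w v; clear -b0; lra.
pose sB := Num.sqrt B; have sB0 : 0 < sB by rewrite sqrtr_gt0.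
have sB2 : sB ^+ 2 = B by rewrite sqr_sqrtr // ltW.
have bound h : V h -> n2 (rop k h) <= sB ^+ 2 * n2 h by rewrite sB2; exact: homB.
(* The square of the operator acts on [g] as sB^2: either [g] itself has eigenvalue - sB, or the sum
   of [sB g] and its image is a nonzero vector with eigenvalue sB. *)
have [[x ex0]|ne] := pselect (exists x, rop k g x + sB * g x != 0); last first.
  exists sB, g; split => //; right => x; apply/eqP; rewrite mulNr -subr_eq0 opprK.
  by apply/negPn/negP => h; apply: ne; exists x.
exists sB, (fun x => sB * g x + rop k g x); split => //.
- by apply: (cs_lin cV) => //; exact: VT.
- by exists x; rewrite addrC.
left => y; have b0 := bV _ Vg; have b1 := bV _ (VT Vg).
rewrite (ropD mu_haar _ rk (bmfZ sB b0) b1) (ropZ mu_haar _ _ rk b0) TTg -sB2; ring.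
Qed.

End Spectral.

(** * Half-plane coordinates on the group *)

Section HalfPlaneCoordinates.
Variable R : realType.
Implicit Types (g h : SL2 R) (s t : R).

(* The point [g i] of the half plane is [X g + i Y g]. *)
Definition Y g := (ec g ^+ 2 + ed g ^+ 2)^-1.
Definition X g := (ea g * ec g + eb g * ed g) * Y g.

Lemma Yden_gt0 g : 0 < ec g ^+ 2 + ed g ^+ 2.
Proof.
have D := SL2_detE g; rewrite lt_neqAle addr_ge0 ?sqr_ge0 // andbT eq_sym.
apply/eqP => /eqP; rewrite paddr_eq0 ?sqr_ge0 // !sqrf_eq0 => /andP[/eqP c0 /eqP d0].
by move: D; rewrite c0 d0 !mulr0 subr0 => /esym/eqP; rewrite oner_eq0.
Qed.

Lemma Y_gt0 g : 0 < Y g. Proof. by rewrite invr_gt0 Yden_gt0. Qed.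

(** The formula for the hyperbolic cosine of a distance in the half plane; through it radial kernels
    see only the points g i and h i. *)
Lemma hs_XY g h : hs (g^-1 * h)%g = ((X g - X h) ^+ 2 + Y g ^+ 2 + Y h ^+ 2) / (2 * Y g * Y h).
Proof.
have D := SL2_detE g; have D' := SL2_detE h; have n := Yden_gt0 g; have n' := Yden_gt0 h.
rewrite /X /Y /hs !entM !entV.
move: (ea g) (eb g) (ec g) (ed g) (ea h) (eb h) (ec h) (ed h) D D' n n' => a b c d a' b' c' d' D D' n n'.
have E : (a * c + b * d) ^+ 2 + 1 = (a ^+ 2 + b ^+ 2) * (c ^+ 2 + d ^+ 2) by rewrite -[1](expr1n _ 2) -D; ring.
have E' : (a' * c' + b' * d') ^+ 2 + 1 = (a' ^+ 2 + b' ^+ 2) * (c' ^+ 2 + d' ^+ 2) by rewrite -[1](expr1n _ 2) -D'; ring.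
set ga := c ^+ 2 + d ^+ 2 in n E *; set ga' := c' ^+ 2 + d' ^+ 2 in n' E' *.
have -> : ((a * c + b * d) * ga^-1 - (a' * c' + b' * d') * ga'^-1) ^+ 2 + ga^-1 ^+ 2 + ga'^-1 ^+ 2 =
  (((a * c + b * d) ^+ 2 + 1) * ga' ^+ 2 - 2 * (a * c + b * d) * (a' * c' + b' * d') * ga * ga'
   + ((a' * c' + b' * d') ^+ 2 + 1) * ga ^+ 2) / (ga ^+ 2 * ga' ^+ 2).
  by field; rewrite !gt_eqF.
rewrite E E' /ga /ga'; field.
by rewrite !gt_eqF.
Qed.

Lemma hs1_rotation g : hs g = 1 -> rotation g.
Proof.
have D := SL2_detE g; rewrite /hs => H.
have E : (ea g - ed g) ^+ 2 + (eb g + ec g) ^+ 2 = 0.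
  have : ea g ^+ 2 + eb g ^+ 2 + ec g ^+ 2 + ed g ^+ 2 = 2 * (ea g * ed g - eb g * ec g) by rewrite D; lra.
  by move=> E; lra.
move/eqP: E; rewrite paddr_eq0 ?sqr_ge0 // !sqrf_eq0 => /andP[/eqP e1 /eqP e2].
by split; lra.
Qed.

Lemma XY_rotation g h : X g = X h -> Y g = Y h -> rotation (g^-1 * h)%g.
Proof.
move=> eX eY; apply: hs1_rotation; rewrite hs_XY eX eY subrr.
by field; rewrite gt_eqF ?Y_gt0.
Qed.

Lemma dl_subproof s : (if 0 < s then Num.sqrt s else 1) * (if 0 < s then Num.sqrt s else 1)^-1 - 0 * 0 = 1.
Proof. by rewrite mulr0 subr0 divff //; case: ifP => s0; rewrite ?oner_eq0 // gt_eqF // sqrtr_gt0. Qed.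

(** For s > 0 it acts on the half plane as multiplication by s. The other values are the identity,
    only to make the family total. *)
Definition dl s := mkSL2 (dl_subproof s).

Lemma dl_XY s h : 0 < s -> X (dl s * h)%g = s * X h /\ Y (dl s * h)%g = s * Y h.
Proof.
move=> s0; have [a b c d] := mkSL2E (dl_subproof s).
rewrite -/(dl s) s0 in a b c d; have n := Yden_gt0 h.
have S : Num.sqrt s ^+ 2 = s by rewrite sqr_sqrtr // ltW.
have q0 : 0 < Num.sqrt s by rewrite sqrtr_gt0.
have eY : Y (dl s * h)%g = s * Y h.
  rewrite -[X in X * Y h]S /Y !entM c d !mul0r !add0r; field.
  by rewrite !gt_eqF.
by split=> //; rewrite /X eY !entM a b c d !mul0r !add0r !addr0; field; rewrite gt_eqF.
Qed.

Lemma nx_XY t h : X (E12 t * h)%g = X h + t /\ Y (E12 t * h)%g = Y h.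
Proof.
have [a b c d] := E12E t; have n := Yden_gt0 h.
have eY : Y (E12 t * h)%g = Y h by rewrite /Y !entM c d !mul0r !mul1r !add0r.
split=> //; rewrite /X eY !entM a b c d !mul0r !mul1r !add0r.
have -> : (ea h + t * ec h) * ec h + (eb h + t * ed h) * ed h = ea h * ec h + eb h * ed h + t * (ec h ^+ 2 + ed h ^+ 2) by ring.
by rewrite mulrDl -[X in _ + X]mulrA /Y divff ?mulr1 // gt_eqF.
Qed.

Lemma XY1 : X (1%g : SL2 R) = 0 /\ Y (1%g : SL2 R) = 1.
Proof. by rewrite /X /Y !ent1; split; rewrite ?mul0r ?mulr0 ?addr0 ?mul0r // expr0n /= add0r expr1n invr1. Qed.

Definition gz (x y : R) := (E12 x * dl y)%g.

Lemma gz_XY x y : 0 < y -> X (gz x y) = x /\ Y (gz x y) = y.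
Proof.
move=> y0; have [-> ->] := nx_XY x (dl y); have [X1 Y1] := XY1.
by have := dl_XY 1%g y0; rewrite mulg1 X1 Y1 mulr0 mulr1 => -[-> ->]; rewrite add0r.
Qed.

Lemma Y_bound h : Y h <= 2 * hs h /\ (Y h)^-1 <= 2 * hs h.
Proof.
have D := SL2_detE h; have n := Yden_gt0 h; rewrite /Y invrK /hs; split; last first.
  by have := sqr_ge0 (ea h); have := sqr_ge0 (eb h); lra.
rewrite -div1r ler_pdivrMr //.
have E : (ea h * ec h + eb h * ed h) ^+ 2 + 1 = (ea h ^+ 2 + eb h ^+ 2) * (ec h ^+ 2 + ed h ^+ 2).
  by rewrite -[1](expr1n _ 2) -D; ring.
have -> : 2 * ((ea h ^+ 2 + eb h ^+ 2 + ec h ^+ 2 + ed h ^+ 2) / 2) * (ec h ^+ 2 + ed h ^+ 2) =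
  ((ea h * ec h + eb h * ed h) ^+ 2 + 1) + (ec h ^+ 2 + ed h ^+ 2) ^+ 2 by rewrite E; field.
by have := sqr_ge0 (ea h * ec h + eb h * ed h); have := sqr_ge0 (ec h ^+ 2 + ed h ^+ 2); lra.
Qed.

Lemma X_bound h : `|X h| <= 2 * hs h ^+ 2.
Proof.
have [y1 _] := Y_bound h; have y0 := Y_gt0 h; have h1 := hs_ge1 h.
rewrite /X normrM (gtr0_norm y0).
have : `|ea h * ec h + eb h * ed h| <= hs h.
  by rewrite /hs ler_norml; have := sqr_ge0 (ea h - ec h); have := sqr_ge0 (eb h - ed h);
    have := sqr_ge0 (ea h + ec h); have := sqr_ge0 (eb h + ed h); lra.
move=> le; rewrite expr2 mulrCA; apply: ler_pM => //; exact: ltW.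
Qed.

Lemma Y_continuous : continuous Y.
Proof.
move=> h; have [a b c d] := ent_cvg h.
apply: (@cvgV _ _ (nbhs h) _ (fun x : SL2 R => ec x ^+ 2 + ed x ^+ 2)); first by rewrite gt_eqF ?Yden_gt0.
by apply: (@cvgD _ _ _ (nbhs h)); rewrite !expr2; [apply: (@cvgM _ _ (nbhs h) _ _ _ _ _ c c)|apply: (@cvgM _ _ (nbhs h) _ _ _ _ _ d d)].
Qed.

Lemma X_continuous : continuous X.
Proof.
move=> h; have [a b c d] := ent_cvg h.
apply: (@cvgM _ _ (nbhs h)); last exact: Y_continuous.
by apply: (@cvgD _ _ _ (nbhs h)); [apply: (@cvgM _ _ (nbhs h) _ _ _ _ _ a c)|apply: (@cvgM _ _ (nbhs h) _ _ _ _ _ b d)].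
Qed.

End HalfPlaneCoordinates.

(** * First-order expansions along left flows *)

Section Flows.
Variables (R : realType).
Implicit Types (g h : SL2 R) (t : R) (w v : SL2 R -> R).

(* [fl true] is the horizontal flow and [fl false] the dilation flow. *)
Definition fl (b : bool) t := if b then E12 t else dl (1 + t).

(** Bounds are local because the left flows do not commute with Gamma: derivatives of invariant
    functions along them need not be invariant, nor globally bounded. *)
Definition lbd w := forall C : R, exists M : R, forall h, hs h <= C -> `|w h| <= M.

(** [v] is the derivative of [w] along a flow, with an error quadratic in t and uniform on balls.
    This form survives products and averaging by plain estimates. *)
Definition fd b w v := forall C : R, exists M : R, forall h t, hs h <= C -> `|t| <= 1 / 2 ->
  `|w (fl b t * h)%g - w h - t * v h| <= M * t ^+ 2.

Lemma lbd_pos w (C : R) : lbd w -> exists2 M : R, 1 <= M & forall h, hs h <= C -> `|w h| <= M.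
Proof.
move=> /(_ C)[M wM]; exists (Num.max 1 M); first by rewrite le_max lexx.
by move=> h /wM le; rewrite le_max le orbT.
Qed.

Lemma fd_pos b w v (C : R) : fd b w v -> exists2 M : R, 1 <= M & forall h t, hs h <= C -> `|t| <= 1 / 2 ->
  `|w (fl b t * h)%g - w h - t * v h| <= M * t ^+ 2.
Proof.
move=> /(_ C)[M wM]; exists (Num.max 1 M); first by rewrite le_max lexx.
by move=> h t hC tb; apply: le_trans (wM h t hC tb) _; rewrite ler_wpM2r ?sqr_ge0 // le_max lexx orbT.
Qed.

Lemma fl_hs b t h : `|t| <= 1 / 2 -> hs (fl b t * h)%g <= 4 * hs h.
Proof.
move=> tb; have : hs (fl b t) <= 2; last by move=> le; have := hsM (fl b t) h; have := hs_ge1 h; nra.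
have [t1 t2] : - (1/2) <= t /\ t <= 1 / 2 by move: tb; rewrite ler_norml => /andP.
rewrite /fl; case: b; first by rewrite hs_E12; nra.
have s0 : 0 < 1 + t by lra.
have := hs_XY 1%g (dl (1 + t)); have [-> ->] := XY1 R; rewrite invg1 mul1g => ->.
have := dl_XY 1%g s0; have [-> ->] := XY1 R; rewrite mulg1 mulr0 mulr1 => -[-> ->].
rewrite ler_pdivrMr; last by lra.
nra.
Qed.

Lemma lbdD w v : lbd w -> lbd v -> lbd (fun h => w h + v h).
Proof.
move=> bw bv C; have [M wM] := bw C; have [N vN] := bv C; exists (M + N) => h hC.
by apply: le_trans (ler_normD _ _) _; apply: lerD; auto.
Qed.

Lemma lbdM w v : lbd w -> lbd v -> lbd (fun h => w h * v h).
Proof.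
move=> bw bv C; have [M wM] := bw C; have [N vN] := bv C; exists (M * N) => h hC.
by rewrite normrM ler_pM //; auto.
Qed.

Lemma lbd_cst (c : R) : lbd (fun=> c). Proof. by move=> C; exists `|c|. Qed.

Lemma lbd_X : lbd (@X R).
Proof.
move=> C; exists (2 * C ^+ 2) => h hC; apply: le_trans (X_bound h) _.
by rewrite ler_pM2l // ler_sqr ?nnegrE // ltW // (lt_le_trans (hs_gt0 h)).
Qed.

Lemma lbd_Y : lbd (@Y R).
Proof. by move=> C; exists (2 * C) => h hC; rewrite gtr0_norm ?Y_gt0 //; have [le _] := Y_bound h; lra. Qed.

Lemma lbd_YV : lbd (fun h => (Y h)^-1).
Proof. move=> C; exists (2 * C) => h hC; have y0 := Y_gt0 h; have [_ le] := Y_bound h.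
have -> : `|(Y h)^-1| = (Y h)^-1 by apply: ger0_norm; rewrite invr_ge0 ltW.
by apply: (le_trans le); rewrite ler_pM2l. Qed.

Lemma fdD b w w1 v v1 : fd b w w1 -> fd b v v1 -> fd b (fun h => w h + v h) (fun h => w1 h + v1 h).
Proof.
move=> dw dv C; have [M wM] := dw C; have [N vN] := dv C; exists (M + N) => h t hC tb.
have -> : w (fl b t * h)%g + v (fl b t * h)%g - (w h + v h) - t * (w1 h + v1 h) =
  (w (fl b t * h)%g - w h - t * w1 h) + (v (fl b t * h)%g - v h - t * v1 h) by ring.
by apply: le_trans (ler_normD _ _) _; rewrite mulrDl lerD //; auto.
Qed.

Lemma fd_cst b (c : R) : fd b (fun=> c) (fun=> 0).
Proof. by move=> C; exists 0 => h t _ _; rewrite subrr mulr0 subrr normr0 mul0r. Qed.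

Lemma fd_lip b w v (C : R) : fd b w v -> lbd v -> exists2 N : R, 1 <= N & forall h t, hs h <= C -> `|t| <= 1 / 2 ->
  `|w (fl b t * h)%g - w h| <= N * `|t|.
Proof.
move=> dw bv; have [M M1 wM] := fd_pos C dw; have [N N1 vN] := lbd_pos C bv.
exists (M + N) => [|h t hC tb]; first by lra.
have -> : w (fl b t * h)%g - w h = (w (fl b t * h)%g - w h - t * v h) + t * v h by ring.
apply: le_trans (ler_normD _ _) _; rewrite mulrDl lerD //.
  apply: le_trans (wM h t hC tb) _; rewrite -[t ^+ 2]real_normK ?num_real // ler_pM2l; last by lra.
  by have := normr_ge0 t; nra.
by rewrite normrM mulrC ler_wpM2r //; exact: vN.
Qed.

Lemma fdM b w w1 v v1 : fd b w w1 -> fd b v v1 -> lbd w -> lbd w1 -> lbd v -> lbd v1 ->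
  fd b (fun h => w h * v h) (fun h => w1 h * v h + w h * v1 h).
Proof.
move=> dw dv bw bw1 bv bv1 C.
have [M M1 wM] := fd_pos C dw; have [N N1 vN] := fd_pos C dv.
have [K K1 wK] := lbd_pos C bw; have [J J1 vJ] := lbd_pos C bv.
have [P P1 wP] := fd_lip C dw bw1; have [Q Q1 vQ] := fd_lip C dv bv1.
exists (M * J + K * N + P * Q) => h t hC tb; set e := fl b t.
have -> : w (e * h)%g * v (e * h)%g - w h * v h - t * (w1 h * v h + w h * v1 h) =
  (w (e * h)%g - w h - t * w1 h) * v h + w h * (v (e * h)%g - v h - t * v1 h)
  + (w (e * h)%g - w h) * (v (e * h)%g - v h) by ring.
rewrite (mulrDl _ (P * Q)) (mulrDl (M * J)); apply: le_trans (ler_normD _ _) _; apply: lerD; first apply: le_trans (ler_normD _ _) _.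
  apply: lerD.
    by rewrite normrM mulrAC; apply: ler_pM => //; [exact: wM|exact: vJ].
  by rewrite normrM -mulrA; apply: ler_pM => //; [exact: wK|exact: vN].
have -> : P * Q * t ^+ 2 = (P * `|t|) * (Q * `|t|) by rewrite -[t ^+ 2]real_normK ?num_real //; ring.
by rewrite normrM; apply: ler_pM => //; [exact: wP|exact: vQ].
Qed.

Lemma fd_uniq b w v v' : fd b w v -> fd b w v' -> v =1 v'.
Proof.
move=> d d' h; apply/eqP; rewrite eq_sym -subr_eq0; apply/negPn/negP => ne.
have [M M1 wM] := fd_pos (hs h) d; have [N N1 wN] := fd_pos (hs h) d'.
set u := `|v' h - v h|; have u0 : 0 < u by rewrite normr_gt0.
set t := Num.min (1 / 2) (u / (2 * (M + N))).
have MN : 0 < 2 * (M + N) by lra.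
have t0 : 0 < t by rewrite lt_min divr_gt0 // divr_gt0.
have tb : `|t| <= 1 / 2 by rewrite gtr0_norm // ge_min lexx.
have tu : t * (2 * (M + N)) <= u by rewrite -ler_pdivlMr // ge_min lexx orbT.
have := wM h t (lexx _) tb; have := wN h t (lexx _) tb => H1 H2.
have : `|t * (v' h - v h)| <= (M + N) * t ^+ 2.
  have -> : t * (v' h - v h) = (w (fl b t * h)%g - w h - t * v h) - (w (fl b t * h)%g - w h - t * v' h) by ring.
  by apply: le_trans (ler_normB _ _) _; rewrite mulrDl lerD.
rewrite normrM (gtr0_norm t0) -/u => le.
have : u <= (M + N) * t by rewrite -(ler_pM2l t0); move: le; rewrite expr2 mulrCA.
nra.
Qed.

Definition X1 b (h : SL2 R) : R := if b then 1 else X h.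
Definition Y1 b (h : SL2 R) : R := if b then 0 else Y h.
Definition YV1 b (h : SL2 R) : R := if b then 0 else - (Y h)^-1.

Lemma fl_XY b t h : `|t| <= 1 / 2 -> X (fl b t * h)%g = X h + t * X1 b h /\ Y (fl b t * h)%g = Y h + t * Y1 b h.
Proof.
rewrite ler_norml => /andP[t1 t2]; rewrite /X1 /Y1; case: b => /=.
  by have [-> ->] := nx_XY t h; rewrite mulr1 mulr0 addr0.
by have [|-> ->] := @dl_XY _ (1 + t) h; [lra|split; ring].
Qed.

Lemma fd_X b : fd b (@X R) (X1 b).
Proof. by move=> C; exists 0 => h t hC /fl_XY-/(_ b h)[-> _]; rewrite mul0r; have -> : X h + t * X1 b h - X h - t * X1 b h = 0 :> R by [ring]; rewrite normr0. Qed.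
Lemma fd_Y b : fd b (@Y R) (Y1 b).
Proof. by move=> C; exists 0 => h t hC /fl_XY-/(_ b h)[_ ->]; rewrite mul0r; have -> : Y h + t * Y1 b h - Y h - t * Y1 b h = 0 :> R by [ring]; rewrite normr0. Qed.

Lemma fd_YV b : fd b (fun h => (Y h)^-1) (YV1 b).
Proof.
move=> C; exists (4 * C) => h t hC tb; have [_ ->] := fl_XY b h tb; rewrite /Y1 /YV1.
have h1 := hs_ge1 h; have y0 := Y_gt0 h; have [_ y1] := Y_bound h.
move: tb; rewrite ler_norml => /andP[t1 t2]; case: b.
  by rewrite !mulr0 addr0 !subr0 subrr normr0 mulr_ge0 ?sqr_ge0 //; lra.
have s0 : 0 < 1 + t by lra.
have -> : (Y h + t * Y h)^-1 - (Y h)^-1 - t * - (Y h)^-1 = (Y h)^-1 * (1 + t)^-1 * t ^+ 2.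
  have e : Y h + t * Y h = (1 + t) * Y h by ring.
  by rewrite e; field; rewrite !gt_eqF.
have yi : 0 <= (Y h)^-1 by rewrite invr_ge0 ltW.
have si : 0 <= (1 + t)^-1 by rewrite invr_ge0 ltW.
rewrite ger0_norm; last by rewrite mulr_ge0 ?sqr_ge0 // mulr_ge0.
apply: ler_wpM2r; first exact: sqr_ge0.
have -> : 4 * C = (2 * C) * 2 by ring.
apply: ler_pM => //; first by lra.
by rewrite -div1r ler_pdivrMr //; lra.
Qed.

Lemma lbd_X1 b : lbd (X1 b). Proof. by case: b; [exact: lbd_cst|exact: lbd_X]. Qed.
Lemma lbd_Y1 b : lbd (Y1 b). Proof. by case: b; [exact: lbd_cst|exact: lbd_Y]. Qed.

End Flows.

(** * Differentiating the averaging operators *)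

Section KernelFlow.
Variables (R : realType) (mu : SL2_measure R).
Hypothesis mu_haar : is_haar mu.
Local Notation G := (borelSL2 R).
Local Notation hI := (hI mu).
Local Notation rop := (rop mu).
Implicit Types (g h : SL2 R) (s t : R) (w F : SL2 R -> R) (k : R -> R).

(** A truncated square has only a Lipschitz first derivative; the quadratic remainder is what [fd]
    asks for. *)
Definition c11 k k1 := exists2 M : R, 0 <= M & forall s s', 1 <= s -> 1 <= s' ->
  `|k s' - k s - k1 s * (s' - s)| <= M * (s' - s) ^+ 2.

(* The derivative of [hs (g^-1 * h)] along the flow in the variable [g]. *)
Definition dhs b g h : R := if b then (X g - X h) / (Y g * Y h)
  else (X g ^+ 2 + Y g ^+ 2 - X h ^+ 2 - Y h ^+ 2) / (2 * Y g * Y h).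

Lemma hs_flow b (C : R) : exists2 M : R, 1 <= M & forall g h t, hs g <= C -> hs h <= C -> `|t| <= 1 / 2 ->
  `|hs ((fl b t * g)^-1 * h)%g - hs (g^-1 * h)%g - t * dhs b g h| <= M * t ^+ 2 /\ `|dhs b g h| <= M.
Proof.
have [B0 B01 XB] := lbd_pos C (@lbd_X R); have [B1 B11 YB] := lbd_pos C (@lbd_Y R).
have [B2 B21 VB] := lbd_pos C (@lbd_YV R); set B := B0 + B1 + B2.
have BB : 1 <= B by rewrite /B; lra.
have {}XB h : hs h <= C -> `|X h| <= B by move=> /XB le; apply: le_trans le _; rewrite /B; lra.
have {}YB h : hs h <= C -> `|Y h| <= B by move=> /YB le; apply: le_trans le _; rewrite /B; lra.
have {}VB h : hs h <= C -> `|(Y h)^-1| <= B by move=> /VB le; apply: le_trans le _; rewrite /B; lra.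
clearbody B; clear B0 B1 B2 B01 B11 B21.
have sqB (z : R) : `|z| <= B -> z ^+ 2 <= B ^+ 2.
  by move=> le; rewrite -[z ^+ 2]real_normK ?num_real // ler_sqr ?nnegrE //; lra.
have BE : B ^+ 2 * B ^+ 2 = B ^+ 4 by ring.
have B34 : B ^+ 3 <= B ^+ 4 by rewrite ler_weXn2l.
have B24 : B ^+ 2 <= B ^+ 4 by rewrite ler_weXn2l.
have B04 : 1 <= B ^+ 4 by rewrite exprn_ege1.
exists (4 * B ^+ 4) => [|g h t gC hC tb]; first by lra.
have yg := Y_gt0 g; have yh := Y_gt0 h.
have VV : `|(Y g)^-1 * (Y h)^-1| <= B ^+ 2 by rewrite normrM expr2 ler_pM // VB.
have V0 : 0 <= (Y g)^-1 * (Y h)^-1 by rewrite mulr_ge0 // invr_ge0 ltW.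
have [XX YY] := fl_XY b g tb; rewrite !hs_XY XX YY /X1 /Y1 /dhs; move: tb; rewrite ler_norml => /andP[t1 t2].
have s0 : 0 < 1 + t by lra.
have t20 := sqr_ge0 t.
rewrite (ger0_norm V0) in VV.
case: b {XX YY}; split.
- rewrite (_ : _ - _ - _ = ((Y g)^-1 * (Y h)^-1 / 2) * t ^+ 2); last by field; rewrite !gt_eqF.
  rewrite ger0_norm; last by rewrite mulr_ge0 // divr_ge0.
  by apply: ler_wpM2r => //; lra.
- rewrite invfM normrM (ger0_norm V0).
  have le : `|X g - X h| <= 2 * B by apply: le_trans (ler_normB _ _) _; have := XB g gC; have := XB h hC; lra.
  have : `|X g - X h| * ((Y g)^-1 * (Y h)^-1) <= (2 * B) * B ^+ 2 by apply: ler_pM.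
  have -> : (2 * B) * B ^+ 2 = 2 * B ^+ 3 by ring.
  lra.
- have e : Y g + t * Y g = (1 + t) * Y g by ring.
  rewrite e (_ : _ - _ - _ = (((Y g)^-1 * (Y h)^-1) * (X h ^+ 2 + Y h ^+ 2)) * ((1 + t)^-1 / 2) * t ^+ 2); last by field; rewrite !gt_eqF.
  have x2 := sqB _ (XB h hC); have y2 := sqB _ (YB h hC).
  have xy0 : 0 <= X h ^+ 2 + Y h ^+ 2 by rewrite addr_ge0 ?sqr_ge0.
  have si : 0 <= (1 + t)^-1 / 2 by rewrite divr_ge0 // invr_ge0 ltW.
  have s1 : (1 + t)^-1 / 2 <= 1 by rewrite ler_pdivrMr // -div1r ler_pdivrMr //; lra.
  rewrite ger0_norm; last by rewrite mulr_ge0 // mulr_ge0 // mulr_ge0.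
  apply: ler_wpM2r => //.
  have H : (Y g)^-1 * (Y h)^-1 * (X h ^+ 2 + Y h ^+ 2) <= B ^+ 2 * (2 * B ^+ 2) by apply: ler_pM => //; lra.
  have : (Y g)^-1 * (Y h)^-1 * (X h ^+ 2 + Y h ^+ 2) * ((1 + t)^-1 / 2) <= (B ^+ 2 * (2 * B ^+ 2)) * 1 by apply: ler_pM => //; rewrite mulr_ge0.
  have -> : (B ^+ 2 * (2 * B ^+ 2)) * 1 = 2 * B ^+ 4 by ring.
  lra.
- rewrite (_ : _ / _ = ((Y g)^-1 * (Y h)^-1) * ((X g ^+ 2 + Y g ^+ 2 - X h ^+ 2 - Y h ^+ 2) / 2)); last by field; rewrite !gt_eqF.
  rewrite normrM (ger0_norm V0) -BE mulrCA.
  apply: ler_pM => //; have x2 := sqB _ (XB h hC); have y2 := sqB _ (YB h hC).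
  have x2' := sqB _ (XB g gC); have y2' := sqB _ (YB g gC).
  rewrite ler_norml; have := sqr_ge0 (X g); have := sqr_ge0 (Y g); have := sqr_ge0 (X h); have := sqr_ge0 (Y h).
  by lra.
Qed.

Lemma adm_local F (D : R) : measurable_fun [set: G] F -> lbd F -> (forall h, D < hs h -> F h = 0) -> adm F.
Proof.
move=> mF bF F0; have [M M1 FM] := lbd_pos D bF; apply: (@admP _ F M D) => // h.
by case: (leP (hs h) D) => [/FM//|/F0 ->]; rewrite normr0; lra.
Qed.

Lemma measurable_X : measurable_fun [set: G] (@X R).
Proof. by apply: continuous_measurable_SL2; exact: X_continuous. Qed.
Lemma measurable_Y : measurable_fun [set: G] (@Y R).
Proof. by apply: continuous_measurable_SL2; exact: Y_continuous. Qed.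

Lemma measurable_YV : measurable_fun [set: G] (fun h : G => (Y h)^-1).
Proof.
apply: continuous_measurable_SL2 => h; apply: (@cvgV _ _ (nbhs h)); last exact: Y_continuous.
by rewrite gt_eqF ?Y_gt0.
Qed.

Lemma measurable_dhs b g : measurable_fun [set: G] (fun h : G => dhs b g h).
Proof.
case: b; rewrite /dhs.
  have -> : (fun h => (X g - X h) / (Y g * Y h)) = (fun h => (X g - X h) * ((Y g)^-1 * (Y h)^-1)).
    by apply/funext => h; rewrite invfM.
  apply: measurable_funM; first by apply: measurable_funB => //; exact: measurable_X.
  by apply: measurable_funM => //; exact: measurable_YV.
have -> : (fun h => (X g ^+ 2 + Y g ^+ 2 - X h ^+ 2 - Y h ^+ 2) / (2 * Y g * Y h)) =
  (fun h => (X g ^+ 2 + Y g ^+ 2 - X h * X h - Y h * Y h) * ((2 * Y g)^-1 * (Y h)^-1)).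
  by apply/funext => h; rewrite invfM !expr2.
have mX := measurable_X; have mY := measurable_Y.
apply: measurable_funM; last by apply: measurable_funM => //; exact: measurable_YV.
by apply: measurable_funB; [apply: measurable_funB => //|]; exact: measurable_funM.
Qed.

Lemma lbd_dhs b g : lbd (dhs b g).
Proof.
move=> C; have [M _ MP] := hs_flow b (Num.max C (hs g)); exists M => h hC.
by have [|||_ //] := MP g h 0; rewrite ?le_max ?lexx ?hC ?orbT // normr0; lra.
Qed.

Lemma hI_ball F (D N : R) : adm F -> 0 <= N -> (forall h, hs h <= D -> `|F h| <= N) ->
  (forall h, D < hs h -> F h = 0) -> `|hI F| <= N * hI (\1_[set y : SL2 R | hs y <= D]).
Proof.
move=> aF N0 FN F0; have a0 : adm (\1_[set y : SL2 R | hs y <= D]).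
  by apply: (@adm_indic R [set y : SL2 R | hs y <= D] D); first exact: hs_measurable.
apply: le_trans (hI_norm mu_haar aF) _; rewrite -hIZ //.
apply: hI_le => //; [exact: adm_norm|exact: admZ|move=> h].
rewrite indicE; case: (leP (hs h) D) => hD; first by rewrite mem_set // mulr1 FN.
by rewrite F0 // normr0 mulr_ge0.
Qed.

Section Convolution.
Variables (k k1 : R -> R) (A : R) (F : SL2 R -> R) (b : bool).
Hypotheses (A0 : 0 <= A) (mk : measurable_fun [set: R] k) (mk1 : measurable_fun [set: R] k1).
Hypotheses (kk1 : c11 k k1) (k0 : forall s, A < s -> k s = 0) (k10 : forall s, A < s -> k1 s = 0).
Hypotheses (kb : exists K : R, forall s, 1 <= s -> `|k s| <= K) (k1b : exists K : R, forall s, 1 <= s -> `|k1 s| <= K).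
Hypotheses (mF : measurable_fun [set: G] F) (bF : lbd F).

Lemma hs_far g h : 2 * A * hs g < hs h -> A < hs (g^-1 * h)%g.
Proof.
move=> lt; have := hsM g (g^-1 * h)%g; rewrite mulVKg => le.
rewrite -(ltr_pM2l (hs_gt0 g)); lra.
Qed.

Lemma conv_adm (w : SL2 R -> R) (j : R -> R) g : measurable_fun [set: R] j -> (forall s, A < s -> j s = 0) ->
  (exists K : R, forall s, 1 <= s -> `|j s| <= K) -> measurable_fun [set: G] w -> lbd w ->
  adm (fun h => j (hs (g^-1 * h)%g) * w h).
Proof.
move=> mj j0 [K jK] mw bw; apply: (@adm_local _ (2 * A * hs g)).
- by apply: measurable_funM => //; apply: measurable_khs.
- by apply: lbdM => // C; exists K => h _; apply: jK; exact: hs_ge1.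
- by move=> h /hs_far/j0 ->; rewrite mul0r.
Qed.

Definition rop_deriv g : R := hI (fun h => k1 (hs (g^-1 * h)%g) * (dhs b g h * F h)).

(** The flow acts on the centre of the kernel, so [F] only has to be measurable and locally bounded:
    averaging gains a derivative. *)
Lemma rop_fd : fd b (rop k F) rop_deriv /\ lbd rop_deriv /\ lbd (rop k F).
Proof.
have mDF g : measurable_fun [set: G] (fun h : G => dhs b g h * F h) by apply: measurable_funM => //; exact: measurable_dhs.
have bDF g : lbd (fun h => dhs b g h * F h) by apply: lbdM => //; exact: lbd_dhs.
have a1 g := conv_adm g mk k0 kb mF bF.
have a2 g := conv_adm g mk1 k10 k1b (mDF g) (bDF g).
have mxl (p q : R) : p <= Num.max p q by rewrite le_max lexx.
have mxr (p q : R) : q <= Num.max p q by rewrite le_max lexx orbT.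
have [M M0 MP] := kk1; have [K KP] := k1b; have [K' KP'] := kb.
split; [|split].
- move=> C; set D := 2 * A * (4 * C); have [N N1 NP] := hs_flow b (Num.max C D).
  have [J J1 FJ] := lbd_pos D bF.
  exists ((M * (2 * N) ^+ 2 + `|K| * N) * J * hI (\1_[set y : SL2 R | hs y <= D])) => g t gC tb.
  have g1 := hs_ge1 g.
  rewrite /rop /rop_deriv -hIZ // -!hIB //; last first.
    + by apply: admZ; exact: a2.
    + by apply: admB => //; exact: a1.
  set T := (X in hI X).
  have aT : adm T by apply: admB; [apply: admB; exact: a1|apply: admZ; exact: a2].
  rewrite mulrAC; apply: hI_ball => //.
    by rewrite mulr_ge0 ?sqr_ge0 // mulr_ge0 ?addr_ge0 ?mulr_ge0 ?sqr_ge0 //; lra.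
  + move=> h hD; have [H1 H2] := NP g h t (le_trans gC (mxl C D)) (le_trans hD (mxr C D)) tb.
    rewrite /T; set c' := hs ((fl b t * g)^-1 * h)%g in H1 *; set c := hs (g^-1 * h)%g in H1 *.
    have c'1 : 1 <= c' by exact: hs_ge1.
    have c1 : 1 <= c by exact: hs_ge1.
    have dc : `|c' - c| <= 2 * N * `|t|.
      have -> : c' - c = (c' - c - t * dhs b g h) + t * dhs b g h by ring.
      apply: le_trans (ler_normD _ _) _; rewrite normrM.
      have : `|t| * `|dhs b g h| <= `|t| * N by rewrite ler_wpM2l.
      have : N * t ^+ 2 <= N * `|t| by rewrite -[t ^+ 2]real_normK ?num_real // ler_pM2l; [have := normr_ge0 t; nra|lra].
      by lra.
    have -> : k c' * F h - k c * F h - t * (k1 c * (dhs b g h * F h)) =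
      ((k c' - k c - k1 c * (c' - c)) + k1 c * (c' - c - t * dhs b g h)) * F h by ring.
    rewrite normrM mulrAC; apply: ler_pM => //; last exact: FJ.
    apply: le_trans (ler_normD _ _) _; rewrite mulrDl; apply: lerD.
      apply: le_trans (MP _ _ c1 c'1) _; rewrite -mulrA ler_wpM2l //.
      rewrite -[_ ^+ 2]real_normK ?num_real // -[t ^+ 2]real_normK ?num_real // -exprMn ler_sqr ?nnegrE //.
      by rewrite mulr_ge0 //; lra.
    rewrite normrM -mulrA; apply: ler_pM => //.
    by apply: le_trans (KP _ c1) _; rewrite ler_norm.
  + move=> h hD; rewrite /T.
    have f1 : A < hs (g^-1 * h)%g.
      by apply: hs_far; apply: le_lt_trans hD; rewrite /D ler_wpM2l ?mulr_ge0 //; lra.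
    have f2 : A < hs ((fl b t * g)^-1 * h)%g.
      apply: hs_far; apply: le_lt_trans hD; rewrite /D ler_wpM2l ?mulr_ge0 //.
      by apply: le_trans (fl_hs b g tb) _; lra.
    by rewrite !k0 // k10 // !mul0r mulr0 !subr0.
- move=> C; set D := 2 * A * C; have [N N1 NP] := hs_flow b (Num.max C D).
  have [J J1 FJ] := lbd_pos D bF.
  exists (`|K| * N * J * hI (\1_[set y : SL2 R | hs y <= D])) => g gC.
  apply: hI_ball => //; first by rewrite !mulr_ge0 //; lra.
  + move=> h hD; have z2 : `|0 : R| <= 1 / 2 by rewrite normr0; lra.
    have [_ H2] := NP g h 0 (le_trans gC (mxl C D)) (le_trans hD (mxr C D)) z2.
    rewrite !normrM -mulrA; apply: ler_pM; rewrite ?mulr_ge0 //.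
      by apply: le_trans (KP _ (hs_ge1 _)) _; rewrite ler_norm.
    by apply: ler_pM => //; exact: FJ.
  + move=> h hD; rewrite k10 ?mul0r //; apply: hs_far; apply: le_lt_trans hD.
    by rewrite /D ler_wpM2l // mulr_ge0.
- move=> C; set D := 2 * A * C.
  have [J J1 FJ] := lbd_pos D bF.
  exists (`|K'| * J * hI (\1_[set y : SL2 R | hs y <= D])) => g gC.
  apply: hI_ball => //; first by rewrite !mulr_ge0 //; lra.
  + move=> h hD; rewrite !normrM; apply: ler_pM => //; last exact: FJ.
    by apply: le_trans (KP' _ (hs_ge1 _)) _; rewrite ler_norm.
  + move=> h hD; rewrite k0 ?mul0r //; apply: hs_far; apply: le_lt_trans hD.
    by rewrite /D ler_wpM2l // mulr_ge0.
Qed.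

End Convolution.
End KernelFlow.

(** * Smoothness of eigenfunctions of an averaging operator *)

Section SmoothClass.
Variables (R : realType) (mu : SL2_measure R).
Hypothesis mu_haar : is_haar mu.
Local Notation G := (borelSL2 R).
Local Notation hI := (hI mu).
Local Notation rop := (rop mu).
Implicit Types (g h : SL2 R) (s t : R) (w F : SL2 R -> R) (k : R -> R).

(** The truncated power (A - s)_+^j. Differentiation in A or in s lowers j, so that the exponents 1,
    2, 3 support a second-order equation. *)
Definition ker (j : nat) (A s : R) : R := Num.max 0 (A - s) ^+ j.

Lemma ker_measurable j A : measurable_fun [set: R] (ker j A).
Proof.
apply: measurable_funX; apply: measurable_maxr => //.
by apply: measurable_funB.
Qed.

Lemma ker_far j A s : (0 < j)%N -> A < s -> ker j A s = 0.
Proof. by move=> j0 lt; rewrite /ker max_l ?expr0n ?(gtn_eqF j0) //; lra. Qed.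
Lemma ker_ge0 j A s : 0 <= ker j A s.
Proof. by rewrite exprn_ge0 // le_max lexx. Qed.
Lemma ker_le j A s : 1 <= A -> 1 <= s -> ker j A s <= A ^+ j.
Proof. by move=> A1 s1; rewrite lerXn2r ?nnegrE ?le_max ?lexx // ?ge_max; lra. Qed.
Lemma maxr_cases (x : R) : (Num.max 0 x = x /\ 0 <= x) \/ (Num.max 0 x = 0 /\ x <= 0).
Proof. by case: (leP 0 x) => h; [left|right; split => //; exact: ltW]. Qed.

Lemma c11_ker2 A : c11 (ker 2 A) (fun s => - 2 * ker 1 A s).
Proof.
exists 3 => // s s' _ _; rewrite /ker expr1.
case: (maxr_cases (A - s)) => -[-> h]; case: (maxr_cases (A - s')) => -[-> h'].
- have -> : (A - s') ^+ 2 - (A - s) ^+ 2 - -2 * (A - s) * (s' - s) = (s' - s) ^+ 2 by ring.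
  by rewrite ger0_norm ?sqr_ge0 //; have := sqr_ge0 (s' - s); lra.
- have -> : 0 ^+ 2 - (A - s) ^+ 2 - -2 * (A - s) * (s' - s) = (A - s) * (2 * (s' - s) - (A - s)) by ring.
  rewrite ger0_norm; last by rewrite mulr_ge0 //; lra.
  apply: (@le_trans _ _ ((s' - s) * (2 * (s' - s)))); first by apply: ler_pM => //; lra.
  by have := sqr_ge0 (s' - s); rewrite expr2; lra.
- have -> : (A - s') ^+ 2 - 0 ^+ 2 - -2 * 0 * (s' - s) = (A - s') ^+ 2 by ring.
  rewrite ger0_norm ?sqr_ge0 //.
  have h1 : (A - s') ^+ 2 <= (s' - s) ^+ 2 by rewrite -[(s' - s) ^+ 2]sqrrN ler_sqr ?nnegrE; lra.
  by have := sqr_ge0 (s' - s); lra.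
- have -> : 0 ^+ 2 - 0 ^+ 2 - -2 * 0 * (s' - s) = 0 :> R by ring.
  by rewrite normr0 mulr_ge0 ?sqr_ge0.
Qed.

Lemma c11_ker3 A : 1 <= A -> c11 (ker 3 A) (fun s => - 3 * ker 2 A s).
Proof.
move=> A1; exists (3 * A); first by lra.
move=> s s' s1 s1'; rewrite /ker.
case: (maxr_cases (A - s)) => -[-> h]; case: (maxr_cases (A - s')) => -[-> h'].
- have -> : (A - s') ^+ 3 - (A - s) ^+ 3 - -3 * (A - s) ^+ 2 * (s' - s) = (2 * (A - s) + (A - s')) * (s' - s) ^+ 2 by ring.
  rewrite normrM (ger0_norm (sqr_ge0 _)) ler_wpM2r ?sqr_ge0 //.
  by rewrite ger0_norm; lra.
- have -> : 0 ^+ 3 - (A - s) ^+ 3 - -3 * (A - s) ^+ 2 * (s' - s) = (A - s) ^+ 2 * (2 * (A - s) + 3 * (s' - A)) by ring.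
  have h1 : (A - s) ^+ 2 <= (A - s) * (s' - s) by rewrite expr2 ler_wpM2l //; lra.
  have h2 : (2 * (A - s) + 3 * (s' - A)) <= 3 * (s' - s) by lra.
  rewrite ger0_norm; last by rewrite mulr_ge0 ?sqr_ge0 //; lra.
  have e : (A - s) ^+ 2 * (2 * (A - s) + 3 * (s' - A)) <= (A - s) * (s' - s) * (3 * (s' - s)).
    by apply: ler_pM => //; rewrite ?sqr_ge0 //; lra.
  apply: le_trans e _; rewrite (_ : _ * _ = 3 * (A - s) * (s' - s) ^+ 2); last by ring.
  by rewrite ler_wpM2r ?sqr_ge0 //; lra.
- have -> : (A - s') ^+ 3 - 0 ^+ 3 - -3 * 0 ^+ 2 * (s' - s) = (A - s') ^+ 3 by ring.
  rewrite ger0_norm ?exprn_ge0 //.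
  have h1 : (A - s') ^+ 2 <= (s' - s) ^+ 2 by rewrite -[(s' - s) ^+ 2]sqrrN ler_sqr ?nnegrE; lra.
  rewrite exprS; apply: ler_pM => //; rewrite ?sqr_ge0 //; lra.
- have -> : 0 ^+ 3 - 0 ^+ 3 - -3 * 0 ^+ 2 * (s' - s) = 0 :> R by ring.
  by rewrite normr0 mulr_ge0 ?sqr_ge0 //; lra.
Qed.

Lemma ker_bounded j A c : 1 <= A -> exists K : R, forall s, 1 <= s -> `|c * ker j A s| <= K.
Proof.
move=> A1; exists (`|c| * A ^+ j) => s s1; rewrite normrM ler_wpM2l // ger0_norm ?ker_ge0 //; exact: ker_le.
Qed.

Lemma ker_bounded1 j A : 1 <= A -> exists K : R, forall s, 1 <= s -> `|ker j A s| <= K.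
Proof. by move=> /(ker_bounded j 1)[K KP]; exists K => s /KP; rewrite mul1r. Qed.

Lemma ker_rop_fd j A F b : 1 <= A -> (j = 2 \/ j = 3)%N -> measurable_fun [set: G] F -> lbd F ->
  exists u1, [/\ fd b (rop (ker j A) F) u1, lbd u1 & lbd (rop (ker j A) F)].
Proof.
move=> A1 j23 mF bF; have A0 : 0 <= A by lra.
exists (rop_deriv mu (fun s => - j%:R * ker j.-1 A s) F b).
suff [H1 [H2 H3]] : fd b (rop (ker j A) F) (rop_deriv mu (fun s => - j%:R * ker j.-1 A s) F b) /\
    lbd (rop_deriv mu (fun s => - j%:R * ker j.-1 A s) F b) /\ lbd (rop (ker j A) F) by split.
apply: (rop_fd mu_haar b A0) => //.
- exact: ker_measurable.
- by apply: measurable_funM => //; exact: ker_measurable.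
- by case: j23 => ->; [exact: c11_ker2|exact: c11_ker3].
- by move=> s; apply: ker_far; case: j23 => ->.
- by move=> s As; rewrite ker_far ?mulr0 //; case: j23 => ->.
- exact: ker_bounded1.
- exact: ker_bounded.
Qed.

(** Solutions of F = c T F for the operator T of kernel [ker 3 A]. Invariance under Gamma is left
    out, so that derivatives along left flows stay in the class. *)
Definition fixcl (A c : R) F := [/\ measurable_fun [set: G] F, lbd F,
  forall g u, rotation u -> F (g * u)%g = F g & forall g, F g = c * rop (ker 3 A) F g].

Lemma fd_measurable b F F1 : measurable_fun [set: G] F -> fd b F F1 -> measurable_fun [set: G] F1.
Proof.
move=> mF dF; pose u (n : nat) (h : G) : R := (F (fl b n.+2%:R^-1 * h)%g - F h) * n.+2%:R.
apply: (@measurable_fun_cvg _ G R [set: G] u F1) => [n|h _].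
  apply: measurable_funM => //; apply: measurable_funB => //.
  by apply: (measurableT_comp mF (measurable_mull _)).
have [M M1 MP] := fd_pos (hs h) dF.
apply/cvgrPdist_le => e e0; near=> n.
have n0 : (0 : R) < n.+2%:R^-1 by rewrite invr_gt0.
have n2 : n.+2%:R^-1 <= 1 / 2 :> R by rewrite div1r lef_pV2 ?posrE // ler_nat.
have := MP h n.+2%:R^-1 (lexx _); rewrite (gtr0_norm n0) => /(_ n2) H.
have -> : F1 h - u n h = - ((F (fl b n.+2%:R^-1 * h)%g - F h - n.+2%:R^-1 * F1 h) * n.+2%:R).
  by rewrite /u; field; rewrite -natr1 -natr1 gt_eqF // ltr_wpDr.
rewrite normrN normrM [X in _ * X]ger0_norm //.
apply: (@le_trans _ _ (M * n.+2%:R^-1 ^+ 2 * n.+2%:R)); first by rewrite ler_wpM2r.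
rewrite expr2 mulrA mulrVK ?unitfE //.
rewrite ler_pdivrMr // mulrC -ler_pdivrMr //.
near: n; case: (nbhs_infty_ger (M / e)) => m _ mP; exists m => // n mn.
by apply: le_trans (mP n mn) _; rewrite ler_nat leqW // leqW.
Unshelve. all: by end_near. Qed.

Lemma fd_right b F F1 : fd b F F1 -> (forall g u, rotation u -> F (g * u)%g = F g) ->
  forall g u, rotation u -> F1 (g * u)%g = F1 g.
Proof.
move=> dF rF g k rk; have := @fd_uniq _ b (fun x => F (x * k)%g) (fun x => F1 (x * k)%g) F1.
move=> /(_ _ _ g); apply.
  move=> C; have [M MP] := dF C; exists M => h t hC tb; rewrite -mulgA; apply: MP => //.
  by rewrite hs_rotr.
by move=> C; have [M MP] := dF C; exists M => h t hC tb; rewrite !(rF _ _ rk); exact: MP.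
Qed.

(** The derivative exists because [F] is an average. Averages commute with left translations, so [c]
    times the average of the derivative is also a derivative of [F], and [fd_uniq] identifies the
    two; the argument can then be iterated. *)
Lemma fixcl_fd b A c F : 1 <= A -> fixcl A c F -> exists2 F1, fd b F F1 & fixcl A c F1.
Proof.
move=> A1 [mF bF rF eF]; have [u1 [du bu _]] := @ker_rop_fd 3 A F b A1 (or_intror erefl) mF bF.
have dF : fd b F (fun h => c * u1 h).
  move=> C; have [M MP] := du C; exists (`|c| * M) => h t hC tb; rewrite !eF.
  rewrite (_ : _ - _ - _ = c * (rop (ker 3 A) F (fl b t * h)%g - rop (ker 3 A) F h - t * u1 h)); last by ring.
  by rewrite normrM -mulrA ler_wpM2l //; exact: MP.
exists (fun h => c * u1 h) => //.
have mF1 := fd_measurable mF dF; have bF1 : lbd (fun h => c * u1 h) by apply: lbdM => //; exact: lbd_cst.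
split=> //; first exact: (fd_right dF rF).
suff dF' : fd b F (fun g => c * rop (ker 3 A) (fun h => c * u1 h) g) by exact: (fd_uniq dF dF').
move=> C.
have A0 : 0 <= A by lra.
have [M M1 MP] := fd_pos (2 * A * C) dF.
have kf : forall s, A < s -> ker 3 A s = 0 by move=> s; exact: ker_far.
have aF w g : measurable_fun [set: G] w -> lbd w -> adm (fun h => ker 3 A (hs (g^-1 * h)%g) * w h).
  by move=> mw bw; apply: (@conv_adm _ A) => //; [exact: ker_measurable|exact: ker_bounded1].
set J := hI (\1_[set y : SL2 R | hs y <= 2 * A * C]).
exists (`|c| * (A ^+ 3 * M) * J) => g t gC tb.
have mFl : measurable_fun [set: G] (fun h : G => F (fl b t * h)%g) by apply: (measurableT_comp mF (measurable_mull _)).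
have bFl : lbd (fun h => F (fl b t * h)%g).
  move=> D; have [N N1 NP] := lbd_pos (4 * D) bF; exists N => h hD; apply: NP.
  by apply: le_trans (fl_hs b h tb) _; lra.
have -> : F (fl b t * g)%g = c * rop (ker 3 A) (fun h => F (fl b t * h)%g) g.
  rewrite eF; congr (_ * _); rewrite /rop -(hI_left mu_haar (fl b t)) //; last exact: aF.
  by apply: eq_hI => h; rewrite invgM -mulgA mulKg.
have -> : c * rop (ker 3 A) (fun h => F (fl b t * h)%g) g - F g - t * (c * rop (ker 3 A) (fun h => c * u1 h) g) =
  c * (rop (ker 3 A) (fun h => F (fl b t * h)%g) g - rop (ker 3 A) F g - t * rop (ker 3 A) (fun h => c * u1 h) g).
  by rewrite [X in _ - X - _]eF; ring.
rewrite normrM -!mulrA ler_wpM2l // /rop -hIZ //; last exact: aF.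
have e1 := aF _ g mFl bFl; have e2 := aF _ g mF bF; have e3 := admZ t (aF _ g mF1 bF1).
rewrite -!hIB //; last exact: admB.
set T := (X in hI X).
have aT : adm T by apply: admB; [apply: admB; exact: aF|apply: admZ; exact: aF].
rewrite [X in _ <= X](_ : _ = A ^+ 3 * M * t ^+ 2 * J); last by ring.
have A30 : 0 <= A ^+ 3 by rewrite exprn_ge0.
have M0 : 0 <= M by lra.
apply: hI_ball => //; first exact: mulr_ge0 (mulr_ge0 A30 M0) (sqr_ge0 t).
  move=> h hD; have -> : T h = ker 3 A (hs (g^-1 * h)%g) * (F (fl b t * h)%g - F h - t * (c * u1 h)) by rewrite /T; ring.
  rewrite normrM -mulrA; apply: ler_pM => //; last exact: MP.
  by rewrite ger0_norm ?ker_ge0 //; apply: ker_le => //; exact: hs_ge1.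
move=> h hD; have far : A < hs (g^-1 * h)%g.
  by apply: (@hs_far _ A); apply: le_lt_trans hD; rewrite ler_wpM2l // mulr_ge0.
by rewrite /T kf // !mul0r mulr0 !subr0.
Qed.

End SmoothClass.

(** * From flow derivatives to partial derivatives *)

Section Quadratic.
Variable R : realType.

Definition lin2 (a b : R) (v : R * R) : R := v.1 * a + v.2 * b.

Lemma lin2_linear a b : linear (lin2 a b).
Proof. by move=> c [x1 y1] [x2 y2]; rewrite /lin2 /= -!/(c * _) /GRing.scale /=; ring. Qed.

HB.instance Definition _ a b := GRing.isLinear.Build R (R * R)%type R _ (lin2 a b) (lin2_linear a b).

Lemma lin2_continuous a b : continuous (lin2 a b).
Proof.
move=> v; apply: (@cvgD _ _ _ (nbhs v)).
  by apply: (@cvgM _ _ (nbhs v)); [exact: cvg_fst|exact: cvg_cst].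
by apply: (@cvgM _ _ (nbhs v)); [exact: cvg_snd|exact: cvg_cst].
Qed.

Lemma diff_quadratic (f : R * R -> R) (p : R * R) (a b e M : R) : 0 < e ->
  (forall v : R * R, `|v| < e -> `|f (p + v) - f p - lin2 a b v| <= M * `|v| ^+ 2) ->
  [/\ differentiable f p, dx f p = a & dy f p = b].
Proof.
move=> e0 H.
have E (eps : R) : 0 < eps -> \forall v \near (0 : R * R), `|f (v + p) - (f p + lin2 a b v)| <= eps * `|v|.
  move=> eps0; have m0 : 0 < Num.min e (eps / (`|M| + 1)) by rewrite lt_min e0 divr_gt0 // ltr_wpDl.
  apply: filterS (@nbhs0_lt R (R * R)%type _ m0) => v ve.
  move: ve; rewrite lt_min => /andP[v1 v2].
  rewrite opprD addrA [v + p]addrC; apply: le_trans (H v v1) _; rewrite expr2 mulrA ler_wpM2r //.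
  rewrite ltr_pdivlMr ?ltr_wpDl // in v2.
  by have := normr_ge0 v; have := ler_norm M; nra.
have dE : 'd f p = lin2 a b :> (R * R -> R).
  by apply: diff_unique; [exact: lin2_continuous|apply/eqaddoP => eps /E].
have df : differentiable f p.
  by apply/diff_locallyP; rewrite dE; split; [exact: lin2_continuous|apply/eqaddoP => eps /E].
by split => //; rewrite /dx /dy deriveE // dE /lin2 /=; ring.
Qed.

End Quadratic.

Section SmoothFunctions.
Variables (R : realType) (mu : SL2_measure R).
Hypothesis mu_haar : is_haar mu.
Implicit Types (g h : SL2 R) (s t : R) (w v F : SL2 R -> R) (k : R -> R).
Variables (A c : R).
Hypothesis A1 : 1 <= A.

(** The algebra generated by the solutions and by X and 1 / Y. It contains the coefficients that
    express partial derivatives by the two flows, so it is stable under all of them. *)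
Inductive smcl : (SL2 R -> R) -> Prop :=
| sm_fix F of fixcl mu A c F : smcl F
| sm_X : smcl (@X R)
| sm_YV : smcl (fun h => (Y h)^-1)
| sm_cst a : smcl (fun=> a)
| sm_add w v of smcl w & smcl v : smcl (fun h => w h + v h)
| sm_mul w v of smcl w & smcl v : smcl (fun h => w h * v h).

Lemma rot_XY g u : rotation u -> X (g * u)%g = X g /\ Y (g * u)%g = Y g.
Proof.
move=> ru; have H : hs (g^-1 * (g * u))%g = 1 by rewrite mulKg -[u]mulg1 hs_rotl // hs1.
move: H; rewrite hs_XY; have y0 := Y_gt0 g; have y1 := Y_gt0 (g * u)%g.
move=> /(canRL (mulfVK _)) => /(_ _)/wrap[|E]; first by rewrite !mulf_neq0 ?gt_eqF // pnatr_eq0.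
have : (X g - X (g * u)%g) ^+ 2 + (Y g - Y (g * u)%g) ^+ 2 = 0 by move: E; rewrite mul1r => E; rewrite -[X in X = _]addr0; lra.
by move/eqP; rewrite paddr_eq0 ?sqr_ge0 // !sqrf_eq0 !subr_eq0 => /andP[/eqP -> /eqP ->].
Qed.

Lemma smcl_lbd w : smcl w -> lbd w.
Proof.
elim=> [F []//||| a|u v _ bu _ bv|u v _ bu _ bv].
- exact: lbd_X.
- exact: lbd_YV.
- exact: lbd_cst.
- exact: lbdD.
- exact: lbdM.
Qed.

Lemma smcl_fd w : smcl w -> [/\ lbd w, forall g u, rotation u -> w (g * u)%g = w g &
  forall b, exists2 w1, fd b w w1 & smcl w1].
Proof.
elim=> [F fF||| a|u v su [bu ru du] sv [bv rv dv]|u v su [bu ru du] sv [bv rv dv]].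
- have [_ bF rF _] := fF; split=> // b; have [F1 d1 f1] := fixcl_fd mu_haar b A1 fF.
  by exists F1 => //; exact: sm_fix.
- split; [exact: lbd_X|by move=> g u /(rot_XY g)[]|move=> b; exists (X1 b); first exact: fd_X].
  by case: b; [exact: (sm_cst 1)|exact: sm_X].
- split; [exact: lbd_YV|by move=> g u /(rot_XY g)[_ ->]|move=> b; exists (YV1 b); first exact: fd_YV].
  case: b; first exact: (sm_cst 0).
  have := sm_mul (sm_cst (-1)) sm_YV; congr smcl; apply/funext => h; exact: mulN1r.
- by split => // [|b]; [exact: lbd_cst|exists (fun=> 0); [exact: fd_cst|exact: sm_cst]].
- split; [exact: lbdD|by move=> g k rk; rewrite ru ?rv|move=> b].
  have [u1 d1 s1] := du b; have [v1 d2 s2] := dv b; exists (fun h => u1 h + v1 h); [exact: fdD|exact: sm_add].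
- split; [exact: lbdM|by move=> g k rk; rewrite ru ?rv|move=> b].
  have [u1 d1 s1] := du b; have [v1 d2 s2] := dv b.
  have b1 := smcl_lbd s1; have b2 := smcl_lbd s2.
  exists (fun h => u1 h * v h + u h * v1 h); first exact: fdM.
  by apply: sm_add; apply: sm_mul.
Qed.

Lemma rot_inv_XY w g h : (forall g u, rotation u -> w (g * u)%g = w g) -> X g = X h -> Y g = Y h -> w g = w h.
Proof. by move=> rw eX eY; rewrite -(rw g _ (XY_rotation eX eY)) mulVKg. Qed.

Lemma smcl_diff w : smcl w -> exists wx wy, [/\ smcl wx, smcl wy & forall u : R * R -> R,
  (forall p : R * R, 0 < p.2 -> u p = w (gz p.1 p.2)) -> forall p : R * R, 0 < p.2 ->
  [/\ differentiable u p, dx u p = wx (gz p.1 p.2) & dy u p = wy (gz p.1 p.2)]].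
Proof.
move=> sw; have [bw rw dw] := smcl_fd sw; have [w1 d1 s1] := dw true; have [w2 d2 s2] := dw false.
have [b1 r1 dd1] := smcl_fd s1; have [b2 r2 dd2] := smcl_fd s2; have [w12 d12 s12] := dd1 false.
have [b12 _ _] := smcl_fd s12.
(* The horizontal flow is d/dx and the dilation flow is x d/dx + y d/dy; solving for d/dy gives this
   quotient. *)
exists w1, (fun h => (w2 h + (-1) * (X h * w1 h)) * (Y h)^-1); split => //.
  by apply: sm_mul; [apply: sm_add => //; apply: sm_mul; [exact: sm_cst|apply: sm_mul => //; exact: sm_X]|exact: sm_YV].
move=> u uE [x y] /= y0; set g := gz x y; have [gX gY] := gz_XY x y0.
rewrite gX gY; set a1 := w1 g; set a2 := w2 g.
have [M M1 MP] := fd_pos (4 * hs g) d1; have [N N1 NP] := fd_pos (4 * hs g) d2.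
have [K K1 KP] := fd_lip (4 * hs g) d12 b12.
have h1 := hs_ge1 g.
have yi : 0 < y^-1 by rewrite invr_gt0.
pose B := 1 + `|x| / y; have B1 : 1 <= B by rewrite lerDl mulr_ge0 // ltW.
apply: (@diff_quadratic _ u (x, y) _ _ (Num.min (y / 2) (1 / (2 * B))) (M * B ^+ 2 + N / y ^+ 2 + K / y * B)).
  by rewrite lt_min !divr_gt0 // mulr_gt0 //; lra.
move=> [v1 v2]; rewrite lt_min => /andP[ve1 ve2].
have n1 : `|v1| <= `|(v1, v2)| by rewrite prod_normE le_max lexx.
have n2 : `|v2| <= `|(v1, v2)| by rewrite prod_normE le_max lexx orbT.
move: (`|(v1, v2)|) ve1 ve2 n1 n2 => n ve1 ve2 n1 n2; have n0 : 0 <= n by exact: le_trans n1.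
(* The increment (v1, v2) is a dilation by 1 + tau followed by a translation by t. *)
pose tau := v2 / y; pose t := v1 - x * tau.
have tau_n : `|tau| <= n / y by rewrite /tau normrM (gtr0_norm yi) ler_wpM2r // ltW.
have tauB : `|tau| <= 1 / 2 by apply: le_trans tau_n _; rewrite ler_pdivrMr //; lra.
have t_n : `|t| <= B * n.
  apply: le_trans (ler_normB _ _) _; rewrite /B mulrDl mul1r lerD // normrM -mulrA ler_wpM2l //.
  by rewrite mulrC.
have tB : `|t| <= 1 / 2.
  apply: le_trans t_n _; move: ve2; rewrite ltr_pdivlMr ?mulr_gt0 //; last by lra.
  by move=> H; lra.
have -> : u ((x, y) + (v1, v2)) = w (fl true t * (fl false tau * g))%g.
  have [e1 e2] := fl_XY true (fl false tau * g)%g tB; have [e3 e4] := fl_XY false g tauB.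
  have yy : 0 < y + v2 by have := ler_norm (- v2); rewrite normrN; lra.
  rewrite uE //=; apply: rot_inv_XY => //; have [g1 g2] := gz_XY (x + v1) yy.
    by rewrite g1 e1 e3 /X1 gX /t /tau; ring.
  by rewrite g2 e2 e4 /Y1 gY /tau; field; rewrite gt_eqF.
rewrite uE //= -/g.
have g'C : hs (fl false tau * g)%g <= 4 * hs g by exact: fl_hs.
have gC : hs g <= 4 * hs g by lra.
have -> : lin2 a1 ((a2 + -1 * (x * a1)) / y) (v1, v2) = t * a1 + tau * a2.
  by rewrite /lin2 /= /t /tau; field; rewrite gt_eqF.
have H1 := MP _ _ g'C tB; have H2 := NP _ _ gC tauB; have H3 := KP _ _ gC tauB.
rewrite (_ : _ - _ - _ = (w (fl true t * (fl false tau * g))%g - w (fl false tau * g)%g - t * w1 (fl false tau * g)%g)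
  + (w (fl false tau * g)%g - w g - tau * w2 g) + t * (w1 (fl false tau * g)%g - w1 g)); last by rewrite /a1 /a2; ring.
rewrite [X in _ <= X](_ : _ = M * B ^+ 2 * n ^+ 2 + N / y ^+ 2 * n ^+ 2 + K / y * B * n ^+ 2); last by rewrite !mulrDl.
have sq (z z' : R) : `|z| <= z' -> z ^+ 2 <= z' ^+ 2.
  by move=> le; rewrite -[z ^+ 2]real_normK ?num_real // ler_sqr ?nnegrE //; exact: le_trans le.
apply: le_trans (ler_normD _ _) _; apply: lerD; first apply: le_trans (ler_normD _ _) _; first apply: lerD.
- by apply: le_trans H1 _; rewrite -mulrA ler_pM2l; [rewrite -exprMn; exact: sq|lra].
- by apply: le_trans H2 _; rewrite -mulrA ler_pM2l; [rewrite -exprVn -exprMn mulrC; exact: sq|lra].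
- rewrite normrM (_ : K / y * B * n ^+ 2 = (B * n) * (K * (n / y))); last by ring.
  by apply: ler_pM => //; apply: le_trans H3 _; rewrite ler_pM2l //; lra.
Qed.

Definition toH F : R[i] -> R := fun z => F (gz (complex.Re z) (complex.Im z)).

Lemma smcl_iter F (w : seq bool) : smcl F -> exists2 F', smcl F' &
  forall p : R * R, 0 < p.2 -> iter_partial w (in_coords (toH F)) p = F' (gz p.1 p.2).
Proof.
move=> sF; elim: w => [|b w [F' s' IH]]; first by exists F.
have [wx [wy [sx sy H]]] := smcl_diff s'; have {}H := H _ IH.
by case: b; [exists wx|exists wy] => // p /H[].
Qed.

Lemma fixcl_smooth F : fixcl mu A c F -> smooth_on_half_plane (toH F).
Proof.
move=> fF w p p0; have [F' s' E] := smcl_iter w (sm_fix fF).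
by have [wx [wy [_ _ H]]] := smcl_diff s'; have [] := H _ E p p0.
Qed.

End SmoothFunctions.

(** * One-variable calculus and flow derivatives of smooth functions *)

Section OneVariable.
Variable R : realType.

Lemma is_derive_quadratic (F : R -> R) (A a e M : R) : 0 < e ->
  (forall t, `|t| < e -> `|F (A + t) - F A - t * a| <= M * t ^+ 2) -> is_derive A 1 F a.
Proof.
move=> e0 H.
have E : h^-1 *: ((F \o shift A) (h *: 1) - F A) @[h --> 0^'] --> a.
  apply/cvgrPdist_le => eps eps0.
  have m0 : 0 < Num.min e (eps / (`|M| + 1)) by rewrite lt_min e0 divr_gt0 // ltr_wpDl.
  apply: filterS2 (nbhs_dnbhs_neq 0) (nbhs_dnbhs (@nbhs0_lt R R _ m0)) => h h0.
  rewrite lt_min => /andP[h1 h2].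
  rewrite /= /GRing.scale /= mulr1.
  have -> : a - h^-1 * (F (h + A) - F A) = - (h^-1 * (F (A + h) - F A - h * a)).
    by rewrite [h + A]addrC; field.
  rewrite normrN normrM normfV ler_pdivrMl ?normr_gt0 //; apply: le_trans (H h h1) _.
  rewrite ltr_pdivlMr ?ltr_wpDl // in h2.
  rewrite -[h ^+ 2]real_normK ?num_real //; have := normr_ge0 h; have := ler_norm M; nra.
by apply: DeriveDef; [apply/cvg_ex; exists a|exact: cvg_lim].
Qed.

Lemma is_derive_MVT (psi psi1 : R -> R) (t : R) :
  (forall s : R, `|s| <= `|t| -> is_derive s 1 psi (psi1 s)) ->
  exists2 x, `|x| <= `|t| & psi t - psi 0 = psi1 x * t.
Proof.
move=> H.
have cont a b : - `|t| <= a -> b <= `|t| -> {within `[a, b], continuous psi}.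
  move=> ha hb; apply: derivable_within_continuous => s; rewrite in_itv /= => /andP[h1 h2].
  by have := H s ltac:(rewrite ler_norml; apply/andP; split; lra) => -[].
case: (leP 0 t) => t0.
  have tt : `|t| = t by rewrite ger0_norm.
  have [x||x xt E] := @MVT_segment R psi psi1 0 t t0.
  - rewrite in_itv /= => /andP[h1 h2]; apply: H; rewrite tt ger0_norm; lra.
  - by apply: cont; lra.
  exists x; last by rewrite E subr0.
  by move: xt; rewrite in_itv /= => /andP[h1 h2]; rewrite tt ger0_norm.
have tt : `|t| = - t by rewrite ltr0_norm.
have [x||x xt E] := @MVT_segment R psi psi1 t 0 (ltW t0).
- rewrite in_itv /= => /andP[h1 h2]; apply: H; rewrite tt ler0_norm; lra.
- by apply: cont; lra.
exists x; last by rewrite -opprB E; ring.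
by move: xt; rewrite in_itv /= => /andP[h1 h2]; rewrite tt ler0_norm // lerN2.
Qed.

Lemma taylor1 (psi psi1 psi2 : R -> R) (t B : R) :
  (forall s : R, `|s| <= `|t| -> is_derive s 1 psi (psi1 s)) ->
  (forall s : R, `|s| <= `|t| -> is_derive s 1 psi1 (psi2 s)) ->
  (forall s, `|s| <= `|t| -> `|psi2 s| <= B) -> `|psi t - psi 0 - t * psi1 0| <= B * t ^+ 2.
Proof.
move=> d1 d2 b2; have [x xt ->] := is_derive_MVT d1.
have [|y yx E] := @is_derive_MVT psi1 psi2 x; first by move=> s sx; apply: d2; exact: le_trans xt.
have -> : psi1 x * t - t * psi1 0 = psi2 y * x * t by rewrite -E; ring.
rewrite -[t ^+ 2]real_normK ?num_real // expr2 !normrM -mulrA; apply: ler_pM => //; last by rewrite ler_wpM2r.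
by apply: b2; exact: le_trans xt.
Qed.

Lemma is_derive_line (u : R * R -> R) (p v : R * R) (s : R) : differentiable u (p + s *: v) ->
  is_derive s 1 (fun s => u (p + s *: v)) (v.1 * dx u (p + s *: v) + v.2 * dy u (p + s *: v)).
Proof.
move=> du; set q := p + s *: v in du *.
have dv : 'D_v u q = v.1 * dx u q + v.2 * dy u q.
  rewrite /dx /dy !deriveE // -[in LHS](_ : v.1 *: (1, 0) + v.2 *: (0, 1) = v); last first.
    by case: v {q du} => a b; congr pair; rewrite /= /GRing.scale /=; ring.
  by rewrite linearD !linearZ.
have E : (fun h => h^-1 *: (((fun s => u (p + s *: v)) \o shift s) (h *: 1) - u q)) =
         (fun h => h^-1 *: ((u \o shift q) (h *: v) - u q)).
  apply/funext => h /=; congr (_ *: (u _ - _)); rewrite /q.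
  by case: (p) (v) => [x y] [a b]; congr pair; rewrite /= /GRing.scale /=; ring.
have dq : derivable u q v by exact: diff_derivable.
apply: DeriveDef; first by rewrite /derivable E.
by rewrite -dv /derive E.
Qed.

End OneVariable.

Section SmoothToFlow.
Variable R : realType.
Local Notation G := (borelSL2 R).
Variables (f : R[i] -> R) (smf : smooth_on_half_plane f).
Implicit Types (g h : SL2 R) (s t : R).

Definition phi (w : seq bool) h : R := iter_partial w (in_coords f) (X h, Y h).

Lemma phi_continuous w : continuous (phi w).
Proof.
move=> h; have d := differentiable_continuous (smf w (p := (X h, Y h)) (Y_gt0 h)).
apply: (@continuous_comp _ _ _ (fun g : SL2 R => (X g, Y g)) (iter_partial w (in_coords f))) => //.
have cX := @X_continuous R h; have cY := @Y_continuous R h; exact: (cvg_pair cX cY).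
Qed.

Lemma lbd_continuous (w : SL2 R -> R) : continuous w -> lbd w.
Proof.
move=> cw C; have K : compact (w @` [set h | hs h <= C]).
  by apply: continuous_compact; [exact: continuous_subspaceT|exact: hs_compact].
have [M [_ MP]] := compact_bounded K; exists (M + 1) => h hC.
by apply: (MP (M + 1)); [rewrite ltrDl|exists h].
Qed.

Lemma phi_lbd w : lbd (phi w). Proof. by apply: lbd_continuous; exact: phi_continuous. Qed.
Lemma phi_measurable w : measurable_fun [set: G] (phi w).
Proof. by apply: continuous_measurable_SL2; exact: phi_continuous. Qed.

(** The flows move (X, Y) along straight lines, so this is Taylor's formula on a segment, the second
    derivatives being bounded on balls by compactness. *)
Lemma phi_fd w b : fd b (phi w) (fun h => X1 b h * phi (true :: w) h + Y1 b h * phi (false :: w) h).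
Proof.
move=> C.
have bX : lbd (@X1 R b) by exact: lbd_X1.
have bY : lbd (@Y1 R b) by exact: lbd_Y1.
have [K K1 XK] := lbd_pos C bX; have [J J1 YJ] := lbd_pos C bY.
have [M1 M11 P1] := lbd_pos (4 * C) (phi_lbd [:: true, true & w]).
have [M2 M21 P2] := lbd_pos (4 * C) (phi_lbd [:: false, true & w]).
have [M3 M31 P3] := lbd_pos (4 * C) (phi_lbd [:: true, false & w]).
have [M4 M41 P4] := lbd_pos (4 * C) (phi_lbd [:: false, false & w]).
exists (K * (K * M1 + J * M2) + J * (K * M3 + J * M4)) => h t hC tb.
set v : R * R := (X1 b h, Y1 b h); set p : R * R := (X h, Y h).
have line s w' : `|s| <= `|t| -> phi w' (fl b s * h)%g = iter_partial w' (in_coords f) (p + s *: v).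
  by move=> st; have [e1 e2] := fl_XY b h (le_trans st tb); rewrite /phi e1 e2.
have dif s w' : `|s| <= `|t| -> differentiable (iter_partial w' (in_coords f)) (p + s *: v).
  move=> st; apply: smf; have [_ e2] := fl_XY b h (le_trans st tb).
  by have := Y_gt0 (fl b s * h)%g; rewrite e2.
have der s w' : `|s| <= `|t| -> is_derive s 1 (fun s => iter_partial w' (in_coords f) (p + s *: v))
    (X1 b h * iter_partial (true :: w') (in_coords f) (p + s *: v) + Y1 b h * iter_partial (false :: w') (in_coords f) (p + s *: v)).
  by move=> st; exact: is_derive_line (dif s w' st).
have z0 w' : phi w' h = iter_partial w' (in_coords f) (p + 0 *: v) by rewrite scale0r addr0.
pose F w' s := iter_partial w' (in_coords f) (p + s *: v).
pose psi2 s := X1 b h * (X1 b h * F [:: true, true & w] s + Y1 b h * F [:: false, true & w] s) +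
            Y1 b h * (X1 b h * F [:: true, false & w] s + Y1 b h * F [:: false, false & w] s).
have D1 s : `|s| <= `|t| -> is_derive s 1 (F w) (X1 b h * F (true :: w) s + Y1 b h * F (false :: w) s) by exact: der.
have D2 s : `|s| <= `|t| -> is_derive s 1 (fun s => X1 b h * F (true :: w) s + Y1 b h * F (false :: w) s) (psi2 s).
  move=> st; have E1 := der s (true :: w) st; have E2 := der s (false :: w) st.
  exact: (is_deriveD (is_deriveZ (X1 b h) E1) (is_deriveZ (Y1 b h) E2)).
have D3 s : `|s| <= `|t| -> `|psi2 s| <= K * (K * M1 + J * M2) + J * (K * M3 + J * M4).
  move=> st; have hsC : hs (fl b s * h)%g <= 4 * C by apply: le_trans (fl_hs b h (le_trans st tb)) _; lra.
  rewrite /psi2 /F -!line //; have x1 := XK h hC; have y1 := YJ h hC.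
  have := P1 _ hsC; have := P2 _ hsC; have := P3 _ hsC; have := P4 _ hsC => p4 p3 p2 p1.
  have two (a a' c d M N : R) : `|a| <= K -> `|a'| <= J -> `|c| <= M -> `|d| <= N -> `|a * c + a' * d| <= K * M + J * N.
    by move=> h1 h2 h3 h4; apply: le_trans (ler_normD _ _) _; apply: lerD; rewrite normrM; apply: ler_pM.
  by apply: (two) => //; apply: (two).
by have := taylor1 D1 D2 D3; rewrite line // !z0.
Qed.

End SmoothToFlow.

(** * Green's formula for radial kernels *)

Section GreenFormula.
Variables (R : realType) (mu : SL2_measure R).
Hypothesis mu_haar : is_haar mu.
Local Notation G := (borelSL2 R).
Local Notation hI := (hI mu).
Implicit Types (g h : SL2 R) (t : R) (w v : SL2 R -> R) (k : R -> R).

Lemma fd_comp b (c c1 : SL2 R -> R) k k1 : (forall h, 1 <= c h) -> c11 k k1 -> fd b c c1 -> lbd c1 ->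
  lbd (fun h => k1 (c h)) -> fd b (fun h => k (c h)) (fun h => k1 (c h) * c1 h).
Proof.
move=> c_ge [M M0 kM] dc bc1 bk C.
have [P P1 cP] := fd_lip C dc bc1; have [N N1 cN] := fd_pos C dc; have [J J1 kJ] := lbd_pos C bk.
exists (M * P ^+ 2 + J * N) => h t hC tb; set h' := (fl b t * h)%g.
have -> : k (c h') - k (c h) - t * (k1 (c h) * c1 h) =
  (k (c h') - k (c h) - k1 (c h) * (c h' - c h)) + k1 (c h) * (c h' - c h - t * c1 h) by ring.
apply: le_trans (ler_normD _ _) _; rewrite mulrDl; apply: lerD.
  apply: le_trans (kM _ _ (c_ge h) (c_ge h')) _; rewrite -mulrA ler_wpM2l //.
  rewrite -[_ ^+ 2]real_normK ?num_real // -[t ^+ 2]real_normK ?num_real // -exprMn ler_sqr ?nnegrE //; first exact: cP.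
  by rewrite mulr_ge0 //; lra.
by rewrite normrM -mulrA; apply: ler_pM => //; [exact: kJ|exact: cN].
Qed.

Record okf w : Prop := OkF { ok_m : measurable_fun [set: G] w; ok_b : lbd w }.

Lemma okD w v : okf w -> okf v -> okf (fun h => w h + v h).
Proof. by move=> [? ?] [? ?]; split; [exact: measurable_funD|exact: lbdD]. Qed.
Lemma okM w v : okf w -> okf v -> okf (fun h => w h * v h).
Proof. by move=> [? ?] [? ?]; split; [exact: measurable_funM|exact: lbdM]. Qed.
Lemma ok_cst (a : R) : okf (fun=> a).
Proof. by split; [exact: measurable_cst|exact: lbd_cst]. Qed.

Definition fdo b w v := [/\ okf w, okf v & fd b w v].

Lemma fdoM b w w1 v v1 : fdo b w w1 -> fdo b v v1 -> fdo b (fun h => w h * v h) (fun h => w1 h * v h + w h * v1 h).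
Proof.
move=> [p1 p2 d1] [p3 p4 d2]; split; [exact: okM|by apply: okD; apply: okM|].
by apply: fdM => //; [case: p1|case: p2|case: p3|case: p4].
Qed.

(** Left invariance makes the integral of every difference [w (fl b t * h) - w h] zero; the
    quadratic remainder then allows division by t. *)
Lemma fd_int0 b w v (D : R) : fdo b w v -> (forall h, D < hs h -> w h = 0) -> (forall h, D < hs h -> v h = 0) -> hI v = 0.
Proof.
move=> [[mw bw] [mv bv] dw] w0 v0.
have aw := adm_local mw bw w0; have av := adm_local mv bv v0.
have [M M1 MP] := fd_pos (8 * D) dw.
set J := hI (\1_[set y : SL2 R | hs y <= 8 * D]).
have H t : `|t| <= 1 / 2 -> `|t| * `|hI v| <= M * t ^+ 2 * J.
  move=> tb; have al := adm_left (fl b t) aw; have az := admZ t av; have ab := admB al aw.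
  have -> : `|t| * `|hI v| = `|hI (fun h => w (fl b t * h)%g - w h - t * v h)|.
    by rewrite hIB // hIB // hIZ // hI_left // subrr sub0r normrN normrM.
  apply: hI_ball => //; first exact: admB.
  - by rewrite mulr_ge0 ?sqr_ge0 //; lra.
  - by move=> h hD; exact: MP.
  move=> h hD; have h1 := hs_ge1 h.
  have lt1 : D < hs h by case: (leP 0 D) => D0; lra.
  rewrite v0 // (w0 h) // w0 ?mulr0 ?subrr //.
  have e4 := fl_hs b 1%g tb; rewrite mulg1 hs1 in e4.
  have := hsM (fl b t)^-1%g (fl b t * h)%g; rewrite mulKg hsV.
  by have := hs_ge1 (fl b t * h)%g; nra.
have J0 : 0 <= J by apply: hI_ge0 => h; rewrite indicE.
apply/eqP; rewrite -normr_eq0; apply/negPn/negP => ne.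
have v1 : 0 < `|hI v| by rewrite lt_def ne normr_ge0.
have MJ : 0 < 2 * (M * J + 1) by rewrite mulr_gt0 // ltr_wpDl // mulr_ge0 //; lra.
pose t := Num.min (1 / 2) (`|hI v| / (2 * (M * J + 1))).
have t0 : 0 < t by rewrite lt_min !divr_gt0.
have tb : `|t| <= 1 / 2 by rewrite gtr0_norm // ge_min lexx.
have tu : t * (2 * (M * J + 1)) <= `|hI v| by rewrite -ler_pdivlMr // ge_min lexx orbT.
have := H t tb; rewrite (gtr0_norm t0) (_ : M * t ^+ 2 * J = (M * J) * (t * t)); last by ring.
have MJ0 : 0 <= M * J by rewrite mulr_ge0 //; lra.
have t2 : 0 < t * t by rewrite mulr_gt0.
have {}tu : t * (2 * (M * J + 1)) * t <= `|hI v| * t by rewrite ler_wpM2r // ltW.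
clearbody t; move: (M * J) (`|hI v|) tu MJ0 t2 => m n; nra.
Qed.

Lemma fdoD b w w1 v v1 : fdo b w w1 -> fdo b v v1 -> fdo b (fun h => w h + v h) (fun h => w1 h + v1 h).
Proof. by move=> [p1 p2 d1] [p3 p4 d2]; split; [exact: okD|exact: okD|exact: fdD]. Qed.
Lemma fdo_cst b (a : R) : fdo b (fun=> a) (fun=> 0).
Proof. by split; [exact: ok_cst|exact: ok_cst|exact: fd_cst]. Qed.
Lemma ok_X : okf (@X R). Proof. by split; [exact: measurable_X|exact: lbd_X]. Qed.
Lemma ok_Y : okf (@Y R). Proof. by split; [exact: measurable_Y|exact: lbd_Y]. Qed.
Lemma fdo_X b : fdo b (@X R) (X1 b).
Proof. by split; [exact: ok_X|case: b; [exact: ok_cst|exact: ok_X]|exact: fd_X]. Qed.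
Lemma fdo_Y b : fdo b (@Y R) (Y1 b).
Proof. by split; [exact: ok_Y|case: b; [exact: ok_cst|exact: ok_Y]|exact: fd_Y]. Qed.

End GreenFormula.

Section Green.
Variables (R : realType) (mu : SL2_measure R).
Hypothesis mu_haar : is_haar mu.
Local Notation hI := (hI mu).
Implicit Types (g h : SL2 R) (s t : R).
Variables (f : R[i] -> R) (smf : smooth_on_half_plane f) (A : R) (A1 : 1 <= A) (g0 : SL2 R).

Lemma fdo_phi b (w : seq bool) :
  fdo b (phi f w) (fun h => X1 b h * phi f (true :: w) h + Y1 b h * phi f (false :: w) h).
Proof.
have ok' w' : okf (phi f w') by split; [exact: phi_measurable|exact: phi_lbd].
split; [exact: ok'| |exact: phi_fd].
by apply: okD; apply: okM => //; [have [] := fdo_X R b|have [] := fdo_Y R b].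
Qed.

Definition cc h := hs (g0^-1 * h)%g.

Lemma ok_ker (j : nat) (a : R) : okf (fun h => a * ker j A (cc h)).
Proof.
split.
  by apply: measurable_funM => //; exact: (measurable_khs g0 (@ker_measurable R j A)).
by move=> C; have [K KP] := ker_bounded j a A1; exists K => h _; apply: KP; exact: hs_ge1.
Qed.

Lemma fdo_cc b : fdo b cc (fun h => - dhs b g0 h).
Proof.
have E h : cc h = hs (h^-1 * g0)%g by rewrite /cc -hsV invgM invgK.
have E' h : - dhs b g0 h = dhs b h g0.
  by rewrite /dhs; have y0 := Y_gt0 g0; have yh := Y_gt0 h; case: b; field; rewrite !gt_eqF.
split.
- split; first by apply: (measurableT_comp (@measurable_hs R) (measurable_mull _)).
  move=> C; exists (2 * hs g0 * C) => h hC; rewrite ger0_norm ?(le_trans _ (hs_ge1 _)) //.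
  have := hsM g0^-1%g h; rewrite hsV => le; have g1 := hs_ge1 g0.
  have : 2 * hs g0 * hs h <= 2 * hs g0 * C by rewrite ler_pM2l //; lra.
  by rewrite /cc; lra.
- split; first by apply: measurableT_comp => //; exact: measurable_dhs.
  by move=> C; have [M MP] := lbd_dhs b g0 C; exists M => h hC; rewrite normrN; exact: MP.
- move=> C; have [M _ MP] := hs_flow b (Num.max C (hs g0)); exists M => h t hC tb.
  rewrite !E E'; have [|||H _] := MP h g0 t; rewrite ?le_max ?lexx ?hC ?orbT //.
Qed.

Lemma fdo_k0 b : fdo b (fun h => ker 3 A (cc h)) (fun h => (- 3 * ker 2 A (cc h)) * - dhs b g0 h).
Proof.
have [[m1 b1] [m2 b2] d] := fdo_cc b.
split; [|by apply: okM => //; exact: ok_ker|].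
  by have := ok_ker 3 1; congr okf; apply/funext => h; rewrite mul1r.
apply: (fd_comp (k := ker 3 A) (k1 := fun s => - 3 * ker 2 A s) _ _ d b2).
- by move=> h; exact: hs_ge1.
- exact: c11_ker3.
- by case: (ok_ker 2 (-3)).
Qed.

Lemma fdo_k1 b : fdo b (fun h => - 3 * ker 2 A (cc h)) (fun h => (6 * ker 1 A (cc h)) * - dhs b g0 h).
Proof.
have [[m1 b1] [m2 b2] d] := fdo_cc b.
split; [exact: ok_ker|by apply: okM => //; exact: ok_ker|].
apply: (fd_comp (k := fun s => - 3 * ker 2 A s) (k1 := fun s => 6 * ker 1 A s) _ _ d b2).
- by move=> h; exact: hs_ge1.
- have [M M0 MP] := c11_ker2 A; exists (3 * M); first by rewrite mulr_ge0.
  move=> s s' s1 s1'.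
  have -> : -3 * ker 2 A s' - -3 * ker 2 A s - 6 * ker 1 A s * (s' - s) = - 3 * (ker 2 A s' - ker 2 A s - - 2 * ker 1 A s * (s' - s)) by ring.
  have n3 : `|-3 : R| = 3 by rewrite normrN ger0_norm.
  by rewrite normrM n3 -[3 * M * _]mulrA ler_pM2l //; exact: MP.
- by case: (ok_ker 1 6).
Qed.

Definition nul v := adm v /\ hI v = 0.

Lemma nulB v w : nul v -> nul w -> nul (fun h => v h - w h).
Proof. by move=> [a1 e1] [a2 e2]; split; [exact: admB|rewrite hIB // e1 e2 subrr]. Qed.
Lemma nulD v w : nul v -> nul w -> nul (fun h => v h + w h).
Proof. by move=> [a1 e1] [a2 e2]; split; [exact: admD|rewrite hID // e1 e2 addr0]. Qed.
Lemma cc_far h : 2 * A * hs g0 < hs h -> A < cc h. Proof. exact: (@hs_far _ A). Qed.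

Lemma nul_fdo b w v : fdo b w v -> (forall h, A < cc h -> w h = 0) -> (forall h, A < cc h -> v h = 0) -> nul v.
Proof.
move=> d w0 v0; have [_ [mv bv] _] := d; split.
  by apply: (adm_local mv bv) => h /cc_far; exact: v0.
by apply: (fd_int0 mu_haar d) => h /cc_far; [exact: w0|exact: v0].
Qed.

Lemma kz j h : (0 < j)%N -> A < cc h -> ker j A (cc h) = 0. Proof. exact: ker_far. Qed.

Definition lap h := Y h ^+ 2 * (phi f [:: true; true] h + phi f [:: false; false] h).

(** Integration by parts moves the Laplacian onto the kernel: the factor on the right is (s^2 - 1)
    k'' + 2 s k' for k(s) = (A - s)^3, the radial Laplacian in the variable s = cosh d. *)
Lemma green_fun : hI (fun h => ker 3 A (cc h) * lap h) =
  hI (fun h => (6 * ker 1 A (cc h) * (cc h ^+ 2 - 1) - 6 * cc h * ker 2 A (cc h)) * phi f [::] h).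
Proof.
pose dXX b := fdoD (fdo_X R b) (fdo_cst b (- X g0)).
have z h : A < cc h -> [/\ ker 3 A (cc h) = 0, ker 2 A (cc h) = 0 & ker 1 A (cc h) = 0] by move=> Ac; split; exact: kz.
(* Six exact flow derivatives whose combination is the difference of the two integrands. The
   vertical derivative is, up to 1 / Y, the dilation minus X times the horizontal derivative;
   therefore [d5] and [d6] correct [d3] and [d4]. *)
have d1 := fdoM (fdoM (fdoM (fdo_Y R true) (fdo_Y R true)) (fdo_k0 true)) (fdo_phi true [:: true]).
have d2 := fdoM (fdoM (fdoM (fdoM (fdo_Y R true) (fdo_cst true (Y g0)^-1)) (dXX true)) (fdo_k1 true)) (fdo_phi true [::]).
have d3 b := fdoM (fdoM (fdo_Y R b) (fdo_k0 b)) (fdo_phi b [:: false]).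
have d4 b := fdoM (fdoM (fdoD (fdoM (fdo_Y R b) (fdo_cst b (Y g0)^-1)) (fdoM (fdo_cst b (-1)) (fdo_cc b))) (fdo_k1 b)) (fdo_phi b [::]).
have d5 := fdoM (fdo_X R true) (d3 true).
have d6 := fdoM (fdo_X R true) (d4 true).
have [| |n1 m1] := nul_fdo d1; try by move=> h /z[k3 k2 k1]; rewrite k3 ?k2 !(mulr0, mul0r, addr0).
have [| |n2 m2] := nul_fdo d2; try by move=> h /z[k3 k2 k1]; rewrite k2 ?k1 !(mulr0, mul0r, addr0).
have [| |n3 m3] := nul_fdo (d3 false); try by move=> h /z[k3 k2 k1]; rewrite k3 ?k2 !(mulr0, mul0r, addr0).
have [| |n4 m4] := nul_fdo (d4 false); try by move=> h /z[k3 k2 k1]; rewrite k2 ?k1 !(mulr0, mul0r, addr0).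
have [| |n5 m5] := nul_fdo d5; try by move=> h /z[k3 k2 k1]; rewrite k3 ?k2 !(mulr0, mul0r, addr0).
have [| |n6 m6] := nul_fdo d6; try by move=> h /z[k3 k2 k1]; rewrite k2 ?k1 !(mulr0, mul0r, addr0).
have [n m] := nulD (nulB (conj n1 m1) (conj n2 m2)) (nulB (nulB (conj n3 m3) (conj n5 m5)) (nulB (conj n4 m4) (conj n6 m6))).
clear n1 n2 n3 n4 n5 n6 m1 m2 m3 m4 m5 m6 d1 d2 d3 d4 d5 d6.
have pf w : okf (phi f w) by split; [exact: phi_measurable|exact: phi_lbd].
have aE : adm (fun h => ker 3 A (cc h) * lap h).
  have [p1 p2] : okf (fun h => 1 * ker 3 A (cc h) * (Y h * Y h * (phi f [:: true; true] h + phi f [:: false; false] h))).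
    apply: okM; first exact: ok_ker.
    by apply: okM; [apply: okM; exact: ok_Y|exact: okD].
  have -> : (fun h => ker 3 A (cc h) * lap h) = (fun h => 1 * ker 3 A (cc h) * (Y h * Y h * (phi f [:: true; true] h + phi f [:: false; false] h))).
    by apply/funext => h; rewrite mul1r.
  by apply: (adm_local p1 p2) => h /cc_far/z[-> _ _]; rewrite mulr0 mul0r.
rewrite -[LHS]subr0 -[X in _ - X]m -hIB //.
apply: eq_hI => h; rewrite /lap.
have y0 := Y_gt0 g0; have yh := Y_gt0 h.
rewrite /X1 /Y1 /dhs /= /cc hs_XY.
move: (phi f [:: true; true] h) (phi f [:: false; false] h) (phi f [:: false; true] h) (phi f [:: true; false] h)
  (phi f [:: true] h) (phi f [:: false] h) (phi f [::] h) => f11 f22 f21 f12 f1 f2 f0.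
move: (X h) (Y h) (X g0) (Y g0) y0 yh => x y x0 y0 Hy0 Hy.
move: (ker 3 A _) (ker 2 A _) (ker 1 A _) => k3 k2 k1.
by field; rewrite !gt_eqF.
Qed.

End Green.

(** * Radial means as functions of the radius *)

Section RadialMeans.
Variables (R : realType) (mu : SL2_measure R).
Hypothesis mu_haar : is_haar mu.
Local Notation hI := (hI mu).
Local Notation rop := (rop mu).
Implicit Types (g h : SL2 R) (s t A : R).
Variables (F : SL2 R -> R) (okF : okf F) (g0 : SL2 R).

Definition mean (j : nat) A : R := rop (ker j A) F g0.

Lemma mean_adm j A : (0 < j)%N -> 1 <= A -> adm (fun h => ker j A (hs (g0^-1 * h)%g) * F h).
Proof.
move=> j0 A1; case: okF => mF bF; apply: (@conv_adm _ A) => //.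
- exact: ker_measurable.
- by move=> s; exact: ker_far.
- exact: ker_bounded1.
Qed.

(** [ker j A s] depends on A - s only, so varying A amounts to varying s. Shifting to the fixed
    parameter A + 2 keeps all arguments above 1, where the [c11] estimate applies. *)
Lemma mean_derive j A : (j = 2 \/ j = 3)%N -> 1 < A -> is_derive A 1 (mean j) (j%:R * mean j.-1 A).
Proof.
move=> j23 A1; have j0 : (0 < j)%N by case: j23 => ->.
have j1 : (0 < j.-1)%N by case: j23 => ->.
have [M M0 MP] : c11 (ker j (A + 2)) (fun s => - j%:R * ker j.-1 (A + 2) s).
  by case: j23 => ->; [exact: c11_ker2|apply: c11_ker3; lra].
have [_ bF] := okF; set D := 2 * (A + 2) * hs g0; have [J J1 FJ] := lbd_pos D bF.
have g1 := hs_ge1 g0.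
pose e := Num.min 1 (A - 1).
apply: (@is_derive_quadratic R _ A _ e (M * J * hI (\1_[set y : SL2 R | hs y <= D]))); first by rewrite lt_min subr_gt0 A1 ltr01.
move=> t; rewrite lt_min ltr_norml => /andP[/andP[t1 t2]]; rewrite ltr_norml => /andP[t3 t4].
have At : 1 <= A + t by lra.
have a1 := mean_adm j0 At; have a2 := mean_adm j0 (ltW A1); have a3 := mean_adm j1 (ltW A1).
have az := admZ (t * j%:R) a3.
rewrite /mean /rop mulrA -(hIZ mu_haar _ a3) -(hIB mu_haar a1 a2) -(hIB mu_haar (admB a1 a2) az).
rewrite (_ : M * J * _ * t ^+ 2 = M * J * t ^+ 2 * hI (\1_[set y : SL2 R | hs y <= D])); last by ring.
have aT := admB (admB a1 a2) (admZ (t * j%:R) a3).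
have sh i B s : ker i B s = ker i (A + 2) (s + (A + 2) - B).
  by rewrite /ker; congr (Num.max _ _ ^+ _); ring.
have J0 : 0 <= J by lra.
apply: hI_ball => //; first exact: mulr_ge0 (mulr_ge0 M0 J0) (sqr_ge0 t).
  move=> h hD; set s := hs _.
  have s1 : 1 <= s by exact: hs_ge1.
  have -> : ker j (A + t) s * F h - ker j A s * F h - t * j%:R * (ker j.-1 A s * F h) =
    (ker j (A + t) s - ker j A s - t * j%:R * ker j.-1 A s) * F h by ring.
  rewrite normrM [M * J * _]mulrAC; apply: ler_pM => //; last exact: FJ.
  rewrite (sh j (A + t)) (sh j A) (sh j.-1 A).
  have := MP (s + (A + 2) - A) (s + (A + 2) - (A + t)) ltac:(lra) ltac:(lra).
  have -> : s + (A + 2) - (A + t) - (s + (A + 2) - A) = - t by ring.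
  by rewrite sqrrN mulrN opprK mulNr mulrA; move=> H; apply: le_trans H; rewrite le_eqVlt; apply/orP; left; apply/eqP; congr `|_|; ring.
move=> h hD; have far : A + 2 < hs (g0^-1 * h)%g by exact: (@hs_far _ (A + 2)).
by rewrite !ker_far // ?mul0r ?mulr0 ?subrr //; lra.
Qed.

End RadialMeans.

Section GreenMeans.
Variables (R : realType) (mu : SL2_measure R).
Hypothesis mu_haar : is_haar mu.
Local Notation rop := (rop mu).
Implicit Types (g h : SL2 R) (s : R).
Variables (f : R[i] -> R) (smf : smooth_on_half_plane f).

Lemma phi_ok w : okf (phi f w).
Proof. by split; [exact: phi_measurable|exact: phi_lbd]. Qed.

(** Substituting s = A - (A - s) writes the radial Laplacian of the kernel through the three kernels
    themselves, which closes the system of means. *)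
Lemma green g A : 1 <= A -> rop (ker 3 A) (lap f) g =
  6 * (A ^+ 2 - 1) * mean mu (phi f [::]) g 1 A - 18 * A * mean mu (phi f [::]) g 2 A + 12 * mean mu (phi f [::]) g 3 A.
Proof.
move=> A1; rewrite /rop (green_fun mu_haar smf A1 g) /mean.
have a j : (0 < j)%N -> adm (fun h => ker j A (hs (g^-1 * h)%g) * phi f [::] h) by move=> j0; exact: (mean_adm (phi_ok [::])).
have a1 := a 1%N isT; have a2 := a 2%N isT; have a3 := a 3%N isT.
rewrite /rop -!hIZ // -hIB //; [|exact: admZ..]; rewrite -hID //; [|by apply: admB; exact: admZ|exact: admZ].
apply: eq_hI => h; rewrite /cc /ker; set s := hs _.
case: (maxr_cases (A - s)) => -[-> _]; first by ring.
by ring.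
Qed.

End GreenMeans.

(** * Derivative rules and the singular endpoint *)

Section DeriveTools.
Variable R : realType.
Implicit Types (f g : R -> R) (x a b : R).

Lemma dE f x a b : is_derive x 1 f a -> a = b -> is_derive x 1 f b.
Proof. by move=> + <-. Qed.
Lemma dM f g x a b : is_derive x 1 f a -> is_derive x 1 g b -> is_derive x 1 (fun y => f y * g y) (a * g x + f x * b).
Proof. by move=> df dg; apply: is_derive_eq (is_deriveM df dg) _; rewrite /GRing.scale /=; ring. Qed.
Lemma dD f g x a b : is_derive x 1 f a -> is_derive x 1 g b -> is_derive x 1 (fun y => f y + g y) (a + b).
Proof. by move=> df dg; exact: is_deriveD. Qed.
Lemma dB f g x a b : is_derive x 1 f a -> is_derive x 1 g b -> is_derive x 1 (fun y => f y - g y) (a - b).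
Proof. by move=> df dg; exact: is_deriveB. Qed.
Lemma dC x a : is_derive x 1 (fun=> a) 0.
Proof. exact: is_derive_cst. Qed.
Lemma dI x : is_derive x 1 (fun y => y) 1.
Proof. exact: is_derive_id. Qed.

Lemma dP f x a (n : nat) : is_derive x 1 f a -> is_derive x 1 (fun y => f y ^+ n.+1) (n.+1%:R * f x ^+ n * a).
Proof.
move=> df; elim: n => [|n IH]; first by apply: dE df _; rewrite expr0 !mul1r.
have := dM IH df; rewrite (_ : (fun y => f y ^+ n.+1 * f y) = (fun y => f y ^+ n.+2)); last by apply/funext => y; rewrite -exprSr.
by move=> D; apply: dE D _; rewrite -[n.+2%:R]natr1 exprSr; ring.
Qed.

Lemma dV f x a : is_derive x 1 f a -> f x != 0 -> is_derive x 1 (fun y => (f y)^-1) (- a / f x ^+ 2).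
Proof. by move=> df fx; apply: is_derive_eq (is_deriveV fx df) _; rewrite /GRing.scale /=; field. Qed.
Lemma dcomp f g x a b : is_derive x 1 f a -> is_derive (f x) 1 g b -> is_derive x 1 (fun y => g (f y)) (b * a).
Proof. by move=> df dg; apply: is_derive_eq (is_derive1_comp dg df) _; rewrite /GRing.scale /=. Qed.

Lemma derive_mono f f1 a b : a <= b -> (forall x, a <= x <= b -> is_derive x 1 f (f1 x)) ->
  (forall x, a <= x <= b -> 0 <= f1 x) -> f a <= f b.
Proof.
move=> ab df f0; have [x||x xI E] := @MVT_segment R f f1 a b ab.
- by rewrite in_itv /= => /andP[h1 h2]; apply: df; rewrite !ltW.
- by apply: derivable_within_continuous => x; rewrite in_itv /= => /df[].
by rewrite -subr_ge0 E mulr_ge0 ?subr_ge0 // f0 // -in_itv.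
Qed.

Lemma derive_anti f f1 a b : a <= b -> (forall x, a <= x <= b -> is_derive x 1 f (f1 x)) ->
  (forall x, a <= x <= b -> f1 x <= 0) -> f b <= f a.
Proof.
move=> ab df f0; rewrite -lerN2; apply: (@derive_mono (fun x => - f x) (fun x => - f1 x)) => // x xI.
  by have := dB (dC x 0) (df x xI); rewrite sub0r; congr is_derive; apply/funext => y; rewrite sub0r.
by rewrite oppr_ge0 f0.
Qed.

(** The radial equation is singular at A = 1, so initial conditions enter as bounds of order s - 1
    near 1; this turns such a bound into a sign. *)
Lemma le0_near (x K c : R) : 1 < c -> (forall s, 1 < s -> s < c -> x <= K * (s - 1)) -> x <= 0.
Proof.
move=> c1 H; rewrite leNgt; apply/negP => x0.
pose s := 1 + Num.min ((c - 1) / 2) (x / (2 * (`|K| + 1))).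
have k0 : 0 < 2 * (`|K| + 1) by rewrite mulr_gt0 // ltr_wpDl.
have s1 : 1 < s by rewrite ltrDl lt_min !divr_gt0 // subr_gt0.
have sc : s < c.
  by have : Num.min ((c - 1) / 2) (x / (2 * (`|K| + 1))) <= (c - 1) / 2 by [rewrite ge_min lexx]; rewrite /s; lra.
have sx : (s - 1) * (2 * (`|K| + 1)) <= x by rewrite /s addrAC subrr add0r -ler_pdivlMr // ge_min lexx orbT.
have := H s s1 sc; have := ler_norm K; nra.
Qed.

End DeriveTools.

(** * The radial differential equation *)

Section RadialODE.
Variable R : realType.
Variables (l : R) (L1 L2 L3 : R -> R).
Hypothesis d3 : forall A : R, 1 < A -> is_derive A 1 L3 (3 * L2 A).
Hypothesis d2 : forall A : R, 1 < A -> is_derive A 1 L2 (2 * L1 A).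
Hypothesis ode : forall A : R, 1 < A -> - l * L3 A = 6 * (A ^+ 2 - 1) * L1 A - 18 * A * L2 A + 12 * L3 A.
Implicit Types (A s : R).

(** Equal to (A - 1)^5 / (A + 1)^3 times the derivative of [nratio]. This weight puts the equation
    in divergence form, with right-hand side - l [nratio] (A - 1)^4 / (A + 1)^4. *)
Definition flux A := (3 * (A - 1) * L2 A - 4 * L3 A) / (A + 1) ^+ 3.
(** The mean divided by the growth of the kernel mass; as A tends to 1 it tends to a multiple of the
    value at the centre. *)
Definition nratio A := L3 A / (A - 1) ^+ 4.
Definition nratio1 A := (3 * (A - 1) * L2 A - 4 * L3 A) / (A - 1) ^+ 5.

Lemma flux_derive A : 1 < A -> is_derive A 1 flux (- l * L3 A / (A + 1) ^+ 4).
Proof.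
move=> A1; have n0 : (A + 1) ^+ 3 != 0 by rewrite expf_neq0 // gt_eqF //; lra.
have D := dM (dB (dM (dM (dC A 3) (dB (dI A) (dC A 1))) (d2 A1)) (dM (dC A 4) (d3 A1))) (dV (dP 2 (dD (dI A) (dC A 1))) n0).
apply: dE D _; have E := ode A1.
have L1E : L1 A = (- l * L3 A + 18 * A * L2 A - 12 * L3 A) / (6 * (A - 1) * (A + 1)).
  rewrite E; field; rewrite !gt_eqF //; lra.
by rewrite L1E; field; rewrite !gt_eqF //; lra.
Qed.

Lemma ratio_derive A : 1 < A -> is_derive A 1 nratio (nratio1 A).
Proof.
move=> A1; have n0 : (A - 1) ^+ 4 != 0 by rewrite expf_neq0 // gt_eqF // subr_gt0.
have D := dM (d3 A1) (dV (dP 3 (dB (dI A) (dC A 1))) n0).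
apply: dE D _.
by rewrite /nratio1; field; rewrite gt_eqF // subr_gt0.
Qed.

Lemma ratio1_flux A : 1 < A -> nratio1 A = flux A * (A + 1) ^+ 3 / (A - 1) ^+ 5.
Proof. by move=> A1; rewrite /nratio1 /flux; field; rewrite !gt_eqF //; lra. Qed.

Lemma ratio1_derive A : 1 < A -> is_derive A 1 nratio1 ((- l * nratio A - (2 * A + 8) * nratio1 A) / (A ^+ 2 - 1)).
Proof.
move=> A1; have n0 : (A - 1) ^+ 5 != 0 by rewrite expf_neq0 // gt_eqF // subr_gt0.
have D := dM (dB (dM (dM (dC A 3) (dB (dI A) (dC A 1))) (d2 A1)) (dM (dC A 4) (d3 A1))) (dV (dP 4 (dB (dI A) (dC A 1))) n0).
apply: dE D _.
have L1E : L1 A = (- l * L3 A + 18 * A * L2 A - 12 * L3 A) / (6 * (A - 1) * (A + 1)).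
  rewrite (ode A1); field; rewrite !gt_eqF //; lra.
rewrite L1E /nratio /nratio1; field; rewrite !gt_eqF //; nra.
Qed.

Section Harmonic.
Hypothesis l0 : l = 0.
Variable K : R.
Hypothesis b2 : forall A, 1 < A -> A < 2 -> `|L2 A| <= K * (A - 1) ^+ 2.
Hypothesis b3 : forall A, 1 < A -> A < 2 -> `|L3 A| <= K * (A - 1) ^+ 3.

Lemma derive0_eq (f : R -> R) a b : 1 < a -> 1 < b -> (forall A, 1 < A -> is_derive A 1 f 0) -> f a = f b.
Proof.
move=> a1 b1 df; wlog ab : a b a1 b1 / a <= b.
  by move=> W; case: (leP a b) => ab; [exact: W|apply/esym; apply: W => //; exact: ltW].
by apply/eqP; rewrite eq_le; apply/andP; split; [apply: (@derive_mono _ f (fun=> 0))|apply: (@derive_anti _ f (fun=> 0))] => // x /andP[ax _];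
  apply: df; exact: lt_le_trans ax.
Qed.

Lemma flux0 A : 1 < A -> flux A = 0.
Proof.
move=> A1; apply/eqP; rewrite -normr_le0.
have two : (1 : R) < 2 by lra.
apply: (le0_near (K := 7 * K) two) => s s1 s2.
have -> : flux A = flux s.
  by apply: (derive0_eq A1 s1) => B B1; have := flux_derive B1; rewrite l0 oppr0 !mul0r.
rewrite /flux normrM; have h2 := b2 s1 s2; have h3 := b3 s1 s2.
have K0 : 0 <= K by have := le_trans (normr_ge0 _) h2; rewrite pmulr_lge0 // exprn_gt0 // subr_gt0.
have H : `|3 * (s - 1) * L2 s - 4 * L3 s| <= 7 * K * (s - 1) ^+ 3.
  apply: le_trans (ler_normB _ _) _; rewrite [`|4 * _|]normrM [`|4|]ger0_norm //.
  rewrite normrM (_ : `|3 * (s - 1)| = 3 * (s - 1)); last by rewrite ger0_norm //; lra.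
  have : 3 * (s - 1) * `|L2 s| <= 3 * (s - 1) * (K * (s - 1) ^+ 2) by rewrite ler_wpM2l //; lra.
  have -> : 3 * (s - 1) * (K * (s - 1) ^+ 2) = 3 * (K * (s - 1) ^+ 3) by ring.
  by lra.
have n1 : `|((s + 1) ^+ 3)^-1| <= 1.
  have s3 : 1 <= (s + 1) ^+ 3 by apply: exprn_ege1; lra.
  by rewrite ger0_norm ?invr_ge0 ?invf_le1 //; lra.
apply: (@le_trans _ _ (7 * K * (s - 1) ^+ 3 * 1)); first exact: ler_pM.
rewrite mulr1 ler_wpM2l // ?mulr_ge0 // exprS ler_piMr //; last by apply: exprn_ile1; lra.
by lra.
Qed.

(** The flux is constant and vanishes at 1, so [nratio] is constant. Applied to the constant
    function this computes all kernel masses up to a single factor. *)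
Lemma harmonic_means : exists c0, forall A, 1 < A ->
  [/\ L3 A = c0 * (A - 1) ^+ 4, L2 A = 4 / 3 * c0 * (A - 1) ^+ 3 & L1 A = 2 * c0 * (A - 1) ^+ 2].
Proof.
exists (nratio 2) => A A1.
have E3 : L3 A = nratio 2 * (A - 1) ^+ 4.
  have -> : nratio 2 = nratio A.
    have two : (1 : R) < 2 by lra.
    apply: (derive0_eq two A1) => B B1; have := ratio_derive B1.
    by rewrite ratio1_flux // flux0 // !mul0r.
  by rewrite /nratio mulfVK // expf_neq0 // gt_eqF // subr_gt0.
have E2 : L2 A = 4 / 3 * nratio 2 * (A - 1) ^+ 3.
  have := flux0 A1; rewrite /flux => /eqP; rewrite mulf_eq0 invr_eq0 => /orP[/eqP F|]; last first.
    by rewrite gt_eqF // exprn_gt0 //; lra.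
  apply: (@mulfI _ (3 * (A - 1))); first by rewrite mulf_neq0 // gt_eqF // subr_gt0.
  by rewrite (_ : _ * L2 A = 4 * L3 A); [rewrite E3; field|lra].
split=> //; have := ode A1; rewrite l0 E3 E2 => E.
apply: (@mulfI _ (6 * (A ^+ 2 - 1))); first by rewrite gt_eqF //; nra.
rewrite (_ : _ * L1 A = 18 * A * (4 / 3 * nratio 2 * (A - 1) ^+ 3) - 12 * (nratio 2 * (A - 1) ^+ 4)).
  by field.
by move: E; rewrite oppr0 mul0r; move: (nratio 2 * (A - 1) ^+ 4) (18 * A * _) => x y; lra.
Qed.

End Harmonic.

Section Bounds.
Variable m : R.
Hypothesis b2 : forall A, 1 < A -> `|L2 A| <= 4 / 3 * m * (A - 1) ^+ 3.
Hypothesis b3 : forall A, 1 < A -> `|L3 A| <= m * (A - 1) ^+ 4.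

Lemma m_ge0 : 0 <= m.
Proof. have := b3 (_ : 1 < 2); rewrite (_ : 2 - 1 = 1) ?expr1n ?mulr1; last by ring. by move=> /(_ ltac:(lra)); exact: le_trans. Qed.

Lemma num_bound A : 1 < A -> `|3 * (A - 1) * L2 A - 4 * L3 A| <= 8 * m * (A - 1) ^+ 4.
Proof.
move=> A1; apply: le_trans (ler_normB _ _) _; rewrite [`|4 * _|]normrM [`|4|]ger0_norm //.
rewrite normrM (_ : `|3 * (A - 1)| = 3 * (A - 1)); last by rewrite ger0_norm //; lra.
have : 3 * (A - 1) * `|L2 A| <= 3 * (A - 1) * (4 / 3 * m * (A - 1) ^+ 3) by rewrite ler_wpM2l ?b2 //; lra.
have -> : 3 * (A - 1) * (4 / 3 * m * (A - 1) ^+ 3) = 4 * (m * (A - 1) ^+ 4) by field.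
by have := b3 A1; lra.
Qed.

Lemma ratio_bound A : 1 < A -> `|nratio A| <= m.
Proof.
move=> A1; have p0 : 0 < (A - 1) ^+ 4 by rewrite exprn_gt0 // subr_gt0.
by rewrite /nratio normrM normfV [`|_ ^+ 4|]gtr0_norm // ler_pdivrMr // b3.
Qed.

(** Integrate the flux equation from 1 using (x + 1)^4 >= 16; 80 is 16 times the 5 coming from the
    integral of (x - 1)^4. *)
Lemma flux_bound A : 1 < A -> `|flux A| <= `|l| * m * (A - 1) ^+ 5 / 80.
Proof.
move=> A1.
have m0 := m_ge0.
have H (e : R) : `|e| = 1 -> e * flux A <= `|l| * m * (A - 1) ^+ 5 / 80.
  move=> e1; rewrite -subr_le0; have c1 : 1 < Num.min A 2 by rewrite lt_min A1; lra.
  apply: (le0_near (K := 8 * m) c1) => s s1; rewrite lt_min => /andP[sA s2].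
  have D x : s <= x <= A -> is_derive x 1 (fun x => `|l| * m / 80 * (x - 1) ^+ 5 - e * flux x)
      (`|l| * m / 80 * (5 * (x - 1) ^+ 4) - e * (- l * L3 x / (x + 1) ^+ 4)).
    move=> /andP[sx xA]; have x1 : 1 < x by lra.
    apply: dE (dB (dM (dC x (`|l| * m / 80)) (dP 4 (dB (dI x) (dC x 1)))) (dM (dC x e) (flux_derive x1))) _.
    by ring.
  have P x : s <= x <= A -> 0 <= `|l| * m / 80 * (5 * (x - 1) ^+ 4) - e * (- l * L3 x / (x + 1) ^+ 4).
    move=> /andP[sx xA]; have x1 : 1 < x by lra.
    rewrite subr_ge0; apply: le_trans (ler_norm _) _.
    have q1 : `|((x + 1) ^+ 4)^-1| <= 1 / 16.
      have q2 : 16 <= (x + 1) ^+ 4.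
        have -> : (16 : R) = 2 ^+ 4 by ring.
        by rewrite lerXn2r ?nnegrE //; lra.
      by rewrite ger0_norm ?invr_ge0; [rewrite div1r lef_pV2 ?posrE //|]; lra.
    rewrite !normrM normrN e1 mul1r.
    have -> : `|l| * m / 80 * (5 * (x - 1) ^+ 4) = `|l| * (m * (x - 1) ^+ 4) * (1 / 16) by field.
    by apply: ler_pM => //; apply: ler_pM => //; exact: b3.
  have := derive_mono (ltW sA) D P.
  have f8 : e * flux s <= 8 * m * (s - 1) ^+ 4.
    apply: le_trans (ler_norm _) _; rewrite normrM e1 mul1r /flux normrM.
    have n1 : `|((s + 1) ^+ 3)^-1| <= 1.
      have s3 : 1 <= (s + 1) ^+ 3 by apply: exprn_ege1; lra.
      by rewrite ger0_norm ?invr_ge0 ?invf_le1 //; lra.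
    by rewrite -[X in _ <= X]mulr1; apply: ler_pM => //; exact: num_bound.
  have s4 : 8 * m * (s - 1) ^+ 4 <= 8 * m * (s - 1).
    rewrite ler_wpM2l ?mulr_ge0 // exprS ler_piMr //; last by apply: exprn_ile1; lra.
    by lra.
  have p5 : 0 <= `|l| * m / 80 * (s - 1) ^+ 5.
    by rewrite mulr_ge0 ?exprn_ge0 ?divr_ge0 ?mulr_ge0 //; lra.
  have -> : `|l| * m * (A - 1) ^+ 5 / 80 = `|l| * m / 80 * (A - 1) ^+ 5 by field.
  by lra.
have n1 : `|-1 : R| = 1 by rewrite normrN normr1.
by rewrite ler_norml; have := H 1 (normr1 R); have := H (-1) n1; lra.
Qed.

(** One more integration, whence 320 = 4 * 80. A small eigenvalue keeps the means close to the value
    at the centre, which later bounds nonzero eigenvalues from below. *)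
Lemma ratio_near m0 A : 1 < A -> (forall e : R, 0 < e -> exists2 d : R, 1 < d & forall s, 1 < s -> s < d -> `|nratio s - m0| <= e) ->
  `|nratio A - m0| <= `|l| * m * (A + 1) ^+ 4 / 320.
Proof.
move=> A1 lim.
have mm := m_ge0.
have H (e : R) : `|e| = 1 -> e * (nratio A - m0) <= `|l| * m * (A + 1) ^+ 4 / 320.
  move=> e1; apply/ler_addgt0Pr => eps eps0; have [d d1 dlim] := lim eps eps0.
  pose s := (1 + Num.min A d) / 2.
  have c1 : 1 < Num.min A d by rewrite lt_min A1.
  have cA : Num.min A d <= A by rewrite ge_min lexx.
  have cd : Num.min A d <= d by rewrite ge_min lexx orbT.
  have s1 : 1 < s by rewrite /s; lra.
  have sA : s < A by rewrite /s; lra.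
  have sd : s < d by rewrite /s; lra.
  have D x : s <= x <= A -> is_derive x 1 (fun x => `|l| * m / 320 * (x + 1) ^+ 4 - e * nratio x)
      (`|l| * m / 320 * (4 * (x + 1) ^+ 3) - e * (flux x * (x + 1) ^+ 3 / (x - 1) ^+ 5)).
    move=> /andP[sx xA]; have x1 : 1 < x by lra.
    apply: dE (dB (dM (dC x (`|l| * m / 320)) (dP 3 (dD (dI x) (dC x 1)))) (dM (dC x e) (ratio_derive x1))) _.
    by rewrite ratio1_flux //; ring.
  have P x : s <= x <= A -> 0 <= `|l| * m / 320 * (4 * (x + 1) ^+ 3) - e * (flux x * (x + 1) ^+ 3 / (x - 1) ^+ 5).
    move=> /andP[sx xA]; have x1 : 1 < x by lra.
    have p5 : 0 < (x - 1) ^+ 5 by rewrite exprn_gt0 // subr_gt0.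
    have p3 : 0 <= (x + 1) ^+ 3 by rewrite exprn_ge0 //; lra.
    rewrite subr_ge0; apply: le_trans (ler_norm _) _.
    rewrite normrM e1 mul1r normrM [`|flux x * _|]normrM normfV (gtr0_norm p5) (ger0_norm p3).
    rewrite ler_pdivrMr //.
    have -> : `|l| * m / 320 * (4 * (x + 1) ^+ 3) * (x - 1) ^+ 5 = `|l| * m * (x - 1) ^+ 5 / 80 * (x + 1) ^+ 3 by field.
    by apply: ler_wpM2r => //; exact: flux_bound.
  have := derive_mono (ltW sA) D P.
  have hs : e * (nratio s - m0) <= eps by apply: le_trans (ler_norm _) _; rewrite normrM e1 mul1r dlim.
  have p5 : 0 <= `|l| * m / 320 * (s + 1) ^+ 4.
    apply: mulr_ge0; last by apply: exprn_ge0; lra.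
    by apply: mulr_ge0; [exact: mulr_ge0|rewrite invr_ge0 ler0n].
  have -> : `|l| * m * (A + 1) ^+ 4 / 320 = `|l| * m / 320 * (A + 1) ^+ 4 by field.
  by rewrite !mulrBr in hs *; lra.
have n1 : `|-1 : R| = 1 by rewrite normrN normr1.
by rewrite ler_norml; have := H 1 (normr1 R); have := H (-1) n1; lra.
Qed.

Section Decay.
Variable r : R.
Hypotheses (r0 : 0 <= r) (r1 : r <= 1).
Hypothesis r_l : l <= 3 / 16 -> r <= 1 - Num.sqrt (1 - 4 * l).

(* The weight in the energy [u ^+ 2 + kap * nratio ^+ 2], where [u] is [nratio / 2] plus the derivative of [nratio]
   with respect to the hyperbolic distance. *)
Lemma kap_exists : exists2 kap, 1 / 16 <= kap & forall u v, 2 * (kap - l + 1 / 4) * u * v <= (1 - r / 2) * (u ^+ 2 + kap * v ^+ 2).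
Proof.
have R0 := r0; have R1 := r1.
(* The natural weight is |l - 1/4|. It degenerates at 1/4, so on the middle interval the weight 1/16
   is kept, at the price of a decay rate r / 2 in place of r. *)
case: (lerP (5 / 16) l) => [l1|l1].
  exists (l - 1 / 4) => [|u v]; first by lra.
  have -> : l - 1 / 4 - l + 1 / 4 = 0 by ring.
  rewrite mulr0 !mul0r; apply: mulr_ge0; first by lra.
  by apply: addr_ge0; [exact: sqr_ge0|apply: mulr_ge0; [lra|exact: sqr_ge0]].
case: (lerP l (3 / 16)) => [l2|l2].
  have rl := r_l l2; set q := Num.sqrt (1 - 4 * l) in rl.
  have q0 : 0 <= q by rewrite sqrtr_ge0.
  have q2 : q ^+ 2 = 1 - 4 * l by rewrite sqr_sqrtr //; lra.
  exists (1 / 4 - l) => [|u v]; first by lra.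
  have -> : 1 / 4 - l = q ^+ 2 / 4 by rewrite q2; field.
  have -> : 2 * (q ^+ 2 / 4 - l + 1 / 4) * u * v = q ^+ 2 * u * v by rewrite q2; field.
  have h1 : q ^+ 2 * u * v <= q * (u ^+ 2 + q ^+ 2 / 4 * v ^+ 2).
    have : 0 <= q * (u - q / 2 * v) ^+ 2 by rewrite mulr_ge0 ?sqr_ge0.
    by rewrite (_ : q * (u - q / 2 * v) ^+ 2 = q * (u ^+ 2 + q ^+ 2 / 4 * v ^+ 2) - q ^+ 2 * u * v); [lra|field].
  apply: le_trans h1 _; apply: ler_wpM2r; last by lra.
  have := sqr_ge0 u; have := mulr_ge0 (sqr_ge0 q) (sqr_ge0 v); lra.
exists (1 / 16) => // u v.
have h0 : `|2 * (1 / 16 - l + 1 / 4) * u * v| <= 1 / 4 * (`|u| * `|v|).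
  rewrite -mulrA normrM [`|u * v|]normrM ler_wpM2r ?mulr_ge0 // ler_norml; lra.
apply: le_trans (ler_norm _) _; apply: le_trans h0 _.
have := sqr_ge0 (`|u| - `|v| / 4); rewrite -[u ^+ 2]real_normK ?num_real // -[v ^+ 2]real_normK ?num_real //.
have := normr_ge0 u; have := normr_ge0 v; move: `|u| `|v| => a c c0 a0.
by nra.
Qed.

(** The hyperbolic sine of the distance whose hyperbolic cosine is A; [hq A] times a derivative in A
    is a derivative in the distance. *)
Definition hq A := Num.sqrt (A ^+ 2 - 1).

Lemma hq_facts A : 2 <= A -> [/\ 0 < hq A, hq A ^+ 2 = A ^+ 2 - 1, A - 1 / 2 <= hq A & hq A <= A].
Proof.
move=> A2; have p : 0 < A ^+ 2 - 1 by nra.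
have q0 : 0 < hq A by rewrite sqrtr_gt0.
have q2 : hq A ^+ 2 = A ^+ 2 - 1 by rewrite sqr_sqrtr // ltW.
by split => //; nra.
Qed.

Lemma hq_derive A : 2 <= A -> is_derive A 1 hq (A / hq A).
Proof.
move=> A2; have [q0 q2 _ _] := hq_facts A2.
have p : 0 < A * A - 1 by nra.
have D := dcomp (dB (dM (dI A) (dI A)) (dC A 1)) (is_derive1_sqrt p).
apply: dE D _; rewrite -expr2 -/(hq A); field; rewrite gt_eqF //.
Qed.

(** Here [v] is [nratio], [w] its derivative in the distance and [1 + eps] the damping coefficient
    (A + 8) / [hq A], which tends to 1 at infinity. *)
Lemma energy_ineq (kap A q v w eps : R) : 1 / 16 <= kap -> 0 <= eps ->
  (forall u v, 2 * (kap - l + 1 / 4) * u * v <= (1 - r / 2) * (u ^+ 2 + kap * v ^+ 2)) ->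
  2 * (w + v / 2) * (- l * v - (eps + 1) * w + w / 2) + 2 * kap * v * w <=
  (- (r / 2) + 2 * eps) * ((w + v / 2) ^+ 2 + kap * v ^+ 2).
Proof.
move=> k1 e0 /(_ (w + v / 2) v); set u := w + v / 2 => H.
have -> : w = u - v / 2 by rewrite /u; ring.
have -> : 2 * u * (- l * v - (eps + 1) * (u - v / 2) + (u - v / 2) / 2) + 2 * kap * v * (u - v / 2) =
  - (u ^+ 2 + kap * v ^+ 2) + eps * (u * v - 2 * u ^+ 2) + 2 * (kap - l + 1 / 4) * u * v by field.
have H1 : u * v - 2 * u ^+ 2 <= 2 * (u ^+ 2 + kap * v ^+ 2).
  by have := sqr_ge0 (v - 4 * u); have := sqr_ge0 u; have := sqr_ge0 v; nra.
have := ler_wpM2l e0 H1; move: (eps * (u * v - _)) H => z H.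
have -> : eps * (2 * (u ^+ 2 + kap * v ^+ 2)) = 2 * eps * (u ^+ 2 + kap * v ^+ 2) by ring.
by rewrite !mulrDl; lra.
Qed.

Lemma decay A : 2 <= A -> nratio A ^+ 2 <= 9602 * expR 36 * m ^+ 2 * expR (- (r / 2) * ln A).
Proof.
have R0 := r0; have R1 := r1.
move=> A2; have [kap k1 kP] := kap_exists.
pose En x := (hq x * nratio1 x + 1 / 2 * nratio x) ^+ 2 + kap * nratio x ^+ 2.
(* An integrating factor: x^(r/2) is the decay to be proved, and 72 / x absorbs the excess damping,
   which is of order 1 / x. Its value at x = 2 is the source of [expR 36]. *)
pose H x := expR (r / 2 * ln x + 72 * x^-1).
have En0 x : 0 <= En x.
  by apply: addr_ge0; [exact: sqr_ge0|apply: mulr_ge0; [lra|exact: sqr_ge0]].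
have anti : En A * H A <= En 2 * H 2.
  pose En1 x := 2 * (hq x * nratio1 x + 1 / 2 * nratio x) ^+ 1 * (x / hq x * nratio1 x +
    hq x * ((- l * nratio x - (2 * x + 8) * nratio1 x) / (x ^+ 2 - 1)) + 1 / 2 * nratio1 x) + kap * (2 * nratio x ^+ 1 * nratio1 x).
  pose H1 x := H x * (r / 2 * x^-1 + 72 * (- 1 / x ^+ 2)).
  apply: (@derive_anti R (fun x => En x * H x) (fun x => En1 x * H x + En x * H1 x)) => // x /andP[x2 xA].
    have x1 : 1 < x by lra.
    have x0 : 0 < x by lra.
    have dr := ratio_derive x1; have dr1 := ratio1_derive x1.
    have dEn : is_derive x 1 En (En1 x).
      apply: dE (dD (dP 1 (dD (dM (hq_derive x2) dr1) (dM (dC x (1 / 2)) dr))) (dM (dC x kap) (dP 1 dr))) _.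
      by rewrite /En1; ring.
    have dH : is_derive x 1 H (H1 x).
      have D := dcomp (dD (dM (dC x (r / 2)) (is_derive1_ln x0)) (dM (dC x 72) (dV (dI x) (lt0r_neq0 x0)))) (is_derive_expR _).
      by apply: dE D _; rewrite /H1 /H; ring.
    exact: dM.
  have x1 : 1 < x by lra.
  have [q0 q2 qx qx'] := hq_facts x2.
  have H0 : 0 < H x by exact: expR_gt0.
  set q := hq x in q0 q2 qx qx' *.
  pose eps := (x + 8) / q - 1.
  have e0 : 0 <= eps by rewrite subr_ge0 ler_pdivlMr //; lra.
  have I := @energy_ineq kap x q (nratio x) (q * nratio1 x) eps k1 e0 kP.
  have E1 : q * En1 x = 2 * (q * nratio1 x + nratio x / 2) * (- l * nratio x - (eps + 1) * (q * nratio1 x) + q * nratio1 x / 2) + 2 * kap * nratio x * (q * nratio1 x).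
    by rewrite /En1 -/q -q2 /eps; field; rewrite gt_eqF.
  have E2 : En x = (q * nratio1 x + nratio x / 2) ^+ 2 + kap * nratio x ^+ 2.
    by rewrite /En -/q; field.
  rewrite -E1 -E2 in I.
  have -> : En1 x * H x + En x * H1 x = (H x / q) * (q * En1 x + q * En x * (r / 2 * x^-1 + 72 * (- 1 / x ^+ 2))).
    by rewrite /H1; field; rewrite !gt_eqF //; lra.
  rewrite pmulr_rle0 ?divr_gt0 //.
  have x0 : 0 < x by lra.
  have J : - (r / 2) + 2 * eps + q * (r / 2 * x^-1 + 72 * (- 1 / x ^+ 2)) <= 0.
    have j1 : q * (r / 2 * x^-1) <= r / 2.
      by rewrite (_ : q * (r / 2 * x^-1) = r / 2 * q / x); [rewrite ler_pdivrMr // ler_wpM2l //; lra|ring].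
    have j2 : 2 * eps <= 72 * q / x ^+ 2.
      rewrite /eps (_ : (x + 8) / q - 1 = (x + 8 - q) / q); last by field; rewrite gt_eqF.
      rewrite mulrA ler_pdivrMr // mulrAC ler_pdivlMr ?exprn_gt0 //.
      have -> : 72 * q * q = 72 * (x ^+ 2 - 1) by rewrite -q2; ring.
      apply: (@le_trans _ _ (17 * x ^+ 2)); last by nra.
      by rewrite ler_wpM2r ?sqr_ge0 //; lra.
    have -> : q * (r / 2 * x^-1 + 72 * (- 1 / x ^+ 2)) = q * (r / 2 * x^-1) - 72 * q / x ^+ 2 by field; rewrite gt_eqF.
    by lra.
  have := ler_wpM2l (En0 x) J; rewrite mulr0.
  rewrite (_ : En x * _ = (- (r / 2) + 2 * eps) * En x + q * En x * (r / 2 * x^-1 + 72 * (- 1 / x ^+ 2))); last by ring.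
  by lra.
have A0 : 0 < A by lra.
have kR : kap * nratio A ^+ 2 <= En A by rewrite /En lerDr sqr_ge0.
have HA : expR (r / 2 * ln A) <= H A by rewrite ler_expR lerDl mulr_ge0 // invr_ge0; lra.
have H2 : H 2 <= 2 * expR 36.
  have -> : H 2 = expR (r / 2 * ln 2) * expR 36 by rewrite /H -expRD; congr (expR (_ + _)); field.
  rewrite ler_wpM2r ?expR_ge0 // -[X in _ <= X](@lnK R 2) ?posrE // ler_expR.
  have l2 : 0 <= ln (2 : R) by rewrite ln_ge0 //; lra.
  by rewrite -[X in _ <= X]mul1r ler_wpM2r //; lra.
have mm := m_ge0.
have E2 : En 2 <= (300 + kap) * m ^+ 2.
  have one2 : (1 : R) < 2 by lra.
  have n2 := num_bound one2; have b2' := ratio_bound one2.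
  have r12 : `|nratio1 2| <= 8 * m.
    move: n2; rewrite /nratio1 (_ : (2 : R) - 1 = 1); last by ring.
    by rewrite !expr1n invr1 !mulr1.
  have [q0 q2 _ qx] := hq_facts (lexx 2).
  have u16 : `|hq 2 * nratio1 2 + 1 / 2 * nratio 2| <= 17 * m.
    apply: le_trans (ler_normD _ _) _; rewrite [`|hq 2 * _|]normrM [`|1 / 2 * _|]normrM (gtr0_norm q0) (_ : `|1 / 2| = 1 / 2); last by rewrite ger0_norm.
    have : hq 2 * `|nratio1 2| <= 2 * (8 * m) by apply: ler_pM => //; exact: ltW.
    by lra.
  have sq (z z' : R) : `|z| <= z' -> z ^+ 2 <= z' ^+ 2.
    by move=> le; rewrite -[z ^+ 2]real_normK ?num_real // ler_sqr ?nnegrE //; exact: le_trans le.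
  have s1 := sq _ _ u16; have s2 := sq _ _ b2'.
  have s3 : kap * nratio 2 ^+ 2 <= kap * m ^+ 2 by apply: ler_wpM2l => //; lra.
  rewrite /En; have := sqr_ge0 m; rewrite exprMn in s1; lra.
have k0 : 0 < kap by lra.
have EE : kap * nratio A ^+ 2 * expR (r / 2 * ln A) <= (300 + kap) * m ^+ 2 * (2 * expR 36).
  apply: (@le_trans _ _ (En A * H A)).
    by apply: ler_pM => //; rewrite ?expR_ge0 // mulr_ge0 ?sqr_ge0 // ltW.
  apply: le_trans anti _; apply: ler_pM => //; exact: expR_ge0.
have -> : - (r / 2) * ln A = - (r / 2 * ln A) by ring.
rewrite expRN ler_pdivlMr ?expR_gt0 //.
rewrite -(ler_pM2l k0) mulrA; apply: le_trans EE _.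
have e36 : 0 <= expR 36 * m ^+ 2 :> R by rewrite mulr_ge0 ?expR_ge0 ?sqr_ge0.
(* [kap >= 1 / 16] gives 2 (300 + kap) <= 9602 kap; the 300 rounds up 17^2 from the initial
   energy. *)
have -> : (300 + kap) * m ^+ 2 * (2 * expR 36) = 2 * (300 + kap) * (expR 36 * m ^+ 2) by ring.
have -> : kap * (9602 * expR 36 * m ^+ 2) = kap * 9602 * (expR 36 * m ^+ 2) by ring.
by apply: ler_wpM2r => //; lra.
Qed.

End Decay.

End Bounds.

End RadialODE.

(* The integral of [(A - cosh d)_+^3] over the hyperbolic plane is a multiple of [(A - 1)^4]. *)
Definition kernel_masses (R : realType) (mu : SL2_measure R) (c0 : R) := forall A, 1 < A -> [/\ kmass mu (ker 3 A) = c0 * (A - 1) ^+ 4,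
  kmass mu (ker 2 A) = 4 / 3 * c0 * (A - 1) ^+ 3 & kmass mu (ker 1 A) = 2 * c0 * (A - 1) ^+ 2].

(** * Admissibility and masses of the kernels *)

Section HaarConstant.
Variables (R : realType) (mu : SL2_measure R).
Hypothesis mu_haar : is_haar mu.
Local Notation hI := (hI mu).
Local Notation rop := (rop mu).
Local Notation kmass := (kmass mu).
Implicit Types (g h : SL2 R) (s t A : R).

Lemma rker_ker j A : (0 < j)%N -> (j <= 3)%N -> 1 <= A -> rker (ker j A).
Proof.
move=> j0 j3 A1; have A3 : A <= A ^+ 3 by rewrite exprS ler_peMr ?exprn_ege1 //; lra.
exists (3 * A ^+ 3); split.
- exact: ker_measurable.
- move=> t t1; rewrite ger0_norm ?ker_ge0 //; apply: le_trans (ker_le j A1 t1) _.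
  by apply: (@le_trans _ _ (A ^+ 3)); [exact: ler_weXn2l|lra].
- by move=> t lt; apply: ker_far => //; lra.
- move=> s t s1 t1; rewrite /ker.
  set x := Num.max 0 (A - s); set y := Num.max 0 (A - t).
  have x0 : 0 <= x by rewrite le_max lexx.
  have y0 : 0 <= y by rewrite le_max lexx.
  have xA : x <= A by rewrite ge_max; apply/andP; split; lra.
  have yA : y <= A by rewrite ge_max; apply/andP; split; lra.
  have xy : `|x - y| <= `|s - t|.
    rewrite /x /y; case: (maxr_cases (A - s)) => -[-> h]; case: (maxr_cases (A - t)) => -[-> h'].
    - by rewrite distrC; have -> : A - t - (A - s) = s - t by ring.
    - by rewrite subr0 (ger0_norm h) ler_normr; apply/orP; right; lra.
    - by rewrite sub0r normrN (ger0_norm h') ler_normr; apply/orP; left; lra.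
    - by rewrite subrr normr0.
  have A2 : A <= A ^+ 2 by rewrite expr2 ler_peMr //; lra.
  have A23 : A ^+ 2 <= A ^+ 3 by exact: ler_weXn2l.
  suff [z [z0 zA ->]] : exists z, [/\ 0 <= z, z <= 3 * A ^+ 3 & x ^+ j - y ^+ j = z * (x - y)].
    by rewrite normrM (ger0_norm z0); apply: ler_pM.
  case: j j0 j3 => [|[|[|[|]]]] // _ _.
  - by exists 1; split; [|lra|ring].
  - by exists (x + y); split; [lra|lra|ring].
  - exists (x ^+ 2 + x * y + y ^+ 2); split; [|nra|ring].
    by rewrite !addr_ge0 ?sqr_ge0 ?mulr_ge0.
Qed.

Lemma iter_partial_cst (w : seq bool) (a : R) : exists c : R, iter_partial w (fun=> a) = fun=> c.
Proof.
elim: w => [|b w [c IH]]; first by exists a.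
exists 0; rewrite /= IH; case: b; apply/funext => p; exact: derive_cst.
Qed.

Lemma phi_cst (w : seq bool) (a : R) h : w != [::] -> phi (fun=> a) w h = 0.
Proof.
case: w => // b w _; rewrite /phi /=; have [c ->] := iter_partial_cst w a.
by case: b; exact: derive_cst.
Qed.

Lemma cst_smooth (a : R) : smooth_on_half_plane (fun=> a).
Proof.
move=> w p _; have [c] := iter_partial_cst w a; rewrite /in_coords => ->; exact: differentiable_cst.
Qed.

Lemma haar_const : exists2 c0 : R, 0 < c0 & kernel_masses mu c0.
Proof.
pose F := phi (fun=> 1 : R) [::].
have F1 : F = fun=> 1 by apply/funext.
have oF : okf F by apply: phi_ok; exact: cst_smooth.
have mE j A : (0 < j)%N -> (j <= 3)%N -> 1 < A -> mean mu F 1%g j A = kmass (ker j A).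
  by move=> j0 j3 A1; rewrite /mean F1 rop1 //; apply: rker_ker => //; exact: ltW.
set N := hI (\1_[set y : SL2 R | hs y <= 2]).
have N0 : 0 <= N by apply: hI_ge0 => h; rewrite indicE.
have kb j A : (0 < j)%N -> (j <= 3)%N -> 1 < A -> A < 2 -> `|mean mu F 1%g j A| <= N * (A - 1) ^+ j.
  move=> j0 j3 A1 A2; have A1' := ltW A1; rewrite mulrC.
  have a := mean_adm oF (1%g : SL2 R) j0 A1'.
  apply: hI_ball => //; first by apply: exprn_ge0; lra.
    move=> h _; rewrite F1 mulr1 ger0_norm ?ker_ge0 //.
    have h1 := hs_ge1 (1^-1 * h)%g.
    by rewrite lerXn2r ?nnegrE ?le_max ?lexx ?ge_max //; lra.
  by move=> h h2; rewrite ker_far ?mul0r // invg1 mul1g; lra.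
have D3 A : 1 < A -> is_derive A 1 (mean mu F 1%g 3) (3 * mean mu F 1%g 2 A).
  by move=> A1; exact: (mean_derive mu_haar oF _ (or_intror erefl) A1).
have D2 A : 1 < A -> is_derive A 1 (mean mu F 1%g 2) (2 * mean mu F 1%g 1 A).
  by move=> A1; exact: (mean_derive mu_haar oF _ (or_introl erefl) A1).
have O A : 1 < A -> - 0 * mean mu F 1%g 3 A = 6 * (A ^+ 2 - 1) * mean mu F 1%g 1 A - 18 * A * mean mu F 1%g 2 A + 12 * mean mu F 1%g 3 A.
  move=> A1; have := green mu_haar (cst_smooth 1) 1%g (ltW A1); rewrite -/F => <-.
  rewrite oppr0 mul0r /rop; have -> : lap (fun=> 1 : R) = (fun=> 0).
    by apply/funext => h; rewrite /lap !phi_cst // addr0 mulr0.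
  by transitivity (hI (fun=> 0)); [rewrite hI0|apply: eq_hI => y; rewrite mulr0].
have [c0 cP] := harmonic_means D3 D2 O erefl (fun A => kb 2%N A isT isT) (fun A => kb 3%N A isT isT).
exists c0; last first.
  by move=> A A1; rewrite -!mE //; exact: cP.
have two : (1 : R) < 2 by lra.
have := cP 2 two; rewrite mE // => -[]; rewrite (_ : (2 : R) - 1 = 1); last by ring.
rewrite expr1n mulr1 => <- _ _.
have rk : rker (ker 3 (2 : R)) by apply: rker_ker => //; lra.
apply: (@hI_gt0 _ mu mu_haar _ [set h | hs h < 3 / 2] (1 / 8)).
- by have := khs_adm (1%g : SL2 R) rk; congr adm; apply/funext => h; rewrite invg1 mul1g.
- by move=> x; exact: ker_ge0.
- by lra.
- exact: hs_open.
- by exists 1%g; rewrite /= hs1; lra.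
move=> x /= h; rewrite /ker (_ : 1 / 8 = (1 / 2) ^+ 3); last by field.
have le : 1 / 2 <= Num.max 0 (2 - hs x) by rewrite le_max; apply/orP; right; lra.
by rewrite lerXn2r ?nnegrE //; lra.
Qed.

End HaarConstant.

(** * Nonnegativity of eigenvalues *)

Section Nonneg.
Variable R : realType.

Lemma derive_mvt (f f1 : R -> R) (a b : R) : a < b -> (forall x, a <= x <= b -> is_derive x 1 f (f1 x)) ->
  exists2 c, a <= c <= b & f b - f a = f1 c * (b - a).
Proof.
move=> ab df; have [x||x xI E] := @MVT_segment R f f1 a b (ltW ab).
- by rewrite in_itv /= => /andP[h1 h2]; apply: df; rewrite !ltW.
- by apply: derivable_within_continuous => x; rewrite in_itv /= => /df[].
by exists x; rewrite -?in_itv.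
Qed.

Variables (l : R) (L1 L2 L3 : R -> R) (m : R).
Hypothesis d3 : forall A : R, 1 < A -> is_derive A 1 L3 (3 * L2 A).
Hypothesis d2 : forall A : R, 1 < A -> is_derive A 1 L2 (2 * L1 A).
Hypothesis ode : forall A : R, 1 < A -> - l * L3 A = 6 * (A ^+ 2 - 1) * L1 A - 18 * A * L2 A + 12 * L3 A.
Hypothesis b2 : forall A, 1 < A -> `|L2 A| <= 4 / 3 * m * (A - 1) ^+ 3.
Hypothesis b3 : forall A, 1 < A -> `|L3 A| <= m * (A - 1) ^+ 4.
Hypothesis m_gt0 : 0 < m.
Hypothesis lim : forall e : R, 0 < e -> exists2 d : R, 1 < d & forall s, 1 < s -> s < d -> `|nratio L3 s - m| <= e.

(* For a negative eigenvalue the mean would increase with the radius beyond the maximal value. *)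
Lemma eigenvalue_ge0 : 0 <= l.
Proof.
rewrite leNgt; apply/negP => l0.
have [d d1 dl] := lim (divr_gt0 m_gt0 (ltr0n R 2)).
pose B := Num.min 2 ((1 + d) / 2).
have B1 : 1 < B by rewrite lt_min; apply/andP; split; lra.
have Bd : B < d.
  by have : B <= (1 + d) / 2 by [rewrite ge_min lexx orbT]; lra.
have B2 : B <= 2 by rewrite ge_min lexx.
have pos s : 1 < s -> s <= B -> 0 < L3 s.
  move=> s1 sB; have := dl s s1 (le_lt_trans sB Bd); rewrite ler_norml => /andP[h _].
  have : 0 < nratio L3 s by have := m_gt0; lra.
  by rewrite /nratio pmulr_lgt0 // invr_gt0 exprn_gt0 // subr_gt0.
have mono a b : 1 < a -> a <= b -> b <= B -> flux L2 L3 a <= flux L2 L3 b.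
  move=> a1 ab bB; apply: (derive_mono (f1 := fun x => - l * L3 x / (x + 1) ^+ 4) ab) => x /andP[ax xb].
    by apply: (flux_derive d3 d2 ode); lra.
  rewrite mulr_ge0 ?invr_ge0 ?exprn_ge0 //; [|lra].
  by rewrite mulr_ge0 ?oppr_ge0 ?ltW // pos //; lra.
have pos' a : 1 < a -> a <= B -> 0 <= flux L2 L3 a.
  move=> a1 aB; rewrite -oppr_le0; apply: (le0_near (K := 8 * m) a1) => s s1 sa.
  have h1 := mono s a s1 (ltW sa) aB.
  have m0 := m_gt0.
  have f8 : - flux L2 L3 s <= 8 * m * (s - 1).
    apply: le_trans (ler_norm _) _; rewrite normrN /flux normrM.
    have n1 : `|((s + 1) ^+ 3)^-1| <= 1.
      have s3 : 1 <= (s + 1) ^+ 3 by apply: exprn_ege1; lra.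
      by rewrite ger0_norm ?invr_ge0 ?invf_le1 //; lra.
    apply: (@le_trans _ _ (8 * m * (s - 1) ^+ 4 * 1)).
      by apply: ler_pM => //; exact: num_bound b2 b3 _ s1.
    rewrite mulr1; apply: ler_wpM2l; first by lra.
    by rewrite exprS ler_piMr //; [lra|apply: exprn_ile1; lra].
  by lra.
have rmono a b : 1 < a -> a <= b -> b <= B -> nratio L3 a <= nratio L3 b.
  move=> a1 ab bB; apply: (derive_mono (f1 := nratio1 L2 L3) ab) => x /andP[ax xb].
    by apply: (ratio_derive d3); lra.
  rewrite ratio1_flux; last by lra.
  apply: mulr_ge0; last by rewrite invr_ge0; apply: exprn_ge0; lra.
  by apply: mulr_ge0; [apply: pos'; lra|apply: exprn_ge0; lra].
(* [nratio] starts at its limit m, is nondecreasing and never exceeds m, so it is constant near 1; a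
   strictly positive flux will contradict this. *)
have rm a : 1 < a -> a <= B -> nratio L3 a = m.
  move=> a1 aB; apply/eqP; rewrite eq_le; apply/andP; split.
    by apply: le_trans (ler_norm _) _; exact: (ratio_bound b3).
  apply/ler_addgt0Pr => e e0; have [d' d1' dl'] := lim e0.
  pose s := (1 + Num.min a d') / 2.
  have c1 : 1 < Num.min a d' by rewrite lt_min a1.
  have cA : Num.min a d' <= a by rewrite ge_min lexx.
  have cd : Num.min a d' <= d' by rewrite ge_min lexx orbT.
  have := dl' s ltac:(rewrite /s; lra) ltac:(rewrite /s; lra).
  have := rmono s a ltac:(rewrite /s; lra) ltac:(rewrite /s; lra) aB.
  by rewrite ler_norml => h /andP[h1 h2]; lra.
pose a := (1 + B) / 2.
have a1 : 1 < a by rewrite /a; lra.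
have aB : a < B by rewrite /a; lra.
have fpos x : 1 < x -> x <= B -> 0 < flux L2 L3 x.
  move=> x1 xB; pose s := (1 + x) / 2.
  have s1 : 1 < s by rewrite /s; lra.
  have sx : s < x by rewrite /s; lra.
  have [c /andP[sc cx] E] := derive_mvt sx (fun y (h : s <= y <= x) => flux_derive d3 d2 ode (lt_le_trans s1 (proj1 (andP h)))).
  have fs := pos' s s1 (le_trans (ltW sx) xB).
  have : 0 < - l * L3 c / (c + 1) ^+ 4 * (x - s).
    have Lc : 0 < L3 c by apply: pos; lra.
    apply: mulr_gt0; last by lra.
    by rewrite mulr_gt0 ?invr_gt0 ?exprn_gt0 ?mulr_gt0 //; lra.
  by lra.
have [c /andP[ac cB] E] := derive_mvt aB (fun y (h : a <= y <= B) => ratio_derive d3 (lt_le_trans a1 (proj1 (andP h)))).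
have : 0 < nratio1 L2 L3 c * (B - a).
  have c1 : 1 < c by lra.
  apply: mulr_gt0; last by lra.
  rewrite ratio1_flux //; apply: mulr_gt0; last by rewrite invr_gt0; apply: exprn_gt0; lra.
  by apply: mulr_gt0; [apply: fpos; lra|apply: exprn_gt0; lra].
by rewrite -E !rm //; lra.
Qed.

End Nonneg.

(** * The Moebius action in group coordinates *)

Section PointPair.
Variable R : realType.
Implicit Types (g h : SL2 R).

Lemma mobius_XY g h : mobius g (Complex (X h) (Y h)) = Complex (X (g * h)%g) (Y (g * h)%g).
Proof.
(* The point h i is (b + a i) / (d + c i); this is the same identity with the denominator
   cleared. *)
have num h' : Complex (X h') (Y h') * Complex (ed h') (ec h') = Complex (eb h') (ea h').
  have D := SL2_detE h'; have n := Yden_gt0 h'; rewrite /X /Y.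
  congr Complex.
    rewrite [RHS](_ : _ = eb h' * (ec h' ^+ 2 + ed h' ^+ 2) / (ec h' ^+ 2 + ed h' ^+ 2)); last by field; rewrite gt_eqF.
    rewrite [LHS](_ : _ = ((ea h' * ec h' + eb h' * ed h') * ed h' - (ea h' * ed h' - eb h' * ec h') * ec h') / (ec h' ^+ 2 + ed h' ^+ 2)); last by rewrite D; field; rewrite gt_eqF.
    by congr (_ / _); ring.
  rewrite [RHS](_ : _ = ea h' * (ec h' ^+ 2 + ed h' ^+ 2) / (ec h' ^+ 2 + ed h' ^+ 2)); last by field; rewrite gt_eqF.
  rewrite [LHS](_ : _ = ((ea h' * ec h' + eb h' * ed h') * ec h' + (ea h' * ed h' - eb h' * ec h') * ed h') / (ec h' ^+ 2 + ed h' ^+ 2)); last by rewrite D; field; rewrite gt_eqF.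
  by congr (_ / _); ring.
have den h' : Complex (ed h') (ec h') != 0.
  have n := Yden_gt0 h'; apply/eqP => -[d0 c0]; move: n; rewrite c0 d0 expr0n addr0 ltxx //.
rewrite /mobius -/(ea g) -/(eb g) -/(ec g) -/(ed g); set z := Complex (X h) (Y h).
have N : (real_complex R (ea g) * z + real_complex R (eb g)) * Complex (ed h) (ec h) = Complex (eb (g * h)%g) (ea (g * h)%g).
  rewrite mulrDl -mulrA num !entM; congr Complex; rewrite /=; ring.
have N' : (real_complex R (ec g) * z + real_complex R (ed g)) * Complex (ed h) (ec h) = Complex (ed (g * h)%g) (ec (g * h)%g).
  rewrite mulrDl -mulrA num !entM; congr Complex; rewrite /=; ring.
have n0 : real_complex R (ec g) * z + real_complex R (ed g) != 0.
  by apply/eqP => E; move: N'; rewrite E mul0r => /esym/eqP; apply/negP; exact: den.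
apply: (mulIf (den (g * h)%g)); rewrite num -N -N'; field.
by rewrite n0.
Qed.

Lemma near_point (u : R * R -> R) (g : SL2 R) : {for (X g, Y g), continuous u} ->
  forall e : R, 0 < e -> exists2 d : R, 1 < d & forall h, hs (g^-1 * h)%g < d -> `|u (X h, Y h) - u (X g, Y g)| <= e.
Proof.
move=> cu e e0; have y0 := Y_gt0 g.
have /cvgrPdist_le /(_ e e0) := cu; rewrite near_simpl => /nbhs_normP[r /= r0 rP].
pose d := Num.min 1 (r ^+ 2 / (16 * Y g ^+ 2)).
have d0 : 0 < d by rewrite lt_min ltr01 divr_gt0 ?mulr_gt0 ?exprn_gt0.
exists (1 + d); first by lra.
move=> h; rewrite hs_XY => lt; have yh := Y_gt0 h.
have d1 : d <= 1 by rewrite ge_min lexx.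
have d2 : d * (16 * Y g ^+ 2) <= r ^+ 2 by rewrite -ler_pdivlMr ?mulr_gt0 ?exprn_gt0 // ge_min lexx orbT.
move: lt; rewrite ltr_pdivrMr ?mulr_gt0 // => lt.
have yy : 0 < Y g * Y h by rewrite mulr_gt0.
have dyy : d * (Y g * Y h) <= Y g * Y h by rewrite ler_piMl // ltW.
have x2 := sqr_ge0 (X g - X h).
have Y4 : Y h <= 4 * Y g.
  rewrite leNgt; apply/negP => yy4.
  have : 4 * Y g * Y h < Y h ^+ 2 by rewrite expr2 ltr_pM2r.
  by have := sqr_ge0 (Y g); lra.
have dy4 : d * (Y g * Y h) <= d * (Y g * (4 * Y g)) by rewrite ler_pM2l // ler_pM2l.
have S : (X g - X h) ^+ 2 + (Y g - Y h) ^+ 2 < r ^+ 2.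
  by have := exprn_gt0 2 r0; rewrite sqrrB; lra.
rewrite distrC; apply: rP; rewrite /ball_ /= prod_normE /= gt_max.
have sq (z : R) : z ^+ 2 < r ^+ 2 -> `|z| < r.
  by move=> H; rewrite -(@ltr_pXn2r _ 2) ?nnegrE // ?ltW // real_normK ?num_real.
by apply/andP; split; apply: sq; have := sqr_ge0 (X g - X h); have := sqr_ge0 (Y g - Y h); lra.
Qed.

End PointPair.

(** * Laplace eigenfunctions under averaging *)

Section Eigenfunction.
Variables (R : realType) (mu : SL2_measure R).
Hypothesis mu_haar : is_haar mu.
Variable L : lattice R.
Local Notation hI := (hI mu).
Local Notation rop := (rop mu).
Local Notation kmass := (kmass mu).
Local Notation qf := (qf L).
Local Notation qI := (qI mu L).
Local Notation Gam := (subgroup_set (lG L)).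
Implicit Types (g h : SL2 R) (s t A : R).
Variable c0 : R.
Hypothesis c0_gt0 : 0 < c0.
Hypothesis c0P : kernel_masses mu c0.

Lemma point_mean (w : SL2 R -> R) g A e : okf w -> 1 < A -> (forall h, hs (g^-1 * h)%g < A -> `|w h - w g| <= e) ->
  `|rop (ker 3 A) w g - c0 * (A - 1) ^+ 4 * w g| <= e * (c0 * (A - 1) ^+ 4).
Proof.
move=> ow A1 we; have rk := @rker_ker R 3 A isT isT (ltW A1).
have [E _ _] := c0P A1; rewrite -E -(rop1 mu_haar g rk) [_ * w g]mulrC.
have a1 := mean_adm ow g (isT : (0 < 3)%N) (ltW A1); have a0 := kf_adm g rk (bmf_cst (1 : R)).
rewrite /rop -!hIZ // -hIB //; last exact: admZ.
have aT := admB a1 (admZ (w g) a0); apply: le_trans (hI_norm mu_haar aT) _; apply: hI_le => //; [exact: adm_norm|exact: admZ|].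
move=> h; rewrite mulr1 [w g * _]mulrC -mulrBr normrM ger0_norm ?ker_ge0 // [e * _]mulrC.
case: (ltP (hs (g^-1 * h)%g) A) => lt; first by apply: ler_wpM2l; [exact: ker_ge0|exact: we].
by rewrite (_ : ker 3 A _ = 0) ?mul0r // /ker max_l ?expr0n //; lra.
Qed.

Variables (f : R[i] -> R) (l : R).
Hypothesis f_smooth : smooth_on_half_plane f.
Hypothesis f_inv : forall z g, upper_half_plane z -> Gam g -> f (right_action z g) = f z.
Hypothesis f_eig : forall z, upper_half_plane z -> laplace_beltrami f z = l * f z.
Let F := phi f [::].

Lemma eig_okf : okf F. Proof. exact: phi_ok. Qed.

Lemma eig_qf : qf F.
Proof.
have inv gam x : Gam gam -> F (gam * x)%g = F x.
  move=> Gg; have [_ _ GV] := subgroupP (lG L).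
  have := f_inv (z := Complex (X x) (Y x)) (Y_gt0 x) (GV _ Gg).
  by rewrite /right_action invgK mobius_XY.
split=> //; split; first by case: eig_okf.
have [M M1 MP] := lbd_pos (lC L) (ok_b eig_okf).
by exists M => x; have [gam Gg Dg] := lD_ex L x; rewrite -(inv gam) // MP // lD_le.
Qed.

Lemma eig_lap h : lap f h = - l * F h.
Proof.
have := f_eig (z := Complex (X h) (Y h)) (Y_gt0 h); rewrite /laplace_beltrami /= -/(F h).
rewrite -[f _]/(F h) /lap /phi /= => E.
by rewrite mulNr -E; ring.
Qed.

Lemma eig_ode g A : 1 < A -> - l * mean mu F g 3 A =
  6 * (A ^+ 2 - 1) * mean mu F g 1 A - 18 * A * mean mu F g 2 A + 12 * mean mu F g 3 A.
Proof.
move=> A1; have A1' := ltW A1; rewrite -(green mu_haar f_smooth g A1') /mean -ropZ //; last by have [] := eig_qf.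
  by apply: eq_hI => h; rewrite eig_lap.
exact: rker_ker.
Qed.

Lemma eig_d3 g A : 1 < A -> is_derive A 1 (mean mu F g 3) (3 * mean mu F g 2 A).
Proof. exact: (mean_derive mu_haar eig_okf _ (or_intror erefl)). Qed.
Lemma eig_d2 g A : 1 < A -> is_derive A 1 (mean mu F g 2) (2 * mean mu F g 1 A).
Proof. exact: (mean_derive mu_haar eig_okf _ (or_introl erefl)). Qed.
Lemma kmass_norm j A : kmass (fun t => `|ker j A t|) = kmass (ker j A).
Proof. by apply: eq_hI => h; rewrite ger0_norm ?ker_ge0. Qed.

(** Integrate the radial equation over the quotient at A = 2. The masses solve the equation with l =
    0, so only the term containing l survives. *)
Lemma eig_mean0 : l != 0 -> qI F = 0.
Proof.
move=> l0; have qF := eig_qf; have [bF _] := qF.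
have two : (1 : R) < 2 by lra.
have r3 := @rker_ker R 3 2 isT isT (ltW two); have r2 := @rker_ker R 2 2 isT isT (ltW two); have r1 := @rker_ker R 1 2 isT isT (ltW two).
have E3 := qI_rop mu_haar r3 qF; have E2 := qI_rop mu_haar r2 qF; have E1 := qI_rop mu_haar r1 qF.
have [m3 m2 m1] := c0P two.
have b3 := (rop_qf mu_haar r3 qF).1; have b2 := (rop_qf mu_haar r2 qF).1; have b1 := (rop_qf mu_haar r1 qF).1.
have : qI (fun g => - l * rop (ker 3 2) F g) = qI (fun g => (18 * rop (ker 1 2) F g + -36 * rop (ker 2 2) F g) + 12 * rop (ker 3 2) F g).
  by apply: eq_hI => g; congr (_ * _); have := eig_ode g two; rewrite /mean => ->; ring.
rewrite qIZ // qID ?qID ?qIZ //; [|exact: bmfZ..|by apply: bmfD; exact: bmfZ|exact: bmfZ].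
rewrite E3 E2 E1 m3 m2 m1 (_ : (2 : R) - 1 = 1); last by ring.
rewrite !expr1n !mulr1 => E.
have : - l * c0 * qI F = 0.
  by rewrite -mulrA E; field.
by move/eqP; rewrite !mulf_eq0 oppr_eq0 (negbTE l0) (gt_eqF c0_gt0) /= => /eqP.
Qed.

Section Sup.
Variable M : R.
Hypothesis FM : forall h, `|F h| <= M.

Lemma eig_b3 g A : 1 < A -> `|mean mu F g 3 A| <= c0 * M * (A - 1) ^+ 4.
Proof.
move=> A1; have [bF _] := eig_qf; have rk := @rker_ker R 3 A isT isT (ltW A1).
apply: le_trans (rop_le mu_haar g rk bF FM) _; rewrite kmass_norm.
by have [-> _ _] := c0P A1; rewrite le_eqVlt; apply/orP; left; apply/eqP; ring.
Qed.

Lemma eig_b2 g A : 1 < A -> `|mean mu F g 2 A| <= 4 / 3 * (c0 * M) * (A - 1) ^+ 3.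
Proof.
move=> A1; have [bF _] := eig_qf; have rk := @rker_ker R 2 A isT isT (ltW A1).
apply: le_trans (rop_le mu_haar g rk bF FM) _; rewrite kmass_norm.
by have [_ -> _] := c0P A1; rewrite le_eqVlt; apply/orP; left; apply/eqP; ring.
Qed.

Lemma eig_near g e : 0 < e -> exists2 d : R, 1 < d & forall s, 1 < s -> s < d ->
  `|nratio (mean mu F g 3) s - c0 * F g| <= e.
Proof.
move=> e0; have cu := differentiable_continuous (f_smooth [::] (p := (X g, Y g)) (Y_gt0 g)).
have [d d1 dP] := near_point cu (divr_gt0 e0 c0_gt0).
exists d => // s s1 sd; have [bF _] := eig_qf.
have H := point_mean eig_okf s1 (fun h (lt : hs (g^-1 * h)%g < s) => dP h (lt_trans lt sd)).
have p4 : 0 < (s - 1) ^+ 4 by rewrite exprn_gt0 // subr_gt0.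
have -> : nratio (mean mu F g 3) s - c0 * F g = (mean mu F g 3 s - c0 * (s - 1) ^+ 4 * F g) / (s - 1) ^+ 4.
  by rewrite /nratio; field; rewrite gt_eqF // subr_gt0.
rewrite normrM normfV (gtr0_norm p4) ler_pdivrMr //; apply: le_trans H _.
by rewrite le_eqVlt; apply/orP; left; apply/eqP; field; rewrite gt_eqF.
Qed.

Lemma eig_upper g A r : 0 <= r -> r <= 1 -> (l <= 3 / 16 -> r <= 1 - Num.sqrt (1 - 4 * l)) -> 2 <= A ->
  nratio (mean mu F g 3) A ^+ 2 <= 9602 * expR 36 * (c0 * M) ^+ 2 * expR (- (r / 2) * ln A).
Proof.
move=> r0 r1 rl A2.
exact: (decay (eig_d3 g) (eig_d2 g) (eig_ode g) (eig_b2 g) (eig_b3 g) r0 r1 rl A2).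
Qed.

Lemma eig_lower g A : 1 < A -> `|nratio (mean mu F g 3) A - c0 * F g| <= `|l| * (c0 * M) * (A + 1) ^+ 4 / 320.
Proof.
move=> A1; apply: (ratio_near (eig_d3 g) (eig_d2 g) (eig_ode g) (eig_b2 g) (eig_b3 g) A1) => e e0.
exact: eig_near.
Qed.

Lemma eig_sign_ge0 g e : 0 < M -> `|e| = 1 -> e * F g = M -> 0 <= l.
Proof.
move=> M0 e1 eM; have m0 : 0 < c0 * M by rewrite mulr_gt0.
have ne j A : `|e * mean mu F g j A| = `|mean mu F g j A| by rewrite normrM e1 mul1r.
apply: (@eigenvalue_ge0 R l (fun A => e * mean mu F g 1 A) (fun A => e * mean mu F g 2 A) (fun A => e * mean mu F g 3 A) (c0 * M)) => //.
- by move=> A A1; apply: dE (dM (dC A e) (eig_d3 g A1)) _; ring.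
- by move=> A A1; apply: dE (dM (dC A e) (eig_d2 g A1)) _; ring.
- by move=> A A1; have := eig_ode g A1; move=> E; rewrite mulrCA E; ring.
- by move=> A A1; rewrite ne; exact: eig_b2.
- by move=> A A1; rewrite ne; exact: eig_b3.
- move=> eps eps0; have [d d1 dP] := eig_near g eps0; exists d => // s s1 sd.
  rewrite -eM (_ : _ - _ = e * (nratio (mean mu F g 3) s - c0 * F g)); last by rewrite /nratio; ring.
  by rewrite normrM e1 mul1r dP.
Qed.

(** With |F| maximal at [g], M - e F is nonnegative with integral M times the volume, and the kernel
    of parameter J + 1 is at least 1 on representatives of all orbits. So the mean at that radius
    stays well below M times the kernel mass, which [eig_lower] forbids when l is small. *)
Lemma eig_gap g e J : 0 < M -> `|e| = 1 -> e * F g = M -> qI F = 0 -> 1 <= J ->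
  (forall x y : SL2 R, exists2 gam, Gam gam & hs (x^-1 * gam * y)%g <= J) ->
  320 * qvol mu L / (c0 * J ^+ 4 * (J + 2) ^+ 4) <= `|l|.
Proof.
move=> M0 e1 eM F0 J1 diam; pose A := J + 1; have A1 : 1 < A by rewrite /A; lra.
have rk := @rker_ker R 3 A isT isT (ltW A1); have [bF invF] := eig_qf.
have bc (a : R) : bmf (fun=> a) by exact: bmf_cst.
have beF : bmf (fun h => e * F h) by exact: bmfZ.
have bg : bmf (fun h => M + - 1 * (e * F h)) by apply: bmfD => //; exact: bmfZ.
have eFM h : e * F h <= M by apply: le_trans (ler_norm _) _; rewrite normrM e1 mul1r.
pose T h := ker 3 A (hs (g^-1 * h)%g) * (M + -1 * (e * F h)).
have aT : adm T by exact: kf_adm.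
have T0 h : 0 <= T h by rewrite mulr_ge0 ?ker_ge0 //; have := eFM h; lra.
have IT : hI T = M * (c0 * (A - 1) ^+ 4) - e * mean mu F g 3 A.
  have [<- _ _] := c0P A1; rewrite -(rop1 mu_haar g rk) -[hI T]/(rop (ker 3 A) (fun h => M + -1 * (e * F h)) g).
  rewrite ropD //; last exact: bmfZ.
  rewrite ropZ // ropZ // /mean mulN1r; congr (_ - _).
  by rewrite -ropZ //; apply: eq_hI => h; rewrite mulr1.
have far h : 2 * A * hs g < hs h -> T h = 0 by move=> /(@hs_far _ A) lt; rewrite /T ker_far ?mul0r.
have low : M * qvol mu L <= hI T.
  have -> : M * qvol mu L = qI (fun h => M + -1 * (e * F h)).
    rewrite qID //; last exact: bmfZ.
    by rewrite qIZ // qIZ // F0 !mulr0 addr0 qI_cst.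
  rewrite (unfold mu_haar L aT far).
  apply: hI_le => //; [exact: qI_adm| |].
    apply: D_admM.
      by apply: measurable_sum => gam; case: (adm_left gam aT).
    have [mT [C [TC _]]] := aT.
    exists (\sum_(gam <- gl mu_haar L (2 * (2 * A * hs g) * lC L)) C) => x.
    by apply: le_trans (ler_norm_sum _ _ _) _; apply: ler_sum.
  move=> y; rewrite ![X in X * _ <= _]indicE; case: (boolP (y \in lD L)) => [/set_mem Dy|]; last by rewrite indicE => /negbTE ->; rewrite !mul0r.
  rewrite indicE mem_set // !mul1r; have [gam Gg hJ] := diam g y.
  have gl' : gam \in gl mu_haar L (2 * (2 * A * hs g) * lC L).
    apply/glP; split=> //; have := lD_le Dy.
    have h1 := hs_quot gam y; have h2 := hsM g (g^-1 * gam * y)%g.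
    rewrite !mulgA mulgV mul1g in h2.
    have g1 := hs_ge1 g; have y1 := hs_ge1 y => yC.
    have e1' : hs (gam * y)%g <= 2 * A * hs g.
      have : 2 * hs g * hs (g^-1 * gam * y)%g <= 2 * hs g * A by rewrite ler_pM2l; [rewrite /A; lra|lra].
      by lra.
    apply: le_trans h1 _; have c1 : 1 <= lC L by lra.
    have gy1 := hs_ge1 (gam * y)%g.
    by apply: ler_pM; lra.
  rewrite (big_rem gam gl') /=; apply: (@le_trans _ _ (T (gam * y)%g)); last by rewrite lerDl sumr_ge0.
  have -> : M + -1 * (e * F y) = M + -1 * (e * F (gam * y)%g) by rewrite invF.
  rewrite /T mulgA.
  have k1 : 1 <= ker 3 A (hs (g^-1 * gam * y)%g).
    by rewrite /ker exprn_ege1 // le_max; apply/orP; right; rewrite /A; lra.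
  by rewrite ler_peMl //; have := eFM (gam * y)%g; lra.
have := eig_lower g A1; rewrite /nratio -(ler_pM2l (_ : 0 < (A - 1) ^+ 4)) ?exprn_gt0 ?subr_gt0 //.
rewrite -[X in X * `|_|](@gtr0_norm _ ((A - 1) ^+ 4)) ?exprn_gt0 ?subr_gt0 // -normrM => up.
have a4 : 0 < (A - 1) ^+ 4 by rewrite exprn_gt0 // subr_gt0.
have {}up : hI T <= (A - 1) ^+ 4 * (`|l| * (c0 * M) * (A + 1) ^+ 4 / 320).
  have e2 : e * e = 1 by rewrite -expr2 -real_normK ?num_real // e1 expr1n.
  have E : (A - 1) ^+ 4 * (mean mu F g 3 A / (A - 1) ^+ 4 - c0 * F g) = - (e * hI T).
    rewrite IT -eM mulrBr mulrBr [(A - 1) ^+ 4 * (_ / _)]mulrCA divff ?gt_eqF // mulr1.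
    have -> : e * (e * F g * (c0 * (A - 1) ^+ 4)) = (e * e) * (F g * (c0 * (A - 1) ^+ 4)) by ring.
    have -> : e * (e * mean mu F g 3 A) = (e * e) * mean mu F g 3 A by ring.
    by rewrite e2; ring.
  apply: le_trans up; rewrite E normrN normrM e1 mul1r; exact: ler_norm.
have J2 : (A + 1) = J + 2 by rewrite /A; ring.
have J0 : A - 1 = J by rewrite /A; ring.
rewrite J2 J0 in up.
have p1 : 0 < c0 * J ^+ 4 * (J + 2) ^+ 4 by rewrite !mulr_gt0 ?exprn_gt0 //; lra.
rewrite ler_pdivrMr // -(ler_pM2l M0).
have := le_trans low up; rewrite (_ : J ^+ 4 * _ = (`|l| * (c0 * J ^+ 4 * (J + 2) ^+ 4) * M) / 320); last by ring.
by rewrite ler_pdivlMr ?ltr0n //; lra.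
Qed.

End Sup.

Lemma eig_attain : (exists h, F h != 0) -> exists (M : R) g (e : R), [/\ 0 < M, forall h, `|F h| <= M, `|e| = 1 & e * F g = M].
Proof.
move=> [h0 Fh0]; have [_ invF] := eig_qf.
have ne : [set h : SL2 R | hs h <= lC L] !=set0.
  by have [gam _ Dg] := lD_ex L (1%g : SL2 R); exists (gam * 1)%g; exact: lD_le.
have cF : {within [set h : SL2 R | hs h <= lC L], continuous (fun h => `|F h|)}.
  apply: continuous_subspaceT => h; apply: (@continuous_comp _ _ _ F Num.norm); last exact: norm_continuous.
  exact: phi_continuous.
have K : compact [set h : SL2 R | hs h <= lC L] by exact: hs_compact.
have [g _ gmax] := compact_EVT_max ne K cF.
have FM h : `|F h| <= `|F g|.
  by have [gam Gg Dg] := lD_ex L h; rewrite -(invF gam) //; apply: gmax; apply: mem_set; exact: lD_le.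
exists `|F g|, g, (Num.sg (F g)); split => //.
- by apply: lt_le_trans (FM h0); rewrite normr_gt0.
- rewrite normr_sg (_ : F g != 0) // -normr_gt0; apply: lt_le_trans (FM h0); by rewrite normr_gt0.
- by rewrite -normrEsg.
Qed.

End Eigenfunction.

(** * Packing and mixing of cells *)

Section CellPacking.
Variables (R : realType) (mu : SL2_measure R).
Hypothesis mu_haar : is_haar mu.
Variable L : lattice R.
Local Notation hI := (hI mu).
Local Notation rop := (rop mu).
Local Notation kmass := (kmass mu).
Local Notation qf := (qf L).
Local Notation qI := (qI mu L).
Local Notation n2 := (n2 mu L).
Local Notation Gam := (subgroup_set (lG L)).
Local Notation bvol := (bvol mu L).
Local Notation qvol := (qvol mu L).
Implicit Types (x y g h : SL2 R) (A : R).

Definition orbit_cell x : set (SL2 R) := [set y | exists2 gam, Gam gam & cell L x (gam * y)%g].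
Definition sI x : SL2 R -> R := \1_(orbit_cell x).

Lemma sI_le1 x y : `|sI x y| <= 1. Proof. exact: indic_bound. Qed.

Lemma orbit_cell_open x : open (orbit_cell x).
Proof.
rewrite (_ : orbit_cell x = \bigcup_(gam in Gam) [set y | cell L x (gam * y)%g]).
  apply: bigcup_open => gam _; apply: (@open_comp _ _ (fun y => gam * y)%g (cell L x)) => [y _|]; last exact: cell_open.
  exact: SL2_mul_continuous.
by rewrite predeqE => y; split => [[gam Gg c]|[gam Gg c]]; exists gam.
Qed.

Lemma sI_qf x : qf (sI x).
Proof.
split; first split.
- by apply: measurable_indic; apply: open_measurable_SL2; exact: orbit_cell_open.
- by exists 1 => y; exact: sI_le1.
move=> gam y Gg; have [_ GM GV] := subgroupP (lG L).
rewrite /sI !indicE; congr (nat_of_bool _)%:R; apply/idP/idP => /set_mem [d Gd c]; apply: mem_set.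
  by exists (d * gam)%g; [exact: GM|rewrite -mulgA].
by exists (d * gam^-1)%g; [by apply: GM => //; exact: GV|rewrite mulgA mulgVK].
Qed.

Lemma qI_sI x : qI (sI x) = bvol.
Proof.
rewrite -(bvolE mu_haar L x) (@unfold _ _ mu_haar L _ (4 * hs x)); [|exact: cell_adm|]; last first.
  by move=> y lt; rewrite indicE memNset // => /cell_hs; rewrite leNgt lt.
apply: eq_hI => y; rewrite [\1_(lD L) y]indicE; case: (boolP (y \in lD L)) => [/set_mem Dy|]; last by rewrite !mul0r.
rewrite !mul1r; have [[gam Gg c]|n] := pselect (orbit_cell x y); last first.
  rewrite /sI indicE memNset // big1_seq // => gam /andP[_ /glP[Gg _]].
  by rewrite indicE memNset // => c; apply: n; exists gam.
rewrite /sI indicE mem_set; last by exists gam.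
have gs : gam \in gl mu_haar L (2 * (4 * hs x) * lC L).
  apply/glP; split => //; apply: le_trans (hs_quot gam y) _.
  have := cell_hs c; have := lD_le Dy; have := hs_ge1 y; have := hs_ge1 (gam * y)%g; have := hs_ge1 x => h1 h2 h3 h4 h5.
  by apply: ler_pM; lra.
rewrite (bigD1_seq gam) ?gl_uniq //= indicE mem_set // big1_seq ?addr0 // => d /andP[ne /glP[Gd _]].
rewrite indicE memNset // => cd; case/eqP: ne.
have [_ GM GV] := subgroupP (lG L).
have := cell_uniq (GM _ _ Gd (GV _ Gg)) c; rewrite mulgA mulgVK => /(_ cd) E.
by rewrite -[LHS](mulgVK gam) E mul1g.
Qed.

Lemma hsM3 x y g : hs (x * y * g)%g <= 4 * hs x * hs y * hs g.
Proof.
have := hsM (x * y)%g g; have := hsM x y; have := hs_gt0 g => g0 h1 h2.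
have : hs (x * y)%g * hs g <= 2 * hs x * hs y * hs g by rewrite ler_pM2r //; lra.
lra.
Qed.

Lemma cell_lt2 x y : cell L x y -> hs (x^-1 * y)%g < 2.
Proof. by rewrite /cell /= => h; have := lb_le1 L; lra. Qed.

Lemma orbit_cell_dist x y (u z : SL2 R) A : orbit_cell x u -> orbit_cell y z -> hs (z^-1 * u)%g <= A ->
  exists2 gam, Gam gam & hs (x^-1 * gam * y)%g <= 16 * A.
Proof.
move=> [a Ga ca] [b Gb cb] zu; have [_ GM GV] := subgroupP (lG L).
exists (a * b^-1)%g; first by apply: GM => //; exact: GV.
have -> : (x^-1 * (a * b^-1) * y = (x^-1 * (a * u)) * (z^-1 * u)^-1 * (y^-1 * (b * z))^-1)%g.
  by rewrite !invgM !invgK !mulgA !mulgK.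
apply: le_trans (hsM3 _ _ _) _; rewrite !hsV.
have h1 := cell_lt2 ca; have h2 := cell_lt2 cb.
have g1 := hs_gt0 (x^-1 * (a * u))%g; have g2 := hs_gt0 (y^-1 * (b * z))%g; have g3 := hs_gt0 (z^-1 * u)%g.
move: (hs (x^-1 * (a * u))%g) (hs (z^-1 * u)%g) (hs (y^-1 * (b * z))%g) h1 h2 g1 g2 g3 zu => p q r h1 h2 g1 g2 g3 zu.
have pq : p * q <= 2 * A by apply: ler_pM; lra.
have : p * q * r <= 2 * A * 2 by apply: ler_pM; [rewrite mulr_ge0 ?ltW|lra|lra|lra].
lra.
Qed.

(* Pairwise distant orbits of points carry disjoint cells. *)
Lemma diam_pack (n : nat) : qvol < n.+1%:R * bvol ->
  forall x y, exists2 gam, Gam gam & hs (x^-1 * gam * y)%g <= 32 ^+ n.*2.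
Proof.
move=> lt x; have [G1 GM GV] := subgroupP (lG L).
pose S (k : nat) y := exists2 gam, Gam gam & hs (x^-1 * gam * y)%g <= 32 ^+ k.
have Sle k k' y : (k <= k')%N -> S k y -> S k' y.
  by move=> kk [gam Gg h]; exists gam => //; apply: le_trans h _; rewrite ler_weXn2l //; lra.
(* If the region reached stops growing at one of these scales, it is stable under small steps and
   hence everything, by [near1_gen]. *)
have [[k kn Sk]|no] := pselect (exists2 k : nat, (k <= n)%N & forall y, S k.*2.+1 y -> S k.*2 y).
  have P g : S k.*2 (x * g)%g.
    apply: (near1_gen (b := 1) (P := fun g => S k.*2 (x * g)%g)) => //.
      by exists 1%g => //; rewrite mulg1 mulgA mulVg mul1g hs1 exprn_ege1 //; lra.
    move=> h w [gam Gg hh] hw; apply: Sk; exists gam => //; rewrite !mulgA in hh *.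
    have := hsM (x^-1 * gam * x * h)%g w; have := hs_gt0 (x^-1 * gam * x * h)%g; have := hs_gt0 w => w0 h0 hm.
    have : hs (x^-1 * gam * x * h)%g * hs w <= 32 ^+ k.*2 * 2 by apply: ler_pM; lra.
    rewrite exprS; have : (1 : R) <= 32 ^+ k.*2 by rewrite exprn_ege1 //; lra.
    lra.
  by move=> y; apply: (@Sle k.*2); [rewrite leq_double|rewrite -[y](mulVKg x); exact: P].
have ex (k : 'I_n.+1) : exists y, S k.*2.+1 y /\ ~ S k.*2 y.
  apply: contrapT => ne; apply: no; exists k; first by rewrite -ltnS.
  by move=> y Sy; apply: contrapT => nS; apply: ne; exists y.
have [z zP] := choice ex.
(* If two cells met, the later point would be reached from the earlier one at the cost of 16 for the
   two cells and 2 from [hsM]. The product 32 leads from the scale of exponent 2 k + 1 to 2 k + 2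
   only. *)
have disj (k k' : 'I_n.+1) u : (k < k')%N -> orbit_cell (z k) u -> orbit_cell (z k') u -> False.
  move=> kk cu cu'; have [S1 _] := zP k; have [_ N2] := zP k'; apply: N2.
  have [gam Gg le] := S1; have [d Gd le2] := orbit_cell_dist (A := 1) cu cu' ltac:(by rewrite mulVg hs1).
  exists (gam * d)%g; first exact: GM.
  have -> : (x^-1 * (gam * d) * z k' = (x^-1 * gam * z k) * ((z k)^-1 * d * z k'))%g by rewrite !mulgA mulgK.
  have := hsM (x^-1 * gam * z k)%g ((z k)^-1 * d * z k')%g.
  have h1 := hs_ge1 (x^-1 * gam * z k)%g; have h2 := hs_ge1 ((z k)^-1 * d * z k')%g.
  have : hs (x^-1 * gam * z k)%g * hs ((z k)^-1 * d * z k')%g <= 32 ^+ k.*2.+1 * 16 by apply: ler_pM; lra.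
  move=> h3; have e32 : (32 : R) ^+ k.*2.+2 = 32 ^+ k.*2.+1 * 32 by rewrite exprSr.
  have : (32 : R) ^+ k.*2.+2 <= 32 ^+ k'.*2 by apply: ler_weXn2l; [lra|rewrite -doubleS leq_double].
  by lra.
have le1 u : \sum_(k < n.+1) sI (z k) u <= 1.
  have [[k ck]|nk] := pselect (exists k, orbit_cell (z k) u); last first.
    by rewrite big1 // => k _; rewrite /sI indicE memNset // => c; apply: nk; exists k.
  rewrite (bigD1 k) //= big1 ?addr0; first by rewrite /sI indicE; case: (_ \in _).
  move=> k' ne; rewrite /sI indicE memNset // => ck'.
  by case: (ltngtP k k') => [lt'|lt'|/val_inj E]; [exact: (disj k k' u)|exact: (disj k' k u)|rewrite E eqxx in ne].
have bs : bmf (fun u => \sum_(k < n.+1) sI (z k) u).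
  split; first by apply: measurable_sum => k; have [[]] := sI_qf (z k).
  by exists n.+1%:R => u; apply: le_trans (ler_norm_sum _ _ _) _; apply: le_trans (ler_sum _ (fun k _ => sI_le1 (z k) u)) _; rewrite sumr_const card_ord.
have E : qI (fun u => \sum_(k < n.+1) sI (z k) u) = n.+1%:R * bvol.
  transitivity (hI (fun u => \sum_(k < n.+1) \1_(lD L) u * sI (z k) u)).
    by apply: eq_hI => u; rewrite mulr_sumr.
  rewrite hI_sum //; last by move=> k; apply: qI_adm; have [] := sI_qf (z k).
  rewrite (eq_bigr (fun=> bvol)); last by move=> k _; exact: qI_sI.
  by rewrite sumr_const card_ord mulr_natl.
have b1 : bmf (fun=> 1 : R) by exact: bmf_cst.
have : qI (fun u => \sum_(k < n.+1) sI (z k) u) <= qI (fun=> 1) by apply: qI_le.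
rewrite E qI_cst // mul1r.
by rewrite leNgt lt.
Qed.

(** Pair the indicators of the two orbit cells, each minus its mean, through the operator. If no
    element joins the cells the result is - m v^2 / V, with m the kernel mass, v the cell volume and
    V the volume; the norm bound allows at most N v in absolute value. *)
Lemma mixing A (N c : R) : 1 < A -> 0 < N -> (forall f, qf f -> qI f = 0 -> n2 (rop (ker 3 A) f) <= N ^+ 2 * n2 f) ->
  N * qvol < kmass (ker 3 A) * bvol -> forall x y, exists2 gam, Gam gam & hs (x^-1 * gam * y)%g <= 16 * A.
Proof.
move=> A1 N0 bN lt x y; apply: contrapT => no.
have rk := @rker_ker R 3 A isT isT (ltW A1).
set k := ker 3 A in rk bN lt *; set T := rop k in bN *; set v := bvol in lt *; set V := qvol in lt *; set m := kmass k in lt *.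
have V0 : 0 < V by exact: qvol_gt0.
have v0 : 0 < v by exact: bvol_gt0.
pose kap := v / V.
have bc (a : R) : bmf (fun=> a) by exact: bmf_cst.
have qfc (a : R) : qf (fun=> a) by split.
have qB (p q : SL2 R -> R) : qf p -> qf q -> qf (fun u => p u + - 1 * q u).
  move=> [bp ip] [bq iq]; split; first by apply: bmfD => //; exact: bmfZ.
  by move=> gam u Gg; rewrite ip ?iq.
have qx := sI_qf x; have qy := sI_qf y.
have [bx _] := qx; have [by_ _] := qy.
pose f u := sI x u + -1 * kap; pose g u := sI y u + -1 * kap.
have qff : qf f by exact: qB (qfc kap).
have qfg : qf g by exact: qB (qfc kap).
have [bf _] := qff; have [bg _] := qfg.
have mean0 z : qI (fun u => sI z u + -1 * kap) = 0.
  by rewrite qID //; [rewrite qI_sI qI_cst // -/v -/V /kap; field; rewrite gt_eqF|have [] := sI_qf z].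
have n2v z : n2 (fun u => sI z u + -1 * kap) <= v.
  have [bz _] := sI_qf z.
  have -> : n2 (fun u => sI z u + -1 * kap) = qI (fun u => (1 - 2 * kap) * sI z u + kap ^+ 2).
    by apply: eq_hI => u; congr (_ * _); rewrite /sI indicE; case: (_ \in _) => /=; ring.
  rewrite qID //; last exact: bmfZ.
  rewrite qIZ // qI_sI qI_cst // -/v -/V /kap (_ : _ + _ = v - v ^+ 2 / V); last by field; rewrite gt_eqF.
  by rewrite lerBlDr lerDl mulr_ge0 ?invr_ge0 ?exprn_ge0 // ltW.
have Tf : qf (T f) by exact: rop_qf.
have Tx : qf (T (sI x)) by exact: rop_qf.
have Tc a u : T (fun=> a) u = a * m.
  by rewrite /m -(rop1 mu_haar u rk) -ropZ //; apply: eq_hI => h; rewrite mulr1.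
have z0 u : sI y u * T (sI x) u = 0.
  rewrite {1}/sI indicE; case: (boolP (u \in _)) => [/set_mem cu|_]; last by rewrite mul0r.
  rewrite mul1r -(hI0 mu_haar); apply: eq_hI => h; case: (leP (hs (u^-1 * h)%g) A) => le; last by rewrite /k ker_far ?mul0r.
  by rewrite /sI indicE memNset ?mulr0 // => cx; apply: no; exact: orbit_cell_dist cx cu le.
have [bTx _] := Tx; have [bTf _] := Tf.
have E1 : qI (fun u => g u * T f u) = - kap * m * v.
  have -> : qI (fun u => g u * T f u) = qI (fun u => (- kap * T (sI x) u + (- kap * m) * sI y u) + kap ^+ 2 * m).
    apply: eq_hI => u; congr (_ * _).
    have -> : T f u = T (sI x) u + - 1 * kap * m by rewrite /T /f ropD // -/T Tc.
    by rewrite /g mulrDl mulrDr z0; ring.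
  rewrite qID //; last by apply: bmfD; exact: bmfZ.
  rewrite qID //; [|exact: bmfZ..]; rewrite !qIZ // qI_rop // !qI_sI qI_cst // -/v -/V -/m /kap.
  by field; rewrite gt_eqF.
have bgT : bmf (fun u => -1 * (g u * T f u)) by apply: bmfZ; exact: bmfM.
have bb : bmf (fun u => (2 * N)^-1 * (T f u * T f u) + N / 2 * (g u * g u)).
  by apply: bmfD; apply: bmfZ; exact: bmfM.
(* The inequality of means with weight N, so that both squares contribute N v / 2. *)
have pw u : lD L u -> -1 * (g u * T f u) <= (2 * N)^-1 * (T f u * T f u) + N / 2 * (g u * g u).
  move=> _; have : 0 <= (2 * N)^-1 * (T f u + N * g u) ^+ 2 by rewrite mulr_ge0 ?sqr_ge0 // invr_ge0 mulr_ge0 // ltW.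
  rewrite (_ : _ * (T f u + N * g u) ^+ 2 = (2 * N)^-1 * (T f u * T f u) + N / 2 * (g u * g u) + g u * T f u); last by field; rewrite gt_eqF.
  by lra.
have := qI_le mu_haar bgT bb pw; have bgg := bmfM bg bg; have bTT := bmfM bTf bTf.
rewrite qIZ ?E1 //; last exact: bmfM.
rewrite qID ?qIZ //; [|exact: bmfZ..].
rewrite -!/(n2 _) => H.
have h1 := bN f qff (mean0 x); have h2 := n2v x; have h3 := n2v y.
have h4 : (2 * N)^-1 * n2 (T f) <= N / 2 * v.
  rewrite mulrC ler_pdivrMr ?mulr_gt0 //; apply: le_trans h1 _.
  rewrite (_ : N / 2 * v * (2 * N) = N ^+ 2 * v); last by field.
  by rewrite ler_pM2l ?exprn_gt0.
have h5 : N / 2 * n2 g <= N / 2 * v by rewrite ler_pM2l // divr_gt0.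
have : kap * m * v <= N * v by lra.
rewrite ler_pM2r // /kap mulrAC ler_pdivrMr // mulrC => le.
by move: lt; rewrite ltNge le.
Qed.

End CellPacking.

(** * From averaging operators to the Laplacian *)

Section LaplaceSpectrum.
Variables (R : realType) (mu : SL2_measure R).
Hypothesis mu_haar : is_haar mu.
Variable L : lattice R.
Local Notation G := (borelSL2 R).
Local Notation rop := (rop mu).
Local Notation kmass := (kmass mu).
Local Notation qf := (qf L).
Local Notation qI := (qI mu L).
Local Notation n2 := (n2 mu L).
Local Notation qvol := (qvol mu L).
Implicit Types (x y g h : SL2 R) (s t A : R) (k : R -> R).
Variable c0 : R.
Hypothesis c0_gt0 : 0 < c0.
Hypothesis c0P : kernel_masses mu c0.

Lemma rkerZ (c : R) k : rker k -> rker (fun t => c * k t).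
Proof.
move=> [C [mk kC k0 kl]]; have C0 : 0 <= C by apply: le_trans (kC 1 (lexx _)).
exists (Num.max C (`|c| * C)); split.
- exact: measurable_funM.
- by move=> t t1; rewrite normrM le_max; apply/orP; right; apply: ler_wpM2l => //; exact: kC.
- by move=> t; rewrite gt_max => /andP[/k0 -> _]; rewrite mulr0.
- move=> s t s1 t1; rewrite -mulrBr normrM; apply: (@le_trans _ _ (`|c| * C * `|s - t|)).
    by rewrite -mulrA ler_wpM2l //; exact: kl.
  by rewrite ler_wpM2r // le_max lexx orbT.
Qed.

Lemma rkerD k k' : rker k -> rker k' -> rker (fun t => k t + k' t).
Proof.
move=> [C [mk kC k0 kl]] [C' [mk' kC' k0' kl']].
have C0 : 0 <= C by apply: le_trans (kC 1 (lexx _)).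
have C0' : 0 <= C' by apply: le_trans (kC' 1 (lexx _)).
exists (C + C'); split.
- exact: measurable_funD.
- by move=> t t1; apply: le_trans (ler_normD _ _) _; apply: lerD; [exact: kC|exact: kC'].
- by move=> t lt; rewrite k0 ?k0' ?addr0 //; lra.
- move=> s t s1 t1; rewrite opprD addrACA mulrDl; apply: le_trans (ler_normD _ _) _.
  by apply: lerD; [exact: kl|exact: kl'].
Qed.

(* The radial kernel of the Laplacian composed with the operator of kernel [ker 3 A]. *)
Definition lapker A t : R := (6 * (A ^+ 2 - 1) * ker 1 A t + - (18 * A) * ker 2 A t) + 12 * ker 3 A t.

Lemma rker_lapker A : 1 < A -> rker (lapker A).
Proof.
move=> A1; have r j : (0 < j)%N -> (j <= 3)%N -> rker (ker j A) by move=> j0 j3; apply: rker_ker => //; exact: ltW.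
by apply: rkerD; [apply: rkerD|]; apply: rkerZ; exact: r.
Qed.

Lemma lapker_rop (f : SL2 R -> R) A g : 1 < A -> bmf f -> rop (lapker A) f g =
  6 * (A ^+ 2 - 1) * mean mu f g 1 A - 18 * A * mean mu f g 2 A + 12 * mean mu f g 3 A.
Proof.
move=> A1 bf; have r j : (0 < j)%N -> (j <= 3)%N -> rker (ker j A) by move=> j0 j3; apply: rker_ker => //; exact: ltW.
have a1 := kf_adm g (r 1%N isT isT) bf; have a2 := kf_adm g (r 2%N isT isT) bf; have a3 := kf_adm g (r 3%N isT isT) bf.
rewrite /mean /rop -!hIZ // -hIB //; [|exact: admZ..]; rewrite -hID //; [|by apply: admB; exact: admZ|exact: admZ].
by apply: eq_hI => h; rewrite /lapker; ring.
Qed.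

(** A continuous function nonzero at [x] has positive mass on a small open set, and [ball_mass]
    transfers this mass to the quotient. *)
Lemma n2_eq0 (f : SL2 R -> R) : qf f -> continuous f -> n2 f = 0 -> forall x, f x = 0.
Proof.
move=> qff cf f0 x; apply/eqP/negPn/negP => fx.
have [bf invf] := qff.
have qff2 : qf (fun y => f y * f y) by split; [exact: bmfM|move=> gam y Gg; rewrite invf].
pose C := hs x + 1; have [N N0 NP] := ball_mass mu_haar C qff2.
have := NP _ qff2; rewrite (_ : qI (fun y => `|f y * f y|) = 0); last first.
  by rewrite -f0; apply: eq_hI => y; rewrite ger0_norm // -expr2 sqr_ge0.
rewrite mulr0 leNgt => /negP; apply.
have mU : measurable ([set y | hs y <= C] : set G) by exact: hs_measurable.
have aI : adm (\1_[set y : SL2 R | hs y <= C]) by apply: (@adm_indic R [set y : SL2 R | hs y <= C] C).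
pose U := [set y | `|f x| / 2 < `|f y|] `&` [set y : SL2 R | hs y < C].
have cn : continuous (fun y => `|f y|).
  by move=> y; apply: (@continuous_comp _ _ _ f Num.norm); [exact: cf|exact: norm_continuous].
have fx0 : 0 < `|f x| by rewrite normr_gt0.
apply: (@hI_gt0 _ mu mu_haar _ U ((`|f x| / 2) ^+ 2)).
- have [mf [M fM]] := bf; apply: (admMr (C := M * M)) aI.
    by apply: measurableT_comp => //; exact: measurable_funM.
  by move=> y; rewrite normr_id normrM ler_pM.
- by move=> y; rewrite mulr_ge0 // indicE.
- by rewrite exprn_gt0 // divr_gt0.
- apply: openI; last exact: hs_open.
  by apply: (@open_comp _ _ (fun y => `|f y|) [set z | `|f x| / 2 < z]) => [y _|]; [exact: cn|exact: open_gt].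
- by exists x; split; rewrite /= ?/C; lra.
move=> y [/= fy hy]; rewrite indicE mem_set ?mul1r /=; last exact: ltW.
by rewrite normrM expr2 ler_pM // ?ltW // divr_ge0.
Qed.

Section FixedSpace.
Variables (A c : R).
Hypothesis A1 : 1 < A.
Hypothesis c_neq0 : c != 0.
Let k := ker 3 A.

Definition eigsp (f : SL2 R -> R) := [/\ qf f, qI f = 0 & forall x, rop k f x = c * f x].

Lemma rk3 : rker k. Proof. by apply: rker_ker => //; exact: ltW. Qed.

Lemma mean0_closed : closed_subspace L (fun f => qf f /\ qI f = 0).
Proof.
split.
- by move=> f [].
- move=> a f g [[bf invf] f0] [[bg invg] g0]; have bz := bmfZ a bf; split.
    by split; [exact: bmfD|move=> gam x Gg; rewrite invf ?invg].
  by rewrite qID // qIZ // f0 g0 mulr0 addr0.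
move=> f_ g U UF fV cg fg; have PF := @ultra_proper _ U UF.
have bg : qf g.
  split; last first.
    move=> gam x Gg; apply/eqP; rewrite -subr_eq0 -normr_le0; apply/ler_addgt0Pr => e e0; rewrite add0r.
    have [n nP] := filter_ex (fg (e / 2) (divr_gt0 e0 (ltr0n R 2))).
    have [[_ ivn] _] := fV n; have E := ivn gam x Gg; have := nP x; have := nP (gam * x)%g; rewrite E => h1 h2.
    rewrite (_ : _ - _ = (f_ n x - g x) - (f_ n x - g (gam * x)%g)); last by ring.
    by apply: le_trans (ler_normB _ _) _; lra.
  split; first exact: continuous_measurable_SL2.
  have [n nP] := filter_ex (fg 1 ltr01); have [[[_ [M fM]] _] _] := fV n; exists (M + 1) => x.
  rewrite (_ : g x = f_ n x - (f_ n x - g x)); last by ring.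
  by apply: le_trans (ler_normB _ _) _; apply: lerD; [exact: fM|exact: nP].
split => //; apply/eqP; rewrite -normr_le0; apply/ler_addgt0Pr => e e0; rewrite add0r.
have V0 := qvol_gt0 mu_haar L.
have [n nP] := filter_ex (fg (e / qvol) (divr_gt0 e0 V0)); have [[bf _] f0] := fV n; have [bg' _] := bg.
have H (s : R) : `|s| = 1 -> s * qI g <= e.
  move=> s1; have -> : s * qI g = qI (fun x => s * g x + - s * f_ n x).
    by rewrite qID ?qIZ // ?f0 ?mulr0 ?addr0 //; exact: bmfZ.
  have -> : e = qI (fun=> e / qvol) by rewrite qI_cst // mulfVK // gt_eqF.
  apply: qI_le => //; [by apply: bmfD; exact: bmfZ|exact: bmf_cst|move=> x _].
  rewrite mulNr -mulrBr; apply: le_trans (ler_norm _) _; rewrite normrM s1 mul1r distrC; exact: nP.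
by rewrite ler_norml; have := H 1 (normr1 R); have := H (-1) ltac:(by rewrite normrN normr1); lra.
Qed.

Lemma eigsp_closed : closed_subspace L eigsp.
Proof.
have [H1 H2 H3] := mean0_closed; split.
- by move=> f [].
- move=> a f g [qf1 f0 fE] [qg g0 gE]; have [q i] := H2 a f g (conj qf1 f0) (conj qg g0); split => // x.
  have [bf _] := qf1; have [bg _] := qg.
  by rewrite ropD ?ropZ // ?fE ?gE; [ring|exact: rk3|exact: rk3|exact: bmfZ].
move=> f_ g U UF fV cg fg; have PF := @ultra_proper _ U UF.
have fV' n : qf (f_ n) /\ qI (f_ n) = 0 by have [] := fV n.
have [qg g0] := H3 f_ g U UF fV' cg fg; split => // x.
apply/eqP; rewrite -subr_eq0 -normr_le0; apply/ler_addgt0Pr => e e0; rewrite add0r.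
set K := kmass (fun t => `|k t|).
have K0 : 0 <= K by apply: hI_ge0.
have Kc : 0 < K + `|c| by rewrite ltr_wpDl // normr_gt0.
have [n nP] := filter_ex (fg (e / (K + `|c|)) (divr_gt0 e0 Kc)).
have [[bf _] _ fE] := fV n; have [bg _] := qg.
have H : `|rop k (fun y => f_ n y - g y) x| <= e / (K + `|c|) * K.
  by apply: rop_le => //; [exact: rk3|have := bmfD bf (bmfZ (-1) bg); congr bmf; apply/funext => y; rewrite mulN1r].
rewrite ropB // ?fE in H; last exact: rk3.
rewrite (_ : _ - _ = c * (f_ n x - g x) - (c * f_ n x - rop k g x)); last by ring.
apply: le_trans (ler_normB _ _) _; rewrite normrM.
have := nP x => /(ler_wpM2l (normr_ge0 c)) H2'.
have -> : e = `|c| * (e / (K + `|c|)) + e / (K + `|c|) * K by field; rewrite gt_eqF.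
exact: lerD.
Qed.

Lemma eigsp_stable k' : rker k' -> forall f, eigsp f -> eigsp (rop k' f).
Proof.
move=> rk' f [qff f0 fE]; split; first exact: rop_qf.
  by rewrite qI_rop // f0 mulr0.
move=> x; have := rop_comm mu_haar rk3 rk' qff => /(congr1 (fun F => F x)) ->.
rewrite -ropZ //; last by case: qff.
by apply: eq_hI => y; rewrite fE.
Qed.

End FixedSpace.
End LaplaceSpectrum.

Section LaplaceEigenvalues.
Variables (R : realType) (mu : SL2_measure R).
Hypothesis mu_haar : is_haar mu.
Variable L : lattice R.
Local Notation rop := (rop mu).
Local Notation kmass := (kmass mu).
Local Notation qf := (qf L).
Local Notation qI := (qI mu L).
Local Notation n2 := (n2 mu L).
Local Notation Gam := (subgroup_set (lG L)).
Local Notation qvol := (qvol mu L).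
Implicit Types (x y g h : SL2 R) (A : R) (k : R -> R).
Variable c0 : R.
Hypothesis c0_gt0 : 0 < c0.
Hypothesis c0P : kernel_masses mu c0.
Variable J : R.
Hypothesis J1 : 1 <= J.
Hypothesis diam : forall x y : SL2 R, exists2 gam, Gam gam & hs (x^-1 * gam * y)%g <= J.

Definition gap_bound : R := 320 * qvol / (c0 * J ^+ 4 * (J + 2) ^+ 4).

Lemma gap_bound_gt0 : 0 < gap_bound.
Proof.
have V0 : 0 < qvol by exact: qvol_gt0.
have j1 := J1; have H : 0 < c0 * J ^+ 4 * (J + 2) ^+ 4.
  by apply: mulr_gt0; [apply: mulr_gt0 => //|]; apply: exprn_gt0; lra.
have n320 : (0 : R) < 320 by rewrite ltr0n.
exact: (divr_gt0 (mulr_gt0 n320 V0) H).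
Qed.

Lemma eigenvalue_gap l : is_eigenvalue Gam l -> l != 0 -> gap_bound <= l.
Proof.
move=> [f [sf fi [z z0 fz] fe]] l0.
have ne : exists h, phi f [::] h != 0.
  exists (gz (complex.Re z) (complex.Im z)); rewrite /phi /= /in_coords /=.
  by have [-> ->] := gz_XY (complex.Re z) z0; case: (z) fz.
have [M [g [e [M0 FM e1 eM]]]] := eig_attain sf fi ne.
have l_ge0 := eig_sign_ge0 mu_haar c0_gt0 c0P sf fi fe FM M0 e1 eM.
have F0 := eig_mean0 mu_haar c0_gt0 c0P sf fi fe l0.
have := eig_gap mu_haar c0_gt0 c0P sf fi fe FM M0 e1 eM F0 J1 diam.
by rewrite ger0_norm.
Qed.

(** Adds to [spectral] the case of an operator that vanishes on [V], where the eigenvalue is 0. *)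
Lemma spectral_zero (V : (SL2 R -> R) -> Prop) k : closed_subspace L V -> rker k -> (forall f, V f -> V (rop k f)) ->
  (exists2 f, V f & exists x, f x != 0) -> exists (c : R) f, [/\ V f, exists x, f x != 0 & forall x, rop k f x = c * f x].
Proof.
move=> cV rk VT [f Vf fx].
have [[f1 Vf1 pos]|no] := pselect (exists2 f1, V f1 & 0 < n2 (rop k f1)).
  have [N [h [N0 Vh hx [hE|hE] _]]] := spectral mu_haar cV rk VT Vf1 pos.
    by exists N, h.
  by exists (- N), h.
exists 0, f; split => // x; rewrite mul0r.
have qfT := cs_qf cV (VT _ Vf).
apply: (n2_eq0 mu_haar qfT); first by apply: (rop_continuous mu_haar rk); exact: cs_qf cV _ Vf.
apply/eqP; rewrite eq_le n2_ge0 andbT leNgt; apply/negP => pos; apply: no; by exists f.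
Qed.

(** Means over shrinking balls recover the value at the centre, so pointwise identities can be
    tested after averaging with all small kernels. *)
Lemma approx_identity (w : SL2 R -> R) (g : SL2 R) (u : R * R -> R) : okf w -> (forall h, w h = u (X h, Y h)) ->
  {for (X g, Y g), continuous u} -> forall e : R, 0 < e -> exists2 d : R, 1 < d & forall A, 1 < A -> A < d ->
  `|rop (ker 3 A) w g - c0 * (A - 1) ^+ 4 * w g| <= e * (c0 * (A - 1) ^+ 4).
Proof.
move=> ow wu cu e e0; have [d d1 dP] := near_point cu e0; exists d => // A A1 Ad.
by apply: (point_mean mu_haar c0P ow A1) => h lt; rewrite !wu; apply: dP; exact: lt_trans lt Ad.
Qed.

Lemma approx_eq (w : SL2 R -> R) (x y : SL2 R) (u : R * R -> R) : okf w -> (forall h, w h = u (X h, Y h)) ->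
  (forall g, {for (X g, Y g), continuous u}) ->
  (forall A, 1 < A -> rop (ker 3 A) w x = rop (ker 3 A) w y) -> w x = w y.
Proof.
move=> ow wu cu E; apply/eqP; rewrite -subr_eq0 -normr_le0; apply/ler_addgt0Pr => e e0; rewrite add0r.
have e2 : 0 < e / 2 by rewrite divr_gt0.
have [d d1 dP] := approx_identity ow wu (cu x) e2; have [d' d1' dP'] := approx_identity ow wu (cu y) e2.
pose A := (1 + Num.min d d') / 2.
have m1 : 1 < Num.min d d' by rewrite lt_min d1.
have A1 : 1 < A by rewrite /A; lra.
have Ad : A < d by have : Num.min d d' <= d by [rewrite ge_min lexx]; rewrite /A; lra.
have Ad' : A < d' by have : Num.min d d' <= d' by [rewrite ge_min lexx orbT]; rewrite /A; lra.
have H := dP A A1 Ad; have H' := dP' A A1 Ad'; rewrite E // in H.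
have m0 : 0 < c0 * (A - 1) ^+ 4 by rewrite mulr_gt0 // exprn_gt0 // subr_gt0.
move: (c0 * (A - 1) ^+ 4) m0 H H' => m m0 H H'.
rewrite -(ler_pM2l m0) -[X in X * `|_|](gtr0_norm m0) -normrM.
rewrite (_ : m * (w x - w y) = (rop (ker 3 A) w y - m * w y) - (rop (ker 3 A) w y - m * w x)); last by ring.
by apply: le_trans (ler_normB _ _) _; lra.
Qed.

Lemma lap_point f : smooth_on_half_plane f -> exists2 u : R * R -> R, (forall h, lap f h = u (X h, Y h)) &
  forall g : SL2 R, {for (X g, Y g), continuous u}.
Proof.
move=> sf; exists (fun p => p.2 ^+ 2 * (iter_partial [:: true; true] (in_coords f) p + iter_partial [:: false; false] (in_coords f) p)) => // g.
have c1 := differentiable_continuous (sf [:: true; true] (X g, Y g) (Y_gt0 g)).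
have c2 := differentiable_continuous (sf [:: false; false] (X g, Y g) (Y_gt0 g)).
move: (iter_partial [:: true; true] _) (iter_partial [:: false; false] _) c1 c2 => p1 p2 c1 c2.
have s2 : {for (X g, Y g), continuous (fun p : R * R => p.2)} by exact: cvg_snd.
exact: (cvgM (cvgM s2 s2) (cvgD c1 c2)).
Qed.

(** The operator of [lapker A] commutes with that of [ker 3 A], so it has an eigenvector F inside
    the eigenspace, and F is smooth. Averaging with [ker 3 B] turns [lap] into [lapker B]; by
    commutation every such average of lap F - (m / c) F vanishes, hence so does the function
    itself. *)
Lemma laplace_eigen A c : 1 < A -> c != 0 -> (exists2 f, eigsp mu L A c f & exists x, f x != 0) ->
  exists l f, [/\ [/\ smooth_on_half_plane f, forall z g, upper_half_plane z -> Gam g -> f (right_action z g) = f z &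
      forall z, upper_half_plane z -> laplace_beltrami f z = l * f z],
    exists h, phi f [::] h != 0, l != 0 & forall x, rop (ker 3 A) (phi f [::]) x = c * phi f [::] x].
Proof.
move=> A1 cn0 ex; have rk := rk3 A1; have rl := rker_lapker A1.
have [m [F [VF Fx mF]]] := spectral_zero (eigsp_closed mu_haar L A1 cn0) rl (eigsp_stable mu_haar A1 rl) ex.
have [qF F0 cF] := VF; have [bF invF] := qF.
have FE g : F g = c^-1 * rop (ker 3 A) F g by rewrite cF mulKf.
have rotF g (u : SL2 R) : rotation u -> F (g * u)%g = F g by move=> ru; rewrite FE rop_rotation // -FE.
have fF : fixcl mu A c^-1 F.
  by have [mF' [M FM]] := bF; split => // C; exists M => h _; exact: FM.
pose f := toH F.
have sf : smooth_on_half_plane f by apply: (fixcl_smooth mu_haar (ltW A1) fF).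
have fE h : phi f [::] h = F h.
  rewrite /phi /= /in_coords /f /toH /=; have [gX gY] := gz_XY (X h) (Y_gt0 h).
  exact: rot_inv_XY.
have fE' : phi f [::] = F by apply/funext.
have oL : okf (lap f).
  have o w := phi_ok sf w; have oY := ok_Y R.
  by have := okM (okM oY oY) (okD (o [:: true; true]) (o [:: false; false])); congr okf; apply/funext => h; rewrite /lap expr2.
have gr B g : 1 < B -> rop (ker 3 B) (lap f) g = rop (lapker B) F g.
  by move=> B1; rewrite (green mu_haar sf g (ltW B1)) fE' -lapker_rop.
have [u uE uc] := lap_point sf.
have qL : qf (lap f).
  have inv gam x : Gam gam -> lap f (gam * x)%g = lap f x.
    move=> Gg; apply: (approx_eq oL uE uc) => B B1; rewrite !gr //.
    by have [_ ->] := rop_qf mu_haar (rker_lapker B1) qF.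
  split => //; split; first by case: oL.
  have [M M1 MP] := lbd_pos (lC L) (ok_b oL).
  by exists M => x; have [gam Gg Dg] := lD_ex L x; rewrite -(inv gam) // MP // lD_le.
have [bL _] := qL.
pose l := - (m / c).
have lapE g : lap f g = - l * F g.
  have key B x : 1 < B -> rop (ker 3 B) (fun h => lap f h - m / c * F h) x = 0.
    move=> B1; have rB := rk3 B1.
    rewrite ropB // ?ropZ //; last exact: bmfZ.
    apply: (mulfI cn0); rewrite mulr0 mulrBr mulrA mulrCA divff // mulr1.
    have -> : c * rop (ker 3 B) (lap f) x = rop (ker 3 A) (rop (ker 3 B) (lap f)) x.
      have -> : rop (ker 3 B) (lap f) = rop (lapker B) F by apply/funext => g'; exact: gr.
      have [_ _ ->] := eigsp_stable mu_haar A1 (rker_lapker B1) VF; by [].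
    rewrite (rop_comm mu_haar rk rB qL).
    have -> : rop (ker 3 A) (lap f) = (fun g' => m * F g') by apply/funext => g'; rewrite gr // mF.
    by rewrite ropZ // subrr.
  have ow : okf (fun h => lap f h - m / c * F h).
    have oF : okf F by rewrite -fE'; exact: phi_ok.
    have := okD oL (okM (ok_cst (- (m / c))) oF); congr okf; apply/funext => h; by rewrite mulNr.
  have uc' : {for (X g, Y g), continuous (fun p => u p - m / c * in_coords f p)}.
    have cf := differentiable_continuous (sf [::] (X g, Y g) (Y_gt0 g)).
    apply: (@cvgB _ _ _ (nbhs (X g, Y g))); first exact: uc.
    by apply: (@cvgM _ _ (nbhs (X g, Y g))); [exact: cvg_cst|exact: cf].
  have uE' h : lap f h - m / c * F h = u (X h, Y h) - m / c * in_coords f (X h, Y h) by rewrite uE -fE.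
  suff : lap f g - m / c * F g = 0 by rewrite /l opprK; lra.
  apply/eqP; rewrite -normr_le0; apply/ler_addgt0Pr => e e0; rewrite add0r.
  have [d d1 dP] := approx_identity ow uE' uc' e0; pose B := (1 + d) / 2.
  have B1 : 1 < B by rewrite /B; lra.
  have Bd : B < d by rewrite /B; lra.
  have := dP B B1 Bd; rewrite key // sub0r normrN normrM.
  have m0 : 0 < c0 * (B - 1) ^+ 4 by rewrite mulr_gt0 // exprn_gt0 // subr_gt0.
  by rewrite (gtr0_norm m0) mulrC ler_pM2r.
have gzE (z : R[i]) : upper_half_plane z -> X (gz (complex.Re z) (complex.Im z)) = complex.Re z /\ Y (gz (complex.Re z) (complex.Im z)) = complex.Im z.
  by move=> z0; exact: gz_XY.
have finv (z : R[i]) g : upper_half_plane z -> Gam g -> f (right_action z g) = f z.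
  move=> z0 Gg; have [gX gY] := gzE z z0; have [_ _ GV] := subgroupP (lG L).
  have zE : z = Complex (X (gz (complex.Re z) (complex.Im z))) (Y (gz (complex.Re z) (complex.Im z))).
    by rewrite gX gY; case: (z).
  rewrite /right_action {1}zE mobius_XY.
  have -> h : f (Complex (X h) (Y h)) = F h by rewrite -fE.
  by rewrite invF; [|exact: GV].
have feig (z : R[i]) : upper_half_plane z -> laplace_beltrami f z = l * f z.
  move=> z0; have [gX gY] := gzE z z0; have := lapE (gz (complex.Re z) (complex.Im z)).
  rewrite -[f z]/(F (gz (complex.Re z) (complex.Im z))) /laplace_beltrami /lap /phi gX gY /= => E.
  by rewrite mulNr E mulNr opprK.
exists l, f; split; first by split.
- by have [x Fx0] := Fx; exists x; rewrite fE.
- have ne : exists h, phi f [::] h != 0 by have [x Fx0] := Fx; exists x; rewrite fE.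
  (* A function of mean zero cannot be harmonic: the gap estimate keeps |l| away from 0. *)
  have [M [g [e [M0 FM e1 eM]]]] := eig_attain sf finv ne.
  have F0' : qI (phi f [::]) = 0 by rewrite fE'.
  have := eig_gap mu_haar c0_gt0 c0P sf finv feig FM M0 e1 eM F0' J1 diam.
  by move=> le; rewrite -normr_gt0; apply: lt_le_trans le; exact: gap_bound_gt0.
- by move=> x; rewrite fE' cF.
Qed.

End LaplaceEigenvalues.

(** * The operator norm and the existence of eigenvalues *)

Section OperatorBound.
Variables (R : realType) (mu : SL2_measure R).
Hypothesis mu_haar : is_haar mu.
Variable L : lattice R.
Local Notation rop := (rop mu).
Local Notation kmass := (kmass mu).
Local Notation qf := (qf L).
Local Notation qI := (qI mu L).
Local Notation n2 := (n2 mu L).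
Local Notation Gam := (subgroup_set (lG L)).
Local Notation qvol := (qvol mu L).
Implicit Types (x y g h : SL2 R) (A : R) (k : R -> R).
Variable c0 : R.
Hypothesis c0_gt0 : 0 < c0.
Hypothesis c0P : kernel_masses mu c0.
Variable J : R.
Hypothesis J1 : 1 <= J.
Hypothesis diam : forall x y : SL2 R, exists2 gam, Gam gam & hs (x^-1 * gam * y)%g <= J.

Lemma mean0_stable k : rker k -> forall f, qf f /\ qI f = 0 -> qf (rop k f) /\ qI (rop k f) = 0.
Proof. by move=> rk f [qff f0]; split; [exact: rop_qf|rewrite qI_rop // f0 mulr0]. Qed.

(** The extremal eigenspace on functions of mean zero contains a Laplace eigenfunction, so the
    operator norm is read off one solution of the radial equation. *)
Lemma op_eigen A f1 : 1 < A -> qf f1 -> qI f1 = 0 -> 0 < n2 (rop (ker 3 A) f1) ->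
  exists (N c l : R) f, [/\ 0 < N, `|c| = N, is_eigenvalue Gam l /\ l != 0,
    [/\ smooth_on_half_plane f, forall z g, upper_half_plane z -> Gam g -> f (right_action z g) = f z &
      forall z, upper_half_plane z -> laplace_beltrami f z = l * f z] /\
    ((exists h, phi f [::] h != 0) /\ forall x, rop (ker 3 A) (phi f [::]) x = c * phi f [::] x) &
    forall w, qf w -> qI w = 0 -> n2 (rop (ker 3 A) w) <= N ^+ 2 * n2 w].
Proof.
move=> A1 qf1 f10 pos; have rk := rk3 A1.
have [N [F [N0 [qF F0] Fx FE HN]]] := spectral mu_haar (mean0_closed mu_haar L) rk (mean0_stable rk) (conj qf1 f10) pos.
have [c [cN cE]] : exists c, `|c| = N /\ forall x, rop (ker 3 A) F x = c * F x.
  by case: FE => FE; [exists N|exists (- N)]; rewrite ?normrN gtr0_norm.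
have cn0 : c != 0 by rewrite -normr_gt0 cN.
have ex : exists2 f, eigsp mu L A c f & exists x, f x != 0 by exists F.
have [l [f [[sf fi fe] [h fh] l0 fT]]] := laplace_eigen mu_haar c0_gt0 c0P J1 diam A1 cn0 ex.
exists N, c, l, f; split => //.
- split => //; exists f; split => //; exists (Complex (X h) (Y h)) => //; exact: Y_gt0.
- by split => //; split => //; exists h.
by move=> h' qh h0; exact: HN.
Qed.

(** Evaluate the averaging identity where |F| is maximal: there the decay of the mean is a bound for
    the eigenvalue itself. *)
Lemma op_bound r A : 0 <= r -> r <= 1 ->
  (forall l, is_eigenvalue Gam l -> l != 0 -> l <= 3 / 16 -> r <= 1 - Num.sqrt (1 - 4 * l)) -> 2 <= A ->
  forall f, qf f -> qI f = 0 ->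
  n2 (rop (ker 3 A) f) <= 9602 * expR 36 * (c0 * (A - 1) ^+ 4) ^+ 2 * expR (- (r / 2) * ln A) * n2 f.
Proof.
move=> r0 r1 rl A2 f qff f0; have A1 : 1 < A by lra.
have K0 : 0 <= 9602 * expR 36 * (c0 * (A - 1) ^+ 4) ^+ 2 * expR (- (r / 2) * ln A).
  by apply: mulr_ge0; [apply: mulr_ge0; [apply: mulr_ge0; [exact: ler0n|exact: expR_ge0]|exact: sqr_ge0]|exact: expR_ge0].
case: (ltP 0 (n2 (rop (ker 3 A) f))) => [pos|le]; last first.
  by apply: le_trans le _; apply: mulr_ge0 => //; exact: n2_ge0.
have [N [c [l [w [N0 cN [lE l0] [[sw wi we] [wh wT]] HN]]]]] := op_eigen A1 qff f0 pos.
apply: le_trans (HN f qff f0) _; apply: ler_wpM2r; first exact: n2_ge0.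
have [M [g [e [M0 FM e1 eM]]]] := eig_attain sw wi wh.
have up := eig_upper mu_haar c0P sw wi we FM g r0 r1 (rl l lE l0) A2.
have p4 : 0 < (A - 1) ^+ 4 by rewrite exprn_gt0 // subr_gt0.
have E : nratio (mean mu (phi w [::]) g 3) A = c * phi w [::] g / (A - 1) ^+ 4 by rewrite /nratio /mean wT.
have wg : phi w [::] g ^+ 2 = M ^+ 2.
  by rewrite -eM exprMn -[e ^+ 2]real_normK ?num_real // e1 expr1n mul1r.
have cc : c ^+ 2 = N ^+ 2 by rewrite -[c ^+ 2]real_normK ?num_real // cN.
move: up; rewrite E !exprMn wg cc exprVn => up.
have M2 : 0 < M ^+ 2 by rewrite exprn_gt0.
rewrite -(ler_pM2r M2).
have p8 : 0 < (A - 1) ^+ 4 ^+ 2 by rewrite exprn_gt0.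
move: up; rewrite ler_pdivrMr // => /le_trans; apply.
by rewrite le_eqVlt; apply/orP; left; apply/eqP; ring.
Qed.

Lemma half_gap (x gam : SL2 R) : Gam gam -> gam != 1%g -> 1 + 6 * (lb L / 2) <= hs (x^-1 * gam * x)%g.
Proof. by move=> Gg n1; have := @l_gap _ L x gam Gg n1; have := lb_gt0 L; move: (hs _) => z; lra. Qed.

(** Halving the cell parameter makes the cell volume strictly less than the volume of the quotient,
    so the indicator of an orbit cell is not almost everywhere equal to its mean. *)
Definition half_lattice : lattice R.
Proof.
refine (@Lattice R (lG L) (lb L / 2) (lC L) (lD L) _ _ half_gap (@lD_measurable _ L) (@lD_le _ L) (lD_ex L) (@lD_uniq _ L)).
- by rewrite divr_gt0 // lb_gt0.
- by have := lb_le1 L; have := lb_gt0 L; lra.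
Defined.

(** [lambda1] is an infimum and would be 0 if there were no nonzero eigenvalue at all. *)
Lemma eigenvalue_exists : exists l, is_eigenvalue Gam l /\ l != 0.
Proof.
pose L' := half_lattice; have b0 := lb_gt0 L; have b1 := lb_le1 L.
set v := bvol mu L'.
have V0 : 0 < qvol by exact: qvol_gt0.
have vV : v < qvol.
  apply: lt_le_trans (qvol_ge_bvol mu_haar L); rewrite -subr_gt0.
  have a1 := cell_adm L (1%g : SL2 R); have a2 := cell_adm L' (1%g : SL2 R).
  rewrite /v /bvol -hIB //.
  pose U : set (SL2 R) := [set h | 1 + lb L / 2 < hs h] `&` [set h | hs h < 1 + lb L].
  apply: (@hI_gt0 _ mu mu_haar _ U 1 (admB a1 a2)) => //.
  - move=> x; rewrite subr_ge0 !indicE /cell /=; case: (boolP (x \in [set y | hs (1^-1 * y)%g < 1 + lb L / 2])) => [/set_mem h|_] //.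
    rewrite mem_set //; move: h; rewrite /= => h; lra.
  - apply: openI; last exact: hs_open.
    by apply: (@open_comp _ _ (@hs R) [set z | 1 + lb L / 2 < z]) => [y _|]; [exact: hs_continuous|exact: open_gt].
  - exists (E12 (Num.sqrt (3 * lb L / 2))); rewrite /U /= hs_E12 sqr_sqrtr; last by lra.
    by split; rewrite /=; lra.
  - move=> x [/= h1 h2]; rewrite !indicE mem_set; last by rewrite /cell /= invg1 mul1g.
    by rewrite memNset ?subr0 // /cell /= invg1 mul1g => h3; lra.
pose x : SL2 R := 1%g.
pose kap := v / qvol.
pose f h := sI L' x h + -1 * kap.
have qx : qf (sI L' x) by exact: (sI_qf L' x).
have qff : qf f.
  have [bx ix] := qx; split; last by move=> gam y Gg; rewrite /f ix.
  by apply: bmfD => //; exact: bmf_cst.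
have f0 : qI f = 0.
  rewrite /f qID //; [|by case: qx|exact: bmf_cst].
  have := qI_sI mu_haar L' x; rewrite -/v => E.
  rewrite (_ : qI (sI L' x) = v) // qI_cst // /kap mulNr mul1r mulNr mulfVK ?subrr // gt_eqF //.
have A1 : 1 < 1 + lb L / 2 by lra.
have rk := rk3 A1; have [bx _] := qx.
have Tx : rop (ker 3 (1 + lb L / 2)) f x = kmass (ker 3 (1 + lb L / 2)) * (1 - kap).
  rewrite /f ropD //; last exact: bmf_cst.
  have -> : rop (ker 3 (1 + lb L / 2)) (sI L' x) x = kmass (ker 3 (1 + lb L / 2)).
    apply: eq_hI => h; rewrite invg1 mul1g; case: (ltP (hs h) (1 + lb L / 2)) => le.
      rewrite /sI indicE mem_set ?mulr1 //; exists 1%g; first by have [] := subgroupP (lG L).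
      by rewrite mul1g /cell /= invg1 mul1g.
    by rewrite (_ : ker 3 _ _ = 0) ?mul0r // /ker max_l ?expr0n //; lra.
  rewrite -(rop1 mu_haar x rk) mulrBr mulr1; congr (_ + _).
  have b1' : bmf (fun=> 1 : R) by exact: bmf_cst.
  transitivity (-1 * kap * rop (ker 3 (1 + lb L / 2)) (fun=> 1) x); last by ring.
  by rewrite -ropZ //; apply: eq_hI => h; rewrite mulr1.
have pos : 0 < n2 (rop (ker 3 (1 + lb L / 2)) f).
  rewrite lt_neqAle n2_ge0 // andbT eq_sym; apply/eqP => E.
  have := n2_eq0 mu_haar (rop_qf mu_haar rk qff) (rop_continuous mu_haar rk qff) E x.
  rewrite Tx => /eqP; rewrite mulf_eq0 => /orP[|].
    have [-> _ _] := c0P A1; rewrite gt_eqF //; apply: mulr_gt0 => //; apply: exprn_gt0; lra.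
  by rewrite subr_eq0 eq_sym lt_eqF // /kap ltr_pdivrMr // mul1r.
have [N [c [l [w [_ _ [lE l0] _ _]]]]] := op_eigen A1 qff f0 pos.
by exists l.
Qed.

End OperatorBound.

(** * Generation by elements of bounded norm *)

Section Generation.
Variables (R : realType) (mu : SL2_measure R).
Hypothesis mu_haar : is_haar mu.
Implicit Types (x y g h : SL2 R) (t A : R).

Lemma SL2_norm_le g A : 0 <= A -> hs g <= A ^+ 2 / 2 -> `|SL2_mx g| <= A.
Proof.
move=> A0 hA; rewrite [`|_|]mx_normrE.
have E (x y : R) : x ^+ 2 + y <= A ^+ 2 -> 0 <= y -> `|x| <= A.
  move=> le y0; rewrite -(ler_pXn2r (ltn0Sn 1)) ?nnegrE ?normr_ge0 // real_normK ?num_real //; lra.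
have [qa [qb [qc qd]]] : 0 <= ea g ^+ 2 /\ 0 <= eb g ^+ 2 /\ 0 <= ec g ^+ 2 /\ 0 <= ed g ^+ 2 by rewrite !sqr_ge0.
move: hA; rewrite /hs => hA.
apply: bigmax_le => // -[i j] _ /=.
by case: (ord2P i) => ->; case: (ord2P j) => ->; rewrite -/(ea g) -/(eb g) -/(ec g) -/(ed g);
  [apply: (E _ (eb g ^+ 2))|apply: (E _ (ea g ^+ 2))|apply: (E _ (ed g ^+ 2))|apply: (E _ (ec g ^+ 2))]; lra.
Qed.

Lemma generated_is_subgroup (T : groupType) (S : set T) : is_subgroup (generated S).
Proof.
split=> [K [[] //]|x y Hx Hy K [sK SK]|x Hx K [sK SK]]; have [_ HM HV] := sK.
  by apply: HM; [exact: Hx|exact: Hy].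
by apply: HV; exact: Hx.
Qed.

Lemma mix_const_ex : exists B : R, 1 <= B /\ B ^+ 2 = 9602 * expR 36.
Proof.
have k1 : 1 <= 9602 * expR 36 :> R.
  have e1 : (1 : R) <= expR 36 by have := @expR_ge1Dx R 36; lra.
  by have : 1 * 1 <= 9602 * expR 36 :> R; [apply: ler_pM => //; rewrite ?ler1n|rewrite mulr1].
move: (9602 * _) k1 => t t1; exists (Num.sqrt t).
by split; [rewrite -[X in X <= _]sqrtr1; exact: ler_wsqrtr|rewrite sqr_sqrtr //; lra].
Qed.

(* The constant of [op_bound]; [cid] keeps the conversion checks below from unfolding it. *)
Definition mix_const : R := projT1 (cid mix_const_ex).
Lemma mix_const_ge1 : 1 <= mix_const. Proof. by rewrite /mix_const; case: cid => B []. Qed.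
Lemma mix_constE : mix_const ^+ 2 = 9602 * expR 36. Proof. by rewrite /mix_const; case: cid => B []. Qed.

(** When a point moves by a small step, the element bringing it into the ball changes by a factor of
    bounded displacement, and connectedness reaches the whole group. The bound [8 * E ^+ 2] is 2 E
    (2 E 2), two uses of [hsM]. *)
Lemma covering_generates (H : subgroup (SL2 R)) E : 1 <= E ->
  (forall y, exists2 gam, subgroup_set H gam & hs (gam * y)%g <= E) ->
  generated [set gam | subgroup_set H gam /\ hs gam <= 8 * E ^+ 2] = H.
Proof.
move=> E1 cov; have [G1 GM GV] := subgroupP H.
set S := [set gam | _]; apply/seteqP; split.
  by apply: smallest_sub; [exact: subgroupP|by move=> gam []].
have [H1 HM HV] := generated_is_subgroup S.
have SH : S `<=` generated S by exact: sub_smallest.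
have P g : exists2 gam, generated S gam /\ subgroup_set H gam & hs (gam * g)%g <= E.
  apply: (near1_gen (b := 1) (P := fun g => exists2 gam, generated S gam /\ subgroup_set H gam & hs (gam * g)%g <= E)) => //.
    by exists 1%g => //; rewrite mulg1 hs1.
  move=> h w [gam [Hg Gg] le] hw; have [d Gd ld] := cov (h * w)%g.
  exists d => //; split => //.
  have -> : d = (d * gam^-1 * gam)%g by rewrite mulgVK.
  apply: HM => //; apply: SH; split; first by apply: GM => //; exact: GV.
  have -> : (d * gam^-1 = (d * (h * w)) * (gam * h * w)^-1)%g by rewrite !invgM !mulgA !mulgK.
  have h1 := hsM (d * (h * w))%g (gam * h * w)^-1%g; rewrite hsV in h1.
  have h2 := hsM (gam * h)%g w.
  have h3 : hs (gam * h)%g * hs w <= E * 2 by apply: ler_pM; rewrite ?(ltW (hs_gt0 _)) //; lra.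
  have h4 : hs (d * (h * w))%g * hs (gam * h * w)%g <= E * (4 * E).
    by apply: ler_pM; rewrite ?(ltW (hs_gt0 _)) //; move: h2 h3; rewrite -mulrA; move: (hs (gam * h * w)%g) (_ * hs w) => a c; lra.
  by move: h1 h4; rewrite -mulrA; move: (hs (d * (h * w))%g * _) (hs (_ / _)%g) => a c; lra.
move=> gam Gg; have [d [Hd Gd] le] := P gam^-1%g.
have -> : gam = ((d * gam^-1)^-1 * d)%g by rewrite invgM invgK mulgVK.
apply: HM => //; apply: HV; apply: SH; split; first by apply: GM => //; exact: GV.
have : 0 <= (E - 1) * E by apply: mulr_ge0; lra.
by move: le; move: (hs _) => z; lra.
Qed.

(** [ker 1 (1 + b)] is at most b on the cell and zero outside it, while its mass is 2 c0 b^2. *)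
Lemma bvol_ge (L : lattice R) c0 : (forall A, 1 < A -> [/\ kmass mu (ker 3 A) = c0 * (A - 1) ^+ 4,
    kmass mu (ker 2 A) = 4 / 3 * c0 * (A - 1) ^+ 3 & kmass mu (ker 1 A) = 2 * c0 * (A - 1) ^+ 2]) ->
  2 * c0 * lb L <= bvol mu L.
Proof.
move=> c0P; have b0 := lb_gt0 L.
have [_ _ E] := c0P (1 + lb L) ltac:(lra).
have a1 := cell_adm L (1%g : SL2 R).
suff : kmass mu (ker 1 (1 + lb L)) <= lb L * bvol mu L.
  rewrite E (_ : 1 + lb L - 1 = lb L); last by ring.
  by rewrite (_ : 2 * c0 * lb L ^+ 2 = lb L * (2 * c0 * lb L)) ?ler_pM2l //; ring.
rewrite /bvol -(hIZ mu_haar) //; apply: (hI_le mu_haar).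
- have := khs_adm (1%g : SL2 R) (rker_ker (j := 1) (A := 1 + lb L) isT isT ltac:(lra)).
  by congr adm; apply/funext => y; rewrite invg1 mul1g.
- exact: admZ.
move=> x; rewrite indicE /ker; case: (ltP (hs x) (1 + lb L)) => le.
  rewrite mem_set ?mulr1 /cell /= ?invg1 ?mul1g // expr1.
  by have := hs_ge1 x; move: le; move: (hs x) => z; rewrite ge_max; lra.
rewrite max_l ?expr0n /=; last by move: le; move: (hs x) => z; lra.
by rewrite mulr_ge0 ?ler0n // ltW.
Qed.

Definition spec_gap (Gam : set (SL2 R)) : R := 1 - Num.sqrt (1 - 4 * Num.min (1 / 4) (lambda1 Gam)).

Lemma spec_gap_le1 Gam : spec_gap Gam <= 1.
Proof. by rewrite /spec_gap lerBlDr lerDl sqrtr_ge0. Qed.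

Section Numerics.
Variables (c0 : R) (L : lattice R).
Hypothesis c0_gt0 : 0 < c0.
Hypothesis c0P : kernel_masses mu c0.
Variables (n : nat) (J : R).
Hypothesis pack : qvol mu L < n.+1%:R * bvol mu L.
Hypothesis JE : J = 32 ^+ n.*2.
Local Notation Gam := (subgroup_set (lG L)).
Local Notation gap := (gap_bound mu L c0 J).

Let J1 : 1 <= J. Proof. by rewrite JE; apply: exprn_ege1; lra. Qed.
Let diam x y : exists2 gam, Gam gam & hs (x^-1 * gam * y)%g <= J.
Proof. by rewrite JE; have := diam_pack mu_haar pack x y. Qed.

Lemma lambda1_ge_gap : gap <= lambda1 Gam.
Proof.
have [l lP] := eigenvalue_exists mu_haar c0_gt0 c0P J1 diam.
apply: lb_le_inf; first by exists l.
by move=> l' [le l0]; have := eigenvalue_gap mu_haar c0_gt0 c0P J1 diam le l0.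
Qed.

Lemma lambda1_le l : is_eigenvalue Gam l -> l != 0 -> lambda1 Gam <= l.
Proof.
move=> le l0; apply: ge_inf => //; exists gap => l' [le' l0'].
by have := eigenvalue_gap mu_haar c0_gt0 c0P J1 diam le' l0'.
Qed.

Lemma spec_gap_ge t : 0 <= t -> t <= 1 / 4 -> t <= gap -> 2 * t <= spec_gap Gam.
Proof.
move=> t0 t4 tg; have le := le_trans tg lambda1_ge_gap.
have tm : t <= Num.min (1 / 4) (lambda1 Gam) by rewrite le_min t4.
have m4 : Num.min (1 / 4) (lambda1 Gam) <= 1 / 4 by rewrite ge_min lexx.
rewrite /spec_gap; move: (Num.min _ _) tm m4 => m tm m4.
(* Since (1 - 2 t)^2 >= 1 - 4 t. *)
suff : Num.sqrt (1 - 4 * m) <= 1 - 2 * t by lra.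
have -> : 1 - 2 * t = Num.sqrt ((1 - 2 * t) ^+ 2) by rewrite sqrtr_sqr ger0_norm //; lra.
apply: ler_wsqrtr; have := sqr_ge0 t; lra.
Qed.

Lemma spec_gap_gt0 : 0 < spec_gap Gam.
Proof.
have g0 : 0 < gap by exact: gap_bound_gt0.
have m0 : 0 < Num.min (1 / 4) gap by rewrite lt_min g0 andbT; lra.
have := @spec_gap_ge (Num.min (1 / 4) gap) (ltW m0).
by rewrite !ge_min !lexx orbT => /(_ isT isT); lra.
Qed.

Lemma spec_gap_eigenvalue l : is_eigenvalue Gam l -> l != 0 -> spec_gap Gam <= 1 - Num.sqrt (1 - 4 * l).
Proof.
move=> le l0; have ll := lambda1_le le l0; rewrite /spec_gap lerD2l lerN2; apply: ler_wsqrtr.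
have : Num.min (1 / 4) (lambda1 Gam) <= lambda1 Gam by rewrite ge_min lexx orbT.
lra.
Qed.

Local Notation B := mix_const.

Lemma lattice_norm_generated S : (forall gam, Gam gam ->
    `|SL2_mx gam| <= 64 * (2 * B * (qvol mu L / bvol mu L)) `^ (4 / spec_gap Gam) -> S gam) ->
  S `<=` Gam -> generated S = Gam.
Proof.
have r0 := spec_gap_gt0; have r1 := spec_gap_le1 Gam.
have V0 : 0 < qvol mu L by exact: qvol_gt0.
have v0 : 0 < bvol mu L by exact: bvol_gt0.
have b1 := mix_const_ge1.
(* With A = T^(4/r) the operator norm is at most the kernel mass times B / T, and this T makes it
   half of what [mixing] allows. The resulting displacement bound 8 (16 A)^2 equals (64 A)^2 / 2,
   which is a norm bound 64 A. *)
set T := 2 * B * _; set r := spec_gap Gam in r0 r1 *; set A := T `^ _.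
have q1 : 1 <= qvol mu L / bvol mu L by rewrite ler_pdivlMr // mul1r; exact: qvol_ge_bvol.
have T2 : 2 <= T by have : 1 * 1 <= B * (qvol mu L / bvol mu L); [apply: ler_pM; lra|rewrite /T; lra].
have A2 : 2 <= A.
  apply: (@le_trans _ _ (T `^ 1)); first by rewrite powRr1 //; lra.
  by apply: ler_powR; [lra|rewrite ler_pdivlMr // mul1r; lra].
have A1 : 1 < A by lra.
have lnA : expR (- (r / 2) * ln A) = T ^- 2.
  rewrite /A ln_powR (_ : - (r / 2) * _ = - (2%:R * ln T)); last by field; rewrite gt_eqF.
  by rewrite expRN expRM_natl lnK // posrE; lra.
pose N := B * (c0 * (A - 1) ^+ 4) / T.
have p4 : 0 < c0 * (A - 1) ^+ 4 by apply: mulr_gt0 => //; apply: exprn_gt0; lra.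
have N0 : 0 < N by apply: divr_gt0; [apply: mulr_gt0 => //|]; lra.
have mix : N * qvol mu L < kmass mu (ker 3 A) * bvol mu L.
  have [-> _ _] := c0P A1.
  have -> : N * qvol mu L = c0 * (A - 1) ^+ 4 * bvol mu L / 2.
    by rewrite /N /T; field; rewrite !gt_eqF //; lra.
  by have := mulr_gt0 p4 v0; lra.
have bd f : qf L f -> qI mu L f = 0 -> n2 mu L (rop mu (ker 3 A) f) <= N ^+ 2 * n2 mu L f.
  move=> qff f0; have := op_bound mu_haar c0_gt0 c0P J1 diam (ltW r0) r1 (fun l le l0 _ => spec_gap_eigenvalue le l0) A2 qff f0.
  have -> : N ^+ 2 = B ^+ 2 * (c0 * (A - 1) ^+ 4) ^+ 2 * T ^- 2 by rewrite /N [LHS]exprMn exprVn [(B * _) ^+ 2]exprMn.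
  by rewrite lnA mix_constE.
have cov y : exists2 gam, Gam gam & hs (gam * y)%g <= 16 * A.
  by have [gam Gg le] := mixing mu_haar 0 A1 N0 bd mix 1%g y; exists gam => //; rewrite invg1 mul1g in le.
move=> SP SG; apply/seteqP; split; first by apply: smallest_sub => //; exact: subgroupP.
rewrite -[X in X `<=` _](covering_generates _ cov); last by lra.
apply: smallest_sub; first exact: generated_is_subgroup.
move=> gam [Gg le]; apply: (@sub_smallest _ _ S S) => //; apply: SP => //.
by apply: SL2_norm_le; [lra|apply: le_trans le _; lra].
Qed.

End Numerics.

(** A base below 1 is harmless whatever the exponent; a base above 1 occurs only where r is bounded
    below, and there one constant suffices. *)
Lemma powR_absorb (Q r r0 K : R) : 0 < Q -> 0 < r -> 0 < r0 -> (1 < Q -> r0 <= r /\ Q <= K) ->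
  Q `^ r^-1 <= 1 + K `^ r0^-1.
Proof.
move=> Q0 rp r0p H; have [Q1|Q1] := leP Q 1.
  apply: (@le_trans _ _ 1); last by rewrite lerDl powR_ge0.
  by have := congr1 (@^~ r^-1) (powR1 R) => /= <-; apply: ge0_ler_powR; rewrite ?nnegrE ?invr_ge0 ?(ltW rp) ?(ltW Q0).
have [rr QK] := H Q1; apply: (@le_trans _ _ (K `^ r^-1)).
  by apply: ge0_ler_powR; rewrite ?nnegrE ?invr_ge0 //; lra.
apply: (@le_trans _ _ (K `^ r0^-1)); last by rewrite lerDr.
by apply: ler_powR; [lra|rewrite lef_pV2 // posrE].
Qed.

Lemma pow_le_1D (x y : R) (n : nat) : 0 <= x -> x ^+ n.+1 <= y -> x <= 1 + y.
Proof.
move=> x0 xy; have [x1|x1] := leP x 1; last by apply: le_trans (_ : x <= x ^+ n.+1) _; [rewrite exprS ler_peMr // exprn_ege1 // ltW|lra].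
by have := exprn_ge0 n.+1 x0; lra.
Qed.

(* Where the volume is large compared with the injectivity radius the exponents 6 and 180 absorb all
   constants; otherwise packing bounds the diameter, hence the spectral gap, from below. *)
Lemma lattice_bound (c x0 : R) : 0 < c -> 0 < x0 -> exists2 C, 0 < C &
  forall (L : lattice R) (x V : R), x0 <= x -> lb L = c / x -> qvol mu L <= V ->
  let r := spec_gap (lG L) in
  0 < r /\ forall S : set (SL2 R), S `<=` lG L -> (forall gam, subgroup_set (lG L) gam -> `|SL2_mx gam| < C * x `^ (15 / r) * V `^ (6 / r) -> S gam) ->
  generated S = lG L.
Proof.
move=> cp x0p; have [c0 c0p c0P] := haar_const mu_haar.
pose B := mix_const; have B1 : 1 <= B by exact: mix_const_ge1.
pose a := 2 * c0 * c; pose K := 2 * B / a.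
have ap : 0 < a by rewrite /a; apply: mulr_gt0 => //; lra.
have Kp : 0 < K by apply: divr_gt0 => //; lra.
(* The ratio Q introduced below can exceed 1 only when x <= x1 and V <= V1; in that range cells have
   volume at least v1. *)
pose x1 := 1 + K ^+ 4 / a ^+ 2; pose V1 := 1 + K ^+ 4 / x0 ^+ 11; pose v1 := a / x1.
have x1p : 0 < x1 by rewrite /x1 addr_gt0 // divr_gt0 // exprn_gt0.
have v1p : 0 < v1 by exact: divr_gt0.
have [n nP] : exists n : nat, V1 < n.+1%:R * v1.
  exists (Num.truncn (V1 / v1)); rewrite -ltr_pdivrMr //; exact: truncnS_gt.
pose J : R := 32 ^+ n.*2; have J1 : 1 <= J by apply: exprn_ege1; lra.
pose g1 := Num.min (1 / 4) (320 * v1 / (c0 * J ^+ 4 * (J + 2) ^+ 4)).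
have j1 : 0 < J by lra.
have j2 : 0 < J + 2 by lra.
have Jp : 0 < c0 * J ^+ 4 * (J + 2) ^+ 4 := mulr_gt0 (mulr_gt0 c0p (exprn_gt0 4 j1)) (exprn_gt0 4 j2).
have g1p : 0 < g1.
  rewrite lt_min; apply/andP; split; first by lra.
  have n320 : (0 : R) < 320 by rewrite ltr0n.
  exact: (divr_gt0 (mulr_gt0 n320 v1p) Jp).
pose K2 := K ^+ 4 / (a ^+ 2 * x0 ^+ 9).
(* 65 against the 64 of [lattice_norm_generated] makes the norm inequality strict. *)
exists (65 * (1 + K2 `^ (2 * g1)^-1)).
  have k2 : 0 < 1 + K2 `^ (2 * g1)^-1 by have := powR_ge0 K2 (2 * g1)^-1; lra.
  have n65 : (0 : R) < 65 by rewrite ltr0n.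
  exact: mulr_gt0 n65 k2.
move=> L x V xx0 bE qV r.
have xp : 0 < x by exact: lt_le_trans xx0.
have vge : a / x <= bvol mu L by have := @bvol_ge L c0 c0P; rewrite bE mulrA.
have vp : 0 < bvol mu L by exact: bvol_gt0.
have qv : bvol mu L <= qvol mu L by exact: qvol_ge_bvol.
have Vp : 0 < V by lra.
have [m mP] : exists m : nat, qvol mu L < m.+1%:R * bvol mu L.
  exists (Num.truncn (qvol mu L / bvol mu L)); rewrite -ltr_pdivrMr //; exact: truncnS_gt.
have rp : 0 < r by exact: (spec_gap_gt0 c0p c0P mP erefl).
split => // S SG SP; apply: (lattice_norm_generated c0p c0P mP erefl) SG => gam Gg le; apply: SP => //.
apply: le_lt_trans le _; rewrite -/r.
(* Chosen so that (K V x)^4 = Q x^15 V^6: the surplus of the exponents 15 and 6 over 4 makes Q small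
   for large x or V. *)
pose Q := K ^+ 4 / (V ^+ 2 * x ^+ 11).
have Qp : 0 < Q by apply: divr_gt0; [exact: exprn_gt0|apply: mulr_gt0; exact: exprn_gt0].
have axV : a ^+ 2 * x ^+ 9 <= V ^+ 2 * x ^+ 11.
  have -> : a ^+ 2 * x ^+ 9 = (a / x) ^+ 2 * x ^+ 11 by field; rewrite gt_eqF.
  apply: ler_wpM2r; first by apply: exprn_ge0; lra.
  apply: lerXn2r; rewrite ?nnegrE; [by apply: divr_ge0; lra|lra..].
have QK : 1 < Q -> 2 * g1 <= r /\ Q <= K2.
  rewrite {1}/Q ltr_pdivlMr; last by apply: mulr_gt0; exact: exprn_gt0.
  rewrite mul1r => QV; split; last first.
    rewrite /Q /K2; apply: ler_wpM2l; first by apply: exprn_ge0; lra.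
    rewrite lef_pV2 ?posrE; last by apply: mulr_gt0; exact: exprn_gt0.
      apply: le_trans axV; apply: ler_wpM2l; first exact: sqr_ge0.
      by apply: lerXn2r; rewrite ?nnegrE //; lra.
    by apply: mulr_gt0; exact: exprn_gt0.
  have xx1 : x <= x1.
    apply: (@pow_le_1D _ _ 8); first by lra.
    by rewrite ler_pdivlMr ?exprn_gt0 // mulrC; apply: le_trans axV (ltW QV).
  have VV1 : V <= V1.
    apply: (@pow_le_1D _ _ 1); first by lra.
    rewrite ler_pdivlMr ?exprn_gt0 //; apply: le_trans (ltW QV).
    apply: ler_wpM2l; first exact: sqr_ge0.
    by apply: lerXn2r; rewrite ?nnegrE //; lra.
  have vv1 : v1 <= bvol mu L.
    by apply: le_trans vge; apply: ler_wpM2l; [lra|rewrite lef_pV2 ?posrE].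
  have pk : qvol mu L < n.+1%:R * bvol mu L.
    apply: le_lt_trans (le_trans qV VV1) _; apply: lt_le_trans nP _.
    by apply: ler_wpM2l.
  apply: (spec_gap_ge c0p c0P pk erefl (ltW g1p)); first by rewrite ge_min lexx.
  rewrite ge_min; apply/orP; right; rewrite /gap_bound.
  apply: ler_wpM2r; first by rewrite invr_ge0 ltW.
  by apply: ler_wpM2l; [rewrite ler0n|lra].
have E : 64 * (2 * B * (qvol mu L / bvol mu L)) `^ (4 / r) <= 64 * (Q `^ r^-1 * (x `^ (15 / r) * V `^ (6 / r))).
  apply: ler_wpM2l; first by rewrite ler0n.
  have Tp : 0 <= 2 * B * (qvol mu L / bvol mu L) by apply: mulr_ge0; [lra|apply: divr_ge0; lra].
  rewrite !powRrM !powR_mulrn ?(ltW xp) ?(ltW Vp) //.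
  have pr := mulr_ge0 (exprn_ge0 15 (ltW xp)) (exprn_ge0 6 (ltW Vp)).
  rewrite -(powRM _ (exprn_ge0 15 (ltW xp)) (exprn_ge0 6 (ltW Vp))) -(powRM _ (ltW Qp) pr).
  apply: ge0_ler_powR; rewrite ?nnegrE ?invr_ge0 ?(ltW rp) ?(exprn_ge0 4 Tp) ?(mulr_ge0 (ltW Qp) pr) //.
  have -> : Q * (x ^+ 15 * V ^+ 6) = (K * V * x) ^+ 4 by rewrite /Q; field; rewrite !gt_eqF.
  apply: lerXn2r; rewrite ?nnegrE //; first by apply: mulr_ge0; [apply: mulr_ge0|]; lra.
  have -> : K * V * x = 2 * B * (V * (a / x)^-1) by rewrite /K; field; rewrite !gt_eqF.
  apply: ler_wpM2l; first by lra.
  apply: ler_pM; rewrite ?invr_ge0 //; [lra|lra|].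
  by rewrite lef_pV2 ?posrE // divr_gt0.
apply: le_lt_trans E _.
have g2 : 0 < 2 * g1 by lra.
have H := powR_absorb Qp rp g2 QK.
have p1 : 0 < x `^ (15 / r) by exact: powR_gt0.
have p2 : 0 < V `^ (6 / r) by exact: powR_gt0.
rewrite -[X in _ < X]mulrA mulrA; move: (x `^ _ * V `^ _) (mulr_gt0 p1 p2) => z z0.
by rewrite ltr_pM2r //; have := powR_ge0 K2 (2 * g1)^-1; lra.
Qed.

End Generation.

(** * Simultaneous triangular form of commuting matrices *)

Section Triangular.
Variables (C : numClosedFieldType) (n : nat) (P : 'M[C]_n.+1).
Hypothesis P_unit : P \in unitmx.
Implicit Types (A B : 'M[C]_n.+1) (G : {poly C}).

Definition trig_by B := is_trig_mx (P *m B *m invmx P).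
(** A diagonal entry after conjugation by [P]. On matrices that [P] makes triangular it is additive
    and multiplicative, which turns eigenvalues into ring homomorphisms. *)
Definition dg (i : 'I_n.+1) B := (P *m B *m invmx P) i i.

Lemma conjM A B : P *m (A *m B) *m invmx P = (P *m A *m invmx P) *m (P *m B *m invmx P).
Proof. by rewrite !mulmxA mulmxKV. Qed.

Lemma trig_prod (S T : 'M[C]_n.+1) : is_trig_mx S -> is_trig_mx T ->
  is_trig_mx (S *m T) /\ forall i, (S *m T) i i = S i i * T i i.
Proof.
move=> /is_trig_mxP tS /is_trig_mxP tT; split.
  apply/is_trig_mxP => i j ij; rewrite mxE big1 // => l _.
  by have [il|li] := ltnP i l; [rewrite tS // mul0r|rewrite tT ?mulr0 // (leq_ltn_trans li)].
move=> i; rewrite mxE (bigD1 i) //= big1 ?addr0 // => l li.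
by case: (ltngtP i l) => [il|il|E]; [rewrite tS // mul0r|rewrite tT ?mulr0|move: li; rewrite (val_inj E) eqxx].
Qed.

Lemma trig_byM A B : trig_by A -> trig_by B -> trig_by (A *m B).
Proof. by move=> tA tB; rewrite /trig_by conjM; have [] := trig_prod tA tB. Qed.
Lemma dgM i A B : trig_by A -> trig_by B -> dg i (A *m B) = dg i A * dg i B.
Proof. by move=> tA tB; rewrite /dg conjM; have [_ ->] := trig_prod tA tB. Qed.
Lemma dgD i A B : dg i (A + B) = dg i A + dg i B. Proof. by rewrite /dg mulmxDr mulmxDl mxE. Qed.
Lemma dgZ i c A : dg i (c *: A) = c * dg i A. Proof. by rewrite /dg -scalemxAr -scalemxAl mxE. Qed.

Lemma trig_byD A B : trig_by A -> trig_by B -> trig_by (A + B).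
Proof.
move=> /is_trig_mxP tA /is_trig_mxP tB; apply/is_trig_mxP => i j ij.
by rewrite mulmxDr mulmxDl mxE tA // tB // addr0.
Qed.

Lemma trig_byZ c A : trig_by A -> trig_by (c *: A).
Proof. by move=> /is_trig_mxP tA; apply/is_trig_mxP => i j ij; rewrite -scalemxAr -scalemxAl mxE tA // mulr0. Qed.
Lemma conj_scalar c : P *m c%:M *m invmx P = c%:M. Proof. by rewrite scalar_mxC mulmxK. Qed.
Lemma trig_by_scalar c : trig_by c%:M. Proof. by rewrite /trig_by conj_scalar scalar_mx_is_trig. Qed.
Lemma dg_scalar i c : dg i c%:M = c. Proof. by rewrite /dg conj_scalar mxE eqxx. Qed.

Lemma trig_horner B G : trig_by B -> trig_by (horner_mx B G) /\ forall i, dg i (horner_mx B G) = G.[dg i B].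
Proof.
move=> tB; elim/poly_ind: G => [|G c [tG dG]].
  by rewrite rmorph0 -(raddf0 (@scalar_mx C n.+1)); split=> [|i]; rewrite ?trig_by_scalar // dg_scalar horner0.
rewrite rmorphD rmorphM /= horner_mx_X horner_mx_C; split.
  by apply: trig_byD; [exact: trig_byM|exact: trig_by_scalar].
by move=> i; rewrite dgD -[_ * B]/(_ *m B) dgM // dg_scalar dG hornerMXaddC.
Qed.

Lemma det_dg B : trig_by B -> \det B = \prod_i dg i B.
Proof.
by move=> tB; rewrite -(det_trig tB) !det_mulmx mulrAC -det_mulmx mulmxV // det1 mul1r.
Qed.

Lemma char_poly_dg B : trig_by B -> char_poly B = \prod_i ('X - (dg i B)%:P).
Proof.
move=> tB; rewrite -(char_poly_trig tB) /char_poly /char_poly_mx.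
have E : map_mx polyC P *m ('X%:M - map_mx polyC B) *m map_mx polyC (invmx P) = 'X%:M - map_mx polyC (P *m B *m invmx P).
  rewrite mulmxBr mulmxBl !map_mxM /=; congr (_ - _).
  by rewrite scalar_mxC -mulmxA -map_mxM mulmxV // map_mx1 mulmx1.
by rewrite -E !det_mulmx mulrAC -det_mulmx -map_mxM mulmxV // map_mx1 det1 mul1r.
Qed.

End Triangular.

Lemma joint_trig (C : numClosedFieldType) n (As : seq 'M[C]_n.+1) :
  {in As &, forall A B, A *m B = B *m A} -> exists2 P, P \in unitmx & forall B, B \in As -> trig_by P B.
Proof.
move=> /cotrigonalization[P uP /allP tP]; exists P; first exact: unitarymx_unit.
by move=> B /tP; rewrite /= /similar_to conjumx // unitarymx_unit.
Qed.

(** * Integer and minimal polynomials *)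

Section IntegerPolynomials.
Implicit Types (g h q : {poly int}).
Local Notation "p ^Q" := (map_poly (intr : int -> rat) p) (at level 2, format "p ^Q").

(** Gauss's lemma: after clearing denominators the factorisation is over the integers, and both
    leading coefficients are units. *)
Lemma monic_dvd_int (p : {poly rat}) q : p \is monic -> q \is monic -> p %| q^Q ->
  exists2 p1 : {poly int}, p1 \is monic & p = p1^Q.
Proof.
move=> pm qm /dvdpP_rat_int[p1 [a a0 pE] [r qE]].
have E1 : lead_coef p1 * lead_coef r = 1 by rewrite -lead_coefM -qE; exact/eqP.
have l1 : a * (lead_coef p1)%:~R = 1.
  by have := eqP pm; rewrite pE lead_coefZ lead_coef_map_inj //; exact: intr_inj.
have : lead_coef p1 = 1 \/ lead_coef p1 = - 1.
  have : (`|lead_coef p1| * `|lead_coef r| == 1)%N by rewrite -abszM E1.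
  by rewrite muln_eq1 => /andP[/eqP h _]; lia.
case=> E; move: l1; rewrite E; first by rewrite mulr1 => a1; exists p1; rewrite ?monicE ?E // pE a1 scale1r.
rewrite mulrN1 => /eqP; rewrite eqr_oppLR => /eqP aE.
exists (- p1); first by rewrite monicE lead_coefN E opprK.
by rewrite pE aE scaleN1r rmorphN.
Qed.

Variable K : numFieldType.
Local Notation "p ^K" := (map_poly (intr : int -> K) p) (at level 2, format "p ^K").
Local Notation "p ^R" := (map_poly (ratr : rat -> K) p) (at level 2, format "p ^R").

Lemma map_int_rat q : (q^Q)^R = q^K.
Proof. by rewrite -map_poly_comp; apply: eq_map_poly => z /=; rewrite ratr_int. Qed.

Lemma min_rat_poly (al : K) (q0 : {poly rat}) : q0 != 0 -> root q0^R al ->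
  exists2 p : {poly rat}, p \is monic /\ root p^R al & forall q : {poly rat}, root q^R al -> p %| q.
Proof.
move=> q00 rq0.
have ex : exists k, `[< exists p : {poly rat}, [/\ p != 0, root p^R al & size p = k] >].
  by exists (size q0); apply/asboolP; exists q0.
case: (ex_minnP ex) => k /asboolP[p [p0 rp sp]] kmin.
have l0 : lead_coef p != 0 by rewrite lead_coef_eq0.
exists ((lead_coef p)^-1 *: p); first split.
- by rewrite monicE lead_coefZ mulVf.
- by rewrite map_polyZ rootZ // fmorph_eq0 invr_eq0.
move=> q rq; rewrite dvdpZl ?invr_eq0 //; apply/modp_eq0P/eqP; apply: contraT => m0.
have : (k <= size (q %% p)%R)%N.
  apply: kmin; apply/asboolP; exists (q %% p); split=> //.
  have := divp_eq q p => /(congr1 (map_poly (ratr : rat -> K))); rewrite rmorphD rmorphM /= => E.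
  by apply/rootP; have := rootP rq; rewrite E hornerD hornerM (rootP rp) mulr0 add0r => ->.
by rewrite leqNgt -sp ltn_modp p0.
Qed.

Lemma min_rat_dvd (al : K) (g d r : {poly rat}) : g != 0 -> root g^R al ->
  (forall q : {poly rat}, root q^R al -> g %| q) -> g = d * r -> (1 < size d)%N -> g %| d.
Proof.
move=> g0 rg gmin gE d1; move: rg; rewrite gE rmorphM rootM => /orP[/gmin|/gmin gr]; rewrite -gE //.
have r0 : r != 0 by apply: contraNneq g0 => r0; rewrite gE r0 mulr0.
have d0 : d != 0 by apply: contraNneq g0 => d0; rewrite gE d0 mul0r.
have sg : size g = (size d + size r).-1 by rewrite gE size_mul.
have := dvdp_leq r0 gr; have r1 : (0 < size r)%N by rewrite size_poly_gt0.
move: sg d1 r1; move: (size g) (size d) (size r) => x y z; lia.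
Qed.

(** [g] is a minimal polynomial, hence irreducible. *)
Lemma min_rat_coprime (al : K) (g r : {poly rat}) : g != 0 -> root g^R al ->
  (forall q : {poly rat}, root q^R al -> g %| q) -> coprimep g r \/ g %| r.
Proof.
move=> g0 rg gmin; case: (boolP (coprimep g r)) => [|ncop]; [by left|right].
have /dvdpP[q gE] := dvdp_gcdl g r; rewrite mulrC in gE.
apply: dvdp_trans (dvdp_gcdr g r); apply: (min_rat_dvd g0 rg gmin gE).
by move: ncop; rewrite /coprimep neq_ltn => /orP[|//]; rewrite ltnS leqn0 size_poly_eq0 gcdp_eq0 (negPf g0).
Qed.

End IntegerPolynomials.

(** The binomial theorem modulo p, with Fermat's little theorem for the coefficients. *)
Lemma Frobenius_poly (p : nat) (f : {poly int}) : prime p -> exists h, f \Po 'X^p = f ^+ p + h *+ p.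
Proof.
case: p => // p pp; have p0 := prime_gt0 pp.
have add (a b : {poly int}) : exists h, (a + b) ^+ p.+1 = a ^+ p.+1 + b ^+ p.+1 + h *+ p.+1.
  exists (\sum_(i < p) (a ^+ (p - i) * b ^+ i.+1) *+ ('C(p.+1, i.+1) %/ p.+1)).
  rewrite exprDn big_ord_recl big_ord_recr /= !bin0 !mulr1n subn0 expr0 mulr1.
  rewrite (_ : bump 0 p = p.+1) // subnn expr0 mul1r binn mulr1n -addrA [X in _ + X]addrC; congr (_ + (_ + _)).
  rewrite -sumrMnl; apply: eq_bigr => i _; rewrite (_ : bump 0 i = i.+1) // subSS -mulrnA divnK //.
  by apply: prime_dvd_bin => //; exact: (ltn_ord i).
have fermat (c : int) : exists d : int, c ^+ p.+1 = c + d *+ p.+1.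
  have nn (m : nat) : exists d : int, m%:Z ^+ p.+1 = m%:Z + d *+ p.+1.
    elim: m => [|m [d dE]]; first by exists 0; rewrite expr0n mul0rn addr0.
    have [h hE] := add m%:Z%:P 1; exists (d + h.[0]).
    have := congr1 (fun g => g.[0]) hE; rewrite !(hornerE, horner_exp) expr1n dE => E.
    by rewrite -addn1 PoszD E mulrnDl hornerMn; ring.
  case: (intP c) => [|m|m]; [exact: (nn 0%N)|exact: nn|].
  have [d dE] := nn m.+1; have [p2|o] := even_prime pp.
    by exists (d + m.+1%:Z); rewrite p2 sqrrN -{1}p2 dE p2; ring.
  by exists (- d); rewrite exprNn -signr_odd o expr1 mulN1r dE; ring.
elim/poly_ind: f => [|f c [h hE]]; first by exists 0; rewrite comp_poly0 expr0n mul0rn addr0.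
have [h2 E2] := add (f * 'X) c%:P; have [d dE] := fermat c.
exists (h * 'X^(p.+1) - h2 - d%:P).
rewrite comp_polyD comp_polyM comp_polyX comp_polyC hE E2 exprMn -polyC_exp dE polyCD.
rewrite mulrDl !mulrnBl -mulrnAl polyCMn; ring.
Qed.

(** * Powers of an algebraic integer with one conjugate outside the unit disc *)

Section ConjugateRoots.
Variables (C : numClosedFieldType) (n : nat) (A : 'M[int]_n.+1) (P : 'M[C]_n.+1).
Local Notation "p ^Z" := (map_poly (intr : int -> C) p) (at level 2, format "p ^Z").
Local Notation "p ^Q" := (map_poly (intr : int -> rat) p) (at level 2, format "p ^Q").
Local Notation "p ^R" := (map_poly (ratr : rat -> C) p) (at level 2, format "p ^R").
Hypothesis P_unit : P \in unitmx.
Local Notation AC := (map_mx (intr : int -> C) A).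
Hypothesis P_trig : trig_by P AC.
Local Notation z i := (dg P i AC).
Local Notation f := (char_poly A).
Implicit Types (F G h : {poly int}).

Lemma norm_horner G : (\det (horner_mx A G))%:~R = \prod_i (G^Z).[z i].
Proof.
have [t d] := trig_horner P_unit (G^Z) P_trig.
rewrite -(det_map_mx (intr : int -> C)) map_horner_mx (det_dg P_unit t).
by apply: eq_bigr => i _.
Qed.

Lemma char_poly_pow k : (char_poly (A ^+ k))^Z = \prod_i ('X - (z i ^+ k)%:P).
Proof.
have [t d] := trig_horner P_unit ('X^k : {poly C}) P_trig.
have E : A ^+ k = horner_mx A 'X^k by rewrite rmorphXn /= horner_mx_X.
rewrite map_char_poly E map_horner_mx map_polyXn.
by rewrite (char_poly_dg P_unit t); apply: eq_bigr => i _; rewrite d hornerXn.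
Qed.

Lemma char_poly_roots : f^Z = \prod_i ('X - (z i)%:P).
Proof. by have := char_poly_pow 1; rewrite expr1 => ->; apply: eq_bigr => i _; rewrite expr1. Qed.

(** f(A) = 0 by Cayley-Hamilton, so f(A^p) is p times an integer matrix; its m-th power contributes
    p^m in each of the n + 1 dimensions of the determinant. *)
Lemma norm_Frobenius (p m : nat) F G : prime p -> F = f ^+ m * G ->
  exists N : int, \prod_i (F^Z).[z i ^+ p] = (N * p%:Z ^+ (n.+1 * m))%:~R.
Proof.
move=> pp FE; have [h hE] := Frobenius_poly f pp.
have E : \prod_i (F^Z).[z i ^+ p] = (\det (horner_mx A (F \Po 'X^p)))%:~R.
  by rewrite norm_horner; apply: eq_bigr => i _; rewrite map_comp_poly horner_comp map_polyXn hornerXn.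
exists (\det (horner_mx A (h ^+ m * (G \Po 'X^p)))); rewrite {}E; congr (_%:~R).
rewrite FE rmorphM /= rmorphXn /= hE !rmorphM !rmorphXn rmorphD rmorphXn /= Cayley_Hamilton.
rewrite expr0n gtn_eqF ?prime_gt0 //= add0r rmorphMn /= -scaler_nat exprZn -scalerAl detZ mulrC.
by rewrite -exprM mulnC natz.
Qed.

Lemma monic_intQ (q : {poly int}) : q \is monic -> q^Q \is monic.
Proof. by move=> qm; rewrite monicE lead_coef_map_inj //; [rewrite (monicP qm)|exact: intr_inj]. Qed.

Variable al : C.
Hypothesis f_min : forall q : {poly rat}, root q^R al -> f^Q %| q.
Hypothesis f_al : root f^Z al.
Hypothesis al_gt1 : 1 < `|al|.
Hypothesis small : forall i, z i = al \/ `|z i| <= 1.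

Let f_monic : f \is monic. Proof. exact: char_poly_monic. Qed.

(** A minimal polynomial has no double root, because its derivative has smaller degree. *)
Lemma al_simple : exists i0, z i0 = al /\ forall i, i != i0 -> `|z i| <= 1.
Proof.
have [i0 i0E] : exists i0, z i0 = al.
  have := f_al; rewrite char_poly_roots /root horner_prod => /eqP/eqP; rewrite prodf_seq_eq0 => /hasP[i _].
  by rewrite hornerXsubC subr_eq0 => /eqP E; exists i.
exists i0; split => // i ne; have [iE|//] := small i; exfalso.
have [r GE] : exists r, f^Z = ('X - al%:P) * (('X - al%:P) * r).
  exists (\prod_(j | (j != i0) && (j != i)) ('X - (z j)%:P)).
  by rewrite char_poly_roots (bigD1 i0) //= i0E (bigD1 i) //= iE.
have rd : root (f^`()^Q)^R al.
  rewrite map_int_rat -deriv_map GE !derivM !derivXsubC /root !hornerE subrr.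
  by rewrite !(mul0r, mulr0, add0r, addr0).
have d0 : f^`()^Q != 0.
  apply: contra_neq (_ : f^`()`_n != 0) => [E|].
    by have := congr1 (fun q : {poly rat} => q`_n) E; rewrite coef_map coef0 => /eqP; rewrite intr_eq0 => /eqP.
  have lf : f`_n.+1 = 1 by have := monicP f_monic; rewrite lead_coefE size_char_poly.
  by rewrite coef_deriv lf.
have := dvdp_leq d0 (f_min rd); rewrite !size_map_inj_poly ?rmorph0 //; try exact: intr_inj.
by rewrite leqNgt lt_size_deriv // monic_neq0.
Qed.

(** The degree does not drop from [al] to its k-th power. Otherwise the characteristic polynomial of
    A^k would contain the minimal polynomial of this power twice and have it as a double root, but
    only one conjugate of [al] has modulus above 1. *)
Lemma pow_min k : (0 < k)%N -> forall q : {poly rat}, root q^R (al ^+ k) -> (char_poly (A ^+ k))^Q %| q.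
Proof.
move=> k0 q rq; have [i0 [i0E i0P]] := al_simple.
set hq := (char_poly (A ^+ k))^Q.
have hm : hq \is monic by exact: monic_intQ (char_poly_monic _).
have h0 : hq != 0 by exact: monic_neq0.
have hR : hq^R = \prod_i ('X - (z i ^+ k)%:P) by rewrite map_int_rat char_poly_pow.
have rh : root hq^R (al ^+ k).
  by rewrite hR -i0E (bigD1 i0) //= rootM root_XsubC eqxx.
have [gq [gm rg] gmin] := min_rat_poly h0 rh.
suff hg : hq %| gq by exact: dvdp_trans hg (gmin _ rq).
have g0 : gq != 0 by exact: monic_neq0.
have gz i : root gq^R (z i ^+ k).
  have : root (gq \Po 'X^k)^R al by rewrite map_comp_poly map_polyXn /root horner_comp hornerXn.
  move=> /f_min/dvdpP[q1 E]; have := congr1 (map_poly (ratr : rat -> C)) E.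
  rewrite map_comp_poly map_polyXn rmorphM /= map_int_rat => /(congr1 (fun p => p.[z i])).
  rewrite horner_comp hornerXn hornerM => gE; apply/rootP; rewrite gE.
  by rewrite char_poly_roots [X in _ * X](_ : _ = 0) ?mulr0 // horner_prod (bigD1 i) //= hornerXsubC subrr mul0r.
have /dvdpP[r rE] := gmin _ rh.
have r0 : r != 0 by apply: contraNneq h0 => r0; rewrite rE r0 mul0r.
case: (ltnP 1 (size r)) => [r1|]; last first.
  move=> r1; have /eqP sr : size r == 1%N by rewrite eqn_leq r1 size_poly_gt0.
  have /size_poly1P[c c0 cE] : size r == 1%N by rewrite sr.
  by rewrite rE cE mul_polyC dvdpZl.
have [w rw] : exists w, root r^R w.
  by apply: closed_rootP; rewrite size_map_inj_poly ?rmorph0 //; [rewrite neq_ltn r1 orbT|exact: fmorph_inj].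
have gw : root gq^R w.
  have : root hq^R w by rewrite rE rmorphM rootM rw.
  rewrite hR /root horner_prod prodf_seq_eq0 => /hasP[i _]; rewrite hornerXsubC subr_eq0 => /eqP ->.
  exact: gz.
have [cop|gr] := min_rat_coprime r g0 rg gmin.
  have : coprimep gq^R r^R by rewrite coprimep_map.
  by move=> /coprimepP/(_ ('X - w%:P)); rewrite !dvdp_XsubCl => /(_ gw rw)/eqp_size; rewrite size_XsubC size_poly1.
have /dvdpP[r2 r2E] := gr.
exfalso; have gal : ('X - (al ^+ k)%:P) %| gq^R by rewrite dvdp_XsubCl.
have : ('X - (al ^+ k)%:P) * ('X - (al ^+ k)%:P) %| hq^R.
  by rewrite rE r2E !rmorphM /= -mulrA dvdp_mull // dvdp_mul.
rewrite hR (bigD1 i0) //= i0E dvdp_mul2l ?polyXsubC_eq0 // dvdp_XsubCl /root horner_prod.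
rewrite prodf_seq_eq0 => /hasP[i _] /andP[ne]; rewrite hornerXsubC subr_eq0 => /eqP E.
have : `|z i ^+ k| <= 1 by rewrite normrX exprn_ile1 // i0P.
have a1 : 1 < `|al ^+ k| by rewrite normrX exprn_egt1 // -lt0n.
by rewrite -E => /(lt_le_trans a1); rewrite ltxx.
Qed.

(** The powers of [al] keep the full degree and are pairwise not conjugate, since the only conjugate
    of such a power with modulus above 1 is the power itself. Hence the product of their minimal
    polynomials divides F. *)
Lemma vanishing_size F (ps : seq nat) : F != 0 -> uniq ps -> all (fun k => 0 < k)%N ps ->
  (forall k, k \in ps -> root F^Z (al ^+ k)) -> (size ps * n.+1 < size F)%N.
Proof.
move=> F0 ups pos rF; pose H k := (char_poly (A ^+ k))^Q.
have Hm k : H k \is monic by exact: monic_intQ (char_poly_monic _).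
have key : [/\ \prod_(k <- ps) H k \is monic, size (\prod_(k <- ps) H k) = (size ps * n.+1).+1 & \prod_(k <- ps) H k %| F^Q].
  elim: ps ups pos rF => [|k ps IH] /=; first by rewrite big_nil monic1 size_poly1 dvd1p.
  move=> /andP[kps ups] /andP[k0 pos] rF.
  have [pm ps_size pd] := IH ups pos (fun k' kk => rF k' (mem_behead (s := k :: ps) kk)).
  have rFk : root (F^Q)^R (al ^+ k) by rewrite map_int_rat; apply: rF; rewrite mem_head.
  rewrite big_cons; split; first by rewrite monicMl.
    rewrite size_monicM // ?monic_neq0 // ps_size /H size_map_inj_poly ?rmorph0 ?size_char_poly //; last exact: intr_inj.
    by rewrite mulSn addnS.
  have rk : root (H k)^R (al ^+ k).
    have [i0 [i0E _]] := al_simple.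
    by rewrite /H map_int_rat char_poly_pow (bigD1 i0) //= i0E rootM root_XsubC eqxx.
  have [cop|] := min_rat_coprime (\prod_(k' <- ps) H k') (monic_neq0 (Hm k)) rk (pow_min k0).
    by rewrite Gauss_dvdp // pd (pow_min k0 rFk).
  move=> /dvdpP[q qE]; exfalso; move: (rk); have : root (\prod_(k' <- ps) H k')^R (al ^+ k).
    by rewrite qE rmorphM rootM rk orbT.
  rewrite rmorph_prod /root horner_prod prodf_seq_eq0 => /hasP[k' k'ps] /=.
  rewrite /H map_int_rat char_poly_pow horner_prod prodf_seq_eq0 => /hasP[i _] /=.
  rewrite hornerXsubC subr_eq0 => /eqP E _.
  have a1 k1 : (0 < k1)%N -> 1 < `|al ^+ k1| by move=> k10; rewrite normrX exprn_egt1 // -lt0n.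
  have k'0 : (0 < k')%N by exact: (allP pos).
  have [iE|le] := small i; last first.
    have le' : `|z i ^+ k'| <= 1 by rewrite normrX exprn_ile1.
    by have := lt_le_trans (a1 k k0); rewrite E => /(_ _ le'); rewrite ltxx.
  have : `|al| ^+ k = `|al| ^+ k' by rewrite -!normrX E iE.
  move=> /(ieexprIn (lt_trans ltr01 al_gt1)) kk; rewrite kk ?k'ps // in kps.
  by rewrite gt_eqF.
have [_ sz dv] := key.
have inj : injective (intr : int -> rat) by exact: intr_inj.
have sF : size F^Q = size F by rewrite size_map_inj_poly ?rmorph0.
by rewrite -sF -sz; apply: dvdp_leq dv; rewrite -size_poly_eq0 sF size_poly_eq0.
Qed.

End ConjugateRoots.

(** * A lower bound for the number of primes *)

(** Legendre's formula: each k contributes at most 1 to the exponent of p, and nothing once p^k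
    exceeds 2 t. *)
Lemma logn_bin_central (p t : nat) : prime p -> (0 < t)%N -> (p ^ logn p 'C(t.*2, t) <= t.*2)%N.
Proof.
move=> pp t0; set l := trunc_log p t.*2.
have p1 := prime_gt1 pp.
have tl : (p ^ l <= t.*2)%N by apply: trunc_logP => //; rewrite double_gt0.
suff le : (logn p 'C(t.*2, t) <= l)%N by apply: leq_trans tl; rewrite leq_pexp2l // prime_gt0.
have E : (logn p 'C(t.*2, t) + (logn p t`! + logn p t`!) = logn p (t.*2)`!)%N.
  have := @bin_fact t.*2 t; rewrite -addnn leq_addr addnK => /(_ isT) <-.
  by rewrite !lognM ?muln_gt0 ?fact_gt0 // bin_gt0 leq_addr.
rewrite !logn_fact // in E.
have W : (\sum_(1 <= k < t.+1) t %/ p ^ k = \sum_(1 <= k < t.*2.+1) t %/ p ^ k)%N.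
  rewrite (big_cat_nat (n := t.+1) (p := t.*2.+1)) //=; last by rewrite ltnS -addnn leq_addr.
  suff -> : (\sum_(t.+1 <= k < t.*2.+1) t %/ p ^ k = 0)%N by rewrite addn0.
  rewrite big_nat_cond big1 // => k /andP[/andP[tk _] _].
  by rewrite divn_small // (leq_trans tk) // ltnW // ltn_expl.
rewrite W in E.
have : (\sum_(1 <= k < t.*2.+1) t.*2 %/ p ^ k <= \sum_(1 <= k < t.*2.+1) (t %/ p ^ k + t %/ p ^ k + (k <= l)))%N.
  rewrite big_nat_cond [leqRHS]big_nat_cond; apply: leq_sum => k /andP[/andP[k1 _] _].
  have pk : (0 < p ^ k)%N by rewrite expn_gt0 prime_gt0.
  case: (leqP k l) => [_|lk].
    rewrite -ltnS -[X in (_ < X)%N]addnS ltn_divLR //.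
    by have := ltn_ceil t pk; rewrite -addnn !mulnDl; nia.
  by rewrite divn_small // (@leq_trans (p ^ l.+1)) ?trunc_log_ltn // leq_pexp2l // prime_gt0.
rewrite !big_split /= -E.
have M m : (\sum_(1 <= k < m.+1) (k <= l) <= minn m l)%N.
  elim: m => [|m IH]; first by rewrite big_geq.
  by rewrite big_nat_recr //=; move: IH; case: leqP; lia.
have := M t.*2; lia.
Qed.

Lemma central_ge (t : nat) : (2 ^ t <= 'C(t.*2, t))%N.
Proof.
elim: t => [|t IH]; first by rewrite bin0.
have E : 'C(t.*2.+1, t) = 'C(t.*2.+1, t.+1).
  by rewrite -[in RHS]bin_sub; [congr ('C(_, _)); lia|lia].
by rewrite doubleS binS E expnS mul2n -addnn leq_add // binS (leq_trans IH) // leq_addl.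
Qed.

(** Compare 2^t <= C(2t, t) <= (2t)^c for t = s^2, where c counts the primes up to 2 t. From s = 7
    on, 2 s^2 <= 2^s. *)
Lemma many_primes (s : nat) : (7 <= s)%N -> (s <= count prime (iota 0 (2 * s ^ 2).+1))%N.
Proof.
move=> s7; set t := (s ^ 2)%N; set P := iota _ _; set c := count prime P.
have t0 : (0 < t)%N by rewrite expn_gt0 (leq_trans _ s7).
have pw : (2 * s ^ 2 <= 2 ^ s)%N.
  rewrite /t -mulnn -(subnK s7); elim: (s - 7)%N => // k; rewrite addSn expnS.
  by move: (2 ^ _)%N => x; nia.
rewrite leqNgt; apply/negP => cs.
have C0 : (0 < 'C(t.*2, t))%N by rewrite bin_gt0 -addnn leq_addr.
have le : ('C(t.*2, t) <= t.*2 ^ c)%N.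
  rewrite [X in (X <= _)%N](prod_prime_decomp C0) prime_decompE big_map /=.
  apply: (@leq_trans (\prod_(p <- primes 'C(t.*2, t)) t.*2)).
    rewrite big_seq [leqRHS]big_seq; apply: leq_prod => p; rewrite mem_primes => /and3P[pp _ _].
    exact: logn_bin_central.
  rewrite big_const_seq count_predT iter_muln muln1 leq_pexp2l ?double_gt0 //.
  rewrite /c -size_filter; apply: uniq_leq_size; first exact: primes_uniq.
  move=> p pC; move: (pC); rewrite mem_primes mem_filter => /and3P[pp _ _]; rewrite pp mem_iota /= add0n ltnS mul2n.
  by apply: leq_trans (logn_bin_central pp t0); rewrite -[leqLHS]expn1; apply: leq_pexp2l; [exact: prime_gt0|rewrite logn_gt0].
have : (2 ^ t <= 2 ^ (s * c))%N.
  apply: leq_trans (central_ge t) (leq_trans le _); rewrite expnM -mul2n.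
  case: (c) => [|c']; [by rewrite !expn0|by rewrite leq_exp2r].
by rewrite leq_exp2l // /t -mulnn leq_pmul2l ?(leq_trans _ s7) // leqNgt cs.
Qed.

(** * Pigeonhole and divided derivatives *)

Section Boxes.
Variable R : realType.
(** Cells of side 1/4: the interval [-B, B] needs 8 B + 1 of them, the last one for its right
    endpoint. *)
Lemma box_pigeonhole (T J : finType) (v : T -> J -> R) (B : nat) :
  (forall t j, `|v t j| <= B%:R) -> ((8 * B).+1 ^ #|J| < #|T|)%N ->
  exists t t', t != t' /\ forall j, `|v t j - v t' j| <= 1 / 4.
Proof.
move=> vB lt.
have cellP t j : (Num.truncn (4 * (v t j + B%:R)) < (8 * B).+1)%N.
  rewrite ltnS; have := vB t j; rewrite ler_norml => /andP[h1 h2].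
  rewrite -(@ler_nat R); apply: le_trans (_ : 4 * (v t j + B%:R) <= _); last by rewrite natrM; lra.
  by rewrite truncn_le //; lra.
pose cell t : {ffun J -> 'I_(8 * B).+1} := [ffun j => Ordinal (cellP t j)].
have /injectivePn[t [t' tt' E]] : ~~ injectiveb cell.
  apply: contraL lt => /injectiveP/leq_card; rewrite card_ffun card_ord -leqNgt; exact.
exists t, t'; split; first by [].
move=> j; have := congr1 (fun f : {ffun J -> _} => val (f j)) E; rewrite !ffunE /= => e.
have b1 := vB t j; have b2 := vB t' j; rewrite !ler_norml in b1 b2; case/andP: b1 b2 => a1 a2 /andP[a3 a4].
have p1 : 0 <= 4 * (v t j + B%:R) by lra.
have p2 : 0 <= 4 * (v t' j + B%:R) by lra.
have := truncn_itv p1; have := truncn_itv p2; rewrite e -[(Num.truncn _).+1%:R]natr1; move: ((Num.truncn _)%:R) => q /andP[c1 c2] /andP[c3 c4].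
by rewrite ler_norml; apply/andP; split; lra.
Qed.
End Boxes.

(** Divided derivatives are used because they preserve integer coefficients and enlarge them only by
    binomial coefficients. *)
Lemma nderiv_XsubC_dvd (F : fieldType) (al : F) (m : nat) (p : {poly F}) :
  (forall l, (l < m)%N -> root p^`N(l) al) -> ('X - al%:P) ^+ m %| p.
Proof.
elim: m p => [|m IH] p rp; first by rewrite expr0 dvd1p.
have := rp 0 isT; rewrite nderivn0 -dvdp_XsubCl => /dvdpP[q qE].
rewrite qE exprSr dvdp_mul //; apply: IH => l lm.
have := rp l.+1 lm; rewrite qE (_ : q * ('X - al%:P) = q * 'X + 0%:P - al *: q); last first.
  by rewrite polyC0 addr0 mulrBr mulrC -mul_polyC [al%:P * _]mulrC.
rewrite nderivnB nderivnZ nderivnMXaddC /root !hornerE => /eqP E; apply/eqP; rewrite -E; ring.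
Qed.

Lemma bin_le_exp (k l : nat) : ('C(k, l) <= k ^ l)%N.
Proof.
elim: l k => [|l IH] [|k]; rewrite ?bin0 ?bin0n //.
apply: leq_trans (leq_pmull _ (ltn0Sn l)) _; rewrite -mul_bin_diag expnS leq_mul //=.
by apply: leq_trans (IH k) _; case: (l) => [|l']; rewrite ?expn0 // leq_exp2r.
Qed.

Section ComplexParts.
Variable R : realType.

Lemma Re_Im_le (x : R[i]) (B : nat) : `|x| <= B%:R -> `|complex.Re x| <= B%:R /\ `|complex.Im x| <= B%:R.
Proof.
rewrite normc_def -(rmorph_nat (real_complex R)) lecR => le.
have E (a b : R) : Num.sqrt (a ^+ 2 + b) <= B%:R -> 0 <= b -> `|a| <= B%:R.
  move=> h b0; apply: le_trans h; rewrite -sqrtr_sqr; apply: ler_wsqrtr; lra.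
by split; [apply: E le _|rewrite addrC in le; apply: E le _]; exact: sqr_ge0.
Qed.

Lemma norm_le_half (x : R[i]) : `|complex.Re x| <= 1 / 4 -> `|complex.Im x| <= 1 / 4 -> `|x| <= 1 / 2.
Proof.
rewrite !ler_norml => /andP[h1 h2] /andP[h3 h4].
rewrite normc_def (_ : 1 / 2 = (1 / 2 : R)%:C%C); last by rewrite rmorphM fmorphV rmorph1 rmorph_nat.
rewrite lecR [leRHS](_ : _ = Num.sqrt ((1 / 2) ^+ 2)); last by rewrite sqrtr_sqr ger0_norm //; lra.
apply: ler_wsqrtr; nra.
Qed.

End ComplexParts.

(** * Dobrowolski's argument *)

Section Siegel.
Variables (R : realType) (n : nat) (A : 'M[int]_n.+1) (P : 'M[R[i]]_n.+1).
Local Notation C := (R[i]).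
Local Notation "p ^Z" := (map_poly (intr : int -> C) p) (at level 2, format "p ^Z").
Local Notation "p ^Q" := (map_poly (intr : int -> rat) p) (at level 2, format "p ^Q").
Local Notation "p ^R" := (map_poly (ratr : rat -> C) p) (at level 2, format "p ^R").
Hypothesis P_unit : P \in unitmx.
Local Notation AC := (map_mx (intr : int -> C) A).
Hypothesis P_trig : trig_by P AC.
Local Notation z i := (dg P i AC).
Local Notation f := (char_poly A).
Variable al : C.
Hypothesis f_min : forall q : {poly rat}, root q^R al -> f^Q %| q.
Hypothesis f_al : root f^Z al.
Hypothesis al_gt1 : 1 < `|al|.
Hypothesis small : forall i, z i = al \/ `|z i| <= 1.
Implicit Types (F G h : {poly int}).

Lemma conj_root q i : root q^R (z i) -> f^Q %| q.
Proof.
have fm : f^Q \is monic by exact: monic_intQ (char_poly_monic _).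
have rf : root (f^Q)^R al by rewrite map_int_rat.
have [cop|//] := min_rat_coprime q (monic_neq0 fm) rf f_min.
move=> rq; have : coprimep (f^Q)^R q^R by rewrite coprimep_map.
move=> /coprimepP/(_ ('X - (z i)%:P)); rewrite !dvdp_XsubCl rq => H.
have rz : root (f^Q)^R (z i) by rewrite map_int_rat (char_poly_roots P_unit P_trig) (bigD1 i) //= rootM root_XsubC eqxx.
by have := H rz isT => /eqp_size; rewrite size_XsubC size_poly1.
Qed.

(** [al] is a simple root of [f], so each factor X - al of G brings a whole factor [f], and these
    can be removed one at a time. *)
Lemma dvd_of_nderiv (m : nat) G : (forall l, (l < m)%N -> root (G^`N(l))^Z al) -> exists h, G = f ^+ m * h.
Proof.
move=> rG; have : ('X - al%:P) ^+ m %| (G^Q)^R.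
  by apply: nderiv_XsubC_dvd => l lm; rewrite map_int_rat nderivn_map rG.
have [i0 [i0E i0P]] := al_simple P_unit P_trig f_min f_al small.
set x := 'X - al%:P => dG; pose r := \prod_(i | i != i0) ('X - (z i)%:P).
have fE : f^Z = x * r by rewrite (char_poly_roots P_unit P_trig) (bigD1 i0) //= i0E.
have ral : ~~ root r al.
  rewrite /root horner_prod prodf_seq_neq0; apply/allP => i _; apply/implyP => ne.
  rewrite hornerXsubC subr_eq0; apply/eqP => E; have := i0P i ne.
  by rewrite -E => /(lt_le_trans al_gt1); rewrite ltxx.
have dv k (q : {poly rat}) : x ^+ k %| q^R -> (f^Q) ^+ k %| q.
  elim: k q => [|k IH] q; first by move=> _; rewrite expr0 dvd1p.
  move=> dq; have : f^Q %| q.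
    by apply: f_min; rewrite -dvdp_XsubCl; apply: dvdp_trans dq; rewrite exprS dvdp_mulr.
  move=> /dvdpP[q1 qE]; rewrite qE exprSr dvdp_mul //; apply: IH.
  have cop : coprimep (x ^+ k) r by rewrite coprimep_expl // coprimep_sym coprimep_XsubC.
  move: dq; rewrite qE rmorphM /= map_int_rat fE [x * r]mulrC mulrA exprSr dvdp_mul2r ?polyXsubC_eq0 //.
  by rewrite Gauss_dvdpl.
have := dv m G^Q dG; rewrite -rmorphXn /= dvdp_rat_int.
have fm : f ^+ m \is monic by rewrite monic_exp // char_poly_monic.
by move=> /(Pdiv.IdomainMonic.dvdpP fm)[h hE]; exists h; rewrite mulrC.
Qed.

(** * An integer polynomial with N coefficients, of order m at [al]; [U_small] is the assumption to
    be refuted *)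

Section AuxiliaryPolynomial.
Variables (m s : nat).
Hypothesis m_gt0 : (0 < m)%N.
Hypothesis s_def : s = (4 * m * (m + 4))%N.
Local Notation N := (s * n.+1)%N.
Hypothesis m_large : (2 * N ^ 2 < 2 ^ m)%N.
Hypothesis U_small : `|al| ^+ (2 * s ^ 3) <= 2.

Definition int_comb (c : 'I_N -> int) : {poly int} := \sum_(j < N) c j *: 'X^j.

Lemma size_int_comb c : (size (int_comb c) <= N)%N.
Proof.
apply: leq_trans (size_sum _ _ _) _; apply/bigmax_leqP => j _.
by apply: leq_trans (size_scale_leq _ _) _; rewrite size_polyXn.
Qed.

Lemma coef_int_comb c (j : 'I_N) : (int_comb c)`_j = c j.
Proof.
rewrite /int_comb coef_sum (bigD1 j) //= big1 ?addr0 => [|k kj]; first by rewrite coefZ coefXn eqxx mulr1.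
by rewrite coefZ coefXn [_ == _](_ : _ = false) ?mulr0 //; apply: contraNF kj => /eqP e; apply/eqP/val_inj.
Qed.

Lemma eval_bound c (l : nat) (y rho : C) : (forall j, `|c j| <= N%:Z) -> 1 <= rho -> `|y| <= rho ->
  `|(((int_comb c)^`N(l))^Z).[y]| <= (N ^ l.+2)%:R * rho ^+ N.
Proof.
move=> cN r1 yr; have r0 : 0 <= rho by apply: le_trans r1; exact: ler01.
rewrite -nderivn_map /int_comb rmorph_sum /= raddf_sum horner_sum.
apply: le_trans (ler_norm_sum _ _ _) _.
have -> : (N ^ l.+2)%:R * rho ^+ N = \sum_(j < N) ((N ^ l.+1)%:R * rho ^+ N).
  by rewrite sumr_const card_ord expnS natrM -mulrA mulr_natl.
apply: ler_sum => j _; rewrite /= map_polyZ map_polyXn nderivnZ nderivnXn hornerZ hornerMn hornerXn -mulr_natr !normrM normrX.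
have b1 : `|(c j)%:~R : C| <= N%:R by rewrite -intr_norm (ler_int C _ N%:Z).
have b2 : `|y| ^+ (j - l) <= rho ^+ N.
  apply: le_trans (lerXn2r _ _ _ yr) _; rewrite ?nnegrE //.
  by apply: ler_weXn2l => //; rewrite (leq_trans (leq_subr _ _)) // ltnW.
have b3 : `|'C(j, l)%:R : C| <= (N ^ l)%:R.
  rewrite normr_nat ler_nat; apply: leq_trans (_ : j ^ l <= _)%N; last by case: (l) => [|l']; rewrite ?expn0 // leq_exp2r // ltnW.
  exact: bin_le_exp.
rewrite expnS natrM mulrAC mulrA.
by do 2 (apply: ler_pM => //; rewrite ?mulr_ge0 ?exprn_ge0).
Qed.

(** Values at [al] may be as large as its N-th power; dividing by the weight makes all conjugates
    comparable in the pigeonhole argument. *)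
Local Notation weight i := (if z i == al then `|al| ^+ N else 1 : C).

Let U1 : 1 <= `|al|. Proof. exact: ltW. Qed.
Let s_gt0 : (0 < s)%N. Proof. by rewrite s_def !muln_gt0 m_gt0 addn_gt0 orbT. Qed.
Lemma weight_ge1 i : 1 <= weight i.
Proof. by case: eqP => // _; rewrite exprn_ege1. Qed.

Lemma prod_weight p : \prod_i weight i ^+ p = `|al| ^+ (p * N).
Proof.
have [i0 [i0E i0P]] := al_simple P_unit P_trig f_min f_al small.
rewrite (bigD1 i0) //= i0E eqxx big1 ?mulr1 -?exprM 1?mulnC // => i ne.
rewrite (_ : (z i == al) = false) ?expr1n //; apply/eqP => E.
by have := i0P i ne; rewrite E => /(lt_le_trans al_gt1); rewrite ltxx.
Qed.

Lemma U_pow_le k : (k <= 2 * s ^ 3)%N -> `|al| ^+ (k * n.+1) <= 2 ^+ n.+1.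
Proof.
move=> ks; rewrite exprM; apply: lerXn2r; rewrite ?nnegrE ?exprn_ge0 //.
by apply: le_trans U_small; exact: ler_weXn2l.
Qed.

Lemma eval_weight c (l p : nat) i : (0 < p)%N -> (forall j, `|c j| <= N%:Z) ->
  `|(((int_comb c)^`N(l))^Z).[z i ^+ p]| <= (N ^ l.+2)%:R * weight i ^+ p.
Proof.
move=> p0 cN; case: eqP => [->|ne].
  rewrite exprAC; apply: eval_bound => //; last by rewrite normrX.
  by rewrite exprn_ege1.
rewrite expr1n -[X in _ * X](expr1n _ N); apply: eval_bound => //.
by rewrite normrX exprn_ile1 //; case: (small i).
Qed.

(** The product over the conjugates is an integer multiple of K of size below K, hence zero. One
    factor vanishes, and by conjugacy so does the one at [al]. *)
Lemma int_prod_lt (G : {poly int}) p (w : 'I_n.+1 -> C) (K : nat) :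
  (exists N' : int, \prod_i (G^Z).[z i ^+ p] = (N' * K%:Z)%:~R) ->
  (forall i, `|(G^Z).[z i ^+ p]| <= w i) -> \prod_i w i < K%:R -> root G^Z (al ^+ p).
Proof.
move=> [N' E] le lt1.
have : `|(N' * K%:Z)%:~R : C| < K%:R.
  by rewrite -E normr_prod; apply: le_lt_trans lt1; apply: ler_prod => i _; rewrite normr_ge0 le.
rewrite -intr_norm -[K%:R]/(K%:Z%:~R) ltr_int => lt2.
have N0 : N' = 0 by move: lt2; clear; nia.
move: E; rewrite N0 mul0r => /eqP; rewrite prodf_seq_eq0 => /hasP[i _ /= /eqP Gi].
have q0 : root ((G \Po 'X^p)^Q)^R (z i).
  by rewrite map_int_rat map_comp_poly map_polyXn /root horner_comp hornerXn Gi.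
have /dvdpP[q E] := conj_root q0.
have : root ((G \Po 'X^p)^Q)^R al by rewrite E rmorphM /= rootM map_int_rat f_al orbT.
by rewrite map_int_rat map_comp_poly map_polyXn /root horner_comp hornerXn.
Qed.

(** Two coefficient vectors with entries in [0, N) have divided derivatives of order below m that
    agree within half the weight at every conjugate. For their difference the product over the
    conjugates is below |al|^N / 2^(n+1) < 1, so each such derivative vanishes at [al]. *)
Lemma siegel : exists c, [/\ int_comb c != 0, forall j, `|c j| <= N%:Z & exists h, int_comb c = f ^+ m * h].
Proof.
have N0 : (0 < N)%N by rewrite muln_gt0 s_gt0.
pose B := (N ^ m.+1)%N.
pose F (a : {ffun 'I_N -> 'I_N}) := int_comb (fun j => (a j)%:Z).
pose J := ('I_n.+1 * 'I_m * bool)%type.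
pose v (a : {ffun 'I_N -> 'I_N}) (j : J) : R :=
  let w := (((F a)^`N(j.1.2))^Z).[z j.1.1] / weight j.1.1 in if j.2 then complex.Re w else complex.Im w.
have w0 i : 0 < weight i by apply: lt_le_trans (weight_ge1 i); exact: ltr01.
have vB a j : `|v a j| <= B%:R.
  have le : `|(((F a)^`N(j.1.2))^Z).[z j.1.1] / weight j.1.1| <= B%:R.
    rewrite normrM normfV [`|weight _|]gtr0_norm // ler_pdivrMr //.
    have := @eval_weight (fun j => (a j)%:Z) j.1.2 1 j.1.1 isT; rewrite !expr1 => H.
    apply: le_trans (H _) _ => [k|]; first by rewrite ger0_norm // lez_nat ltnW.
    by apply: ler_wpM2r; [exact: ltW|rewrite ler_nat leq_pexp2l // ltnS].
  by have [h1 h2] := Re_Im_le le; rewrite /v; case: j.2.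
(* There are 2 m (n + 1) real coordinates with at most N^(m+5) cells each, against N^(s (n+1))
   vectors; s = 4 m (m + 4) exceeds 2 m (m + 5). *)
have cnt : ((8 * B).+1 ^ #|{: J}| < #|{: {ffun 'I_N -> 'I_N}}|)%N.
  rewrite !card_ffun !card_prod card_bool !card_ord.
  have N2 : (2 <= N)%N by rewrite s_def; move: m_gt0; clear; nia.
  have B9 : ((8 * B).+1 <= N ^ (m + 5))%N.
    have N4 : (2 ^ 4 <= N ^ 4)%N by rewrite leq_exp2r.
    have B0 : (0 < B)%N by rewrite expn_gt0 N0.
    by rewrite (_ : m + 5 = m.+1 + 4)%N ?expnD -/B; [move: N4 B0; clear; nia|lia].
  apply: (@leq_ltn_trans ((N ^ (m + 5)) ^ (n.+1 * m * 2))); first by rewrite leq_exp2r // !muln_gt0 m_gt0.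
  by rewrite -expnM ltn_exp2l // s_def; move: m_gt0; clear; nia.
have [a [a' [ne close]]] := box_pigeonhole vB cnt.
pose c j : int := (a j)%:Z - (a' j)%:Z.
have cE : int_comb c = F a - F a'.
  by rewrite /F /int_comb -sumrB; apply: eq_bigr => j _; rewrite scalerBl.
exists c; split.
- apply: contraNneq ne => c0; apply/eqP/ffunP => j; apply/val_inj.
  have := coef_int_comb c j; rewrite c0 coef0 => /esym/eqP.
  by rewrite /c subr_eq0 => /eqP[].
- by move=> j; rewrite /c; have := ltn_ord (a j); have := ltn_ord (a' j); lia.
apply: dvd_of_nderiv => l lm.
have := @int_prod_lt ((int_comb c)^`N(l)) 1 (fun i => weight i / 2) 1; rewrite expr1; apply.
- exists (\det (horner_mx A ((int_comb c)^`N(l)))); rewrite mulr1 (norm_horner P_unit P_trig).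
  by apply: eq_bigr => i _; rewrite expr1.
- move=> i; rewrite expr1 cE nderivnB rmorphB /= hornerD hornerN.
  have := close (i, Ordinal lm, true); have := close (i, Ordinal lm, false); rewrite /v /= -!raddfB /= -mulrBl => cI cR.
  have := norm_le_half cR cI; rewrite normrM normfV [`|weight _|]gtr0_norm // ler_pdivrMr // mulrC.
  by rewrite mul1r.
rewrite big_split prodr_const card_ord /=.
have := prod_weight 1; rewrite mul1n; under eq_bigr do rewrite expr1; move=> ->.
rewrite exprVn ltr_pdivrMr ?exprn_gt0 // mul1r exprM.
have Us : `|al| ^+ s < 2.
  apply: lt_le_trans U_small; rewrite ltr_eXn2l //.
  by move: s_gt0; clear; rewrite !expnS expn0; nia.
by apply: ltrXn2r; rewrite ?nnegrE ?exprn_ge0.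
Qed.

(** The product over the conjugates is a multiple of p^(m (n+1)), at least 2^(m (n+1)), while
    [U_small] bounds it by (2 N^2)^(n+1), which is smaller by [m_large]. *)
Lemma auxiliary_vanishes c (p : nat) : prime p -> (p <= 2 * s ^ 2)%N -> (forall j, `|c j| <= N%:Z) ->
  (exists h, int_comb c = f ^+ m * h) -> root (int_comb c)^Z (al ^+ p).
Proof.
move=> pp pP cN [h hE].
apply: (@int_prod_lt _ p (fun i => (N ^ 2)%:R * weight i ^+ p) (p ^ (n.+1 * m))).
- have [N' N'E] := norm_Frobenius P_unit P_trig pp hE; exists N'; rewrite N'E; congr (_%:~R).
  by congr (_ * _); rewrite -[RHS]natz natrX natz.
- by move=> i; have := @eval_weight c 0 p i (prime_gt0 pp) cN; rewrite nderivn0.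
rewrite big_split prodr_const card_ord /= prod_weight mulnA.
apply: (@le_lt_trans _ _ ((N ^ 2)%:R ^+ n.+1 * 2 ^+ n.+1)).
  apply: ler_wpM2l; first by rewrite exprn_ge0.
  by apply: U_pow_le; move: pP; clear; rewrite !expnS !expn0; nia.
rewrite -exprMn -natrM -natrX ltr_nat expnM mulnC.
apply: (@leq_trans ((2 ^ n.+1) ^ m)%N); last by case: (m) => // m'; rewrite leq_exp2r // leq_exp2r // prime_gt1.
by rewrite -expnM [(n.+1 * m)%N]mulnC expnM ltn_exp2r.
Qed.

(** Each of at least s primes up to 2 s^2 costs n + 1 in the degree of F, which has only N = s (n +
    1) coefficients. *)
Lemma U_contradiction : (7 <= s)%N -> False.
Proof.
move=> s7; have [c [c0 cN cf]] := siegel.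
pose ps := [seq p <- iota 0 (2 * s ^ 2).+1 | prime p].
have pP p : p \in ps -> prime p /\ (p <= 2 * s ^ 2)%N.
  by rewrite mem_filter mem_iota /= add0n ltnS => /andP[-> ->].
have := vanishing_size P_unit P_trig f_min f_al al_gt1 small (F := int_comb c) (ps := ps) c0.
have u : uniq ps by rewrite filter_uniq // iota_uniq.
have a : all (fun k => 0 < k)%N ps by apply/allP => p /pP[/prime_gt0].
have v p : p \in ps -> root (int_comb c)^Z (al ^+ p) by move=> /pP[pp le]; exact: auxiliary_vanishes.
move=> /(_ u a v) lt; have := leq_trans lt (size_int_comb c).
by rewrite ltn_mul2r /= size_filter ltnNge many_primes.
Qed.

End AuxiliaryPolynomial.

End Siegel.

Lemma companion_exists (p : {poly int}) n : p \is monic -> size p = n.+2 -> exists A : 'M[int]_n.+1, char_poly A = p.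
Proof. by move=> pm sz; have := companionmxK pm; move: (companionmx p); rewrite sz => A AE; exists A. Qed.

(** Of order log d; the factor 4 and the shift 7 are what makes 2 N^2 < 2^m hold for N = s d, with s
    of order m^2 and so of order (log d)^2. *)
Definition dob_m (d : nat) : nat := (4 * (up_log 2 d + 7))%N.
Definition dob_s (d : nat) : nat := (4 * dob_m d * (dob_m d + 4))%N.

Lemma dob_s_ge7 d : (7 <= dob_s d)%N.
Proof.
by apply: (@leq_trans (4 * dob_m d)); [rewrite /dob_m; lia|apply: leq_pmulr; rewrite addn_gt0 orbT].
Qed.

Lemma dob_m_large d : (2 * (dob_s d * d) ^ 2 < 2 ^ dob_m d)%N.
Proof.
rewrite /dob_s /dob_m; have := up_logP d (isT : 1 < 2)%N; move: (up_log 2 d) => l dl.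
have e1 : ((l + 7) * (l + 8) <= 2 ^ (l + 7))%N.
  by elim: l {dl} => // l IH; rewrite addSn expnS; move: IH; move: (2 ^ _)%N => x; nia.
have -> : (2 ^ (4 * (l + 7)) = (2 ^ (l + 7)) ^ 2 * 2 ^ 14 * (2 ^ l) ^ 2)%N.
  by rewrite -!expnM -!expnD; congr expn; lia.
have e2 : (((l + 7) * (l + 8)) ^ 2 <= (2 ^ (l + 7)) ^ 2)%N by rewrite leq_exp2r.
have e3 : (d ^ 2 <= (2 ^ l) ^ 2)%N by rewrite leq_exp2r.
have e4 : (0 < (2 ^ (l + 7)) ^ 2)%N by rewrite !expn_gt0.
have e5 : (0 < (2 ^ l) ^ 2)%N by rewrite !expn_gt0.
have -> : (2 * (4 * (4 * (l + 7)) * (4 * (l + 7) + 4) * d) ^ 2 = 2 ^ 13 * (((l + 7) * (l + 8)) ^ 2 * d ^ 2))%N.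
  by rewrite (_ : 4 * (l + 7) + 4 = 4 * (l + 8))%N ?mulnDr -?addnA // !expnMn; ring.
apply: (@leq_ltn_trans (2 ^ 13 * ((2 ^ (l + 7)) ^ 2 * (2 ^ l) ^ 2))%N).
  by rewrite leq_mul2l leq_mul.
rewrite mulnCA -[X in (_ < X)%N]mulnA ltn_mul2l e4 /= ltn_mul2r e5 /=.
by rewrite ltn_exp2l.
Qed.

(** [f0] supplies integrality and [q0] the degree bound. Conjugacy is expressed through rational
    polynomials, so the two may come from different number fields. *)
Lemma dobrowolski (R : realType) (U : R) (f0 : {poly int}) (q0 : {poly rat}) (d : nat) :
  let al : R[i] := real_complex R U in
  1 < U -> f0 \is monic -> root (map_poly intr f0) al -> q0 != 0 -> (size q0 <= d.+1)%N -> root (map_poly ratr q0) al ->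
  (forall z : R[i], (forall q : {poly rat}, root (map_poly ratr q) al -> root (map_poly ratr q) z) -> z = al \/ `|z| <= 1) ->
  2 < U ^+ (2 * dob_s d ^ 3).
Proof.
move=> al U1 f0m rf0 q00 sq0 rq0 conj.
have [p [pm rp] pmin] := min_rat_poly q00 rq0.
have rf0' : root (map_poly ratr (map_poly intr f0 : {poly rat})) al by rewrite map_int_rat.
have [f fm pE] := monic_dvd_int pm f0m (pmin _ rf0').
have inj : injective (intr : int -> rat) by exact: intr_inj.
have sp : size p = size f by rewrite pE size_map_inj_poly ?rmorph0.
have p0 : p != 0 by exact: monic_neq0.
have sz1 : (1 < size p)%N.
  rewrite ltnNge; apply/negP => le; have /size_poly1P[c c0 cE] : size p == 1%N by rewrite eqn_leq le size_poly_gt0.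
  by move: rp; rewrite cE map_polyC /root hornerC fmorph_eq0 (negPf c0).
have [n szn] : exists n, size f = n.+2 by exists (size f - 2)%N; move: sz1; rewrite sp; clear; lia.
have nd : (n.+1 <= d)%N by have := leq_trans (dvdp_leq q00 (pmin _ rq0)) sq0; rewrite sp szn ltnS.
have [A AE] := companion_exists fm szn.
have [P Pu Pt] := @joint_trig R[i] n [:: map_mx intr A] ltac:(by move=> B B' /[!inE] /eqP -> /eqP ->).
have {}Pt := Pt _ (mem_head _ _).
have small i : dg P i (map_mx intr A) = al \/ `|dg P i (map_mx intr A)| <= 1.
  apply: conj => q /pmin/dvdpP[q1 qE]; rewrite qE rmorphM /= rootM pE map_int_rat -AE.
  by rewrite (char_poly_roots Pu Pt) (bigD1 i) //= rootM root_XsubC eqxx orbT.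
have al1 : `|al| = al by rewrite ger0_norm // lecR; lra.
rewrite ltNge; apply/negP => le.
have fmin q : root (map_poly ratr q) al -> map_poly intr (char_poly A) %| q by rewrite AE -pE; exact: pmin.
have fal : root (map_poly intr (char_poly A)) al by move: rp; rewrite pE map_int_rat -AE.
have big1 : 1 < `|al| by rewrite al1 ltcR.
apply: (U_contradiction Pu Pt fmin fal big1 small (m := dob_m d) (s := dob_s d)) => //.
- by rewrite /dob_m muln_gt0 addn_gt0 orbT.
- apply: leq_ltn_trans (dob_m_large d); rewrite leq_mul2l /= leq_exp2r // leq_mul2l nd orbT //.
- by rewrite al1 -rmorphXn /= -(rmorph_nat (real_complex R)) lecR.
- exact: dob_s_ge7.
Qed.

(** * Regular representation and embeddings of a number field *)

Section MultiplicationMatrices.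
Variables (k : fieldExtType rat) (n : nat) (e : n.+1.-tuple k).
Hypothesis e_basis : basis_of {:k} e.

Definition mulM (x : k) : 'M[rat]_n.+1 := \matrix_(i, j) coord e j (x * e`_i).

Lemma mulME x (i : 'I_n.+1) : x * e`_i = \sum_j mulM x i j *: e`_j.
Proof. by rewrite {1}(coord_basis e_basis (memvf (x * e`_i))); apply: eq_bigr => j _; rewrite mxE. Qed.
Lemma mulM0 : mulM 0 = 0. Proof. by apply/matrixP => i j; rewrite !mxE mul0r linear0. Qed.
Lemma mulMD x y : mulM (x + y) = mulM x + mulM y.
Proof. by apply/matrixP => i j; rewrite !mxE mulrDl linearD. Qed.
Lemma mulMZ c x : mulM (c *: x) = c *: mulM x.
Proof. by apply/matrixP => i j; rewrite !mxE -scalerAl linearZ. Qed.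
Lemma mulM1 : mulM 1 = 1%:M.
Proof. by apply/matrixP => i j; rewrite !mxE mul1r coord_free ?(basis_free e_basis) // eq_sym. Qed.
Lemma mulMM x y : mulM (x * y) = mulM x *m mulM y.
Proof.
apply/matrixP => i j; rewrite [x * y]mulrC !mxE -mulrA mulME mulr_sumr linear_sum /=.
by apply: eq_bigr => l _; rewrite -scalerAr linearZ /=; congr (_ * _); rewrite mxE.
Qed.

Lemma mulM_inj x : mulM x = 0 -> x = 0.
Proof.
move=> x0; rewrite -[x]mulr1 [X in _ * X](coord_basis e_basis (memvf 1)) mulr_sumr big1 // => i _.
by rewrite -scalerAr mulME big1 ?scaler0 // => j _; rewrite x0 mxE scale0r.
Qed.

Lemma horner_mulM x (q : {poly rat}) : horner_mx (mulM x) q = mulM (map_poly (in_alg k) q).[x].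
Proof.
elim/poly_ind: q => [|q c IH]; first by rewrite !rmorph0 horner0 mulM0.
rewrite !rmorphD !rmorphM /= horner_mx_X horner_mx_C map_polyX map_polyC hornerMXaddC mulMD mulMM -IH.
by rewrite mulMZ mulM1 scalemx1.
Qed.

Lemma char_poly_mulM x : (map_poly (in_alg k) (char_poly (mulM x))).[x] = 0.
Proof. by apply: mulM_inj; rewrite -horner_mulM Cayley_Hamilton. Qed.

End MultiplicationMatrices.

Lemma dim_basis (k : fieldExtType rat) : exists n (e : n.+1.-tuple k), basis_of {:k} e /\ \dim {:k} = n.+1.
Proof.
have d0 : (0 < \dim {:k})%N by exact: adim_gt0.
have := vbasisP {:k}; move: (vbasis {:k}); rewrite -(prednK d0) => e eb.
by exists (\dim {:k}).-1, e; split => //; rewrite prednK.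
Qed.

Lemma annihilating_poly (k : fieldExtType rat) (x : k) : exists q : {poly rat},
  [/\ q \is monic, size q = (\dim {:k}).+1 & root (map_poly (in_alg k) q) x].
Proof.
have [n [e [eb ->]]] := dim_basis k; exists (char_poly (mulM e x)).
by rewrite char_poly_monic size_char_poly /root char_poly_mulM.
Qed.

Lemma rmorph_in_alg (k : fieldExtType rat) (K : numFieldType) (tau : {rmorphism k -> K}) (q : {poly rat}) x :
  tau (map_poly (in_alg k) q).[x] = (map_poly ratr q).[tau x].
Proof.
rewrite -horner_map -map_poly_comp; congr (_.[_]); apply: eq_map_poly => c.
exact: (fmorph_eq_rat (tau \o in_alg k)).
Qed.

(** The multiplication matrices commute. In a common triangular form each diagonal entry is an
    embedding, real by hypothesis, and the characteristic polynomial is the product over these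
    entries. *)
Lemma embeddings (R : realType) (k : fieldExtType rat) : totally_real R k ->
  exists n (t : 'I_n.+1 -> {rmorphism k -> R}) (chi : k -> {poly rat}), forall x : k,
    [/\ chi x \is monic, root (map_poly (in_alg k) (chi x)) x & map_poly ratr (chi x) = \prod_i ('X - (t i x)%:P)].
Proof.
move=> treal; have [n [e [eb _]]] := dim_basis k; exists n.
pose C : numClosedFieldType := R[i].
pose MC x : 'M[C]_n.+1 := map_mx ratr (mulM e x).
have MCD x y : MC (x + y) = MC x + MC y by rewrite /MC mulMD map_mxD.
have MCZ c x : MC (c *: x) = ratr c *: MC x by rewrite /MC mulMZ map_mxZ.
have MC0 : MC 0 = 0 by rewrite /MC mulM0 map_mx0.
have MCM x y : MC (x * y) = MC x *m MC y by rewrite /MC (mulMM eb) map_mxM.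
have [P Pu Pt] := @joint_trig C n [seq MC e`_i | i : 'I_n.+1] ltac:(by move=> _ _ /mapP[i _ ->] /mapP[j _ ->]; rewrite -!MCM mulrC).
have tr x : trig_by P (MC x).
  rewrite (coord_basis eb (memvf x)).
  elim/big_rec: _ => [|i y _ ty]; first by rewrite MC0 -(raddf0 (@scalar_mx C n.+1)); exact: trig_by_scalar.
  rewrite MCD MCZ; apply: (trig_byD _ ty); apply: trig_byZ; apply: Pt.
  by apply/mapP; exists i; rewrite ?mem_enum.
pose tau i x := dg P i (MC x).
have tauB i : {morph tau i : x y / x - y}.
  by move=> x y; rewrite /tau -[- y]scaleN1r MCD MCZ dgD dgZ rmorphN rmorph1 mulN1r.
have tauM i : monoid_morphism (tau i).
  by split=> [|x y]; [rewrite /tau /MC (mulM1 eb) map_mx1 dg_scalar|rewrite /tau MCM dgM].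
pose tC i : {rmorphism k -> C} := HB.pack (tau i) (GRing.isZmodMorphism.Build _ _ _ (tauB i)) (GRing.isMonoidMorphism.Build _ _ _ (tauM i)).
have re i x : (complex.Re (tau i x))%:C%C = tau i x.
  by have := treal (tC i) x; rewrite -[tC i x]/(tau i x); case: (tau i x) => a b /= ->.
pose tR i x := complex.Re (tau i x).
have tRB i : {morph tR i : x y / x - y} by move=> x y; rewrite /tR tauB; case: (tau i x) (tau i y) => a b [a' b'].
have tRM i : monoid_morphism (tR i).
  have [t1 tM] := tauM i; split=> [|x y]; first by rewrite /tR t1.
  by apply: (@complexI R); rewrite [RHS](rmorphM (real_complex R)); apply: (etrans (re i _)); rewrite tM; congr (_ * _); exact: esym (re i _).
pose t i : {rmorphism k -> R} := HB.pack (tR i) (GRing.isZmodMorphism.Build _ _ _ (tRB i)) (GRing.isMonoidMorphism.Build _ _ _ (tRM i)).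
exists t, (fun x => char_poly (mulM e x)) => x.
rewrite char_poly_monic /root (char_poly_mulM eb) eqxx; split => //.
apply: (map_poly_inj (real_complex R)).
rewrite -map_poly_comp (eq_map_poly (g := ratr)) => [|c]; last exact: (fmorph_eq_rat (real_complex R \o ratr)).
have := char_poly_dg Pu (tr x); rewrite /MC -map_char_poly => ->.
rewrite rmorph_prod; apply: eq_bigr => i _; rewrite rmorphB /= map_polyX map_polyC /=; congr (_ - _%:P).
by rewrite -/(MC x) -/(tau i x) -re.
Qed.

(** * Transfer of integrality *)

Section Integrality.
Variable K : numFieldType.
Local Notation int_over := (integralOver (intr : int -> K)).

Lemma integral_rat (r : rat) : int_over (ratr r) -> exists z : int, r = z%:~R.
Proof.
case=> p pm rp.
have rq : root (map_poly (intr : int -> rat) p) r.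
  by move: rp; rewrite -map_int_rat /root horner_map fmorph_eq0.
have := monic_dvd_int (monicXsubC r) pm; rewrite dvdp_XsubCl => /(_ rq)[p1 _ E].
exists (- p1`_0); rewrite rmorphN /=; have := congr1 (fun q : {poly rat} => q`_0) E.
by rewrite coefB coefX coefC coef_map /= sub0r => <-; rewrite opprK.
Qed.

Lemma integral_prod (I : finType) (F : I -> K) : (forall i, int_over (F i)) -> int_over (\prod_i F i).
Proof. by move=> iF; elim/big_ind: _ => // [|x y]; [exact: integral1|exact: integral_mul]. Qed.

Lemma integral_char_poly n (A : 'M[K]_n) (u : K) : (forall i j, int_over (A i j)) -> root (char_poly A) u -> int_over u.
Proof.
move=> iA ru; apply: (integral_root_monic (char_poly_monic A) ru) => c /(nthP 0)[i _ <-].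
pose Q (p : {poly K}) := forall i, int_over p`_i.
have i0 : int_over 0 by apply: (@mxpoly.integral0 _ _ (intr : int -> K)).
have i1 : int_over 1 by apply: (@integral1 _ _ (intr : int -> K)).
have Q1 : Q 1 by move=> j; rewrite coef1; case: (j == _) => /=; [exact: i1|exact: i0].
have QD p q : Q p -> Q q -> Q (p + q) by move=> hp hq j; rewrite coefD; exact: integral_add.
have QM p q : Q p -> Q q -> Q (p * q).
  move=> hp hq j; rewrite coefM; elim/big_ind: _ => [|x y|l _]; [exact: i0|exact: integral_add|exact: integral_mul].
have QN p : Q p -> Q (- p) by move=> hp j; rewrite coefN; exact: integral_opp.
suff : Q (char_poly A) by apply.
rewrite /char_poly /determinant; elim/big_ind: _ => [j||s _]; [by rewrite coef0; exact: i0|exact: (QD)|].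
apply: (QM); first by case: (perm.odd_perm s); rewrite ?expr1 ?expr0 //; exact: (QN).
elim/big_ind: _ => [||j _]; [exact: Q1|exact: (QM)|].
rewrite !mxE; apply: (QD); last by apply: (QN) => l; rewrite coefC; case: eqP => _; [exact: iA|exact: i0].
by move=> l; case: (_ == _); rewrite ?mulr1n ?mulr0n ?coefX ?coef0; [case: eqP => _|]; [exact: i1|exact: i0|exact: i0].
Qed.

Lemma integral_pullback (F : numFieldType) (k : fieldType) (s : {rmorphism k -> F}) x :
  integralOver (intr : int -> F) (s x) -> alg_integer x.
Proof.
case=> p pm; rewrite /root => rp; exists p => //; rewrite /root -(fmorph_eq0 s) -horner_map -map_poly_comp.
by rewrite (eq_map_poly (g := intr)) // => c; rewrite /= rmorph_int.
Qed.

Lemma integral_push (F : numFieldType) (k : fieldType) (s : {rmorphism k -> F}) x :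
  alg_integer x -> integralOver (intr : int -> F) (s x).
Proof.
case=> p pm /rootP rp; exists p => //; apply/rootP.
have := congr1 s rp; rewrite -horner_map -map_poly_comp rmorph0 => <-.
by congr (_.[_]); apply: eq_map_poly => c; rewrite /= rmorph_int.
Qed.

End Integrality.

(** * Quaternion algebras over the reals *)

Section RealQuaternions.
Variable R : realType.
Implicit Types (M N : 'M[R]_2).

Lemma mul2 (M N : 'M[R]_2) i j : (M *m N) i j = M i 0 * N 0 j + M i 1 * N 1 j.
Proof. by rewrite mxE !big_ord_recl big_ord0 addr0; congr (_ + M i _ * N _ j); apply/val_inj. Qed.
Lemma tr2 M : \tr M = M 0 0 + M 1 1.
Proof. by rewrite /mxtrace !big_ord_recl big_ord0 addr0; congr (_ + M _ _); apply/val_inj. Qed.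
Lemma mx2P M N : M 0 0 = N 0 0 -> M 0 1 = N 0 1 -> M 1 0 = N 1 0 -> M 1 1 = N 1 1 -> M = N.
Proof. by move=> *; apply/matrixP => i j; case: (ord2P i) => ->; case: (ord2P j) => ->. Qed.

(** If i^2 were a positive number s^2, then s + i and s - i would be zero divisors; likewise for
    j. *)
Lemma division_definite (al be : R) : al != 0 -> be != 0 -> is_division al be -> al < 0 /\ be < 0.
Proof.
move=> al0 be0 div.
have zd (x y : quat al be) : x != 0 -> y != 0 -> x * y <> 0.
  move=> x0 y0 xy; have [x' [_ x'x]] := div x x0.
  by have := congr1 (fun z => x' * z) xy; rewrite mulrA x'x mul1r mulr0 => /eqP; rewrite (negPf y0).
split; rewrite ltNge le_eqVlt eq_sym; apply/negP => /orP[/eqP E|pos]; rewrite ?E ?eqxx // in al0 be0.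
  apply: (zd (mkquat _ _ (Num.sqrt al) 1 0 0) (mkquat _ _ (Num.sqrt al) (- 1) 0 0)).
  - by apply/eqP => /(congr1 (@quat1 _ _ _))/eqP; rewrite /quat1 /= oner_eq0.
  - by apply/eqP => /(congr1 (@quat1 _ _ _))/eqP; rewrite /quat1 /= oppr_eq0 oner_eq0.
  have sq := sqr_sqrtr (ltW pos).
  apply: quat_eq; rewrite /GRing.mul /= /quat_mul /mkquat /quat0 /quat1 /quat2 /quat3 /=; rewrite ?(mulr0, mul0r); try ring.
  by rewrite -expr2 sq; ring.
apply: (zd (mkquat _ _ (Num.sqrt be) 0 1 0) (mkquat _ _ (Num.sqrt be) 0 (- 1) 0)).
- by apply/eqP => /(congr1 (@quat2 _ _ _))/eqP; rewrite /quat2 /= oner_eq0.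
- by apply/eqP => /(congr1 (@quat2 _ _ _))/eqP; rewrite /quat2 /= oppr_eq0 oner_eq0.
have sq := sqr_sqrtr (ltW pos).
apply: quat_eq; rewrite /GRing.mul /= /quat_mul /mkquat /quat0 /quat1 /quat2 /quat3 /=; rewrite ?(mulr0, mul0r); try ring.
by rewrite -expr2 sq; ring.
Qed.

Lemma anticommuting_traceless (I J : 'M[R]_2) (be : R) : be != 0 -> I *m J = - (J *m I) -> J *m J = be%:M ->
  \tr I = 0.
Proof.
move=> be0 ac JJ; have E : be * \tr I = - (be * \tr I).
  have e1 : \tr (I *m J *m J) = be * \tr I by rewrite -mulmxA JJ mul_mx_scalar linearZ.
  by rewrite -[in LHS]e1 ac mulNmx linearN /= -mulmxA mxtrace_mulC e1.
by have : be * \tr I = 0 by [lra]; move=> /eqP; rewrite mulf_eq0 (negPf be0) => /eqP.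
Qed.

(** Such a pair would embed the Hamilton quaternions into the real 2 by 2 matrices. The squares of
    the entries are compared directly: anticommutation makes (q r' - q' r)^2 negative. *)
Lemma no_definite_pair (I J : 'M[R]_2) (al be : R) : al < 0 -> be < 0 ->
  I *m I = al%:M -> J *m J = be%:M -> I *m J = - (J *m I) -> False.
Proof.
move=> al0 be0 II JJ ac.
have al1 : al != 0 by rewrite lt_eqF.
have be1 : be != 0 by rewrite lt_eqF.
have tI : \tr I = 0 by apply: (anticommuting_traceless be1 ac JJ).
have tJ : \tr J = 0 by apply: (@anticommuting_traceless J I al al1 _ II); rewrite ac opprK.
rewrite !tr2 in tI tJ.
have e1 : I 0 0 * I 0 0 + I 0 1 * I 1 0 = al by have := congr1 (fun M => M 0 0) II; rewrite mul2 mxE eqxx.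
have e2 : J 0 0 * J 0 0 + J 0 1 * J 1 0 = be by have := congr1 (fun M => M 0 0) JJ; rewrite mul2 mxE eqxx.
have e3 : I 0 0 * J 0 0 + I 0 1 * J 1 0 = - (J 0 0 * I 0 0 + J 0 1 * I 1 0).
  have E : (I *m J) 0 0 = - ((J *m I) 0 0) by rewrite ac mxE.
  by rewrite !mul2 in E.
move: (I 0 0) (I 0 1) (I 1 0) (J 0 0) (J 0 1) (J 1 0) e1 e2 e3 => p q r p' q' r' e1 e2 e3.
have h1 : (q * r' + q' * r) ^+ 2 = 4 * (p ^+ 2 * p' ^+ 2).
  by rewrite (_ : q * r' + q' * r = - 2 * (p * p')); [ring|lra].
have h2 : (q * r' - q' * r) ^+ 2 = 4 * (p ^+ 2 * p' ^+ 2) - 4 * ((al - p ^+ 2) * (be - p' ^+ 2)).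
  by rewrite -h1 -e1 -e2; ring.
have h3 := sqr_ge0 (q * r' - q' * r); rewrite h2 in h3.
have h4 : 0 < al * be by nra.
have := mulr_ge0_le0 (sqr_ge0 p) (ltW be0); have := mulr_ge0_le0 (sqr_ge0 p') (ltW al0).
nra.
Qed.

(* Averaging over the quaternion basis projects to the centre; one conjugation at a time this is
   the polarized Cayley-Hamilton identity. *)
Lemma conj_traceless (I X : 'M[R]_2) (al : R) : \tr I = 0 -> I *m I = al%:M ->
  I *m X *m I = (al * \tr X)%:M + \tr (I *m X) *: I - al *: X.
Proof.
rewrite tr2 => tI II.
have e : I 0 0 * I 0 0 + I 0 1 * I 1 0 = al by have := congr1 (fun M => M 0 0) II; rewrite mul2 mxE eqxx.
have d : I 1 1 = - I 0 0 by lra.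
apply: mx2P; rewrite !tr2 !(mul2, mxE) /= -e d; ring.
Qed.

End RealQuaternions.

(** The index may depend on [x]; the lemma compares values and does not match [tau] with one of the
    listed maps. *)
Lemma embedding_value (R : realType) (k : fieldExtType rat) n (ts : 'I_n.+1 -> {rmorphism k -> R}) (chi : k -> {poly rat}) :
  (forall x, [/\ chi x \is monic, root (map_poly (in_alg k) (chi x)) x & map_poly ratr (chi x) = \prod_i ('X - (ts i x)%:P)]) ->
  forall (tau : {rmorphism k -> R}) x, exists i, ts i x = tau x.
Proof.
move=> chiP tau x; have [_ rt cE] := chiP x.
have : root (map_poly ratr (chi x)) (tau x) by rewrite /root -rmorph_in_alg (rootP rt) rmorph0.
by rewrite cE /root horner_prod prodf_seq_eq0 => /hasP[i _]; rewrite hornerXsubC subr_eq0 => /eqP ->; exists i.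
Qed.

Lemma generator_mem (k : fieldExtType rat) (a b : k) (O : set (quat a b)) m (e : 'I_m -> quat a b) :
  (forall x, O x <-> exists c : 'I_m -> k, (forall i, alg_integer (c i)) /\ x = \sum_i c i *: e i) -> forall i, O (e i).
Proof.
move=> Oe i; apply/Oe; exists (fun j => (j == i)%:R); split.
  by move=> j; case: (j == i); [exact: (integral1 (intr : int -> k))|exact: (@mxpoly.integral0 _ _ (intr : int -> k))].
by rewrite (bigD1 i) //= eqxx scale1r big1 ?addr0 // => j /negPf ->; rewrite scale0r.
Qed.

(** * Integrality and discreteness for an order *)

Section ArithmeticData.
Variables (R : realType) (k : fieldExtType rat) (a b : k) (O : set (quat a b)).
Variables (sigma : {rmorphism k -> R}) (rho : {rmorphism quat a b -> 'M[R]_2}).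
Hypothesis k_real : totally_real R k.
Hypotheses (a0 : a != 0) (b0 : b != 0).
Hypothesis places : exists sigma0 : {rmorphism k -> R}, ~ ramified_at a b sigma0 /\
          forall tau : {rmorphism k -> R}, ~ tau =1 sigma0 -> ramified_at a b tau.
Hypothesis O_order : is_order O.
Hypothesis rhoZ : forall (c : k) x, rho (c *: x) = sigma c *: rho x.
Implicit Types (x y w : quat a b) (tau : {rmorphism k -> R}).

Local Notation q1 := (1 : quat a b).
Definition qi : quat a b := mkquat a b 0 1 0 0.
Definition qj : quat a b := mkquat a b 0 0 1 0.

Lemma quatD x y : (quat0 (x + y) = quat0 x + quat0 y) * (quat1 (x + y) = quat1 x + quat1 y) *
  (quat2 (x + y) = quat2 x + quat2 y) * (quat3 (x + y) = quat3 x + quat3 y).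
Proof. by do !split. Qed.
Lemma quatN x : (quat0 (- x) = - quat0 x) * (quat1 (- x) = - quat1 x) * (quat2 (- x) = - quat2 x) * (quat3 (- x) = - quat3 x).
Proof. by do !split. Qed.
Lemma quatZ c x : (quat0 (c *: x) = c * quat0 x) * (quat1 (c *: x) = c * quat1 x) *
  (quat2 (c *: x) = c * quat2 x) * (quat3 (c *: x) = c * quat3 x).
Proof. by do !split. Qed.
Lemma quatM x y : (quat0 (x * y) = quat0 x * quat0 y + a * (quat1 x * quat1 y) + b * (quat2 x * quat2 y) - a * b * (quat3 x * quat3 y)) *
  (quat1 (x * y) = quat0 x * quat1 y + quat1 x * quat0 y - b * (quat2 x * quat3 y) + b * (quat3 x * quat2 y)) *
  (quat2 (x * y) = quat0 x * quat2 y + quat2 x * quat0 y + a * (quat1 x * quat3 y) - a * (quat3 x * quat1 y)) *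
  (quat3 (x * y) = quat0 x * quat3 y + quat3 x * quat0 y + quat1 x * quat2 y - quat2 x * quat1 y).
Proof. by do !split. Qed.
Lemma quat_base : (quat0 q1 = 1) * (quat1 q1 = 0) * (quat2 q1 = 0) * (quat3 q1 = 0) *
  (quat0 qi = 0) * (quat1 qi = 1) * (quat2 qi = 0) * (quat3 qi = 0) *
  (quat0 qj = 0) * (quat1 qj = 0) * (quat2 qj = 1) * (quat3 qj = 0).
Proof. by do !split. Qed.

Ltac qring := apply: quat_eq; rewrite !(quatD, quatN, quatZ, quatM, quat_base); ring.

Lemma qii : qi * qi = a *: q1. Proof. qring. Qed.
Lemma qjj : qj * qj = b *: q1. Proof. qring. Qed.
Lemma qij : qi * qj = - (qj * qi). Proof. qring. Qed.
Lemma quat_decomp x : x = quat0 x *: q1 + quat1 x *: qi + quat2 x *: qj + quat3 x *: (qi * qj).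
Proof. qring. Qed.

Local Notation I := (rho qi).
Local Notation J := (rho qj).

Lemma rho_scalar c : rho (c *: q1) = (sigma c)%:M.
Proof. by rewrite rhoZ (rmorph1 rho) -[1]/(1%:M) scalemx1. Qed.
Lemma rho_ii : I *m I = (sigma a)%:M.
Proof. by rewrite -[_ *m _](rmorphM rho) qii rho_scalar. Qed.
Lemma rho_jj : J *m J = (sigma b)%:M.
Proof. by rewrite -[_ *m _](rmorphM rho) qjj rho_scalar. Qed.
Lemma rho_ij : I *m J = - (J *m I).
Proof. by rewrite -[I *m J](rmorphM rho) -[J *m I](rmorphM rho) qij rmorphN. Qed.

(** If sigma were not the unramified place, the algebra would be definite there although [rho]
    realises it by real matrices. So every embedding other than sigma is ramified, hence
    definite. *)
Lemma ramified_other tau : ~ tau =1 sigma -> tau a < 0 /\ tau b < 0.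
Proof.
have def (t : {rmorphism k -> R}) : ramified_at a b t -> t a < 0 /\ t b < 0.
  by apply: division_definite; rewrite fmorph_eq0.
have [s0 [ns0 ram]] := places; move=> ne; apply: (def); apply: (ram) => E.
have [E2|ns] := pselect (sigma =1 s0); first by apply: ne => x; rewrite E E2.
have [al be] := def _ (ram _ ns).
exact: no_definite_pair al be rho_ii rho_jj rho_ij.
Qed.

Lemma trace_rho x : \tr (rho x) = 2 * sigma (quat0 x).
Proof.
have a1 : sigma a != 0 by rewrite fmorph_eq0.
have b1 : sigma b != 0 by rewrite fmorph_eq0.
have tI : \tr I = 0 by apply: anticommuting_traceless b1 rho_ij rho_jj.
have tJ : \tr J = 0 by apply: (@anticommuting_traceless _ J I _ a1 _ rho_ii); rewrite rho_ij opprK.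
have tIJ : \tr (I *m J) = 0.
  have := mxtrace_mulC I J; rewrite rho_ij linearN /= => E; lra.
rewrite {1}[x]quat_decomp !rmorphD !rhoZ rmorph1 !linearD /= !linearZ /= tI tJ [rho (qi * qj)](rmorphM rho).
by rewrite -[I * J]/(I *m J) tIJ mxtrace1; ring.
Qed.

(** Polarisation of the norm form, which is positive definite at such a place. *)
Lemma definite_bound tau x y : tau a < 0 -> tau b < 0 ->
  `|tau (2 * quat0 (x * y))| <= tau (reduced_norm x) + tau (reduced_norm y).
Proof.
move=> al be; rewrite quatM /reduced_norm !(rmorphD, rmorphN, rmorphM, rmorphXn, rmorph1) /=.
move: (tau a) (tau b) al be => A B A0 B0; have AB : 0 < A * B by nra.
move: (tau (quat0 x)) (tau (quat1 x)) (tau (quat2 x)) (tau (quat3 x)) => x0 x1 x2 x3.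
move: (tau (quat0 y)) (tau (quat1 y)) (tau (quat2 y)) (tau (quat3 y)) => y0 y1 y2 y3.
have p (c u v : R) : 0 <= c -> 0 <= c * (u + v) ^+ 2 /\ 0 <= c * (u - v) ^+ 2.
  by move=> c0; split; apply: mulr_ge0 => //; exact: sqr_ge0.
have [h0 k0] := p 1 x0 y0 ler01; have [h1 k1] := p (- A) x1 y1 ltac:(lra).
have [h2 k2] := p (- B) x2 y2 ltac:(lra); have [h3 k3] := p (A * B) x3 y3 (ltW AB).
by rewrite ler_norml; apply/andP; split; lra.
Qed.

(** The vectors v e_i, with e_i the generators of the order, span a space on which u acts through a
    matrix of integral entries; u is an eigenvalue of that matrix. *)
Lemma eigenvalue_integral x (v : 'rV[R[i]]_2) (u : R[i]) : O x -> v != 0 ->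
  v *m map_mx (real_complex R) (rho x) = u *: v -> integralOver (intr : int -> R[i]) u.
Proof.
move=> Ox v0 vu; have [Oone OM [m [e [Oe span]]]] := O_order.
pose rC y : 'M[R[i]]_2 := map_mx (real_complex R) (rho y).
have rCM y z : rC (y * z) = rC y *m rC z by rewrite /rC rmorphM -map_mxM.
have OE := generator_mem Oe.
have ex i : exists c : 'I_m -> k, (forall j, alg_integer (c j)) /\ x * e i = \sum_j c j *: e j by apply/Oe; exact: OM.
have [c cP] := choice ex.
pose CM : 'M[R[i]]_m := \matrix_(i, j) real_complex R (sigma (c i j)).
pose W : 'M[R[i]]_(m, 2) := \matrix_(i, l) (v *m rC (e i)) 0 l.
have rowW i : row i W = v *m rC (e i) by apply/rowP => l; rewrite !mxE.
have rClin (s : 'I_m -> k) : rC (\sum_j s j *: e j) = \sum_j real_complex R (sigma (s j)) *: rC (e j).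
  by rewrite /rC rmorph_sum map_mx_sum; apply: eq_bigr => j _; rewrite rhoZ map_mxZ.
have CW : CM *m W = u *: W.
  apply/row_matrixP => i; rewrite row_mul linearZ /= rowW mulmx_sum_row scalemxAl -vu -mulmxA -rCM.
  have [_ ->] := cP i; rewrite rClin mulmx_sumr; apply: eq_bigr => j _.
  by rewrite !mxE rowW -scalemxAr.
have W0 : W != 0.
  apply: contra_neq v0 => W0; have [s sE] := span q1.
  have : rC q1 = 1%:M by rewrite /rC (rmorph1 rho) map_mx1.
  rewrite {1}sE rClin => E; rewrite -[v]mulmx1 -E mulmx_sumr big1 // => j _.
  by rewrite -scalemxAr -rowW W0 row0 scaler0.
apply: (@integral_char_poly _ _ CM^T); first by move=> i j; rewrite !mxE; apply: (integral_push (real_complex R \o sigma)); case: (cP j).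
have /matrix0Pn[i [l il]] := W0.
rewrite -eigenvalue_root_char; apply/eigenvalueP; exists (col l W)^T.
  by rewrite -trmx_mul colE mulmxA CW -scalemxAl -colE linearZ.
by apply: contra_neq il => /(congr1 (fun M : 'rV_m => M 0 i)); rewrite !mxE.
Qed.

Lemma trace_integral x : O x -> alg_integer (2 * quat0 x).
Proof.
move=> Ox; pose M : 'M[R[i]]_2 := map_mx (real_complex R) (rho x).
apply: (@integral_pullback _ _ (real_complex R \o sigma)).
have [P Pu Pt] := @joint_trig R[i] 1 [:: M] ltac:(by move=> B B' /[!inE] /eqP -> /eqP ->).
have {}Pt := Pt _ (mem_head _ _).
have E : (real_complex R \o sigma) (2 * quat0 x) = \sum_i dg P i M.
  have -> : \sum_i dg P i M = \tr (P *m M *m invmx P) by [].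
  by rewrite mxtrace_mulC mulmxA mulVmx // mul1mx /M trace_map_mx trace_rho !rmorphM /= !rmorph_nat.
suff : integralOver (intr : int -> R[i]) (\sum_i dg P i M) by rewrite -E.
elim/big_ind: _ => [|u v|i _]; [exact: (@mxpoly.integral0 _ _ (intr : int -> R[i]))|exact: integral_add|].
have : eigenvalue M (dg P i M).
  by rewrite eigenvalue_root_char (char_poly_dg Pu Pt) (bigD1 i) //= rootM root_XsubC eqxx.
by move=> /eigenvalueP[v vM v0]; exact: (eigenvalue_integral Ox v0 vM).
Qed.

(* An element whose regular representation has norm below 1 vanishes; the place sigma makes it small. *)
Lemma small_integer (B : R) : 1 <= B -> exists2 eps : R, 0 < eps & forall t : k, alg_integer t ->
  (forall tau : {rmorphism k -> R}, ~ tau =1 sigma -> `|tau t| <= B) -> `|sigma t| < eps -> t = 0.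
Proof.
move=> B1; have [n [ts [chi chiP]]] := embeddings k_real.
have Bn : 0 < B ^+ n by apply: exprn_gt0; lra.
exists (Num.min 1 (B ^- n)); first by rewrite lt_min ltr01 invr_gt0.
move=> t it bd; rewrite lt_min => /andP[s1 sB].
have [_ _ cE] := chiP t; have [i0 i0E] := embedding_value chiP sigma t.
have lt1 : `|\prod_i ts i t| < 1.
  rewrite (bigD1 i0) //= i0E normrM normr_prod.
  apply: (@le_lt_trans _ _ (`|sigma t| * B ^+ n)); last by rewrite -ltr_pdivlMr // mul1r.
  apply: ler_wpM2l => //; rewrite -[n in leRHS](_ : #|[pred i : 'I_n.+1 | i != i0]| = n); last first.
    by rewrite cardC1 card_ord.
  rewrite -prodr_const; apply: ler_prod => i _; rewrite normr_ge0 /=.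
  have [E|ne] := pselect (ts i =1 sigma); last exact: bd.
  by rewrite E; lra.
have cE0 : ratr (chi t).[0] = \prod_i - ts i t.
  have -> : ratr (chi t).[0] = (map_poly ratr (chi t)).[ratr 0] :> R by rewrite horner_map.
  by rewrite cE horner_prod; apply: eq_bigr => i _; rewrite hornerXsubC rmorph0 sub0r.
have [|z zE] := @integral_rat R (chi t).[0].
  by rewrite cE0; apply: integral_prod => i; apply: integral_opp; exact: integral_push.
have z1 : `|z%:~R : R| < 1.
  by rewrite -(ratr_int R) -zE cE0 normr_prod (eq_bigr (fun i => `|ts i t|)) -?normr_prod // => i _; rewrite normrN.
have z0 : z = 0 by move: z1; rewrite -intr_norm -[1]/(1%:~R) ltr_int; lia.
move: cE0; rewrite zE z0 ratr_int => /esym/eqP; rewrite prodf_seq_eq0 => /hasP[i _ /=].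
by rewrite oppr_eq0 fmorph_eq0 => /eqP.
Qed.

Lemma order_facts : [/\ O 1, forall x y, O x -> O y -> O (x * y) & forall x y, O x -> O y -> O (x - y)].
Proof.
have [Oone OM [m [e [Oe span]]]] := O_order; split=> // x y /Oe[c [ic ->]] /Oe[d [id ->]].
apply/Oe; exists (fun i => c i - d i); split; first by move=> i; exact: integral_sub (ic i) (id i).
by rewrite -sumrB; apply: eq_bigr => i _; rewrite scalerBl.
Qed.

Lemma quat0_span m (c : 'I_m -> k) (e : 'I_m -> quat a b) y :
  quat0 (y * \sum_i c i *: e i) = \sum_i c i * quat0 (y * e i).
Proof.
elim/big_rec2: _ => [|i u v _ <-]; first by rewrite mulr0.
by rewrite mulrDr quatD; congr (_ + _); rewrite !(quatM, quatZ); ring.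
Qed.

Lemma trace_form_nondegenerate y : (forall w, quat0 (y * w) = 0) -> y = 0.
Proof.
move=> H; have y0 := H q1; have y1 := H qi; have y2 := H qj; have y3 := H (qi * qj).
rewrite !(quatM, quat_base) in y0 y1 y2 y3.
have e0 : quat0 y = 0 by rewrite -y0; ring.
have e1 : a * quat1 y = 0 by rewrite -y1; ring.
have e2 : b * quat2 y = 0 by rewrite -y2; ring.
have e3 : a * b * quat3 y = 0 by rewrite -[0]oppr0 -y3; ring.
move/eqP: e1; rewrite mulf_eq0 (negPf a0) => /eqP e1.
move/eqP: e2; rewrite mulf_eq0 (negPf b0) => /eqP e2.
move/eqP: e3; rewrite !mulf_eq0 (negPf a0) (negPf b0) => /eqP e3.
by apply: quat_eq.
Qed.

(* Test x - 1 against the spanning family under the trace form. *)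
Lemma unit_discrete : exists2 eps : R, 0 < eps & forall x, O x -> reduced_norm x = 1 ->
  (forall i j, `|rho x i j - (1%:M : 'M[R]_2) i j| < eps) -> x = 1.
Proof.
have [Oone OM [m [e [Oe span]]]] := O_order; have [_ _ OB] := order_facts.
have OE := generator_mem Oe.
have [n [ts [chi chiP]]] := embeddings k_real.
pose B := 2 + 2 * \sum_i \sum_j `|ts j (reduced_norm (e i))|.
have nB i j : `|ts j (reduced_norm (e i))| <= \sum_i \sum_j `|ts j (reduced_norm (e i))|.
  rewrite (bigD1 i) //= (bigD1 j) //= -addrA lerDl addr_ge0 ?sumr_ge0 // => i' _; exact: sumr_ge0.
have S0 : 0 <= \sum_i \sum_j `|ts j (reduced_norm (e i))| by apply: sumr_ge0 => i _; exact: sumr_ge0.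
have B1 : 1 <= B by rewrite /B; lra.
have [eps0 e00 small] := small_integer B1.
pose T i := \sum_p \sum_q `|rho (e i) p q|.
pose S := \sum_i T i.
have T0 i : 0 <= T i by apply: sumr_ge0 => p _; exact: sumr_ge0.
have TS i : T i <= S by rewrite /S (bigD1 i) //= lerDl sumr_ge0.
have Sp : 0 < 1 + S by have : 0 <= S by [exact: sumr_ge0]; lra.
exists (eps0 / (1 + S)) => [|x Ox nx near]; first exact: divr_gt0.
suff : x - 1 = 0 by move=> /eqP; rewrite subr_eq0 => /eqP.
apply: trace_form_nondegenerate => w; have [c ->] := span w; rewrite quat0_span big1 // => i _.
have two : (2 : k) != 0 by rewrite -(fmorph_eq0 sigma) rmorph_nat pnatr_eq0.
have : 2 * quat0 ((x - 1) * e i) = 0; last first.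
  by move=> /eqP; rewrite mulf_eq0 (negPf two) => /eqP ->; rewrite mulr0.
apply: small; first by apply: trace_integral; apply: OM => //; exact: OB.
  move=> tau ne; have [al be] := ramified_other ne.
  have h1 := definite_bound x (e i) al be; have h2 := definite_bound 1 (e i) al be.
  have n1 : reduced_norm q1 = 1 by rewrite /reduced_norm !quat_base; ring.
  rewrite nx rmorph1 in h1; rewrite n1 rmorph1 mul1r in h2.
  have [j jE] := embedding_value chiP tau (reduced_norm (e i)).
  have h3 := nB i j; rewrite jE in h3; have h4 := ler_norm (tau (reduced_norm (e i))).
  rewrite mulrBl mul1r quatD quatN mulrBr rmorphB; apply: le_trans (ler_normB _ _) _; rewrite /B.
  by move: h1 h2 h3 h4; move: `|_| `|_| `|_| => *; lra.
have -> : sigma (2 * quat0 ((x - 1) * e i)) = \tr ((rho x - 1%:M) *m rho (e i)).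
  by rewrite rmorphM rmorph_nat -trace_rho rmorphM rmorphB (rmorph1 rho).
pose D := rho x - 1%:M.
have Dn p q : `|D p q| <= eps0 / (1 + S) by have := near p q; rewrite /D !mxE => /ltW.
have c0 : 0 < eps0 / (1 + S) by exact: divr_gt0.
apply: (@le_lt_trans _ _ (eps0 / (1 + S) * T i)); last first.
  by rewrite -mulrAC ltr_pdivrMr // ltr_pM2l //; have := TS i; lra.
rewrite /mxtrace /T exchange_big mulr_sumr /=; apply: le_trans (ler_norm_sum _ _ _) _.
apply: ler_sum => p _; rewrite -/D mxE mulr_sumr; apply: le_trans (ler_norm_sum _ _ _) _.
by apply: ler_sum => q _; rewrite normrM ler_wpM2r.
Qed.

End ArithmeticData.

(** * Hyperbolicity in discrete, cocompact, torsion free groups *)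

Section CocompactDiscrete.
Variables (R : realType) (Gam : subgroup (SL2 R)).
Local Notation G1 := (subgroup_set Gam).
Hypothesis tf : torsion_free G1.
Variable c0 : R.
Hypothesis coc : forall g, exists2 gam, G1 gam & hs (gam * g)%g <= c0.
Variable eps : R.
Hypothesis eps0 : 0 < eps.
Hypothesis disc : forall gam, G1 gam -> near_entries eps 1%g gam -> gam = 1%g.
Implicit Types (x y g h : SL2 R).

Definition trS g : R := ea g + ed g.

(** Cayley-Hamilton writes g^n as s g + r, and its determinant being 1 is the quadratic relation. *)
Lemma pow_lin g n : exists p : R * R, [/\ p.1 ^+ 2 + p.1 * p.2 * trS g + p.2 ^+ 2 = 1, ea (g ^+ n)%g = p.1 * ea g + p.2,
  eb (g ^+ n)%g = p.1 * eb g, ec (g ^+ n)%g = p.1 * ec g & ed (g ^+ n)%g = p.1 * ed g + p.2].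
Proof.
elim: n => [|n [[s r] /= [e A B C D]]]; first by exists (0, 1); rewrite expg0 !ent1 /=; split; ring.
exists (s * trS g + r, - s); have dt := SL2_detE g; rewrite expgS !entM A B C D /trS /= in e *; split.
- by rewrite -e; ring.
- by rewrite (_ : - s = - s * (ea g * ed g - eb g * ec g)); [ring|rewrite dt mulr1].
- by ring.
- by ring.
- by rewrite (_ : - s = - s * (ea g * ed g - eb g * ec g)); [ring|rewrite dt mulr1].
Qed.

Lemma powG gam n : G1 gam -> G1 (gam ^+ n)%g.
Proof.
move=> Gg; have [g1 gM gV] := subgroupP Gam.
by elim: n => [|n IH]; rewrite ?expg0 // expgS; exact: gM.
Qed.

Lemma close_quot x y M d : [/\ `|ea x| <= M, `|eb x| <= M, `|ec x| <= M & `|ed x| <= M] ->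
  [/\ `|ea y - ea x| <= d, `|eb y - eb x| <= d, `|ec y - ec x| <= d & `|ed y - ed x| <= d] ->
  2 * (M * d) < eps -> near_entries eps 1%g (x^-1 * y)%g.
Proof.
move=> [A B C D] [a b c e] lt; have dt := SL2_detE x.
have K (u v s t : R) : `|u| <= M -> `|v| <= M -> `|s| <= d -> `|t| <= d -> `|u * s + v * t| < eps.
  move=> hu hv hs' ht; apply: le_lt_trans lt; apply: le_trans (ler_normD _ _) _; rewrite !normrM.
  by have := ler_pM (normr_ge0 u) (normr_ge0 s) hu hs'; have := ler_pM (normr_ge0 v) (normr_ge0 t) hv ht; lra.
split; rewrite !ent1 !entM !entV distrC.
- by rewrite (_ : _ - 1 = ed x * (ea y - ea x) + - eb x * (ec y - ec x)); [apply: K; rewrite ?normrN|rewrite -dt; ring].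
- by rewrite (_ : _ - 0 = ed x * (eb y - eb x) + - eb x * (ed y - ed x)); [apply: K; rewrite ?normrN|ring].
- by rewrite (_ : _ - 0 = - ec x * (ea y - ea x) + ea x * (ec y - ec x)); [apply: K; rewrite ?normrN|ring].
- by rewrite (_ : _ - 1 = - ec x * (eb y - eb x) + ea x * (ed y - ed x)); [apply: K; rewrite ?normrN|rewrite -dt; ring].
Qed.

(** When the trace is below 2 in modulus the quadratic relation of [pow_lin] is definite, so all
    powers stay bounded. Two of them are close, hence equal by discreteness, and the element would
    be torsion. *)
Lemma not_elliptic gam : G1 gam -> gam != 1%g -> 2 <= `|trS gam|.
Proof.
move=> Gg g1; rewrite leNgt; apply/negP => el; set t := trS gam in el.
have dp : 0 < 4 - t ^+ 2.
  have h : `|t| ^+ 2 < 2 ^+ 2 by rewrite ltrXn2r // nnegrE.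
  by rewrite real_normK ?num_real // in h; lra.
have [sr srP] := choice (pow_lin gam); rewrite -/t in srP.
pose M := 1 + 4 / (4 - t ^+ 2).
have Q0 : 0 < 4 / (4 - t ^+ 2) by apply: divr_gt0 => //; lra.
have bd (u v : R) : u ^+ 2 + u * v * t + v ^+ 2 = 1 -> `|u| <= M.
  move=> e; have h : u ^+ 2 <= 4 / (4 - t ^+ 2).
    by rewrite ler_pdivlMr //; have := sqr_ge0 (2 * v + u * t); lra.
  have := sqr_ge0 (`|u| - 1); rewrite sqrrB1 real_normK ?num_real // /M.
  by have := normr_ge0 u; move: `|u| => z z0; lra.
have bs n : `|(sr n).1| <= M /\ `|(sr n).2| <= M.
  by have [e _ _ _ _] := srP n; split; [apply: bd e|apply: (bd _ (sr n).1); rewrite -e; ring].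
pose W := 1 + (`|ea gam| + `|eb gam| + `|ec gam| + `|ed gam|).
have W1 : 1 <= W by rewrite /W lerDl !addr_ge0.
have M0 : 0 < M by rewrite /M; lra.
pose K := M * W * W / eps.
have K0 : 0 < K by rewrite /K divr_gt0 // !mulr_gt0 //; lra.
have KE : K = M * W * W / eps by [].
clearbody K; pose B := (Num.truncn (K * M)).+1.
have KB : K * M <= B%:R by apply: ltW; exact: truncnS_gt.
pose T := 'I_((8 * B).+1 ^ 2).+1.
pose v (i : T) (j : bool) : R := K * (if j then (sr i).1 else (sr i).2).
have vB i j : `|v i j| <= B%:R.
  rewrite /v normrM gtr0_norm //; apply: le_trans KB; rewrite ler_pM2l //.
  by have [h1 h2] := bs i; case: j.
have cnt : ((8 * B).+1 ^ #|{: bool}| < #|{: T}|)%N by rewrite card_bool card_ord.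
have [i [j [ij cl]]] := box_pigeonhole vB cnt.
have [c1 c2] : `|(sr j).1 - (sr i).1| <= 1 / 4 / K /\ `|(sr j).2 - (sr i).2| <= 1 / 4 / K.
  have := cl true; have := cl false; rewrite /v -!mulrBr !normrM gtr0_norm // => h1 h2.
  by split; rewrite ler_pdivlMr // mulrC distrC.
set x := (gam ^+ i)%g; set y := (gam ^+ j)%g.
have [_ xa xb xc xd] := srP i; have [_ ya yb yc yd] := srP j.
have [wa [wb [wc wd]]] : `|ea gam| <= W - 1 /\ `|eb gam| <= W - 1 /\ `|ec gam| <= W - 1 /\ `|ed gam| <= W - 1.
  rewrite /W; have := normr_ge0 (ea gam); have := normr_ge0 (eb gam); have := normr_ge0 (ec gam); have := normr_ge0 (ed gam).
  by move: `|ea gam| `|eb gam| `|ec gam| `|ed gam|; clear => *; repeat split; lra.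
have lin (m u w s r : R) : `|u| <= W - 1 -> `|s| <= m -> `|r| <= m -> w = 0 \/ w = r -> `|s * u + w| <= m * W.
  move=> hu hs' hr wE; apply: le_trans (ler_normD _ _) _; rewrite normrM.
  have hw : `|w| <= m by case: wE => ->; rewrite ?normr0 //; apply: le_trans hs'.
  by have := ler_pM (normr_ge0 s) (normr_ge0 u) hs' hu; lra.
have [s1 s2] := bs i.
have nr : near_entries eps 1%g (x^-1 * y)%g.
  apply: (@close_quot x y (M * W) (1 / 4 / K * W)).
  - rewrite /x xa xb xc xd -[_ * eb _]addr0 -[_ * ec _]addr0.
    by split; [apply: (lin M _ _ _ (sr i).2)|apply: (lin M _ _ _ (sr i).2)|apply: (lin M _ _ _ (sr i).2)|apply: (lin M _ _ _ (sr i).2)] => //; auto.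
  - have E (u s r s' r' : R) : s' * u + r' - (s * u + r) = (s' - s) * u + (r' - r) by ring.
    have E0 (u s s' : R) : s' * u - s * u = (s' - s) * u + 0 by ring.
    rewrite /x /y xa xb xc xd ya yb yc yd !E !E0.
    by split; apply: (lin _ _ _ _ ((sr j).2 - (sr i).2)) => //; auto.
  have -> : 2 * (M * W * (1 / 4 / K * W)) = eps / 2 by rewrite KE; field; rewrite !gt_eqF //; lra.
  by have e0 := eps0; lra.
have [_ gM gV] := subgroupP Gam.
have xy : x = y.
  have /(congr1 (fun z => x * z)%g) := disc (gM _ _ (gV _ (powG i Gg)) (powG j Gg)) nr.
  by rewrite mulVKg mulg1 => e; exact: esym e.
have tor (p q : nat) : (p < q)%N -> (gam ^+ p)%g = (gam ^+ q)%g -> False.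
  move=> pq E; have : (gam ^+ (q - p))%g = 1%g.
    by apply: (mulgI (gam ^+ p)%g); rewrite -expgnDr subnKC ?mulg1 // ltnW.
  by move=> /(tf Gg); rewrite subn_gt0 pq => /(_ isT) E1; rewrite E1 eqxx in g1.
by case: (ltngtP i j) => [lt|lt|/val_inj E]; [exact: tor lt xy|exact: tor lt (esym xy)|rewrite E eqxx in ij].
Qed.

(** Conjugation takes such an element to an elementary matrix whose entry can be divided by s^2; a
    large s brings it as near to 1 as desired. *)
Lemma contract_unipotent g e : trS g = 2 -> 0 < e -> exists y u : SL2 R, [/\ (g * y)%g = (y * u)%g,
  ea u = 1, ed u = 1, `|eb u| <= e & `|ec u| <= e].
Proof.
rewrite /trS => tr e0; have dt := SL2_detE g.
have dE : ed g = 2 - ea g by lra.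
rewrite dE in dt.
have small (z : R) : `|z| / (1 + `|z| / e) ^+ 2 <= e.
  have z0 : 0 <= `|z| / e by apply: divr_ge0 => //; exact: ltW.
  rewrite ler_pdivrMr; last by apply: exprn_gt0; lra.
  rewrite [X in X <= _](_ : _ = e * (`|z| / e)); last by field; rewrite gt_eqF.
  by rewrite ler_pM2l //; move: (`|z| / e) z0 => w w0; have := sqr_ge0 w; lra.
have [q0|q0] := eqVneq (eb g) 0.
  have a1 : ea g = 1.
    by apply/eqP; rewrite -subr_eq0 -sqrf_eq0; apply/eqP; rewrite q0 in dt; lra.
  pose s := 1 + `|ec g| / e.
  have s0 : 0 < s by have : 0 <= `|ec g| / e by [apply: divr_ge0 => //; exact: ltW]; rewrite /s; lra.
  have h : s^-1 * s - 0 * 0 = 1 by rewrite mulVf ?gt_eqF //; ring.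
  exists (mkSL2 h), (E21 (ec g / s ^+ 2)).
  have [A B C D] := mkSL2E h; have [A' B' C' D'] := E21E (ec g / s ^+ 2).
  rewrite A' B' C' D' normr0; split=> //; [|exact: ltW|by rewrite normrM normfV [`|s ^+ 2|]ger0_norm ?sqr_ge0 //; exact: small].
  by apply: SL2_eq; rewrite !entM !(A, B, C, D, A', B', C', D', q0, dE, a1); field; rewrite ?gt_eqF.
pose s := 1 + `|(eb g)^-1| / e.
have s0 : 0 < s by have : 0 <= `|(eb g)^-1| / e by [apply: divr_ge0 => //; exact: ltW]; rewrite /s; lra.
have h : s * eb g * (s * eb g)^-1 - 0 * (- (s * (ea g - 1))) = 1.
  have nz : s * eb g != 0 by rewrite mulf_neq0 // gt_eqF.
  by rewrite mulfV //; ring.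
exists (mkSL2 h), (E12 ((eb g)^-1 / s ^+ 2)).
have [A B C D] := mkSL2E h; have [A' B' C' D'] := E12E ((eb g)^-1 / s ^+ 2).
rewrite A' B' C' D' normr0; split=> //; [|by rewrite normrM [`|(s ^+ 2)^-1|]ger0_norm ?invr_ge0 ?sqr_ge0 //; exact: small|exact: ltW].
have cE : ec g = - (ea g - 1) ^+ 2 / eb g.
  by apply: (mulfI q0); rewrite mulrCA mulfV // mulr1; lra.
by apply: SL2_eq; rewrite !entM !(A, B, C, D, A', B', C', D', dE, cE); field; rewrite ?q0 ?gt_eqF.
Qed.

(** Cocompactness moves the contracting conjugator into a fixed ball, so some conjugate inside Gamma
    is as near to 1 as discreteness forbids, unless it is 1. *)
Lemma no_unipotent gam : G1 gam -> trS gam = 2 -> gam = 1%g.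
Proof.
move=> Gg tr; have [_ gM gV] := subgroupP Gam.
have c1 : 0 < 2 * c0 by have [d _ h] := coc 1%g; have := hs_ge1 (d * 1)%g; lra.
pose e := eps / (1 + 4 * (2 * c0) ^+ 2).
have D0 : 0 < 1 + 4 * (2 * c0) ^+ 2 by have := sqr_ge0 (2 * c0); lra.
have e0 : 0 < e by exact: divr_gt0.
have [y [u [gy u1 u4 u2 u3]]] := contract_unipotent tr e0.
have [d Gd le] := coc y; set c := (d * y)%g in le.
have E : (c * u * c^-1 = d * gam * d^-1)%g.
  by rewrite /c -[(d * y * u)%g]mulgA -gy invgM !mulgA mulgK.
have G' : G1 (d * gam * d^-1)%g by apply: (gM); [exact: (gM)|exact: gV].
have [x1 [x2 [x3 x4]]] := ent_le_hs c.
have bc (z : R) : `|z| <= 2 * hs c -> `|z| <= 2 * c0 by move=> h; apply: le_trans h _; lra.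
have n : near_entries eps 1%g (d * gam * d^-1)%g.
  rewrite -E -[c in (c * u)%g]invgK -mulgA; apply: (@close_quot _ _ (2 * c0) (e * (2 * c0))).
  - by rewrite !entV !normrN; split; exact: bc.
  - rewrite !entM !entV u1 u4.
    have F (v w p : R) : `|v| <= e -> `|w| <= 2 * hs c -> `|v * w| <= e * (2 * c0).
      by move=> hv hw; rewrite normrM; apply: ler_pM => //; exact: bc.
    split.
    + by rewrite (_ : _ - _ = eb u * - ec c); [apply: F; rewrite ?normrN|ring].
    + by rewrite (_ : _ - _ = eb u * ea c); [apply: F|ring].
    + by rewrite (_ : _ - _ = ec u * ed c); [apply: F|ring].
    + by rewrite (_ : _ - _ = ec u * - eb c); [apply: F; rewrite ?normrN|ring].
  have -> : 2 * (2 * c0 * (e * (2 * c0))) = e * (2 * (2 * c0) ^+ 2) by ring.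
  by rewrite /e mulrAC ltr_pdivrMr // ltr_pM2l //; have := sqr_ge0 (2 * c0); lra.
have /(congr1 (fun z => d^-1 * z * d)%g) := disc G' n.
by rewrite !mulgA mulVg mul1g mulgVK mulg1 mulVg.
Qed.

Lemma hyperbolic gam : G1 gam -> gam != 1%g -> 2 < `|trS gam|.
Proof.
move=> Gg g1; rewrite lt_neqAle not_elliptic // andbT; apply/eqP => t2.
have t4 : trS (gam * gam)%g = 2.
  have dt := SL2_detE gam; rewrite /trS !entM.
  have : `|trS gam| ^+ 2 = 2 ^+ 2 by rewrite -t2.
  by rewrite real_normK ?num_real // /trS => h; lra.
have := no_unipotent (powG 2 Gg); rewrite expgS expg1 => /(_ t4) E.
by have := tf Gg (isT : 0 < 2)%N; rewrite expgS expg1 => /(_ E) E1; rewrite E1 eqxx in g1.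
Qed.

(** A commutative Gamma preserves the binary quadratic form of the fixed points of [h].
    Cocompactness bounds this form on all nonzero vectors, so it is zero and [h] is scalar, against
    hyperbolicity. *)
Lemma noncommuting : exists h1 h2, [/\ G1 h1, G1 h2 & (h1 * h2 != h2 * h1)%g].
Proof.
apply: contrapT => com.
have {}com h1 h2 : G1 h1 -> G1 h2 -> (h1 * h2 = h2 * h1)%g.
  by move=> g1 g2; apply/eqP; apply: contrapT => /negP ne; apply: com; exists h1, h2.
have c1 : 1 <= c0 by have [d _ h] := coc 1%g; have := hs_ge1 (d * 1)%g; lra.
have [h Gh h1] : exists2 h, G1 h & h != 1%g.
  apply: contrapT => no; have [d Gd] := coc (E12 (2 * c0)).
  have -> : d = 1%g by apply/eqP; apply: contrapT => /negP ne; apply: no; exists d.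
  by rewrite mul1g hs_E12; have : 1 * c0 <= c0 * c0 by [apply: ler_wpM2r; lra]; lra.
have hy := hyperbolic Gh h1; have dh := SL2_detE h.
pose Q (x z : R) := ec h * x ^+ 2 + (ed h - ea h) * (x * z) - eb h * z ^+ 2.
have inv g y : G1 g -> Q (ea (g * y)%g) (ec (g * y)%g) = Q (ea y) (ec y).
  move=> Gg; have cm := com g h Gg Gh; have dg := SL2_detE g.
  have e1 : eb g * ec h = eb h * ec g by have := congr1 (@ea R) cm; rewrite !entM => e; lra.
  have e2 : eb g * (ed h - ea h) = eb h * (ed g - ea g) by have := congr1 (@eb R) cm; rewrite !entM => e; lra.
  have e3 : ec g * (ed h - ea h) = ec h * (ed g - ea g) by have := congr1 (@ec R) cm; rewrite !entM => e; lra.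
  apply/eqP; rewrite -subr_eq0 /Q !entM -[X in _ - X]mul1r -dg; apply/eqP.
  pose E1 := eb g * ec h - eb h * ec g; pose E2 := eb g * (ed h - ea h) - eb h * (ed g - ea g).
  pose E3 := ec g * (ed h - ea h) - ec h * (ed g - ea g).
  transitivity (ea y ^+ 2 * (ea g * E3 + ec g * E1) + ea y * ec y * (2 * eb g * E3 + 2 * ed g * E1) + ec y ^+ 2 * (ed g * E2 + eb g * E1)).
    by rewrite /E1 /E2 /E3; ring.
  by rewrite /E1 /E2 /E3 e1 e2 e3 !subrr; ring.
pose K := `|ec h| + `|ed h - ea h| + `|eb h|.
have K0 : 0 <= K by rewrite /K !addr_ge0.
have bound y : `|Q (ea y) (ec y)| <= K * (2 * c0) ^+ 2.
  have [d Gd le] := coc y; rewrite -(inv d y Gd); have [x1 [_ [x3 _]]] := ent_le_hs (d * y)%g.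
  have {}x1 : `|ea (d * y)%g| <= 2 * c0 by lra.
  have {}x3 : `|ec (d * y)%g| <= 2 * c0 by lra.
  move: (ea (d * y)%g) (ec (d * y)%g) x1 x3 => u w hu hw.
  have P3 (p q : R) : `|p| <= 2 * c0 -> `|q| <= 2 * c0 -> `|p * q| <= (2 * c0) ^+ 2.
    by move=> hp hq; rewrite normrM expr2; apply: ler_pM.
  rewrite /Q /K; apply: le_trans (ler_normB _ _) _; rewrite [in leRHS]mulrDl; apply: lerD.
    apply: le_trans (ler_normD _ _) _; rewrite [in leRHS]mulrDl; apply: lerD.
      by rewrite expr2 normrM; apply: ler_wpM2l => //; exact: P3.
    by rewrite normrM; apply: ler_wpM2l => //; exact: P3.
  by rewrite expr2 normrM; apply: ler_wpM2l => //; exact: P3.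
have hom (s x z : R) : Q (s * x) (s * z) = s ^+ 2 * Q x z by rewrite /Q; ring.
have scale (x z : R) : (forall s : R, 0 < s -> exists y, ea y = s * x /\ ec y = s * z) -> Q x z = 0.
  move=> fam; apply/eqP; apply: contrapT => /negP q0; have qp : 0 < `|Q x z| by rewrite normr_gt0.
  pose w := K * (2 * c0) ^+ 2 / `|Q x z|.
  have w0 : 0 <= w by apply: divr_ge0 => //; apply: mulr_ge0 => //; exact: sqr_ge0.
  have [y [Ey Ez]] := fam (1 + w) ltac:(lra); have := bound y; rewrite Ey Ez hom normrM.
  rewrite -ler_pdivlMr // -/w ger0_norm ?sqr_ge0 //; have := sqr_ge0 w; lra.
have q10 : Q 1 0 = 0.
  apply: scale => s s0; have e : s * s^-1 - 0 * 0 = 1 by rewrite mulfV ?gt_eqF //; ring.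
  by exists (mkSL2 e); have [-> _ -> _] := mkSL2E e; split; ring.
have q01 : Q 0 1 = 0.
  apply: scale => s s0; have e : 0 * 0 - (- s^-1) * s = 1 by rewrite mulNr mulVf ?gt_eqF //; ring.
  by exists (mkSL2 e); have [-> _ -> _] := mkSL2E e; split; ring.
have q11 : Q 1 1 = 0.
  apply: scale => s s0; have e : s * s^-1 - 0 * s = 1 by rewrite mulfV ?gt_eqF //; ring.
  by exists (mkSL2 e); have [-> _ -> _] := mkSL2E e; split; ring.
rewrite /Q in q10 q01 q11.
have hc : ec h = 0 by lra.
have hb : eb h = 0 by lra.
have hd : ed h = ea h by lra.
rewrite hc hb hd in dh; have : `|trS h| ^+ 2 = 4 by rewrite real_normK ?num_real // /trS hd; lra.
have := ltr_pM (ler0n R 2) (ler0n R 2) hy hy; rewrite expr2; lra.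
Qed.

(** Powers are affine in h1 and h2 with nonzero slope, so only the first powers matter; there the
    determinant is 2 minus the trace of a commutator, which is hyperbolic. *)
Lemma bracket_unit h1 h2 n1 n2 : G1 h1 -> G1 h2 -> (h1 * h2 != h2 * h1)%g -> (0 < n1)%N -> (0 < n2)%N ->
  \det (SL2_mx (h1 ^+ n1)%g *m SL2_mx (h2 ^+ n2)%g - SL2_mx (h2 ^+ n2)%g *m SL2_mx (h1 ^+ n1)%g) != 0.
Proof.
move=> g1 g2 nc n10 n20; set H1 := SL2_mx (h1 ^+ n1)%g; set H2 := SL2_mx (h2 ^+ n2)%g.
have lin h n : G1 h -> h != 1%g -> (0 < n)%N -> exists s r : R, s != 0 /\ SL2_mx (h ^+ n)%g = s *: SL2_mx h + r%:M.
  move=> Gh h1' n0; have [[s r] /= [e A B C D]] := pow_lin h n; exists s, r; split.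
    apply: contra_neq h1' => s0; rewrite s0 !mul0r ?add0r in e A B C D.
    have := tf Gh (_ : 0 < n * 2)%N; rewrite muln_gt0 n0 expgnA => /(_ isT); apply.
    have r2 : r * r = 1 by rewrite -e; ring.
    by apply: SL2_eq; rewrite expgS expg1 !entM !ent1 !(A, B, C, D); lra.
  by apply: mx2P; rewrite !mxE /= ?mulr1n ?mulr0n ?addr0; [exact: A|exact: B|exact: C|exact: D].
have h11 : h1 != 1%g by apply: contra_neq nc => ->; rewrite mul1g mulg1.
have h21 : h2 != 1%g by apply: contra_neq nc => ->; rewrite mul1g mulg1.
have [s1 [r1 [s10 E1]]] := lin h1 n1 g1 h11 n10; have [s2 [r2 [s20 E2]]] := lin h2 n2 g2 h21 n20.
have -> : H1 *m H2 - H2 *m H1 = (s1 * s2) *: (SL2_mx h1 *m SL2_mx h2 - SL2_mx h2 *m SL2_mx h1).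
  by rewrite /H1 /H2 E1 E2; apply: mx2P; rewrite !(mul2, mxE) /= ?mulr1n ?mulr0n; ring.
rewrite detZ mulf_neq0 ?expf_neq0 ?mulf_neq0 //.
have [_ gM gV] := subgroupP Gam.
set k := ((h2 * h1)^-1 * (h1 * h2))%g.
have Gk : G1 k by apply: (gM); [apply: gV; exact: (gM)|exact: (gM)].
have k1 : k != 1%g by apply: contra_neq nc => k1; rewrite -[RHS]mulg1 -k1 /k mulVKg.
have -> : SL2_mx h1 *m SL2_mx h2 - SL2_mx h2 *m SL2_mx h1 = SL2_mx (h2 * h1)%g *m (SL2_mx k - 1%:M).
  rewrite mulmxBr mulmx1 -[_ *m SL2_mx k]/(SL2_mx ((h2 * h1) * k)%g) /k mulVKg; by [].
rewrite det_mulmx (eqP (SL2_det _)) mul1r; clearbody k.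
have := hyperbolic Gk k1; apply: contraTneq; rewrite det2 !mxE /= => d0; rewrite -leNgt.
have dk := SL2_detE k; rewrite (_ : trS k = 2) ?normr_nat //.
by rewrite /trS /ea /eb /ec /ed in dk *; lra.
Qed.

End CocompactDiscrete.

(** * Rationality of squared traces *)

Section SkolemNoether.
Variables (R : realType) (k : fieldExtType rat) (a b : k).
Variables (sigma : {rmorphism k -> R}) (rho : {rmorphism quat a b -> 'M[R]_2}).
Hypotheses (a0 : a != 0) (b0 : b != 0).
Hypothesis rhoZ : forall (c : k) (x : quat a b), rho (c *: x) = sigma c *: rho x.
Variables (M : 'M[R]_2) (x1 x2 y1 y2 : quat a b).
Hypotheses (xy1 : M *m rho x1 = rho y1 *m M) (xy2 : M *m rho x2 = rho y2 *m M).
Hypothesis br : \det (rho x1 *m rho x2 - rho x2 *m rho x1) != 0.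
Hypothesis M1 : \det M = 1.

Let j0 : 'I_4 := @Ordinal 4 0 isT.
Let j1 : 'I_4 := @Ordinal 4 1 isT.
Let j2 : 'I_4 := @Ordinal 4 2 isT.
Let j3 : 'I_4 := @Ordinal 4 3 isT.
Let comb (v : 'rV[k]_4) (u w : quat a b) : quat a b :=
  v 0 j0 *: (1 : quat a b) + v 0 j1 *: u + v 0 j2 *: w + v 0 j3 *: (u * w).

Lemma rho_comb v u w : rho (comb v u w) =
  (sigma (v 0 j0))%:M + sigma (v 0 j1) *: rho u + (sigma (v 0 j2) *: rho w + sigma (v 0 j3) *: (rho u *m rho w)).
Proof. by rewrite /comb !rmorphD /= (rho_scalar rhoZ) !rhoZ rmorphM -!addrA. Qed.

(* For matrices [p + q X1 + (r + s X1) X2 = 0]; its commutator with X1 is [(r + s X1)[X1, X2] = 0]. *)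
Lemma comb_eq0 v : comb v x1 x2 = 0 -> v = 0.
Proof.
move=> /(congr1 rho); rewrite rmorph0 rho_comb; have := br; set X1 := rho x1; set X2 := rho x2 => ne.
set p := sigma _; set q := sigma _; set r := sigma _; set s := sigma _ => E.
have brU : X1 *m X2 - X2 *m X1 \in unitmx by rewrite unitmxE unitfE.
have nsc (c d : R) : c%:M + d *: X1 = 0 -> d = 0 /\ c = 0.
  move=> h; have d0 : d = 0.
    apply/eqP; apply: contraNT ne => d0.
    have -> : X1 = (- (c / d))%:M.
      apply: (scalerI d0); rewrite scale_scalar_mx mulrN mulrC divfK //.
      by apply/eqP; rewrite -subr_eq0 raddfN opprK addrC h.
    by rewrite mul_scalar_mx mul_mx_scalar subrr det0.
  split=> //; move: h; rewrite d0 scale0r addr0 => /(congr1 (fun Z : 'M[R]_2 => Z 0 0)).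
  by rewrite !mxE eqxx.
have /nsc[s0 r0] : r%:M + s *: X1 = 0.
  rewrite -[LHS](mulmxK brU) (_ : _ *m (_ - _) = 0) ?mul0mx //.
  have := congr1 (fun N => X1 *m N - N *m X1) E; rewrite mulmx0 mul0mx subrr => <-.
  apply: mx2P; do 2 rewrite ?(mul2, mxE, eqxx) /=; rewrite ?big_ord_recl ?big_ord0 /= ?mxE /=; ring.
move: E; rewrite r0 s0 !scale0r !addr0 => /nsc[q0 p0].
have inj (j : 'I_4) : sigma (v 0 j) = 0 -> v 0 j = 0 by move=> /eqP; rewrite fmorph_eq0 => /eqP.
apply/rowP => j; rewrite mxE; apply: inj.
case: j => [[|[|[|[|//]]]] i]; [rewrite -p0|rewrite -q0|rewrite -r0|rewrite -s0]; congr (sigma (v 0 _)); exact: val_inj.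
Qed.

(** 1, x1, x2, x1 x2 form a basis of the algebra over k, so a conjugation that sends x1 and x2 into
    the algebra does so for every element. *)
Lemma conj_rational q : exists q', M *m rho q = rho q' *m M.
Proof.
pose crd (x : quat a b) (l : 'I_4) := nth 0 [:: quat0 x; quat1 x; quat2 x; quat3 x] l.
pose A : 'M[k]_4 := \matrix_(j, l) crd (nth 0 [:: 1; x1; x2; x1 * x2] j) l.
have cA v l : (v *m A) 0 l = crd (comb v x1 x2) l.
  rewrite mxE !big_ord_recl big_ord0 addr0 !mxE /= !addrA.
  have -> : lift ord0 (lift ord0 (lift ord0 ord0)) = j3 by apply/val_inj.
  have -> : lift ord0 (lift ord0 ord0) = j2 by apply/val_inj.
  have -> : lift ord0 ord0 = j1 by apply/val_inj.
  have -> : ord0 = j0 by apply/val_inj.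
  have D (l' : 'I_4) x y : crd (x + y) l' = crd x l' + crd y l' by case: l' => [[|[|[|[|//]]]] i].
  have Z (l' : 'I_4) c x : crd (c *: x) l' = c * crd x l' by case: l' => [[|[|[|[|//]]]] i].
  by rewrite /comb !D !Z.
have Au : A \in unitmx.
  rewrite unitmxE unitfE; apply/negP => /det0P[v v0 vA]; move/eqP: v0; apply; apply: comb_eq0.
  have z l : crd (comb v x1 x2) l = 0 by rewrite -cA vA mxE.
  by apply: quat_eq; [exact: (z j0)|exact: (z j1)|exact: (z j2)|exact: (z j3)].
pose v : 'rV[k]_4 := \row_l crd q l *m invmx A.
have qE : q = comb v x1 x2.
  have z l : crd (comb v x1 x2) l = crd q l by rewrite -cA /v mulmxKV // mxE.
  by apply: quat_eq; [exact: esym (z j0)|exact: esym (z j1)|exact: esym (z j2)|exact: esym (z j3)].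
exists (comb v y1 y2); rewrite qE !rho_comb !mulmxDr !mulmxDl -!scalemxAr -!scalemxAl.
by rewrite scalar_mxC [M *m (rho x1 *m _)]mulmxA xy1 xy2 -[rho y1 *m M *m _]mulmxA xy2 mulmxA.
Qed.

(* With N = M + I M I / a and i*, j* the conjugates of i, j by M, the element w below satisfies
   rho w M = N + J N J / b = 2 tr M. *)
Lemma trace_sq_rational : exists e : k, \tr M ^+ 2 = sigma e.
Proof.
have [i' iE] := conj_rational (qi a b); have [j' jE] := conj_rational (qj a b).
set I := rho (qi a b) in iE; set J := rho (qj a b) in jE.
have a1 : sigma a != 0 by rewrite fmorph_eq0.
have b1 : sigma b != 0 by rewrite fmorph_eq0.
have II := rho_ii rhoZ; have JJ := rho_jj rhoZ; have IJ := rho_ij rho.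
have tI : \tr I = 0 by apply: anticommuting_traceless b1 IJ JJ.
have tJ : \tr J = 0 by apply: (anticommuting_traceless a1 _ II); rewrite IJ opprK.
pose u : quat a b := (1 : quat a b) + a^-1 *: (qi a b * i').
pose w : quat a b := u + b^-1 *: (qj a b * u * j').
pose N := M + (sigma a)^-1 *: (I *m M *m I).
have uM : rho u *m M = N.
  rewrite /u rmorphD rmorph1 /= rhoZ rmorphM fmorphV mulmxDl mul1mx -scalemxAl -!mulmxA.
  by rewrite -[rho (qi a b)]/I -iE mulmxA.
have NE : N = (\tr M)%:M + ((sigma a)^-1 * \tr (I *m M)) *: I.
  rewrite /N (conj_traceless _ tI II) !scalerDr scalerN !scalerA mulVf // scale1r.
  rewrite scale_scalar_mx mulKf //; rewrite addrC -addrA -addrA addNr addr0; done.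
have wM : rho w *m M = (2 * \tr M)%:M.
  set rhs := (_)%:M; rewrite /w rmorphD /= rhoZ !rmorphM fmorphV mulmxDl uM -scalemxAl.
  have -> : rho (qj a b) * rho u * rho j' *m M = J *m N *m J.
    by rewrite -uM -!mulmxA -jE.
  have tJN : \tr (J *m N) = 0.
    have JI : \tr (J *m I) = 0.
      have := congr1 mxtrace IJ; rewrite mxtrace_mulC raddfN /=; lra.
    by rewrite NE mulmxDr mul_mx_scalar -scalemxAr mxtraceD !mxtraceZ tJ JI !mulr0 addr0.
  have tN : \tr N = 2 * \tr M by rewrite NE mxtraceD mxtraceZ tI mulr0 addr0 mxtrace_scalar mulr_natl.
  rewrite (conj_traceless _ tJ JJ) tJN scale0r addr0 scalerDr scalerN scalerA mulVf // scale1r.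
  by rewrite scale_scalar_mx mulKf // tN addrC subrK.
exists (quat0 w).
have Mu : M \in unitmx by rewrite unitmxE M1 unitr1.
have : \tr (rho w) = 2 * \tr M ^+ 2.
  rewrite -[rho w](mulmxK Mu) wM mul_scalar_mx mxtraceZ.
  have -> : \tr (invmx M) = \tr M.
    have d1 : M 0 0 * M 1 1 - M 0 1 * M 1 0 = 1 by rewrite -det2.
    have -> : invmx M = (\tr M)%:M - M.
      rewrite -[RHS](mulKmx Mu) -[LHS]mulmx1; congr (_ *m _).
      by apply: mx2P; rewrite mul2 tr2 !mxE /= ?mulr1n ?mulr0n; [rewrite -d1| | |rewrite -d1]; ring.
    by rewrite mxtraceD raddfN /= mxtrace_scalar; ring.
  by ring.
by rewrite (trace_rho a0 b0 rhoZ) => /(mulfI (_ : 2 != 0)) ->; rewrite // pnatr_eq0.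
Qed.

End SkolemNoether.

(** * Traces of powers and reciprocal polynomials *)

Lemma mxtrace_conj (R : realType) (g h : SL2 R) : \tr (SL2_mx (g * h * g^-1)%g) = trS h.
Proof.
rewrite -[SL2_mx _]/(SL2_mx (g * h)%g *m SL2_mx g^-1%g) mxtrace_mulC.
by rewrite -[_ *m _]/(SL2_mx (g^-1 * (g * h))%g) mulKg tr2.
Qed.

(* The Dickson polynomials, [dickson (w + w^-1) n = w^n + w^-n]. *)
Definition dickson (A : pzRingType) (r : A) n : A := (iter n (fun p => (p.2, r * p.2 - p.1)) (2, r)).1.

Lemma dickson_rec (A : pzRingType) (r : A) (s : nat -> A) n : s 0%N = 2 -> s 1%N = r ->
  (forall m, s m.+2 = r * s m.+1 - s m) -> dickson r n = s n.
Proof.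
move=> s0 s1 sS; rewrite /dickson; suff -> : iter n (fun p => (p.2, r * p.2 - p.1)) (2, r) = (s n, s n.+1) by [].
by elim: n => [|n IH] /=; rewrite ?s0 ?s1 // IH /= sS.
Qed.

Lemma rmorph_dickson (A B : pzRingType) (f : {rmorphism A -> B}) r n : f (dickson r n) = dickson (f r) n.
Proof.
apply/esym/(dickson_rec (s := fun n => f (dickson r n))) => [||m]; [exact: rmorph_nat|by []|].
by rewrite -rmorphM -rmorphB.
Qed.

Lemma dickson_inv (F : fieldType) (w : F) n : w != 0 -> dickson (w + w^-1) n = w ^+ n + (w ^+ n)^-1.
Proof.
move=> w0; apply: (dickson_rec (s := fun n => w ^+ n + (w ^+ n)^-1)) => [||m].
- by rewrite expr0 invr1; ring.
- by rewrite expr1.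
by have wm : w ^+ m != 0 := expf_neq0 m w0; rewrite !exprS; field; rewrite wm.
Qed.

Lemma dickson_trace (R : realType) (g : SL2 R) n : dickson (trS g) n = trS (g ^+ n)%g.
Proof.
apply: (dickson_rec (s := fun n => trS (g ^+ n)%g)) => [||m].
- by rewrite expg0 /trS !ent1; ring.
- by rewrite expg1.
have dt := SL2_detE g; rewrite !expgS /trS !entM; set x := (g ^+ m)%g.
have -> : ea x + ed x = (ea g * ed g - eb g * ec g) * (ea x + ed x) by rewrite dt mul1r.
ring.
Qed.

(** w is a root of x^2 - r x + 1, whose discriminant is at most 0. *)
Lemma inv_sum_unimodular (R : realType) (w : R[i]) (r : R) : w != 0 -> `|r| <= 2 ->
  w + w^-1 = real_complex R r -> `|w| = 1.
Proof.
move=> w0; rewrite ler_norml => /andP[r1 r2] E.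
have {E} : w * w - real_complex R r * w + 1 = 0 by rewrite -E mulrDl mulVf // opprD addrA subrr sub0r addNr.
case: w w0 => p q w0 /eqP; rewrite eq_complex /= => /andP[/eqP e1 /eqP e2].
rewrite normc_def /=; suff -> : p ^+ 2 + q ^+ 2 = 1 by rewrite sqrtr1.
have [q0|q0] := eqVneq q 0.
  have e : p * p - r * p + 1 = 0 by rewrite -e1 q0; ring.
  have : (p - r / 2) ^+ 2 = 0 by apply/eqP; rewrite eq_le sqr_ge0 andbT; nra.
  by move/eqP; rewrite sqrf_eq0 => /eqP pr; rewrite q0; nra.
have : q * (2 * p - r) = 0 by rewrite -e2; ring.
by move/eqP; rewrite mulf_eq0 (negPf q0) /= => /eqP rp; nra.
Qed.

(** The polynomial w^d q(w + 1/w), which passes from an annihilating polynomial of U + 1/U to one of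
    U at the price of doubling the degree. *)
Definition recip d (q : {poly rat}) : {poly rat} := \sum_(i < d.+1) q`_i *: (('X^2 + 1) ^+ i * 'X^(d - i)).

Lemma size_recip d q : (size (recip d q) <= (2 * d).+1)%N.
Proof.
apply: (leq_trans (size_sum _ _ _)); apply/bigmax_leqP => i _; apply: (leq_trans (size_scale_leq _ _)).
apply: (leq_trans (size_polyMleq _ _)); rewrite size_polyXn addnS /=.
have s3 : size ('X^2 + 1 : {poly rat}) = 3%N by rewrite -[1]/(1%:P) size_XnaddC.
have := size_poly_exp_leq ('X^2 + 1 : {poly rat}) i; rewrite s3 /=; have := ltn_ord i; lia.
Qed.

Lemma recip_horner0 d q : q \is monic -> size q = d.+1 -> (recip d q).[0] = 1.
Proof.
move=> qm sq; rewrite /recip big_ord_recr /= hornerD horner_sum big1 => [|i _]; last first.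
  by rewrite hornerZ hornerM hornerXn expr0n subn_eq0 leqNgt ltn_ord /= !mulr0.
have -> : q`_d = 1 by have := monicP qm; rewrite /lead_coef sq.
by rewrite add0r scale1r hornerM hornerXn subnn expr0 mulr1 horner_exp hornerD hornerXn hornerC expr0n add0r expr1n.
Qed.

Lemma recip_eval (F : numFieldType) d (q : {poly rat}) (w : F) : (size q <= d.+1)%N -> w != 0 ->
  (map_poly ratr (recip d q)).[w] = w ^+ d * (map_poly ratr q).[w + w^-1].
Proof.
move=> sq w0; rewrite /recip rmorph_sum horner_sum /= (@horner_coef_wide _ d.+1) ?size_map_poly // mulr_sumr.
apply: eq_bigr => -[i /= id] _; rewrite ltnS in id.
rewrite map_polyZ rmorphM rmorphXn /= rmorphD rmorph1 /= !map_polyXn coef_map.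
rewrite hornerZ hornerM horner_exp hornerD !hornerXn hornerC.
have -> : w ^+ 2 + 1 = w * (w + w^-1) by rewrite mulrDr mulfV.
by rewrite exprMn -[in RHS](subnKC id) exprD /=; ring.
Qed.

(** * Traces in groups commensurable with the units of an order *)

Section Commensurable.
Variable R : realType.
Implicit Types (g h x : SL2 R).

Lemma pow_cvg n g : (h ^+ n)%g @[h --> g] --> (g ^+ n)%g.
Proof.
elim: n => [|n IH]; first by move=> A; rewrite expg0 => /nbhs_singleton A1; apply: (@filterE _ (nbhs g)) => h; exact: A1.
have [a b c d] := ent_cvg g.
have A := cvg_comp _ _ IH (@ea_continuous R (g ^+ n)%g); have B := cvg_comp _ _ IH (@eb_continuous R (g ^+ n)%g).
have C := cvg_comp _ _ IH (@ec_continuous R (g ^+ n)%g); have D := cvg_comp _ _ IH (@ed_continuous R (g ^+ n)%g).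
rewrite expgS; under eq_fun do rewrite expgS.
apply: (@SL2_cvg _ _ (nbhs g)).
- by rewrite eaM; under eq_fun do rewrite eaM; exact: cvgD (cvgM a A) (cvgM b C).
- by rewrite ebM; under eq_fun do rewrite ebM; exact: cvgD (cvgM a B) (cvgM b D).
- by rewrite ecM; under eq_fun do rewrite ecM; exact: cvgD (cvgM c A) (cvgM d C).
- by rewrite edM; under eq_fun do rewrite edM; exact: cvgD (cvgM c B) (cvgM d D).
Qed.

(** Pigeonhole on the cosets of the powers; the bound N does not depend on the element. *)
Lemma power_in_finite_index (Gam : subgroup (SL2 R)) (D : set (SL2 R)) : D 1%g ->
  finite_set (lcosets Gam (subgroup_set Gam `&` D)) ->
  exists N, forall gam, subgroup_set Gam gam -> exists n, [/\ (0 < n)%N, (n <= N)%N & D (gam ^+ n)%g].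
Proof.
move=> D1 /finite_seqP[s sE]; exists (size s) => gam Gg; have [g1 gM gV] := subgroupP Gam.
have pw n : subgroup_set Gam (gam ^+ n)%g by exact: powG.
pose cs n : set (SL2 R) := [set ((gam ^+ n)%g * h)%g | h in subgroup_set Gam `&` D].
have csP n : cs n \in s.
  by have : lcosets Gam (subgroup_set Gam `&` D) (cs n) by [exists (gam ^+ n)%g]; rewrite sE.
have lt n : (index (cs n) s < size s)%N by rewrite index_mem.
have /injectivePn[i [j ij E]] : ~~ injectiveb (fun i : 'I_(size s).+1 => Ordinal (lt i)).
  by apply/negP => /injectiveP/leq_card; rewrite !card_ord ltnn.
have {}E : cs i = cs j.
  by have /(congr1 (nth (cs 0%N) s)) := congr1 val E; rewrite /= !nth_index.
have key (p q : nat) : (p < q)%N -> (q <= size s)%N -> cs p = cs q -> exists n, [/\ (0 < n)%N, (n <= size s)%N & D (gam ^+ n)%g].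
  move=> pq qs e; exists (q - p)%N; split; [by rewrite subn_gt0|by rewrite (leq_trans (leq_subr _ _))|].
  have : cs q (gam ^+ q)%g by exists 1%g; rewrite ?mulg1.
  rewrite -e => -[h [_ Dh] hE]; suff -> : (gam ^+ (q - p))%g = h by [].
  by apply: (mulgI (gam ^+ p)%g); rewrite -expgnDr subnKC ?hE // ltnW.
case: (ltngtP i j) => [l|l|/val_inj e]; [|by apply: (key _ _ l _ (esym E)); rewrite -ltnS|by rewrite e eqxx in ij].
- by apply: (key _ _ l _ E); rewrite -ltnS.
Qed.

Variables (k : fieldExtType rat) (a b : k) (O : set (quat a b)).
Variables (sigma : {rmorphism k -> R}) (rho : {rmorphism quat a b -> 'M[R]_2}).
Hypothesis k_real : totally_real R k.
Hypotheses (a0 : a != 0) (b0 : b != 0).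
Hypothesis places : exists sigma0 : {rmorphism k -> R}, ~ ramified_at a b sigma0 /\
          forall tau : {rmorphism k -> R}, ~ tau =1 sigma0 -> ramified_at a b tau.
Hypothesis O_order : is_order O.
Hypothesis rhoZ : forall (c : k) (x : quat a b), rho (c *: x) = sigma c *: rho x.
Variables (Gam : subgroup (SL2 R)) (g0 : SL2 R).
Local Notation G1 := (subgroup_set Gam).
Local Notation Del := [set (x ^ g0)%g | x in norm_one_image rho O].
Hypothesis comm : commensurable G1 Del.
Hypothesis tf : torsion_free G1.

Lemma DelP x : Del x <-> exists w, [/\ O w, reduced_norm w = 1 & SL2_mx (g0 * x * g0^-1)%g = rho w].
Proof.
split=> [[h [w [Ow nw hE]] <-]|[w [Ow nw hE]]].
  by exists w; rewrite conjgE !mulgA mulgV mul1g mulgK.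
by exists (g0 * x * g0^-1)%g; [exists w|rewrite conjgE !mulgA mulVg mul1g mulgVK].
Qed.

Lemma Del_pow x n : Del x -> Del (x ^+ n)%g.
Proof.
move=> /DelP[w [Ow nw wE]]; apply/DelP; have [Oone OM _] := order_facts O_order.
elim: n => [|n [v [Ov nv vE]]].
  exists (1 : quat a b); rewrite expg0 mulg1 mulgV (rmorph1 rho); split => //.
  by rewrite /reduced_norm !quat_base; ring.
exists (w * v); split; first exact: OM.
  have -> : reduced_norm (w * v) = reduced_norm w * reduced_norm v by rewrite /reduced_norm !quatM; ring.
  by rewrite nw nv mulr1.
by rewrite expgS rmorphM -wE -vE -[RHS]/(SL2_mx (_ * _)%g) !mulgA mulgVK.
Qed.

Lemma Gam_power : exists N, forall gam, G1 gam -> exists n, [/\ (0 < n)%N, (n <= N)%N & Del (gam ^+ n)%g].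
Proof.
apply: power_in_finite_index; last by case: comm.
have := order_facts O_order; case=> Oone _ _; apply/DelP; exists (1 : quat a b); rewrite mulg1 mulgV (rmorph1 rho); split => //.
by rewrite /reduced_norm !quat_base; ring.
Qed.

Lemma near_entriesW (e e' : R) g h : e <= e' -> near_entries e g h -> near_entries e' g h.
Proof. by move=> le [h1 h2 h3 h4]; split; exact: lt_le_trans le. Qed.

(** A bounded power of an element near 1 comes from the order and is still near 1, hence equals 1,
    and the group is torsion free. The bound on the exponent lets one neighbourhood serve for all
    elements. *)
Lemma Gam_discrete : exists2 eps : R, 0 < eps & forall gam, G1 gam -> near_entries eps 1%g gam -> gam = 1%g.
Proof.
have [e1 e10 ud] := unit_discrete k_real a0 b0 places O_order rhoZ; have [N NP] := Gam_power.
have ex n : exists2 e : R, 0 < e & forall g, near_entries e 1%g g -> near_entries e1 1%g (g0 * g ^+ n * g0^-1)%g.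
  have : nbhs (1%g : SL2 R) (fun g => near_entries e1 1%g (g0 * g ^+ n * g0^-1)%g).
    have c : (g0 * x ^+ n * g0^-1)%g @[x --> (1%g : SL2 R)] --> (g0 * 1 ^+ n * g0^-1)%g.
      have c1 := cvg_comp _ _ (@pow_cvg n 1%g) (@SL2_mul_continuous R g0 (1 ^+ n)%g).
      exact: (cvg_comp _ _ c1 (@SL2_mulr_continuous R g0^-1%g _)).
    apply: (c _); rewrite expg1n mulg1 mulgV; exact: near_entries_nbhs.
  by move=> /nbhs_near_entries[e e0 sub]; exists e.
have [e e0 eP] : exists2 e : R, 0 < e & forall n, (n <= N)%N -> forall g, near_entries e 1%g g -> near_entries e1 1%g (g0 * g ^+ n * g0^-1)%g.
  elim: N {NP} => [|N [e e0 eP]]; first by have [e e0 eP] := ex 0%N; exists e => // n; rewrite leqn0 => /eqP ->.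
  have [e' e'0 e'P] := ex N.+1; exists (Num.min e e'); first by rewrite lt_min e0.
  move=> n; rewrite leq_eqVlt => /orP[/eqP ->|lt] g hg; [apply: e'P|apply: (eP n lt)];
    by apply: near_entriesW hg; rewrite ge_min lexx ?orbT.
exists e => // gam Gg near; have [n [n0 nN /DelP[w [Ow nw wE]]]] := NP gam Gg.
have [h1 h2 h3 h4] := eP n nN gam near.
have w1 : w = 1.
  apply: ud => // i j; rewrite -wE [1%:M _ _]mxE.
  case: (ord2P i) => ->; case: (ord2P j) => ->; rewrite /= ?mulr1n ?mulr0n distrC;
    rewrite ?ent1 in h1 h2 h3 h4; [exact: h1|exact: h2|exact: h3|exact: h4].
apply: (tf Gg n0); apply: (mulgI g0); apply: (mulIg g0^-1%g); rewrite mulg1 mulgV.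
by apply/val_inj; apply: (etrans wE); rewrite w1 (rmorph1 rho).
Qed.

Variable c0 : R.
Hypothesis coc : forall g, exists2 gam, G1 gam & hs (gam * g)%g <= c0.
Local Notation rc := (real_complex R).

(** Suitable powers of two noncommuting elements lie in the order together with their conjugates by
    [gam], so [gam] acts by conjugation on the algebra over k. *)
Lemma trace_sq_in_field gam : G1 gam -> exists e : k, trS gam ^+ 2 = sigma e.
Proof.
move=> Gg; have [_ gM gV] := subgroupP Gam.
have [eps eps0 disc] := Gam_discrete.
have [h1 [h2 [G1h G2h nc]]] := noncommuting tf coc eps0 disc.
have [N NP] := Gam_power.
pose M := SL2_mx (g0 * gam * g0^-1)%g.
have prep h : G1 h -> exists n (x y : quat a b), [/\ (0 < n)%N, SL2_mx (g0 * h ^+ n * g0^-1)%g = rho x & M *m rho x = rho y *m M].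
  move=> Gh; have [m [m0 _ Dm]] := NP h Gh.
  have [m' [m'0 _ Dm']] := NP (gam * h * gam^-1)%g (gM _ _ (gM _ _ Gg Gh) (gV _ Gg)).
  have cj n : ((gam * h * gam^-1) ^+ n)%g = (gam * h ^+ n * gam^-1)%g.
    elim: n => [|n IH]; first by rewrite !expg0 mulg1 mulgV.
    by rewrite !expgS IH !mulgA mulgVK.
  have /DelP[x [_ _ xE]] := Del_pow m' Dm.
  have /DelP[y [_ _ yE]] := Del_pow m Dm'.
  exists (m * m')%N, x, y; split; [by rewrite muln_gt0 m0|by rewrite expgnA|].
  rewrite -xE -yE -!expgnA [(m' * m)%N]mulnC cj.
  rewrite -[LHS]/(SL2_mx (_ * _)%g) -[RHS]/(SL2_mx (_ * _)%g); congr SL2_mx.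
  by rewrite !mulgA !mulgVK.
have [n1 [x1 [y1 [n10 X1 E1]]]] := prep h1 G1h.
have [n2 [x2 [y2 [n20 X2 E2]]]] := prep h2 G2h.
have br : \det (rho x1 *m rho x2 - rho x2 *m rho x1) != 0.
  rewrite -X1 -X2 (_ : _ - _ = SL2_mx g0 *m (SL2_mx (h1 ^+ n1)%g *m SL2_mx (h2 ^+ n2)%g -
    SL2_mx (h2 ^+ n2)%g *m SL2_mx (h1 ^+ n1)%g) *m SL2_mx g0^-1%g).
    rewrite !det_mulmx (eqP (SL2_det g0)) (eqP (SL2_det _)) mul1r mulr1.
    exact: (bracket_unit tf coc eps0 disc).
  rewrite mulmxBr mulmxBl; congr (_ - _);
    rewrite -[LHS]/(SL2_mx (_ * _)%g) -[RHS]/(SL2_mx (g0 * (_ * _) * _)%g); congr SL2_mx; by rewrite !mulgA mulgVK.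
have [e eE] := trace_sq_rational a0 b0 rhoZ E1 E2 br (eqP (SL2_det _)).
by exists e; rewrite -eE /M mxtrace_conj.
Qed.

Lemma eigenvalue_alg_integer h U : G1 h -> U ^+ 2 - trS h * U + 1 = 0 ->
  exists2 f0 : {poly int}, f0 \is monic & root (map_poly intr f0) (rc U).
Proof.
move=> Gh UE; have [N NP] := Gam_power.
have [n [n0 _ /DelP[x [Ox _ xE]]]] := NP h Gh.
have /det0P[v v0 vE] : \det (SL2_mx h - U%:M) == 0.
  by have dt := SL2_detE h; rewrite det2 !mxE /= -UE; apply/eqP; rewrite /trS /ea /eb /ec /ed in dt *; nra.
have {}vE : v *m SL2_mx h = U *: v.
  by apply/eqP; rewrite -subr_eq0 -mul_mx_scalar -mulmxBr vE.
have vn m : v *m SL2_mx (h ^+ m)%g = U ^+ m *: v.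
  elim: m => [|m IH]; first by rewrite expg0 expr0 scale1r [SL2_mx _]/(1%:M) mulmx1.
  by rewrite expgS -[SL2_mx _]/(SL2_mx h *m SL2_mx (h ^+ m)%g) mulmxA vE -scalemxAl IH scalerA exprS.
pose v1 := v *m SL2_mx g0^-1%g.
have v1E : v1 *m rho x = U ^+ n *: v1.
  rewrite -xE /v1 scalemxAl -vn -!mulmxA; congr (v *m _).
  by rewrite -[LHS]/(SL2_mx (_ * _)%g) -[RHS]/(SL2_mx (_ * _)%g) !mulgA mulVg mul1g.
have v10 : v1 != 0.
  apply: contraNneq v0 => z; rewrite -[v]mulmx1 -[1%:M]/(SL2_mx 1%g) -(mulVg g0).
  by rewrite -[SL2_mx (_ * _)%g]/(SL2_mx g0^-1%g *m SL2_mx g0) mulmxA -/v1 z mul0mx.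
have [p pm pr] : integralOver (intr : int -> R[i]) (rc (U ^+ n)).
  apply: (eigenvalue_integral O_order rhoZ Ox (_ : map_mx rc v1 != 0)).
    by rewrite map_mx_eq0.
  by rewrite -map_mxM v1E map_mxZ.
exists (p \Po 'X^n); first by rewrite monicE lead_coef_comp ?size_polyXn // lead_coefXn expr1n mulr1 -monicE.
by rewrite map_comp_poly map_polyXn /root horner_comp hornerXn -rmorphXn.
Qed.

(** A nonzero conjugate z satisfies z + 1/z = tau(eta) for some embedding tau. If tau is sigma, z is
    U or 1/U. Otherwise the algebra is definite at tau, so z^n + z^-n is real of modulus at most 2
    and z has modulus 1. *)
Lemma conjugate_unimodular h U eta (z : R[i]) : G1 h -> 1 < U -> U + U^-1 = trS h -> trS h = sigma eta ->
  (forall q : {poly rat}, root (map_poly ratr q) (rc U) -> root (map_poly ratr q) z) -> z = rc U \/ `|z| <= 1.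
Proof.
move=> Gh U1 Uh eE conj; have U0 : rc U != 0 by rewrite fmorph_eq0; apply: lt0r_neq0; exact: lt_trans U1.
have [N NP] := Gam_power; have [n [n0 _ /DelP[x [Ox nx xE]]]] := NP h Gh.
have [m [ts [chi chiP]]] := embeddings k_real; have [cm crt cE] := chiP eta.
set q := chi eta in cm crt cE; pose d := (size q).-1.
have sq : size q = d.+1 by rewrite prednK // lt0n size_poly_eq0 monic_neq0.
have /conj : root (map_poly ratr (recip d q)) (rc U).
  rewrite /root recip_eval ?sq // -fmorphV -rmorphD /= Uh eE.
  by rewrite -(rmorph_in_alg (rc \o sigma)) (rootP crt) rmorph0 mulr0.
have [->|z0] := eqVneq z 0.
  by move=> _; right; rewrite normr0.
rewrite /root recip_eval ?sq // mulf_eq0 expf_eq0 (negPf z0) andbF /=.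
have -> : map_poly ratr q = map_poly rc (map_poly ratr q).
  by rewrite -map_poly_comp; apply: eq_map_poly => c; rewrite /= -(fmorph_eq_rat (rc \o ratr)).
rewrite cE rmorph_prod horner_prod prodf_seq_eq0 => /hasP[i _] /=.
rewrite rmorphB /= map_polyX map_polyC /= hornerXsubC subr_eq0 => /eqP zE.
have [e|ne] := pselect (ts i =1 sigma).
  have : (z - rc U) * (z - (rc U)^-1) = 0.
    have -> : (z - rc U) * (z - (rc U)^-1) = z * (z + z^-1 - (rc U + (rc U)^-1)) by field; rewrite U0 z0.
    by rewrite zE e -eE -Uh rmorphD fmorphV subrr mulr0.
  move/eqP; rewrite mulf_eq0 !subr_eq0 => /orP[/eqP ->|/eqP ->]; [by left|right].
  by rewrite normfV invf_le1 ?normr_gt0 // normc_def /= expr0n addr0 sqrtr_sqr ger0_norm ?(ltW (lt_trans ltr01 U1)) // -(rmorph1 rc) lecR ltW.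
have [na nb] := ramified_other a0 b0 places rhoZ ne.
have bnd := definite_bound x 1 na nb.
have qx : dickson eta n = 2 * quat0 x.
  apply: (fmorph_inj sigma); rewrite rmorph_dickson -eE dickson_trace -(mxtrace_conj g0) xE.
  by rewrite (trace_rho a0 b0 rhoZ) rmorphM rmorph_nat.
have cz : z ^+ n + (z ^+ n)^-1 = rc (ts i (2 * quat0 x)).
  by rewrite -dickson_inv // zE -(rmorph_dickson rc) -rmorph_dickson qx.
have : `|z ^+ n| = 1.
  apply: inv_sum_unimodular cz; first by rewrite expf_neq0.
  move: bnd; rewrite mulr1 nx rmorph1 (_ : reduced_norm 1 = 1) ?rmorph1 //.
  by rewrite /reduced_norm !quat_base; ring.
by rewrite normrX => /eqP; rewrite pexpr_eq1 // => /eqP ->; right.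
Qed.

(** Two fields occur: the one in the arithmetic datum locates the conjugates, the invariant trace
    field [k'] bounds the degree. They are linked by the trace of gam^2, which lies in both. *)
Lemma dilation_bound (k' : fieldExtType rat) (iota : {rmorphism k' -> R}) gam :
  range iota = invariant_trace_field G1 -> G1 gam -> gam != 1%g ->
  exists U : R, [/\ 1 < U, U + U^-1 = trS gam ^+ 2 - 2 & 2 < U ^+ (2 * dob_s (2 * \dim {:k'}) ^ 3)].
Proof.
move=> iE Gg g1; have [_ gM gV] := subgroupP Gam.
have [eps eps0 disc] := Gam_discrete.
have t2 := hyperbolic tf coc eps0 disc Gg g1; set d := \dim _.
have Gh := gM _ _ Gg Gg; set h := (gam * gam)%g in Gh; set y := trS gam ^+ 2 - 2.
have hE : trS h = y.
  by have dt := SL2_detE gam; rewrite /y /h /trS !entM (_ : 2 = 2 * (ea gam * ed gam - eb gam * ec gam)); [ring|rewrite dt mulr1].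
have y2 : 2 < y by rewrite /y -real_normK ?num_real //; nra.
have [e eE] := trace_sq_in_field Gg.
have eta : trS h = sigma (e - 2) by rewrite hE rmorphB rmorph_nat -eE.
pose s := Num.sqrt (y ^+ 2 - 4); have s0 : 0 <= s := sqrtr_ge0 _.
have ss : s ^+ 2 = y ^+ 2 - 4 by rewrite sqr_sqrtr //; nra.
(* The larger eigenvalue of gam^2, whose trace y exceeds 2. *)
pose U := (y + s) / 2; have U1 : 1 < U by rewrite /U; nra.
have Uq : U ^+ 2 - y * U + 1 = 0 by rewrite /U; nra.
have Un : U != 0 by rewrite lt0r_neq0 //; exact: lt_trans U1.
have UE : U + U^-1 = y.
  by apply: (mulIf Un); rewrite mulrDl mulVf //; nra.
exists U; split=> //.
have [f0 f0m f0r] : exists2 f0 : {poly int}, f0 \is monic & root (map_poly intr f0) (rc U).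
  by apply: (eigenvalue_alg_integer Gh); rewrite hE.
have [y' _ y'E] : range iota y.
  rewrite iE => F [_ sub]; apply: sub; exists h; last by rewrite tr2 -hE.
  by move=> H [_ subH]; apply: subH; exists gam.
have [q [qm sq qr]] := annihilating_poly y'.
have rQ : root (map_poly ratr (recip d q)) (rc U).
  rewrite /root recip_eval ?sq ?fmorph_eq0 // -fmorphV -rmorphD /= UE -y'E.
  by rewrite -(rmorph_in_alg (rc \o iota)) (rootP qr) rmorph0 mulr0.
apply: (dobrowolski (q0 := recip d q) U1 f0m f0r _ (size_recip d q) rQ).
  by apply/eqP => z; have := recip_horner0 qm sq; rewrite z horner0 => /eqP; rewrite eq_sym oner_eq0.
move=> z; apply: (conjugate_unimodular Gh U1 _ eta); by rewrite hE.
Qed.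

End Commensurable.

(** * The quantitative displacement gap and the conclusion *)

Lemma bernoulli_upper (R : realType) (e : R) n : 0 <= e -> (1 + e) ^+ n * (1 - n%:R * e) <= 1.
Proof.
move=> e0; elim: n => [|n IH]; first by rewrite expr0; lra.
apply: le_trans IH; rewrite exprSr -mulrA; apply: ler_wpM2l; first by rewrite exprn_ge0 //; lra.
by rewrite -natr1; have := ler0n R n; nra.
Qed.

(** U - 1 is at least 1 / (4 s^3) by a Bernoulli inequality, and U + 1/U - 2 = (U - 1)^2 / U is of
    second order; hence the sixth power of s. *)
Lemma dilation_gap (R : realType) (U T : R) s : 1 < U -> U + U^-1 = T - 2 -> 2 < U ^+ (2 * s ^ 3) ->
  1 + 1 / (64 * s%:R ^+ 6) <= T / 2 - 1.
Proof.
move=> U1 UT big; have sp : (0 < s)%N by rewrite lt0n; apply: contraTneq big => ->; rewrite expr0 -leNgt ler1n.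
pose S : R := s%:R ^+ 3; have s1 : 1 <= (s%:R : R) by rewrite ler1n.
have S1 : 1 <= S by rewrite /S exprn_ege1.
pose e := (4 * S)^-1; have e0 : 0 < e by rewrite invr_gt0; lra.
have eS : 4 * S * e = 1 by rewrite mulfV //; apply/lt0r_neq0; lra.
have Ue : e <= U - 1.
  rewrite leNgt; apply/negP => lt; have := bernoulli_upper (2 * s ^ 3) (ltW e0).
  have le : U ^+ (2 * s ^ 3) <= (1 + e) ^+ (2 * s ^ 3) by apply: lerXn2r; rewrite ?nnegrE; lra.
  rewrite natrM natrX -/S; have := lt_le_trans big le.
  have -> : 1 - 2 * S * e = 1 / 2 by lra.
  by move: ((1 + e) ^+ _) => W; lra.
have -> : 1 / (64 * s%:R ^+ 6) = e ^+ 2 / 4.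
  rewrite /e /S; field; apply/lt0r_neq0; lra.
have Un : U != 0 by apply/lt0r_neq0; lra.
have VU : U^-1 * U = 1 by rewrite mulVf.
have e1 : e <= 1 / 4 by nra.
have V0 : 0 < U^-1 by rewrite invr_gt0; lra.
suff : e ^+ 2 / 2 <= U + U^-1 - 2 by lra.
move: (U^-1) V0 VU {UT} => V V0 VU.
have VE : U + V - 2 = V * (U - 1) ^+ 2 by nra.
have [U2|U2] := leP U 2.
  have V2 : 1 / 2 <= V by nra.
  have e2 : e ^+ 2 <= (U - 1) ^+ 2 by nra.
  by rewrite VE; move: (e ^+ 2) (sqr_ge0 e) e2 => E E0 le; nra.
have : 1 / 2 <= U + V - 2 by nra.
nra.
Qed.

Lemma log_degree_ge (R : realType) d : (0 < d)%N -> Num.min 1 (ln 2) <= log_degree R d /\ ln d%:R <= log_degree R d.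
Proof.
move=> d0; rewrite /log_degree; case: eqP => [->|/eqP d1]; first by rewrite ge_min lexx ln1.
split=> //; rewrite ge_min; apply/orP; right; rewrite ler_ln ?posrE ?ltr0n // ler_nat; lia.
Qed.

(** s is quadratic in the binary logarithm of 2 d. Additive constants are absorbed by the positive
    lower bound [kap] of [log_degree], which also covers d = 1. *)
Lemma dob_s_log (R : realType) : exists2 K : R, 0 < K & forall d, (0 < d)%N -> (dob_s (2 * d))%:R <= K * log_degree R d ^+ 2.
Proof.
pose L : R := ln 2; have L0 : 0 < L by rewrite ln_gt0 // ltr1n.
pose kap := Num.min 1 L; have kap0 : 0 < kap by rewrite lt_min ltr01 L0.
pose K' := 10 / kap + 1 / L; have K'0 : 0 < K' by rewrite addr_gt0 // divr_gt0 // ltr0n.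
exists (64 * K' ^+ 2); first by rewrite mulr_gt0 ?exprn_gt0 // ltr0n.
move=> d d0; have [D1 D2] := log_degree_ge R d0; rewrite -/L -/kap in D1.
set D := log_degree R d in D1 D2 *; set l := up_log 2 (2 * d).
have lD : (l + 8)%:R <= K' * D.
  have l1 : (0 < l)%N by rewrite up_log_gt0 /=; lia.
  have : (2 ^ l.-1 < 2 * d)%N by apply: up_log_gtn => //; lia.
  rewrite -(ltr_nat R) natrX natrM -ltr_ln ?posrE ?exprn_gt0 ?mulr_gt0 ?ltr0n //.
  rewrite lnXn ?ltr0n // lnM ?posrE ?ltr0n // -/L -[L *+ _]mulr_natl => h.
  have lE : (l%:R : R) = l.-1%:R + 1 by rewrite natr1 prednK.
  have h1 : (l%:R : R) < 2 + D / L.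
    by rewrite lE -(ltr_pM2r L0) !mulrDl divfK ?lt0r_neq0 //; lra.
  have h2 : 1 <= D / kap by rewrite ler_pdivlMr // mul1r.
  by rewrite natrD /K' mulrDl -!mulrA [kap^-1 * D]mulrC [L^-1 * D]mulrC; lra.
have -> : (dob_s (2 * d))%:R = 64 * (((l + 8)%:R - 1) * (l + 8)%:R) :> R.
  by rewrite /dob_s /dob_m -/l !(natrM, natrD); ring.
have l8 : 1 <= ((l + 8)%:R : R) by rewrite ler1n addn_gt0 orbT.
move: (K' * D) lD (exprMn 2 K' D) l8 => X; move: ((l + 8)%:R) => Y YX E Y1; rewrite -mulrA -E.
have : (Y - 1) * Y <= X ^+ 2 by nra.
lra.
Qed.

Lemma arithmetic_gap (R : realType) : exists2 c : R, 0 < c &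
  forall (Gamma : subgroup (SL2 R)) (k : fieldExtType rat) (iota : {rmorphism k -> R}),
    arithmetic_fuchsian Gamma -> torsion_free Gamma ->
    (exists c0 : R, forall g, exists2 gam, subgroup_set Gamma gam & hs (gam * g)%g <= c0) ->
    range iota = invariant_trace_field Gamma ->
    let b := c / log_degree R (\dim {:k}) ^+ 12 in
    b <= 1 /\ forall g gam, subgroup_set Gamma gam -> gam != 1%g -> 1 + 6 * b <= hs (g^-1 * gam * g)%g.
Proof.
have [K K0 KP] := dob_s_log R.
pose kap : R := Num.min 1 (ln 2); have kap0 : 0 < kap by rewrite lt_min ltr01 ln_gt0 // ltr1n.
have [B B0 BE] : exists2 B : R, 0 < B & B = 384 * K ^+ 6.
  by exists (384 * K ^+ 6); rewrite ?mulr_gt0 ?exprn_gt0 ?ltr0n.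
(* The factor 384 in [B] is 6 * 64, from the 6 of the lattice gap and the 64 of [dilation_gap]; the
   second entry of the minimum ensures b <= 1. The power 12 is s^6 with s of order the square of
   [log_degree]. *)
pose c := Num.min B^-1 (kap ^+ 12).
have c1 : c <= B^-1 by rewrite ge_min lexx.
have c2 : c <= kap ^+ 12 by rewrite ge_min lexx orbT.
have c00 : 0 < c by rewrite lt_min exprn_gt0 // invr_gt0 B0.
exists c => //.
move=> Gam k' iota [k [a [b [Or [sigma [rho [[kr [a0 b0]] places Oo [_ rhoZ] [g0 comm]]]]]]]] tf [c0 coc] iE.
have d0 : (0 < \dim {:k'})%N by exact: adim_gt0.
have [D1 _] := log_degree_ge R d0; have sK := KP _ d0; set D := log_degree R _ in D1 sK *.
have D0 : 0 < D by exact: lt_le_trans D1.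
have D12 : 0 < D ^+ 12 by rewrite exprn_gt0.
split; first by rewrite ler_pdivrMr // mul1r (le_trans c2) // lerXn2r ?nnegrE // ltW.
move=> g gam Gg g1.
have [U [U1 UE Ub]] := dilation_bound kr a0 b0 places Oo rhoZ comm tf coc iE Gg g1.
have gap := dilation_gap U1 UE Ub; set s := dob_s _ in sK gap.
have tr : trS (g^-1 * gam * g)%g = trS gam by rewrite -(mxtrace_conj g^-1%g gam) invgK tr2.
apply: le_trans (hs_tr _); rewrite -/(trS _) tr; apply: le_trans gap; rewrite lerD2l.
have s0 : 0 < (s%:R : R) by rewrite ltr0n; apply: (leq_trans _ (dob_s_ge7 _)).
have s6 : (s%:R : R) ^+ 6 <= K ^+ 6 * D ^+ 12.
  have -> : K ^+ 6 * D ^+ 12 = (K * D ^+ 2) ^+ 6 by rewrite exprMn -exprM.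
  by rewrite lerXn2r ?nnegrE ?(le_trans (ltW s0)) // ltW.
have s60 : 0 < (s%:R : R) ^+ 6 by rewrite exprn_gt0.
rewrite ler_pdivlMr; last by apply: mulr_gt0 s60; rewrite ltr0n.
have cB : c * B <= 1 by rewrite -ler_pdivlMr // div1r.
apply: le_trans cB; rewrite BE; move: (c) c00 (K ^+ 6) (D ^+ 12) (s%:R ^+ 6) D12 s6 => c' c'0 K6 P S6 P0 s6.
have -> : c' * (384 * K6) = 6 * (c' / P) * (64 * (K6 * P)) by field; rewrite lt0r_neq0.
by rewrite !ler_pM2l ?ltr0n // mulr_gt0 ?divr_gt0 ?ltr0n.
Qed.

Theorem corollary1p3 (R : realType)
    (mu : {measure set (borelSL2 R) -> \bar R}) (mu_haar : is_haar mu) :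
  exists C : R, 0 < C /\
    forall (Gamma : subgroup (SL2 R))
      (k : fieldExtType rat) (iota : {rmorphism k -> R}),
    arithmetic_fuchsian Gamma ->
    torsion_free Gamma ->
    cocompact Gamma ->
    range iota = invariant_trace_field Gamma ->
    let lambda := Num.min (1 / 4) (lambda1 Gamma) in
    let r := 1 - Num.sqrt (1 - 4 * lambda) in
    let small := [set gamma | subgroup_set Gamma gamma /\
      `|SL2_mx gamma| < C * log_degree R (\dim {:k}) `^ (180 / r)
                          * fine (covolume mu Gamma) `^ (6 / r)] in
    finite_set small /\ generated small = Gamma.
Proof.
have [c c0 gap] := arithmetic_gap R.
pose kap : R := Num.min 1 (ln 2); have kap0 : 0 < kap by rewrite lt_min ltr01 ln_gt0 // ltr1n.
have [C C0 CP] := lattice_bound mu_haar c0 (exprn_gt0 12 kap0).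
exists C; split=> // Gamma k iota arith tf coc iE.
have {coc}[c1 coc] : exists c1 : R, forall g, exists2 gam, subgroup_set Gamma gam & hs (gam * g)%g <= c1.
  have [c1 cc] := cocompact_hs coc; have [_ _ GV] := subgroupP Gamma; exists c1 => g.
  have [gam Gg le] := cc g^-1%g; exists gam^-1%g; first exact: GV.
  by rewrite -hsV invgM invgK.
have [b1 bP] := gap Gamma k iota arith tf (ex_intro _ c1 coc) iE.
have [D1 _] := log_degree_ge R (adim_gt0 {:k}); rewrite -/kap in D1.
set D := log_degree R _ in b1 bP D1 *; have D0 : 0 < D by exact: lt_le_trans D1.
have b0 : 0 < c / D ^+ 12 by rewrite divr_gt0 ?exprn_gt0.
have [L LG Lb] := lattice_exists b0 b1 bP coc.
have Dx : kap ^+ 12 <= D ^+ 12 by rewrite lerXn2r ?nnegrE // ltW.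
have [r0 gen] := CP L _ _ Dx Lb (qvol_le_covolume mu_haar L).
rewrite LG -/(spec_gap Gamma) in r0 gen *; set r := spec_gap Gamma in r0 gen *.
move=> lambda r' small.
(* [lattice_bound] is used with x = D^12, so its exponent 15 becomes 12 * 15 = 180. *)
have rE : (D ^+ 12) `^ (15 / r) = D `^ (180 / r).
  rewrite -(powR_mulrn 12 (ltW D0)) -powRrM; congr (D `^ _); rewrite mulrA; congr (_ / r).
  by rewrite -natrM.
split; last by apply: gen => [g []|gam Gg lt] //; split=> //; rewrite -rE.
(* Bounded norm means bounded displacement, so finiteness is that of Gamma in a ball. *)
pose B := C * D `^ (180 / r) * fine (covolume mu Gamma) `^ (6 / r).
apply: sub_finite_set (gamma_finite mu_haar L (2 * B ^+ 2)) => gam [Gg lt]; rewrite LG; split=> //.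
have E (i j : 'I_2) : SL2_mx gam i j ^+ 2 <= B ^+ 2.
  have le : `|SL2_mx gam i j| <= B.
    apply: le_trans (ltW lt); rewrite [X in _ <= X]mx_normrE.
    exact: (le_bigmax 0 (fun p : 'I_2 * 'I_2 => `|SL2_mx gam p.1 p.2|) (i, j)).
  by rewrite -real_normK ?num_real // lerXn2r ?nnegrE // (le_trans _ le).
have := E 0 0; have := E 0 1; have := E 1 0; have := E 1 1; rewrite /hs /ea /eb /ec /ed.
by move: (B ^+ 2) => B2; lra.
Qed.
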